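(* Let $0<\alpha\le 1$, let $A$ be a (possibly unbounded) linear operator in a complex Banach space $\mathbb{X}$, and let $f\in BUC(\mathbb{R}^+,\mathbb{X})$. Consider the equation $D^{\alpha}_C u(t)=Au(t)+f(t)$, $t\ge 0$. (a) If $\Sigma_i(A,\alpha)\subset 2\pi i\,\mathbb{Z}$ and $sp(f)\subset 2\pi\mathbb{Z}$, then every asymptotic mild solution $u$ of this equation is asymptotic $1$-periodic, i.e. $\lim_{t\to\infty}(u(t+1)-u(t))=0$. (b) If $\Sigma_i(A,\alpha)\subset (2\mathbb{Z}+1)\pi i$ and $sp(f)\subset (2\mathbb{Z}+1)\pi$, then every asymptotic mild solution $u$ of this equation is asymptotic anti $1$-periodic, i.e. $\lim_{t\to\infty}(u(t+1)+u(t))=0$.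
   Context: $\mathbb{R}^+=[0,\infty)$. $BUC(\mathbb{R}^+,\mathbb{X})$ is the Banach space of bounded uniformly continuous functions $\mathbb{R}^+\to\mathbb{X}$ with the sup-norm; $C_0(\mathbb{R}^+,\mathbb{X})$ is its closed subspace of functions tending to $0$ at infinity; $\mathbb{Y}=BUC(\mathbb{R}^+,\mathbb{X})/C_0(\mathbb{R}^+,\mathbb{X})$ with the quotient norm, and $\tilde f$ is the class of $f$. $J^\alpha u(t)=\int_0^t \frac{(t-\tau)^{\alpha-1}}{\Gamma(\alpha)}u(\tau)\,d\tau$. For $g$ continuous, a mild solution on $\mathbb{R}^+$ of $D^\alpha_C u=Au+g$ ($D^\alpha_C$ is the Caputo derivative) is a continuous $u:\mathbb{R}^+\to\mathbb{X}$ such that for each $t\ge 0$, $J^\alpha u(t)\in D(A)$ and $u(t)=AJ^\alpha u(t)+J^\alpha g(t)+u(0)$. An asymptotic mild solution of $D^\alpha_Cu=Au+f$ is a function $u\in BUC(\mathbb{R}^+,\mathbb{X})$ for which there is $\epsilon\in C_0(\mathbb{R}^+,\mathbb{X})$ such that $u$ is a mild solution of $D^\alpha_C u=Au+f+\epsilon$. Powers: $\lambda^\alpha=|\lambda|^\alpha e^{i\alpha\arg\lambda}$ with $-\pi<\arg\lambda<\pi$. $\rho(A,\alpha)$ is the set of all $\xi_0\in\mathbb{C}$ such that $\lambda^\alpha-A$ has a (bounded) inverse $(\lambda^\alpha-A)^{-1}$ that is analytic in $\lambda$ in a neighborhood of $\xi_0$; $\Sigma_i(A,\alpha):=i\mathbb{R}\setminus\rho(A,\alpha)$.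 Spectrum: let $\mathcal{D}=d/dt$ in $BUC(\mathbb{R}^+,\mathbb{X})$ with domain $\{f: f'\text{ exists and } f'\in BUC(\mathbb{R}^+,\mathbb{X})\}$. Let $\tilde{\mathcal D}$ be the operator in $\mathbb{Y}$ with domain $\{\tilde f:\ \exists u\in\tilde f,\ u\in D(\mathcal D)\}$ and $\tilde{\mathcal D}\tilde f=\widetilde{\mathcal D u}$ for such $u$ (this is well defined). For $f\in BUC(\mathbb{R}^+,\mathbb{X})$ put $\hat f(\lambda)=(\lambda-\tilde{\mathcal D})^{-1}\tilde f$ for $\operatorname{Re}\lambda\ne 0$. Then $sp(f)$ is the set of $\xi_0\in\mathbb{R}$ such that $\hat f$ has no analytic extension to any neighborhood of $i\xi_0$. *)

(* Defs.v *)
From Stdlib Require Import Reals Lra Lia.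
From Stdlib Require Import FunctionalExtensionality PropExtensionality.
From Stdlib Require Import ProofIrrelevance Classical ClassicalEpsilon.
From Coquelicot Require Import Coquelicot.

Set Implicit Arguments.
Unset Strict Implicit.
Unset Printing Implicit Defensive.

Open Scope R_scope.

Notation CBanach := (CompleteNormedModule C_AbsRing).

Section NormBuilder.
Context {K : AbsRing} (V : ModuleSpace K) (N : V -> R).
Hypothesis Ntri : forall x y, N (plus x y) <= N x + N y.
Hypothesis Nscal : forall (l : K) x, N (scal l x) <= abs l * N x.
Hypothesis N0 : N zero = 0.
Hypothesis Neq0 : forall x, N x = 0 -> x = zero.

Lemma nb_opp x : N (opp x) <= N x.
Proof.
replace (opp x) with (scal (opp (one : K)) x).
- eapply Rle_trans; [apply Nscal|]. 
  apply Rle_trans with (1 * N x); [|lra].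
  right. f_equal. exact (@abs_opp_one K).
- exact (scal_opp_one x).
Qed.

Definition nb_ball (x : V) (e : R) (y : V) : Prop := N (minus y x) < e.

Lemma nb_ball_center x (e : posreal) : nb_ball x e x.
Proof. 
unfold nb_ball. rewrite minus_eq_zero.
eapply Rle_lt_trans; [right; exact N0|apply cond_pos].
Qed.

Lemma nb_ball_sym x y e : nb_ball x e y -> nb_ball y e x.
Proof.
unfold nb_ball; intros H.
rewrite <- opp_minus. eapply Rle_lt_trans; [apply nb_opp|exact H].
Qed.

Lemma nb_ball_triangle x y z e1 e2 :
  nb_ball x e1 y -> nb_ball y e2 z -> nb_ball x (e1 + e2) z.
Proof.
unfold nb_ball; intros H1 H2.
rewrite (minus_trans y z x).
eapply Rle_lt_trans; [apply Ntri|]. lra.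
Qed.

Definition nb_uniform_mixin : UniformSpace.mixin_of V :=
  UniformSpace.Mixin V zero nb_ball nb_ball_center nb_ball_sym nb_ball_triangle.

Definition nb_aux : NormedModuleAux K :=
  NormedModuleAux.Pack K (ModuleSpace.sort K V)
    (NormedModuleAux.Class K V (ModuleSpace.class K V) nb_uniform_mixin) V.

Lemma nb_compat1 (x y : nb_aux) (e : R) : N (minus y x) < e -> ball x e y.
Proof. intros H. exact H. Qed.

Lemma nb_compat2 (x y : nb_aux) (e : posreal) :
  ball x e y -> N (minus y x) < 1 * e.
Proof. intros H. rewrite Rmult_1_l. exact H. Qed.

Definition nb_mixin : NormedModule.mixin_of K nb_aux :=
  NormedModule.Mixin K nb_aux N 1 Ntri Nscal nb_compat1 nb_compat2 Neq0.

Definition normed_module_of : NormedModule K :=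
  NormedModule.Pack K nb_aux
    (NormedModule.Class K nb_aux (NormedModuleAux.class K nb_aux) nb_mixin) V.
End NormBuilder.

Definition inf (E : R -> Prop) : R := real (Glb_Rbar E).

Lemma inf_spec (E : R -> Prop) :
  (forall r, E r -> 0 <= r) -> (exists r, E r) ->
  (forall r, E r -> inf E <= r) /\
  (forall e, 0 < e -> exists r, E r /\ r < inf E + e) /\
  0 <= inf E.
Proof.
intros Hpos [r0 Hr0]. unfold inf.
destruct (Glb_Rbar_correct E) as [Hlb Hgr].
assert (H0 : Rbar_le 0 (Glb_Rbar E)).
{ apply Hgr. intros r Hr. simpl. apply Hpos, Hr. }
assert (H1 := Hlb _ Hr0).
destruct (Glb_Rbar E) as [l| |]; simpl in *; try contradiction.
split; [exact Hlb|]. split; [|exact H0].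
intros e He. apply NNPP. intros Hn.
assert (Hle : Rbar_le (l + e) l).
{ apply Hgr. intros r Hr. simpl. apply Rnot_lt_le. intros Hlt.
  apply Hn. exists r. split; assumption. }
simpl in Hle. lra.
Qed.

(* [real_of X] is X with the same norm and uniform structure, as a real Banach
   space: Coquelicot integrates and differentiates along R only there. *)
Section RealRestriction.
Variable X : CBanach.

Definition rscal (r : R) (x : X) : X := scal (RtoC r : C_AbsRing) x.

Definition rr_module_mixin : ModuleSpace.mixin_of R_Ring X.
Proof.
apply (ModuleSpace.Mixin R_Ring X rscal); unfold rscal.
- intros r s x. rewrite scal_assoc. f_equal.
  symmetry; exact (RtoC_mult r s).
- intros x. exact (scal_one x).
- intros r x y. exact (@scal_distr_l C_Ring X (RtoC r) x y).
- intros r s x. eapply eq_trans; [|exact (@scal_distr_r C_Ring X (RtoC r) (RtoC s) x)].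
  f_equal. exact (RtoC_plus r s).
Defined.

Definition rr_module_class : ModuleSpace.class_of R_Ring X :=
  ModuleSpace.Class R_Ring X (AbelianGroup.class X) rr_module_mixin.

Definition rr_aux : NormedModuleAux R_AbsRing :=
  NormedModuleAux.Pack R_AbsRing X
    (NormedModuleAux.Class R_AbsRing X rr_module_class (UniformSpace.class X)) X.

Lemma rr_norm_scal (r : R_AbsRing) (x : rr_aux) :
  norm (scal r x : X) <= abs r * norm (x : X).
Proof.
eapply Rle_trans; [apply (norm_scal (RtoC r : C_AbsRing) (x : X))|].
apply Rmult_le_compat_r; [apply norm_ge_0|].
right. exact (Cmod_R r).
Qed.

Definition rr_normed_mixin : NormedModule.mixin_of R_AbsRing rr_aux :=
  NormedModule.Mixin R_AbsRing rr_aux (fun x => norm (x : X))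
    (norm_factor (V := X))
    (norm_triangle (V := X)) rr_norm_scal
    (norm_compat1 (V := X)) (norm_compat2 (V := X))
    (norm_eq_zero (V := X)).

Definition rr_normed_class : NormedModule.class_of R_AbsRing X :=
  NormedModule.Class R_AbsRing X (NormedModuleAux.class R_AbsRing rr_aux)
    rr_normed_mixin.

Definition real_of : CompleteNormedModule R_AbsRing :=
  CompleteNormedModule.Pack R_AbsRing X
    (CompleteNormedModule.Class R_AbsRing X rr_normed_class
       (CompleteNormedModule.mixin C_AbsRing X (CompleteNormedModule.class C_AbsRing X)))
    X.
End RealRestriction.

Section BoundedOperators.
Variable V : NormedModule C_AbsRing.

Record blin : Type := Blin { blin_fun :> V -> V; blin_ok : is_linear blin_fun }.

Lemma blin_ext (S T : blin) : (forall x, S x = T x) -> S = T.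
Proof.
destruct S as [s Hs], T as [t Ht]; simpl; intros H.
assert (E : s = t) by (apply functional_extensionality; exact H).
subst t. f_equal. apply proof_irrelevance.
Qed.

Lemma blin_plus_ok (S T : blin) : is_linear (fun x => plus (S x) (T x)).
Proof.
apply (is_linear_comp (fun x => (S x, T x)) (fun p => plus (fst p) (snd p))).
- apply is_linear_prod; apply blin_ok.
- apply is_linear_plus.
Qed.

Lemma blin_scal_ok (l : C) (S : blin) :
  is_linear (fun x => scal (l : C_AbsRing) (S x)).
Proof.
apply (is_linear_comp S (fun x => scal (l : C_AbsRing) x)).
- apply blin_ok.
- apply is_linear_scal_r. intros n m. exact (Cmult_comm n m).
Qed.

Lemma blin_opp_ok (S : blin) : is_linear (fun x => opp (S x)).
Proof.
apply (is_linear_comp S (fun x => opp x)); [apply blin_ok|apply is_linear_opp].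
Qed.

Definition blin_plus S T := Blin (blin_plus_ok S T).
Definition blin_scal l S := Blin (blin_scal_ok l S).
Definition blin_opp S := Blin (blin_opp_ok S).
Definition blin_zero := Blin (@is_linear_zero C_AbsRing V V).

Definition blin_monoid_mixin : AbelianMonoid.mixin_of blin.
Proof.
apply (AbelianMonoid.Mixin blin blin_plus blin_zero);
  intros; apply blin_ext; intros w; simpl.
- apply plus_comm.
- apply plus_assoc.
- apply plus_zero_r.
Defined.

Definition blin_group_mixin :
  AbelianGroup.mixin_of (AbelianMonoid.Pack blin blin_monoid_mixin blin).
Proof.
apply (AbelianGroup.Mixin (AbelianMonoid.Pack blin blin_monoid_mixin blin) blin_opp);
  intros S; apply blin_ext; intros y.
exact (@plus_opp_r (NormedModule.AbelianGroup C_AbsRing V) (blin_fun S y)).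
Defined.

Definition blin_group : AbelianGroup :=
  AbelianGroup.Pack blin (AbelianGroup.Class blin _ blin_group_mixin) blin.

Definition blin_module_mixin : ModuleSpace.mixin_of C_Ring blin_group.
Proof.
apply (ModuleSpace.Mixin C_Ring blin_group blin_scal);
  [intros a b S|intros S|intros a S T|intros a b S]; apply blin_ext; intros z.
- exact (@scal_assoc C_Ring V a b (blin_fun S z)).
- exact (@scal_one C_Ring V (blin_fun S z)).
- exact (@scal_distr_l C_Ring V a (blin_fun S z) (blin_fun T z)).
- exact (@scal_distr_r C_Ring V a b (blin_fun S z)).
Defined.

Definition blin_module : ModuleSpace C_Ring :=
  ModuleSpace.Pack C_Ring blin
    (ModuleSpace.Class C_Ring blin (AbelianGroup.class blin_group) blin_module_mixin) blin.


Definition op_norm (S : blin) : R :=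
  inf (fun M => 0 <= M /\ forall x, norm (S x) <= M * norm x).

Lemma op_norm_spec (S : blin) :
  (forall x, norm (S x) <= op_norm S * norm x) /\ 0 <= op_norm S.
Proof.
destruct (@inf_spec (fun M => 0 <= M /\ forall x, norm (S x) <= M * norm x))
  as [_ [H2 H3]].
- intros r [Hr _]; exact Hr.
- destruct (linear_norm S (blin_ok S)) as [M [HM1 HM2]].
  exists M. split; [lra|exact HM2].
- split; [|exact H3].
  intros x. apply le_epsilon. intros e He.
  destruct (H2 (e / (norm x + 1))) as [r [[Hr1 Hr2] Hr3]].
  { apply Rdiv_lt_0_compat; [exact He|]. assert (P := norm_ge_0 x). lra. }
  fold (op_norm S) in Hr3.
  eapply Rle_trans; [apply Hr2|].
  assert (P := norm_ge_0 x).
  eapply Rle_trans.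
  { apply Rmult_le_compat_r; [exact P|]. left; exact Hr3. }
  rewrite Rmult_plus_distr_r. apply Rplus_le_compat_l.
  apply Rle_trans with (e / (norm x + 1) * (norm x + 1)).
  + apply Rmult_le_compat_l; [|lra].
    left. apply Rdiv_lt_0_compat; lra.
  + right. field. lra.
Qed.

Lemma op_norm_le (S : blin) M :
  0 <= M -> (forall x, norm (S x) <= M * norm x) -> op_norm S <= M.
Proof.
intros H1 H2.
apply (@inf_spec (fun M => 0 <= M /\ forall x, norm (S x) <= M * norm x)).
- intros r [Hr _]; exact Hr.
- exists M; split; assumption.
- split; assumption.
Qed.

Lemma op_norm_plus (S T : blin_module) :
  op_norm (plus S T) <= op_norm S + op_norm T.
Proof.
destruct (op_norm_spec S) as [S1 S2], (op_norm_spec T) as [T1 T2].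
apply op_norm_le; [lra|]. intros x.
eapply Rle_trans; [apply (norm_triangle (S x) (T x))|].
rewrite Rmult_plus_distr_r. apply Rplus_le_compat; [apply S1|apply T1].
Qed.

Lemma op_norm_scal (l : C_AbsRing) (S : blin_module) :
  op_norm (scal l S) <= abs l * op_norm S.
Proof.
destruct (op_norm_spec S) as [S1 S2].
apply op_norm_le.
- apply Rmult_le_pos; [apply abs_ge_0|exact S2].
- intros x. eapply Rle_trans; [apply (norm_scal l (S x))|].
  rewrite Rmult_assoc. apply Rmult_le_compat_l; [apply abs_ge_0|apply S1].
Qed.

Lemma op_norm_zero : op_norm (zero : blin_module) = 0.
Proof.
apply Rle_antisym.
- apply op_norm_le; [lra|]. intros x.
  change (norm (zero : V) <= 0 * norm x). rewrite norm_zero. lra.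
- apply op_norm_spec.
Qed.

Lemma op_norm_eq0 (S : blin_module) : op_norm S = 0 -> S = zero.
Proof.
intros H. apply blin_ext. intros x.
apply norm_eq_zero. apply Rle_antisym; [|apply norm_ge_0].
eapply Rle_trans; [apply op_norm_spec|]. rewrite H. lra.
Qed.

Definition bounded_operators : NormedModule C_AbsRing :=
  normed_module_of op_norm_plus op_norm_scal op_norm_zero op_norm_eq0.
End BoundedOperators.

Record operator (V : NormedModule C_AbsRing) : Type :=
  Operator { dom : V -> Prop; op : V -> V }.

Definition linear_operator (V : NormedModule C_AbsRing) (A : operator V) : Prop :=
  dom A zero /\
  (forall x y, dom A x -> dom A y ->
     dom A (plus x y) /\ op A (plus x y) = plus (op A x) (op A y)) /\
  (forall (l : C_AbsRing) x, dom A x ->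
     dom A (scal l x) /\ op A (scal l x) = scal l (op A x)).

(* [S] is the everywhere defined bounded inverse of [z - A : dom A -> V]. *)
Definition is_resolvent (V : NormedModule C_AbsRing) (A : operator V)
    (z : C_AbsRing) (S : bounded_operators V) : Prop :=
  forall x y : V, S x = y <-> dom A y /\ minus (scal z y) (op A y) = x.

Definition in_resolvent_set (V : NormedModule C_AbsRing) (A : operator V)
    (z : C) : Prop :=
  exists S, is_resolvent A z S.

(* (z - A)^-1; meaningful only when [in_resolvent_set A z]. *)
Definition resolvent (V : NormedModule C_AbsRing) (A : operator V) (z : C) :
    bounded_operators V :=
  epsilon (inhabits zero) (is_resolvent A z).

Definition analytic_at (V : NormedModule C_AbsRing) (F : C -> V) (z0 : C) : Prop :=
  exists a : nat -> V,
    locally z0 (fun z => is_pseries a (minus z z0 : C_AbsRing) (F z)).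

(* Principal argument; it equals PI on the negative real axis. *)
Definition Carg (z : C) : R :=
  if Rle_dec 0 (Im z) then acos (Re z / Cmod z) else - acos (Re z / Cmod z).

Definition cpow (z : C) (a : R) : C :=
  if Ceq_dec z 0 then 0%C
  else Cmult (Rpower (Cmod z) a) (cos (a * Carg z), sin (a * Carg z)).

Definition slit_plane (z : C) : Prop := ~ (Im z = 0 /\ Re z <= 0).

(* The power is analytic in [z] only on the slit plane, so analyticity of
   (z^a - A)^-1 is required at the points of the neighborhood lying there,
   while the bounded inverse has to exist on the whole neighborhood, with
   0^a = 0.  For [xi0] in the slit plane this is analyticity on a full
   neighborhood; without this proviso 0 would never belong to [rho A a] when
   a < 1, not even if A is boundedly invertible. *)
Definition rho (V : NormedModule C_AbsRing) (A : operator V) (a : R) (xi0 : C) :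
    Prop :=
  locally xi0 (fun z =>
    in_resolvent_set A (cpow z a) /\
    (slit_plane z -> analytic_at (fun w => resolvent A (cpow w a)) z)).

Definition Sigma_i (V : NormedModule C_AbsRing) (A : operator V) (a : R) (xi : C) :
    Prop :=
  Re xi = 0 /\ ~ rho A a xi.

(* Functions on [0, oo) are represented by functions on [R] whose values at
   negative arguments are irrelevant. *)

Definition half_line (t : R) : Prop := 0 <= t.

Lemma minus_plus_plus (G : AbelianGroup) (a b c d : G) :
  plus (minus a b) (minus c d) = minus (plus a c) (plus b d).
Proof.
unfold minus. rewrite opp_plus, <- !plus_assoc. f_equal.
rewrite !plus_assoc. f_equal. apply plus_comm.
Qed.

Lemma norm_minus_self (V : NormedModule C_AbsRing) (a : V) : norm (minus a a) = 0.
Proof. rewrite (minus_eq_zero a). exact (@norm_zero _ V). Qed.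

Lemma norm_minus_zero (V : NormedModule C_AbsRing) (a : V) :
  norm (minus a zero) = norm a.
Proof. f_equal. exact (minus_zero_r a). Qed.

Lemma norm_minus_scal (V : NormedModule C_AbsRing) (l : C_AbsRing) (a b : V) :
  norm (minus (scal l a) (scal l b)) <= abs l * norm (minus a b).
Proof.
eapply Rle_trans; [|exact (norm_scal l (minus a b))].
right. f_equal. symmetry. exact (@scal_minus_distr_l C_Ring V l a b).
Qed.

Section FunctionSpaces.
Variable X : NormedModule C_AbsRing.

Definition bounded (f : R -> X) : Prop :=
  exists M, forall t, half_line t -> norm (f t) <= M.

Definition uniformly_continuous (f : R -> X) : Prop :=
  forall e, 0 < e -> exists d, 0 < d /\
    forall s t, half_line s -> half_line t -> Rabs (s - t) < d ->
      norm (minus (f s) (f t)) < e.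

Record BUC : Type := MkBUC {
  buc_fun :> R -> X;
  buc_bounded : bounded buc_fun;
  buc_uc : uniformly_continuous buc_fun }.

Definition vanishing (f : R -> X) : Prop :=
  filterlim f (Rbar_locally p_infty) (locally (zero : X)).

Definition C0 (f : R -> X) : Prop := continuous_on half_line f /\ vanishing f.

Definition sup_norm (f : R -> X) : R :=
  real (Lub_Rbar (fun r => exists t, half_line t /\ r = norm (f t))).

Lemma sup_norm_spec (f : BUC) :
  (forall t, half_line t -> norm (f t) <= sup_norm f) /\ 0 <= sup_norm f.
Proof.
unfold sup_norm.
destruct (Lub_Rbar_correct (fun r => exists t, half_line t /\ r = norm (f t)))
  as [Hub Hl].
destruct (buc_bounded f) as [M HM].
assert (H1 : Rbar_le (Lub_Rbar (fun r => exists t, half_line t /\ r = norm (f t))) M).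
{ apply Hl. intros r [t [Ht ->]]. simpl. apply HM, Ht. }
assert (H0 : half_line 0) by apply Rle_refl.
assert (H2 := Hub _ (ex_intro _ 0 (conj H0 eq_refl))).
destruct (Lub_Rbar _) as [l| |]; simpl in *; try contradiction.
split.
- intros t Ht. apply (Hub (norm (f t))). exists t. split; [exact Ht|reflexivity].
- exact (Rle_trans _ _ _ (norm_ge_0 (f 0)) H2).
Qed.

Lemma sup_norm_le (f : BUC) M :
  (forall t, half_line t -> norm (f t) <= M) -> sup_norm f <= M.
Proof.
intros HM. assert (S1 := sup_norm_spec f). revert S1. unfold sup_norm.
destruct (Lub_Rbar_correct (fun r => exists t, half_line t /\ r = norm (f t)))
  as [Hub Hl].
assert (H1 : Rbar_le (Lub_Rbar (fun r => exists t, half_line t /\ r = norm (f t))) M).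
{ apply Hl. intros r [t [Ht ->]]. simpl. apply HM, Ht. }
assert (H0 : half_line 0) by apply Rle_refl.
assert (H2 := Hub _ (ex_intro _ 0 (conj H0 eq_refl))).
destruct (Lub_Rbar _) as [l| |]; simpl in *; try contradiction.
intros _; exact H1.
Qed.

Lemma buc_plus_bounded (f g : BUC) : bounded (fun t => plus (f t) (g t)).
Proof.
destruct (buc_bounded f) as [M HM], (buc_bounded g) as [M' HM'].
exists (M + M'). intros t Ht.
eapply Rle_trans; [apply norm_triangle|].
apply Rplus_le_compat; auto.
Qed.

Lemma buc_plus_uc (f g : BUC) : uniformly_continuous (fun t => plus (f t) (g t)).
Proof.
intros e He.
destruct (buc_uc f (e := e / 2)) as [d [Hd H]]; [lra|].
destruct (buc_uc g (e := e / 2)) as [d' [Hd' H']]; [lra|].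
exists (Rmin d d'). split; [apply Rmin_pos; assumption|].
intros s t Hs Ht Hst.
replace (minus (plus (f s) (g s)) (plus (f t) (g t)))
  with (plus (minus (f s) (f t)) (minus (g s) (g t))).
- eapply Rle_lt_trans; [apply norm_triangle|].
  assert (A1 := H s t Hs Ht (Rlt_le_trans _ _ _ Hst (Rmin_l _ _))).
  assert (A2 := H' s t Hs Ht (Rlt_le_trans _ _ _ Hst (Rmin_r _ _))). lra.
- apply minus_plus_plus.
Qed.

Lemma buc_scal_bounded (l : C_AbsRing) (f : BUC) : bounded (fun t => scal l (f t)).
Proof.
destruct (buc_bounded f) as [M HM].
exists (abs l * M). intros t Ht.
eapply Rle_trans; [apply norm_scal|].
apply Rmult_le_compat_l; [apply abs_ge_0|auto].
Qed.

Lemma buc_scal_uc (l : C_AbsRing) (f : BUC) :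
  uniformly_continuous (fun t => scal l (f t)).
Proof.
intros e He. assert (P := abs_ge_0 l).
destruct (buc_uc f (e := e / (abs l + 1))) as [d [Hd H]].
{ apply Rdiv_lt_0_compat; lra. }
exists d; split; [exact Hd|]. intros s t Hs Ht Hst.
eapply Rle_lt_trans; [apply norm_minus_scal|].
specialize (H s t Hs Ht Hst).
set (n := norm _) in *.
apply Rle_lt_trans with (abs l * (e / (abs l + 1))).
- apply Rmult_le_compat_l; lra.
- apply Rlt_le_trans with ((abs l + 1) * (e / (abs l + 1))).
  + apply Rmult_lt_compat_r; [apply Rdiv_lt_0_compat; lra|lra].
  + right. field. lra.
Qed.

Lemma buc_zero_bounded : bounded (fun _ => zero).
Proof. exists 0. intros t _. rewrite norm_zero. lra. Qed.

Lemma buc_zero_uc : uniformly_continuous (fun _ => zero).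
Proof.
intros e He. exists 1. split; [lra|]. intros.
eapply Rle_lt_trans; [right; apply norm_minus_self|exact He].
Qed.

Definition buc_plus f g := MkBUC (buc_plus_bounded f g) (buc_plus_uc f g).
Definition buc_scal l f := MkBUC (buc_scal_bounded l f) (buc_scal_uc l f).
Definition buc_zero := MkBUC buc_zero_bounded buc_zero_uc.

Definition eqC0 (f g : BUC) : Prop := C0 (fun t => minus (f t) (g t)).

Lemma vanishingE (f : R -> X) :
  vanishing f <-> forall e, 0 < e -> exists M, forall t, M < t -> norm (f t) < e.
Proof.
unfold vanishing. rewrite filterlim_locally_ball_norm.
split.
- intros H e He. destruct (H (mkposreal e He)) as [M HM].
  exists M. intros t Ht. specialize (HM t Ht). unfold ball_norm in HM.
  eapply Rle_lt_trans; [right; symmetry; apply norm_minus_zero|exact HM].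
- intros H e. destruct (H e (cond_pos e)) as [M HM].
  exists M. intros t Ht. unfold ball_norm.
  eapply Rle_lt_trans; [right; apply norm_minus_zero|auto].
Qed.

Lemma uc_continuous (f : BUC) : continuous_on half_line f.
Proof.
intros t Ht. apply (filterlim_locally_ball_norm (F := within half_line (locally t))).
intros e. destruct (buc_uc f (cond_pos e)) as [d [Hd H]].
exists (mkposreal d Hd). intros s Hs Hs'. apply H; assumption.
Qed.

Lemma eqC0E (f g : BUC) : eqC0 f g <->
  forall e, 0 < e -> exists M, forall t, M < t -> norm (minus (f t) (g t)) < e.
Proof.
rewrite <- (vanishingE (fun t => minus (f t) (g t))).
split; [intros [_ H]; exact H|]. intros H; split; [|exact H].
assert (Hc := @uc_continuous (buc_plus f (buc_scal (opp one) g))).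
replace (fun t => minus (f t) (g t))
  with (buc_fun (buc_plus f (buc_scal (opp one) g))); [exact Hc|].
apply functional_extensionality. intros t. simpl.
unfold minus. f_equal. exact (scal_opp_one (g t)).
Qed.

Lemma eqC0_refl f : eqC0 f f.
Proof.
apply eqC0E. intros e He. exists 0. intros t _.
eapply Rle_lt_trans; [right; apply norm_minus_self|exact He].
Qed.

Lemma eqC0_sym f g : eqC0 f g -> eqC0 g f.
Proof.
rewrite !eqC0E. intros H e He. destruct (H e He) as [M HM].
exists M. intros t Ht. rewrite <- opp_minus, norm_opp. auto.
Qed.

Lemma eqC0_trans f g h : eqC0 f g -> eqC0 g h -> eqC0 f h.
Proof.
rewrite !eqC0E. intros H1 H2 e He.
destruct (H1 (e / 2)) as [M HM]; [lra|].
destruct (H2 (e / 2)) as [M' HM']; [lra|].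
exists (Rmax M M'). intros t Ht.
rewrite (minus_trans (g t)).
eapply Rle_lt_trans; [apply norm_triangle|].
assert (A1 := HM t (Rle_lt_trans _ _ _ (Rmax_l _ _) Ht)).
assert (A2 := HM' t (Rle_lt_trans _ _ _ (Rmax_r _ _) Ht)). lra.
Qed.

Lemma eqC0_plus f f' g g' :
  eqC0 f f' -> eqC0 g g' -> eqC0 (buc_plus f g) (buc_plus f' g').
Proof.
rewrite !eqC0E. intros H1 H2 e He.
destruct (H1 (e / 2)) as [M HM]; [lra|].
destruct (H2 (e / 2)) as [M' HM']; [lra|].
exists (Rmax M M'). intros t Ht. simpl.
replace (minus (plus (f t) (g t)) (plus (f' t) (g' t)))
  with (plus (minus (f t) (f' t)) (minus (g t) (g' t))).
- eapply Rle_lt_trans; [apply norm_triangle|].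
  assert (A1 := HM t (Rle_lt_trans _ _ _ (Rmax_l _ _) Ht)).
  assert (A2 := HM' t (Rle_lt_trans _ _ _ (Rmax_r _ _) Ht)). lra.
- apply minus_plus_plus.
Qed.

Lemma eqC0_scal l f f' : eqC0 f f' -> eqC0 (buc_scal l f) (buc_scal l f').
Proof.
rewrite !eqC0E. intros H e He. assert (P := abs_ge_0 l).
destruct (H (e / (abs l + 1))) as [M HM].
{ apply Rdiv_lt_0_compat; lra. }
exists M. intros t Ht. simpl.
eapply Rle_lt_trans; [apply norm_minus_scal|].
specialize (HM t Ht).
set (n := norm _) in *.
apply Rle_lt_trans with (abs l * (e / (abs l + 1))).
- apply Rmult_le_compat_l; lra.
- apply Rlt_le_trans with ((abs l + 1) * (e / (abs l + 1))).
  + apply Rmult_lt_compat_r; [apply Rdiv_lt_0_compat; lra|lra].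
  + right. field. lra.
Qed.

Record quot : Type := MkQuot {
  coset :> BUC -> Prop;
  coset_ok : exists f, coset = eqC0 f }.

Definition tilde (f : BUC) : quot := MkQuot (ex_intro _ f eq_refl).

Lemma quot_ext (y z : quot) : coset y = coset z -> y = z.
Proof.
destruct y as [y Hy], z as [z Hz]; simpl. intros E. subst z.
f_equal. apply proof_irrelevance.
Qed.

Lemma tilde_eq f g : tilde f = tilde g <-> eqC0 f g.
Proof.
split.
- intros E. change (tilde f g). rewrite E. apply eqC0_refl.
- intros H. apply quot_ext. simpl. apply functional_extensionality. intros h.
  apply propositional_extensionality. split; intros H'.
  + eapply eqC0_trans; [apply eqC0_sym; exact H|exact H'].
  + eapply eqC0_trans; [exact H|exact H'].
Qed.

Lemma tilde_ex (y : quot) : exists f, y = tilde f.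
Proof. destruct (coset_ok y) as [f Hf]. exists f. apply quot_ext. exact Hf. Qed.

Definition repr (y : quot) : BUC :=
  proj1_sig (constructive_indefinite_description _ (tilde_ex y)).

Lemma tilde_repr y : tilde (repr y) = y.
Proof.
unfold repr. destruct (constructive_indefinite_description _ _) as [f Hf].
symmetry; exact Hf.
Qed.

Lemma repr_tilde f : eqC0 (repr (tilde f)) f.
Proof. apply tilde_eq, tilde_repr. Qed.

Lemma in_quot (y : quot) f : y f <-> y = tilde f.
Proof.
rewrite <- (tilde_repr y). rewrite tilde_eq. reflexivity.
Qed.

Definition quot_plus (y z : quot) : quot := tilde (buc_plus (repr y) (repr z)).
Definition quot_scal (l : C) (y : quot) : quot := tilde (buc_scal l (repr y)).
Definition quot_zero : quot := tilde buc_zero.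
Definition quot_opp (y : quot) : quot := quot_scal (opp (one : C_AbsRing)) y.

Lemma tilde_plus f g : quot_plus (tilde f) (tilde g) = tilde (buc_plus f g).
Proof. apply tilde_eq, eqC0_plus; apply repr_tilde. Qed.

Lemma tilde_scal l f : quot_scal l (tilde f) = tilde (buc_scal l f).
Proof. apply tilde_eq, eqC0_scal; apply repr_tilde. Qed.

Lemma eqC0_pw (f g : BUC) : (forall t, f t = g t) -> eqC0 f g.
Proof.
intros H. apply eqC0E. intros e He. exists 0. intros t _.
rewrite H. eapply Rle_lt_trans; [right; apply norm_minus_self|exact He].
Qed.

Lemma quot_ind (P : quot -> Prop) : (forall f, P (tilde f)) -> forall y, P y.
Proof. intros H y. rewrite <- (tilde_repr y). apply H. Qed.

Definition quot_monoid_mixin : AbelianMonoid.mixin_of quot.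
Proof.
apply (AbelianMonoid.Mixin quot quot_plus quot_zero).
- intros y z; pattern y; apply quot_ind; intros f; pattern z; apply quot_ind; intros g.
  rewrite !tilde_plus. apply tilde_eq, eqC0_pw; intros t; simpl. apply plus_comm.
- intros y z w; pattern y; apply quot_ind; intros f; pattern z; apply quot_ind;
    intros g; pattern w; apply quot_ind; intros h.
  rewrite !tilde_plus. apply tilde_eq, eqC0_pw; intros t; simpl. apply plus_assoc.
- intros y; pattern y; apply quot_ind; intros f. unfold quot_zero.
  rewrite tilde_plus. apply tilde_eq, eqC0_pw; intros t; simpl. apply plus_zero_r.
Defined.

Definition quot_group_mixin :
  AbelianGroup.mixin_of (AbelianMonoid.Pack quot quot_monoid_mixin quot).
Proof.
apply (AbelianGroup.Mixin (AbelianMonoid.Pack quot quot_monoid_mixin quot) quot_opp).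
intros y; change (quot_plus y (quot_opp y) = quot_zero).
pattern y; apply quot_ind; intros f.
unfold quot_opp, quot_zero. rewrite tilde_scal, tilde_plus.
apply tilde_eq, eqC0_pw; intros t; simpl.

change (plus (f t) (scal (opp (one : C_AbsRing)) (f t)) = zero).
replace (scal (opp (one : C_AbsRing)) (f t)) with (opp (f t)).
- exact (@plus_opp_r (NormedModule.AbelianGroup C_AbsRing X) (f t)).
- symmetry. exact (scal_opp_one (f t)).
Defined.

Definition quot_group : AbelianGroup :=
  AbelianGroup.Pack quot (AbelianGroup.Class quot _ quot_group_mixin) quot.

Definition quot_module_mixin : ModuleSpace.mixin_of C_Ring quot_group.
Proof.
apply (ModuleSpace.Mixin C_Ring quot_group quot_scal).
- intros a b y; pattern y; apply quot_ind; intros f.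
  rewrite !tilde_scal. apply tilde_eq, eqC0_pw; intros t.
  exact (@scal_assoc C_Ring X a b (f t)).
- intros y; pattern y; apply quot_ind; intros f.
  rewrite tilde_scal. apply tilde_eq, eqC0_pw; intros t.
  exact (@scal_one C_Ring X (f t)).
- intros a y z; pattern y; apply quot_ind; intros f; pattern z; apply quot_ind;
    intros g.
  change (quot_scal a (quot_plus (tilde f) (tilde g)) =
          quot_plus (quot_scal a (tilde f)) (quot_scal a (tilde g))).
  rewrite tilde_plus, !tilde_scal, tilde_plus.
  apply tilde_eq, eqC0_pw; intros t.
  exact (@scal_distr_l C_Ring X a (f t) (g t)).
- intros a b y; pattern y; apply quot_ind; intros f.
  change (quot_scal (plus a b) (tilde f) =
          quot_plus (quot_scal a (tilde f)) (quot_scal b (tilde f))).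
  rewrite !tilde_scal, tilde_plus.
  apply tilde_eq, eqC0_pw; intros t.
  exact (@scal_distr_r C_Ring X a b (f t)).
Defined.

Definition quot_module : ModuleSpace C_Ring :=
  ModuleSpace.Pack C_Ring quot
    (ModuleSpace.Class C_Ring quot (AbelianGroup.class quot_group) quot_module_mixin)
    quot.

Definition quot_norm (y : quot) : R :=
  inf (fun r => exists f : BUC, y f /\ r = sup_norm f).

Lemma quot_norm_spec (y : quot) :
  (forall f, y f -> quot_norm y <= sup_norm f) /\
  (forall e, 0 < e -> exists f, y f /\ sup_norm f < quot_norm y + e) /\
  0 <= quot_norm y.
Proof.
destruct (@inf_spec (fun r => exists f : BUC, y f /\ r = sup_norm f))
  as [H1 [H2 H3]].
- intros r [f [_ ->]]. apply sup_norm_spec.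
- exists (sup_norm (repr y)), (repr y). split; [|reflexivity].
  apply in_quot. symmetry; apply tilde_repr.
- split; [|split; [|exact H3]].
  + intros f Hf. apply H1. exists f. split; [exact Hf|reflexivity].
  + intros e He. destruct (H2 e He) as [r [[f [Hf ->]] Hr]].
    exists f. split; assumption.
Qed.

Lemma quot_norm_plus (y z : quot_module) :
  quot_norm (plus y z) <= quot_norm y + quot_norm z.
Proof.
apply le_epsilon. intros e He.
destruct (quot_norm_spec y) as [_ [Y2 _]], (quot_norm_spec z) as [_ [Z2 _]].
destruct (Y2 (e / 2)) as [f [Hf Hf']]; [lra|].
destruct (Z2 (e / 2)) as [g [Hg Hg']]; [lra|].
apply Rle_trans with (sup_norm (buc_plus f g)).
- apply quot_norm_spec. apply in_quot.
  apply in_quot in Hf. apply in_quot in Hg. rewrite Hf, Hg. apply tilde_plus.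
- apply sup_norm_le. intros t Ht. simpl.
  eapply Rle_trans; [apply norm_triangle|].
  assert (A1 := proj1 (sup_norm_spec f) t Ht).
  assert (A2 := proj1 (sup_norm_spec g) t Ht). lra.
Qed.

Lemma quot_norm_scal (l : C_AbsRing) (y : quot_module) :
  quot_norm (scal l y) <= abs l * quot_norm y.
Proof.
apply le_epsilon. intros e He. assert (P := abs_ge_0 l).
destruct (quot_norm_spec y) as [_ [Y2 _]].
destruct (Y2 (e / (abs l + 1))) as [f [Hf Hf']].
{ apply Rdiv_lt_0_compat; lra. }
apply Rle_trans with (sup_norm (buc_scal l f)).
- apply quot_norm_spec. apply in_quot.
  apply in_quot in Hf. rewrite Hf. apply tilde_scal.
- apply sup_norm_le. intros t Ht. simpl.
  eapply Rle_trans; [apply norm_scal|].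
  assert (A1 := proj1 (sup_norm_spec f) t Ht).
  apply Rle_trans with (abs l * (quot_norm y + e / (abs l + 1))).
  + apply Rmult_le_compat_l; lra.
  + rewrite Rmult_plus_distr_l. apply Rplus_le_compat_l.
    apply Rle_trans with ((abs l + 1) * (e / (abs l + 1))).
    * apply Rmult_le_compat_r; [|lra]. left; apply Rdiv_lt_0_compat; lra.
    * right. field. lra.
Qed.

Lemma quot_norm_zero : quot_norm (zero : quot_module) = 0.
Proof.
apply Rle_antisym; [|apply quot_norm_spec].
apply Rle_trans with (sup_norm buc_zero).
- apply quot_norm_spec. apply in_quot. reflexivity.
- apply sup_norm_le. intros t _. simpl. rewrite norm_zero. lra.
Qed.

Lemma quot_norm_eq0 (y : quot_module) : quot_norm y = 0 -> y = zero.
Proof.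
intros H0. destruct (quot_norm_spec y) as [_ [Y2 _]].
change (y = tilde buc_zero). rewrite <- (tilde_repr y).
apply tilde_eq, eqC0E. intros e He.
destruct (Y2 (e / 2)) as [f [Hf Hf']]; [lra|].
rewrite <- (tilde_repr y) in Hf. simpl in Hf. rewrite eqC0E in Hf.
destruct (Hf (e / 2)) as [M HM]; [lra|].
exists (Rmax M 0). intros t Ht. simpl.
eapply Rle_lt_trans; [right; apply norm_minus_zero|].
assert (B1 := HM t (Rle_lt_trans _ _ _ (Rmax_l _ _) Ht)).
assert (Ht0 : half_line t).
{ left. exact (Rle_lt_trans _ _ _ (Rmax_r _ _) Ht). }
assert (B2 := proj1 (sup_norm_spec f) t Ht0).
replace (repr y t) with (plus (minus (repr y t) (f t)) (f t)).
- eapply Rle_lt_trans; [apply norm_triangle|]. lra.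
- unfold minus. rewrite <- plus_assoc.
  eapply eq_trans; [|exact (@plus_zero_r X (repr y t))].
  f_equal. exact (@plus_opp_l (NormedModule.AbelianGroup C_AbsRing X) (f t)).
Qed.

Definition quotient_space : NormedModule C_AbsRing :=
  normed_module_of quot_norm_plus quot_norm_scal quot_norm_zero quot_norm_eq0.

End FunctionSpaces.

Section Equations.
Variable X : CBanach.

(* v = u' on [0, oo), one-sided at 0; that u and u' are in BUC is in the types. *)
Definition is_derivative (u v : BUC X) : Prop :=
  forall t, half_line t ->
    filterdiff (U := R_NormedModule) (V := real_of X) u
      (within half_line (locally t))
      (fun h => scal (V := real_of X) h (v t)).

(* The class of u' does not depend on the representative u: if u tends to 0 and
   u' is uniformly continuous, then u' tends to 0 (Barbalat), so [epsilon] picks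
   the unique value. *)
Definition D_tilde : operator (quotient_space X) :=
  Operator
    (fun y : quotient_space X => exists u v, coset y u /\ is_derivative u v)
    (fun y : quotient_space X => epsilon (inhabits (zero : quotient_space X))
       (fun z => exists u v, coset y u /\ is_derivative u v /\ z = tilde v)).

Definition hat (f : BUC X) (z : C) : quotient_space X :=
  blin_fun (resolvent D_tilde z) (tilde f).

Definition sp (f : BUC X) (xi0 : R) : Prop :=
  ~ exists F : C -> quotient_space X,
      locally ((0, xi0) : C) (fun z =>
        analytic_at F z /\ (Re z <> 0 -> F z = hat f z)).

Definition Gamma (a : R) : R :=
  RInt_gen (V := R_CompleteNormedModule)
    (fun s => Rpower s (a - 1) * exp (- s)) (at_right 0) (Rbar_locally p_infty).

(* The integral is improper at tau = t when a < 1. *)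
Definition J (a : R) (u : R -> X) (t : R) : X :=
  if Rlt_dec 0 t then
    RInt_gen (V := real_of X)
      (fun tau => scal (V := real_of X) (Rpower (t - tau) (a - 1) / Gamma a)
               (u tau))
      (at_point 0) (at_left t)
  else zero.

Definition mild_solution (a : R) (A : operator X) (g u : R -> X) : Prop :=
  continuous_on half_line u /\
  forall t, half_line t ->
    dom A (J a u t) /\
    u t = plus (plus (op A (J a u t)) (J a g t)) (u 0).

Definition asymptotic_mild_solution (a : R) (A : operator X) (f u : BUC X) : Prop :=
  exists eps : R -> X, C0 eps /\
    mild_solution a A (fun t => plus (f t) (eps t)) u.

Definition asymptotic_1_periodic (u : R -> X) : Prop :=
  vanishing (fun t => minus (u (t + 1)) (u t)).

Definition asymptotic_anti_1_periodic (u : R -> X) : Prop :=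
  vanishing (fun t => plus (u (t + 1)) (u t)).
End Equations.

(* Main.v *)
Require Import Defs.
From Stdlib Require Import Reals Lra Lia List.
From Stdlib Require Import FunctionalExtensionality Classical ClassicalEpsilon.
From Coquelicot Require Import Coquelicot.

(** Let R = (l^a - A)^-1. Applied to the equation, R shows that R (u - u(0)) is the fractional integral of
    l^a R u + R (f + eps) - u. The divided difference H_l = (l^a - D^a) / (l - D), D = d/dt, which for a < 1
    is a Stieltjes integral of exponential convolutions, turns this modulo C_0 into
      hat u (l) = R (H_l (u - u(0)) + l^(a-1) u(0) + hat f (l)),
    and the right-hand side is analytic near each nonzero i xi outside Sigma_i(A,a) and i sp(f).

    Hence the singularities of hat u are among 0 and the roots of e^z = tau (tau = 1 or -1), and they are at
    most simple poles because |hat u (z)| <= C / |Re z|. With S_s the translations, the transform of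
    (S_s - 1)^4 (S_1 - tau)^4 u therefore continues to an entire function bounded by C / |Re z|, so it
    vanishes. Translations are contractions, so their unimodular eigenvalues are semisimple and
    (S_s - 1)(S_1 - tau) u = 0 modulo C_0 for all s > 0. Thus p = (S_1 - tau) u is a fixed class,
    z hat p (z) = p, and letting z decrease to 0 gives p = 0: for tau = 1 because e^z - 1 tends to 0, for
    tau = -1 because z hat u (z) tends to 0 when 0 is neither in Sigma_i(A,a) nor in sp(f).

    Of analyticity only Taylor expansions of order three at every point are used: they suffice for the
    maximum principle for vector-valued functions, and so for Liouville's theorem. *)

Open Scope R_scope.
Set Bullet Behavior "Strict Subproofs".

(** For a < 1 the power l^a branches at 0, so the resolvent formula gives no continuation of hat u
    through 0 even when 0 lies outside Sigma_i(A,a). This is why S_s - 1, whose symbol e^{sz} - 1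
    vanishes at 0, accompanies S_1 - tau, and why 0 is treated separately by a limit along the
    positive axis. The other singularities may be infinitely many; the symbols remove all of them at
    once. The exponent 4 is one for the simple pole plus three for the order of the Taylor
    remainder: b^4 times a simple pole is O(h^3), itself a third order expansion with zero
    coefficients, so no theorem on removable singularities is invoked. The divided difference
    requires the constant of Balakrishnan's integral, the integral of r^(a-1) / (1 + r), to agree
    with Gamma(a) Gamma(1 - a), which arises from the kernels of fractional integration. The two are
    compared by testing a convolution identity on the exponential as t tends to infinity, instead of
    evaluating either as pi / sin(pi a). *)

(** * Linear identities in a complex vector space, by comparison of coefficients *)

Inductive vexp : Type :=
| VAtom (n : nat) | VZero | VPlus (a b : vexp) | VOpp (a : vexp)
| VMinus (a b : vexp) | VScal (c : C) (a : vexp).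

Fixpoint vcoef (e : vexp) (n : nat) : C :=
  match e with
  | VAtom m => if Nat.eqb m n then 1%C else 0%C
  | VZero => 0%C
  | VPlus a b => (vcoef a n + vcoef b n)%C
  | VOpp a => (- vcoef a n)%C
  | VMinus a b => (vcoef a n - vcoef b n)%C
  | VScal c a => (c * vcoef a n)%C
  end.

Section VectorIdentities.
Variable V : ModuleSpace C_Ring.

Fixpoint vden (env : list V) (e : vexp) : V :=
  match e with
  | VAtom m => nth m env zero
  | VZero => zero
  | VPlus a b => plus (vden env a) (vden env b)
  | VOpp a => opp (vden env a)
  | VMinus a b => minus (vden env a) (vden env b)
  | VScal c a => scal (c : C_Ring) (vden env a)
  end.

Fixpoint vlin (env : list V) (k : nat -> C) : V :=
  match env with
  | nil => zero
  | cons v l => plus (scal (k 0%nat : C_Ring) v) (vlin l (fun n => k (S n)))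
  end.

Lemma vlin_plus env : forall k k',
  vlin env (fun n => k n + k' n)%C = plus (vlin env k) (vlin env k').
Proof.
induction env as [|v env IH]; intros k k'; simpl.
- symmetry; apply plus_zero_l.
- rewrite (IH (fun n => k (S n)) (fun n => k' (S n))).
  change (k 0%nat + k' 0%nat)%C with (plus (k 0%nat : C_Ring) (k' 0%nat)).
  rewrite scal_distr_r, <- !plus_assoc. f_equal.
  rewrite !plus_assoc. f_equal. apply plus_comm.
Qed.

Lemma vlin_scal env : forall c k,
  vlin env (fun n => c * k n)%C = scal (c : C_Ring) (vlin env k).
Proof.
induction env as [|v env IH]; intros c k; simpl.
- symmetry. exact (scal_zero_r (c : C_Ring)).
- rewrite (IH c (fun n => k (S n))), scal_distr_l, scal_assoc. reflexivity.
Qed.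

Lemma vlin_ext env : forall k k',
  (forall n, (n < length env)%nat -> k n = k' n) -> vlin env k = vlin env k'.
Proof.
induction env as [|v env IH]; intros k k' H; simpl; [reflexivity|].
rewrite (H 0%nat) by (simpl; lia). f_equal. apply IH.
intros n Hn. apply H. simpl; lia.
Qed.

Lemma vlin_zero env : vlin env (fun _ => 0%C) = zero.
Proof.
induction env as [|v env IH]; simpl; [reflexivity|].
rewrite IH, plus_zero_r. exact (scal_zero_l v).
Qed.

Lemma vlin_atom env : forall m,
  vlin env (fun n => if Nat.eqb m n then 1%C else 0%C) = nth m env zero.
Proof.
induction env as [|v env IH]; intros [|m]; simpl; try reflexivity.
- rewrite vlin_zero, plus_zero_r. exact (scal_one v).
- rewrite (IH m). eapply eq_trans; [|apply plus_zero_l]. f_equal.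
  exact (scal_zero_l v).
Qed.

Lemma vden_lin env e : vden env e = vlin env (vcoef e).
Proof.
induction e; simpl.
- symmetry; apply vlin_atom.
- symmetry; apply vlin_zero.
- rewrite vlin_plus. congruence.
- rewrite IHe. eapply eq_trans; [|apply (vlin_ext env (fun n => (-1) * vcoef e n)%C)].
  + rewrite vlin_scal. eapply eq_trans; [symmetry; exact (scal_opp_one (K := C_Ring) _)|].
    f_equal. simpl. unfold opp, one; simpl. apply injective_projections; simpl; lra.
  + intros; ring.
- unfold minus. rewrite IHe1, IHe2.
  eapply eq_trans; [|apply (vlin_ext env (fun n => vcoef e1 n + (-1) * vcoef e2 n)%C)].
  + rewrite (vlin_plus env (vcoef e1)), vlin_scal. f_equal.
    eapply eq_trans; [symmetry; exact (scal_opp_one (K := C_Ring) _)|].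
    f_equal. unfold opp, one; simpl. apply injective_projections; simpl; lra.
  + intros; ring.
- rewrite vlin_scal. congruence.
Qed.

Fixpoint vagree (N : nat) (e e' : vexp) : Prop :=
  match N with
  | O => True
  | S n => vagree n e e' /\ vcoef e n = vcoef e' n
  end.

Lemma vden_eq env e e' : vagree (length env) e e' -> vden env e = vden env e'.
Proof.
intros H. rewrite !vden_lin. apply vlin_ext.
revert H. generalize (length env). intros N H n Hn.
induction N as [|N IH]; [lia|]. destruct H as [H H'].
destruct (Nat.eq_dec n N) as [->|]; [exact H'|apply IH; [exact H|lia]].
Qed.
End VectorIdentities.

(* Atoms are compared up to unification: one vector may be typed through several canonical-structure paths. *)
Ltac vmem x l :=
  match l with
  | nil => constr:(false)
  | cons ?y ?l' =>
    match constr:(Set) with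
    | _ => let _ := match constr:(Set) with _ => unify x y end in constr:(true)
    | _ => vmem x l'
    end
  end.
Ltac vidx x l :=
  match l with
  | cons ?y ?l' =>
    match constr:(Set) with
    | _ => let _ := match constr:(Set) with _ => unify x y end in constr:(O)
    | _ => let n := vidx x l' in constr:(S n)
    end
  end.
Ltac vatoms V t l :=
  lazymatch t with
  | plus ?a ?b => let l := vatoms V a l in vatoms V b l
  | minus ?a ?b => let l := vatoms V a l in vatoms V b l
  | opp ?a => vatoms V a l
  | zero => l
  | scal _ ?a => vatoms V a l
  | _ => let b := vmem t l in
         match b with true => l | false => constr:(@cons V t l) end
  end.
Ltac vreify t l :=
  lazymatch t with
  | plus ?a ?b => let a := vreify a l in let b := vreify b l in constr:(VPlus a b)
  | minus ?a ?b => let a := vreify a l in let b := vreify b l in constr:(VMinus a b)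
  | opp ?a => let a := vreify a l in constr:(VOpp a)
  | zero => constr:(VZero)
  | scal ?c ?a => let a := vreify a l in constr:(VScal c a)
  | _ => let n := vidx t l in constr:(VAtom n)
  end.
Ltac cnorm :=
  repeat change (@plus C_AbsRing) with Cplus; repeat change (@plus C_Ring) with Cplus;
  change (@one C_AbsRing) with (RtoC 1); change (@one C_Ring) with (RtoC 1);
  change (@zero C_AbsRing) with (RtoC 0); change (@zero C_Ring) with (RtoC 0);
  change (@opp C_AbsRing) with Copp; change (@opp C_Ring) with Copp;
  change (@mult C_AbsRing) with Cmult; change (@mult C_Ring) with Cmult.
Ltac vstep V :=
  lazymatch goal with
  | |- ?a = ?b =>
    let l := vatoms (ModuleSpace.sort C_Ring V) a (@nil (ModuleSpace.sort C_Ring V)) in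
    let l := vatoms (ModuleSpace.sort C_Ring V) b l in
    let ea := vreify a l in let eb := vreify b l in
    apply (@vden_eq V l ea eb); cbn [length vagree vcoef Nat.eqb];
    repeat match goal with |- _ /\ _ => split | |- True => exact I end
  end.
Ltac vring V := vstep (NormedModule.ModuleSpace C_AbsRing V); cnorm; try ring.

(** * Taylor expansions and the maximum principle *)

Section Taylor.
Context {V : NormedModule C_AbsRing}.

(** An expansion at 0 of order n with bounded remainder, kept as nested difference quotients: F =
    F(0) + h F1, F1 = F1(0) + h F2, and so on. In this form sums and products go through by
    induction. At another point z it is applied to h |-> F (z + h). *)
Fixpoint taylor (n : nat) (F : C -> V) : Prop :=
  match n with
  | O => exists M d, 0 < d /\ forall h, Cmod h < d -> norm (F h) <= M
  | S n => exists F1, taylor n F1 /\ exists d, 0 < d /\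
      forall h : C, Cmod h < d -> F h = plus (F 0%C) (scal h (F1 h))
  end.

(** The axiom of normed modules gives <=; the converse is the same axiom for the inverse of c,
    applied to the vector c x. *)
Lemma norm_scal_C (c : C) (x : V) : norm (scal c x) = Cmod c * norm x.
Proof.
apply Rle_antisym; [exact (norm_scal c x)|].
destruct (Ceq_dec c 0) as [->|Hc].
- rewrite Cmod_0, Rmult_0_l. apply norm_ge_0.
- assert (P : 0 < Cmod c) by (apply Cmod_gt_0; exact Hc).
  replace (norm x) with (norm (scal (/ c)%C (scal c x))).
  + apply (Rmult_le_reg_l (/ Cmod c)); [apply Rinv_0_lt_compat; exact P|].
    rewrite <- Rmult_assoc, Rinv_l, Rmult_1_l by lra.
    rewrite <- Cmod_inv by exact Hc. exact (norm_scal (/ c)%C (scal c x)).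
  + f_equal. vring V. field. exact Hc.
Qed.

Lemma norm_minus_le (x y : V) : norm (minus x y) <= norm x + norm y.
Proof.
replace (minus x y) with (plus x (scal (RtoC (-1)) y)) by (vring V).
eapply Rle_trans; [apply norm_triangle|]. rewrite norm_scal_C, Cmod_R.
unfold Rabs. destruct (Rcase_abs (-1)); lra.
Qed.

Lemma taylor_ext n : forall F G d, 0 < d ->
  (forall h, Cmod h < d -> F h = G h) -> taylor n F -> taylor n G.
Proof.
destruct n as [|n]; intros F G d Hd E; simpl.
- intros (M & d' & Hd' & H). exists M, (Rmin d d').
  split; [apply Rmin_pos; assumption|]. intros h Hh.
  rewrite <- E by (eapply Rlt_le_trans; [exact Hh|apply Rmin_l]).
  apply H. eapply Rlt_le_trans; [exact Hh|apply Rmin_r].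
- intros (F1 & H1 & d' & Hd' & H). exists F1. split; [exact H1|].
  exists (Rmin d d'). split; [apply Rmin_pos; assumption|]. intros h Hh.
  rewrite <- !E.
  + apply H. eapply Rlt_le_trans; [exact Hh|apply Rmin_r].
  + rewrite Cmod_0; exact Hd.
  + eapply Rlt_le_trans; [exact Hh|apply Rmin_l].
Qed.

Lemma taylor_0_of_S F : taylor 1 F -> taylor 0 F.
Proof.
intros (F1 & (M & d & Hd & H) & d' & Hd' & E).
exists (norm (F 0%C) + 1 * M), (Rmin 1 (Rmin d d')).
split; [repeat apply Rmin_pos; lra|]. intros h Hh.
assert (H1 : Cmod h < 1) by (eapply Rlt_le_trans; [exact Hh|apply Rmin_l]).
assert (H2 : Cmod h < d).
{ eapply Rlt_le_trans; [exact Hh|]. eapply Rle_trans; [apply Rmin_r|apply Rmin_l]. }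
assert (H3 : Cmod h < d').
{ eapply Rlt_le_trans; [exact Hh|]. eapply Rle_trans; [apply Rmin_r|apply Rmin_r]. }
rewrite (E h H3). eapply Rle_trans; [apply norm_triangle|].
apply Rplus_le_compat_l. rewrite norm_scal_C.
apply Rmult_le_compat; [apply Cmod_ge_0|apply norm_ge_0|lra|auto].
Qed.

Lemma taylor_pred n : forall F, taylor (S n) F -> taylor n F.
Proof.
induction n as [|n IH]; intros F; [apply taylor_0_of_S|].
intros (F1 & H1 & H). exists F1. split; [apply IH; exact H1|exact H].
Qed.

Lemma taylor_le n m F : (n <= m)%nat -> taylor m F -> taylor n F.
Proof. induction 1; [auto|]. intros H1. apply IHle, taylor_pred, H1. Qed.

Lemma taylor_const n : forall v, taylor n (fun _ => v).
Proof.
induction n as [|n IH]; intros v; simpl.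
- exists (norm v), 1. split; [lra|]. intros; lra.
- exists (fun _ => zero). split; [apply IH|]. exists 1; split; [lra|].
  intros. vring V.
Qed.

Lemma taylor_plus n : forall F G, taylor n F -> taylor n G ->
  taylor n (fun h => plus (F h) (G h)).
Proof.
induction n as [|n IH]; intros F G; simpl.
- intros (M & d & Hd & H) (M' & d' & Hd' & H'). exists (M + M'), (Rmin d d').
  split; [apply Rmin_pos; assumption|]. intros h Hh.
  eapply Rle_trans; [apply norm_triangle|]. apply Rplus_le_compat.
  + apply H. eapply Rlt_le_trans; [exact Hh|apply Rmin_l].
  + apply H'. eapply Rlt_le_trans; [exact Hh|apply Rmin_r].
- intros (F1 & H1 & d & Hd & H) (G1 & H1' & d' & Hd' & H').
  exists (fun h => plus (F1 h) (G1 h)). split; [apply IH; assumption|].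
  exists (Rmin d d'). split; [apply Rmin_pos; assumption|]. intros h Hh.
  rewrite (H h) by (eapply Rlt_le_trans; [exact Hh|apply Rmin_l]).
  rewrite (H' h) by (eapply Rlt_le_trans; [exact Hh|apply Rmin_r]).
  vring V.
Qed.

(* A third order Taylor bound is what the maximum principle needs. *)
Lemma taylor_3_bound F : taylor 3 F -> exists a1 a2 r M d, 0 < d /\
  forall h, Cmod h < d -> norm (r h) <= M /\
    F h = plus (F 0%C) (plus (scal h a1) (plus (scal (h * h)%C a2) (scal (h * h * h)%C (r h)))).
Proof.
intros (F1 & (F2 & (F3 & (M & d3 & Hd3 & H3) & d2 & Hd2 & H2) & d1 & Hd1 & H1) & d0 & Hd0 & H0).
exists (F1 0%C), (F2 0%C), F3, M, (Rmin (Rmin d0 d1) (Rmin d2 d3)).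
split; [repeat apply Rmin_pos; assumption|]. intros h Hh.
assert (A := Rmin_l (Rmin d0 d1) (Rmin d2 d3)).
assert (B := Rmin_r (Rmin d0 d1) (Rmin d2 d3)).
assert (A1 := Rmin_l d0 d1). assert (A2 := Rmin_r d0 d1).
assert (B1 := Rmin_l d2 d3). assert (B2 := Rmin_r d2 d3).
split; [apply H3; lra|].
rewrite (H0 h), (H1 h), (H2 h) by lra. vring V.
Qed.

(** Converse of [taylor_3_bound]: the error divided by h^3 is the innermost quotient, from which the
    two outer ones are rebuilt. *)
Lemma taylor_3_of_bound F a1 a2 M d : 0 < d ->
  (forall h, Cmod h < d ->
    norm (minus (F h) (plus (F 0%C) (plus (scal h a1) (scal (h * h)%C a2))))
      <= M * (Cmod h * Cmod h * Cmod h)) -> taylor 3 F.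
Proof.
intros Hd H.
(* The value at h = 0 is arbitrary, since r is always multiplied by h. *)
set (r := fun h => if Ceq_dec h 0 then zero else
  scal (/ (h * h * h))%C (minus (F h) (plus (F 0%C) (plus (scal h a1) (scal (h * h)%C a2))))).
exists (fun h => plus a1 (scal h (plus a2 (scal h (r h))))). split.
- exists (fun h => plus a2 (scal h (r h))). split.
  + exists r. split.
    * exists (Rmax M 0), d. split; [exact Hd|]. intros h Hh. unfold r.
      destruct (Ceq_dec h 0) as [->|Hz].
      -- eapply Rle_trans; [right; exact (@norm_zero C_AbsRing V)|apply Rmax_r].
      -- rewrite norm_scal_C, Cmod_inv.
         2:{ repeat apply Cmult_neq_0; exact Hz. }
         specialize (H h Hh). rewrite !Cmod_mult.
         assert (P : 0 < Cmod h) by (apply Cmod_gt_0; exact Hz).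
         eapply Rle_trans; [|apply Rmax_l].
         assert (P3 : 0 < Cmod h * Cmod h * Cmod h) by (repeat apply Rmult_lt_0_compat; lra).
         apply (Rmult_le_reg_l (Cmod h * Cmod h * Cmod h)); [exact P3|].
         rewrite <- Rmult_assoc, Rinv_r, Rmult_1_l by lra. lra.
    * exists 1. split; [lra|]. intros h _. vring V.
  + exists 1. split; [lra|]. intros h _. vring V.
- exists d. split; [exact Hd|]. intros h Hh. unfold r.
  destruct (Ceq_dec h 0) as [->|Hz]; [vring V|].
  set (w := F h). vring V; field; exact Hz.
Qed.
End Taylor.

Section TaylorSeries.
Context {V : NormedModule C_AbsRing}.

Lemma norm_limit_le {T} (F : (T -> Prop) -> Prop) {FF : ProperFilter F} (f : T -> V) l M :
  filterlim f F (locally l) -> (forall t, norm (f t) <= M) -> norm l <= M.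
Proof.
intros H HM.
apply (filterlim_le (F := F) (fun t => norm (f t)) (fun _ => M) (Finite (norm l)) (Finite M)).
- apply filter_forall. exact HM.
- eapply filterlim_comp; [exact H|]. apply filterlim_norm.
- apply filterlim_const.
Qed.

(** The terms at the point d/2 are bounded, being differences of partial sums of a convergent
    series. For |h| < d/4 the terms are then at most M / 2^k. *)
Lemma pseries_bounded (a : nat -> V) (F : C -> V) d : 0 < d ->
  (forall h : C, Cmod h < d -> is_pseries a h (F h)) -> taylor 0 F.
Proof.
intros Hd H.
assert (Hh0 : Cmod (RtoC (d / 2)) < d) by (rewrite Cmod_R, Rabs_pos_eq; lra).
assert (S0 := H _ Hh0).
assert (B0 : exists M, forall k, norm (scal (pow_n (RtoC (d / 2) : C_AbsRing) k) (a k)) <= M).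
{ assert (L : filterlim (fun n => norm (sum_n (fun k => scal (pow_n (RtoC (d / 2) : C_AbsRing) k) (a k)) n))
     eventually (locally (norm (F (RtoC (d / 2)))))).
  { eapply filterlim_comp; [exact S0|apply filterlim_norm]. }
  destruct (filterlim_bounded (fun n => norm (sum_n (fun k => scal (pow_n (RtoC (d / 2) : C_AbsRing) k) (a k)) n))) as [M HM].
  { exists (norm (F (RtoC (d / 2)))). exact L. }
  assert (HM' : forall n, norm (sum_n (fun k => scal (pow_n (RtoC (d / 2) : C_AbsRing) k) (a k)) n) <= M).
  { intros n. eapply Rle_trans; [apply Rle_abs|exact (HM n)]. }
  exists (M + M). intros [|k].
  - specialize (HM' 0%nat). rewrite sum_O in HM'.
    assert (P := norm_ge_0 (scal (pow_n (RtoC (d / 2) : C_AbsRing) 0) (a 0%nat))). lra.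
  - assert (E : scal (pow_n (RtoC (d / 2) : C_AbsRing) (S k)) (a (S k)) =
      minus (sum_n (fun k => scal (pow_n (RtoC (d / 2) : C_AbsRing) k) (a k)) (S k))
            (sum_n (fun k => scal (pow_n (RtoC (d / 2) : C_AbsRing) k) (a k)) k)).
    { rewrite sum_Sn. vring V. }
    rewrite E. eapply Rle_trans; [apply norm_minus_le|].
    apply Rplus_le_compat.
    + exact (HM' (S k)).
    + exact (HM' k). }
destruct B0 as [M HM].
exists (2 * M), (d / 4). split; [lra|]. intros h Hh.
assert (Mpos : 0 <= M) by (eapply Rle_trans; [|apply (HM 0%nat)]; apply norm_ge_0).
assert (Hs : is_pseries a h (F h)) by (apply H; lra).
refine (norm_limit_le eventually _ _ _ Hs _).
assert (Hk : forall k, norm (scal (pow_n (h : C_AbsRing) k) (a k)) <= M * (/ 2) ^ k).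
{ assert (Q : forall k, Cmod (pow_n (h : C_AbsRing) k) <= Cmod (pow_n (RtoC (d / 2) : C_AbsRing) k) * (/ 2) ^ k).
  { induction k as [|k IH]; simpl.
    - change (Cmod 1 <= Cmod 1 * 1). lra.
    - change (Cmod (h * pow_n (h : C_AbsRing) k)%C <=
       Cmod (RtoC (d / 2) * pow_n (RtoC (d / 2) : C_AbsRing) k)%C * (/ 2 * (/ 2) ^ k)).
      rewrite !Cmod_mult, Cmod_R, Rabs_pos_eq by lra.
      assert (Cmod h <= d / 4) by lra. assert (P1 := Cmod_ge_0 h).
      assert (P2 := Cmod_ge_0 (pow_n (h : C_AbsRing) k)).
      apply Rle_trans with (d / 4 * Cmod (pow_n (h : C_AbsRing) k)).
      { apply Rmult_le_compat_r; [exact P2|lra]. }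
      apply Rle_trans with (d / 4 * (Cmod (pow_n (RtoC (d / 2) : C_AbsRing) k) * (/ 2) ^ k)).
      { apply Rmult_le_compat_l; [lra|exact IH]. }
      right. field. }
  intros k. rewrite norm_scal_C.
  specialize (HM k). rewrite norm_scal_C in HM.
  apply Rle_trans with (Cmod (pow_n (RtoC (d / 2) : C_AbsRing) k) * (/ 2) ^ k * norm (a k)).
  { apply Rmult_le_compat_r; [apply norm_ge_0|apply Q]. }
  rewrite Rmult_assoc, (Rmult_comm _ (norm (a k))), <- Rmult_assoc.
  apply Rmult_le_compat_r; [|exact HM]. apply pow_le; lra. }
intros n.
(* The sharper bound M (2 - 2^-n) is the one that an induction on n can carry. *)
assert (G : norm (sum_n (fun k => scal (pow_n (h : C_AbsRing) k) (a k)) n) <= M * (2 - (/ 2) ^ n)).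
{ induction n as [|n IH].
  - rewrite sum_O. eapply Rle_trans; [apply Hk|]. simpl. lra.
  - rewrite sum_Sn. eapply Rle_trans; [apply norm_triangle|].
    eapply Rle_trans; [apply Rplus_le_compat; [exact IH|exact (Hk (S n))]|].
    simpl. lra. }
assert (P : 0 <= (/ 2) ^ n) by (apply pow_le; lra).
eapply Rle_trans; [exact G|]. nra.
Qed.

(** The quotient (F h - a 0) / h is the sum of the shifted series, so the induction hypothesis
    applies to it; its value at 0 is a 1. *)
Lemma taylor_of_pseries n : forall (a : nat -> V) (F : C -> V) d, 0 < d ->
  (forall h : C, Cmod h < d -> is_pseries a h (F h)) -> taylor n F.
Proof.
induction n as [|n IH]; intros a F d Hd H; [eapply pseries_bounded; eassumption|].
assert (F0 : F 0%C = a 0%nat).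
{ assert (H0 : is_pseries a (RtoC 0 : C_AbsRing) (F 0%C)) by (apply H; rewrite Cmod_0; exact Hd).
  assert (H1 := is_pseries_0 (K := C_AbsRing) a).
  exact (filterlim_locally_unique _ _ _ H0 H1). }
set (F1 := fun h : C => if Ceq_dec h 0 then a 1%nat else scal (/ h)%C (minus (F h) (a 0%nat))).
exists F1. split.
- apply (IH (PS_decr_1 a) F1 d Hd). intros h Hh. unfold F1.
  destruct (Ceq_dec h 0) as [->|Hz].
  + exact (is_pseries_0 (K := C_AbsRing) (PS_decr_1 a)).
  + apply (is_pseries_decr_1 (K := C_AbsRing)); [|apply H; exact Hh].
    change ((/ h * h)%C = 1%C). field. exact Hz.
- exists d. split; [exact Hd|]. intros h Hh. unfold F1. rewrite F0.
  destruct (Ceq_dec h 0) as [->|Hz].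
  + rewrite F0. vring V.
  + set (w := F h). vring V; field; exact Hz.
Qed.

End TaylorSeries.

Lemma locally_C (z : C) (P : C -> Prop) :
  locally z P <-> exists d, 0 < d /\ forall w, Cmod (w - z)%C < d -> P w.
Proof.
split.
- intros H. apply (locally_norm_le_locally (K := C_AbsRing) (V := C_NormedModule)) in H.
  destruct H as [d H]. exists d. split; [apply cond_pos|]. intros w Hw. apply H. exact Hw.
- intros (d & Hd & H). apply (locally_le_locally_norm (K := C_AbsRing) (V := C_NormedModule)).
  exists (mkposreal d Hd). intros w Hw. apply H. exact Hw.
Qed.

Lemma taylor_of_analytic {V : NormedModule C_AbsRing} n (F : C -> V) z :
  analytic_at F z -> taylor n (fun h => F (z + h)%C).
Proof.
intros [a H]. apply locally_C in H. destruct H as (d & Hd & H).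
apply (taylor_of_pseries n a) with d; [exact Hd|]. intros h Hh.
assert (E : minus (z + h)%C z = h).
{ change ((z + h - z)%C = h). ring. }
specialize (H (z + h)%C). change ((z + h - z)%C) with (minus (z + h)%C z) in H.
rewrite E in H. apply H. exact Hh.
Qed.

Section TaylorBilinear.
Context {U V W : NormedModule C_AbsRing}.
Variable B : U -> V -> W.
Hypothesis B_plus_l : forall x x' y, B (plus x x') y = plus (B x y) (B x' y).
Hypothesis B_plus_r : forall x y y', B x (plus y y') = plus (B x y) (B x y').
Hypothesis B_scal_l : forall (l : C) x y, B (scal l x) y = scal l (B x y).
Hypothesis B_scal_r : forall (l : C) x y, B x (scal l y) = scal l (B x y).
Variable K : R.
Hypothesis K0 : 0 <= K.
Hypothesis B_norm : forall x y, norm (B x y) <= K * norm x * norm y.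

(** Leibniz rule for quotients: B (F, G) - B (F 0, G 0) = h (B (F 0, G1) + B (F1, G)). *)
Lemma taylor_bilinear n : forall F G, taylor n F -> taylor n G ->
  taylor n (fun h => B (F h) (G h)).
Proof.
induction n as [|n IH]; intros F G.
- intros (M & d & Hd & H) (M' & d' & Hd' & H').
  exists (K * M * M'), (Rmin d d').
  split; [apply Rmin_pos; assumption|]. intros h Hh.
  assert (H1 : norm (F h) <= M) by (apply H; eapply Rlt_le_trans; [exact Hh|apply Rmin_l]).
  assert (H2 : norm (G h) <= M') by (apply H'; eapply Rlt_le_trans; [exact Hh|apply Rmin_r]).
  eapply Rle_trans; [apply B_norm|].
  apply Rmult_le_compat; [|apply norm_ge_0| |exact H2].
  + apply Rmult_le_pos; [exact K0|apply norm_ge_0].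
  + apply Rmult_le_compat_l; assumption.
- intros HF HG.
  assert (HG0 := taylor_pred _ _ HG).
  destruct HF as (F1 & H1 & d & Hd & H), HG as (G1 & H1' & d' & Hd' & H').
  exists (fun h => plus (B (F 0%C) (G1 h)) (B (F1 h) (G h))). split.
  + apply taylor_plus; apply IH; auto. apply taylor_const.
  + exists (Rmin d d'). split; [apply Rmin_pos; assumption|]. intros h Hh.
    rewrite (H h) by (eapply Rlt_le_trans; [exact Hh|apply Rmin_l]).
    rewrite B_plus_l, B_scal_l.
    rewrite (H' h) at 1 by (eapply Rlt_le_trans; [exact Hh|apply Rmin_r]).
    rewrite B_plus_r, B_scal_r. vring W.
Qed.
End TaylorBilinear.

Lemma taylor_scal {V : NormedModule C_AbsRing} n (f : C -> C) (G : C -> V) :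
  taylor (V := C_NormedModule) n f -> taylor n G -> taylor n (fun h => scal (f h) (G h)).
Proof.
intros H H'. apply (taylor_bilinear (U := C_NormedModule) (fun (c : C) (x : V) => scal c x)) with 1; auto.
- intros x x' y. change (plus x x') with (x + x')%C. vring V.
- intros; vring V.
- intros l x y. change (scal l x) with (l * x)%C. vring V.
- intros; vring V.
- lra.
- intros x y. rewrite norm_scal_C. change (norm x) with (Cmod x). lra.
Qed.

Lemma taylor_id n : taylor (V := C_NormedModule) n (fun h => h).
Proof.
destruct n as [|n].
- exists 1, 1. split; [lra|]. intros h Hh. change (Cmod h <= 1). lra.
- exists (fun _ => RtoC 1). split; [apply taylor_const|]. exists 1. split; [lra|].
  intros h _. change (h = 0 + h * 1)%C. ring.
Qed.

Lemma taylor_mult n (f g : C -> C) :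
  taylor (V := C_NormedModule) n f -> taylor (V := C_NormedModule) n g ->
  taylor (V := C_NormedModule) n (fun h => f h * g h)%C.
Proof. exact (taylor_scal (V := C_NormedModule) n f g). Qed.

Lemma taylor_add n (f g : C -> C) :
  taylor (V := C_NormedModule) n f -> taylor (V := C_NormedModule) n g ->
  taylor (V := C_NormedModule) n (fun h => f h + g h)%C.
Proof. exact (taylor_plus (V := C_NormedModule) n f g). Qed.

Lemma taylor_shift n (c : C) : taylor (V := C_NormedModule) n (fun h => c + h)%C.
Proof. apply taylor_add; [exact (taylor_const (V := C_NormedModule) n c)|apply taylor_id]. Qed.

Lemma taylor_1_lipschitz {V : NormedModule C_AbsRing} (F : C -> V) : taylor 1 F ->
  exists L d, 0 < d /\ forall h, Cmod h < d -> norm (minus (F h) (F 0%C)) <= L * Cmod h.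
Proof.
intros (F1 & (M & d & Hd & H) & d' & Hd' & E). exists M, (Rmin d d').
split; [apply Rmin_pos; assumption|]. intros h Hh.
rewrite (E h) by (eapply Rlt_le_trans; [exact Hh|apply Rmin_r]).
replace (minus (plus (F 0%C) (scal h (F1 h))) (F 0%C)) with (scal h (F1 h)) by (vring V).
rewrite norm_scal_C, Rmult_comm. apply Rmult_le_compat_r; [apply Cmod_ge_0|].
apply H. eapply Rlt_le_trans; [exact Hh|apply Rmin_l].
Qed.

(** Supplies the finite maximum in [compact_max], where P selects the centres lying in K, a property
    without decision procedure. *)
Lemma list_argmax {T} (phi : T -> R) (l : list T) (P : T -> Prop) :
  (exists t, In t l /\ P t) ->
  exists t, In t l /\ P t /\ forall s, In s l -> P s -> phi s <= phi t.
Proof.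
induction l as [|a l IH]; intros (t & Ht & HP); [destruct Ht|].
destruct (classic (exists t, In t l /\ P t)) as [H|H].
- destruct (IH H) as (m & Hm & Pm & Hmax).
  destruct (classic (P a /\ phi m < phi a)) as [[Pa Ha]|Ha].
  + exists a. split; [left; reflexivity|]. split; [exact Pa|].
    intros s [<-|Hs] Ps; [lra|]. specialize (Hmax s Hs Ps). lra.
  + exists m. split; [right; exact Hm|]. split; [exact Pm|].
    intros s [<-|Hs] Ps; [|auto]. apply Rnot_lt_le. intros L. apply Ha. auto.
- destruct Ht as [<-|Ht]; [|exfalso; eauto].
  exists a. split; [left; reflexivity|]. split; [exact HP|].
  intros s [<-|Hs] Ps; [lra|exfalso; eauto].
Qed.

(** If no maximum is attained, each point of K has a neighbourhood on which phi stays below phi (w)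
    for some w in K, and each point outside K has one that misses K. Among the finitely many w of a
    subcover, the one with the largest phi is itself covered: a contradiction. *)
Lemma compact_max (K : C -> Prop) (B : R) (phi : C -> R) :
  (forall z, ~ K z -> exists d, 0 < d /\ forall w, Cmod (w - z)%C < d -> ~ K w) ->
  (forall z, K z -> Cmod z <= B) ->
  (forall z, K z -> forall e, 0 < e ->
     exists d, 0 < d /\ forall w, Cmod (w - z)%C < d -> phi w < phi z + e) ->
  (exists z, K z) -> exists z, K z /\ forall w, K w -> phi w <= phi z.
Proof.
intros Hcl HB Hc [z0 Hz0]. apply NNPP. intros Hno.
assert (Hw : forall z, exists w d, 0 < d /\
  (K z -> K w /\ forall v, Cmod (v - z)%C < d -> phi v < phi w) /\
  (~ K z -> forall v, Cmod (v - z)%C < d -> ~ K v)).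
{ intros z. destruct (classic (K z)) as [Kz|Kz].
  - assert (Ex : exists w, K w /\ phi z < phi w).
    { apply NNPP. intros Hn. apply Hno. exists z. split; [exact Kz|].
      intros w Kw. apply Rnot_lt_le. intros L. apply Hn. eauto. }
    destruct Ex as (w & Kw & L).
    destruct (Hc z Kz (phi w - phi z)) as (d & Hd & H); [lra|].
    exists w, d. split; [exact Hd|]. split; [|tauto]. intros _. split; [exact Kw|].
    intros v Hv. specialize (H v Hv). lra.
  - destruct (Hcl z Kz) as (d & Hd & H). exists z, d. tauto. }
set (pick := fun z => constructive_indefinite_description _ (Hw z)).
set (wt := fun z => proj1_sig (pick z)).
assert (Hd : forall z, exists d : posreal,
  (K z -> K (wt z) /\ forall v, Cmod (v - z)%C < d -> phi v < phi (wt z)) /\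
  (~ K z -> forall v, Cmod (v - z)%C < d -> ~ K v)).
{ intros z. unfold wt. destruct (pick z) as (w & d & Hd & H). simpl.
  exists (mkposreal d Hd). exact H. }
set (dl := fun z => proj1_sig (constructive_indefinite_description _ (Hd z))).
assert (Hdl : forall z, (K z -> K (wt z) /\ forall v, Cmod (v - z)%C < dl z -> phi v < phi (wt z)) /\
  (~ K z -> forall v, Cmod (v - z)%C < dl z -> ~ K v)).
{ intros z. unfold dl. destruct (constructive_indefinite_description _ _) as (d & H). exact H. }
(* The cover is by squares in the sup norm. Halving the radii makes up for the factor sqrt 2 between
   that norm and [Cmod]. *)
apply (compactness_list 2 (- B, (- B, tt)) (B, (B, tt))
  (fun p => pos_div_2 (dl (fst p, fst (snd p))))).
intros (l & Hl).
assert (Cov : forall z, K z -> exists t, In t l /\ Cmod (z - (fst t, fst (snd t)))%C < dl (fst t, fst (snd t))).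
{ intros [x y] Kz. assert (Bz := HB _ Kz).
  assert (B1 := Rmax_Cmod (x, y)). simpl in B1.
  assert (B2 := Rmax_l (Rabs x) (Rabs y)). assert (B3 := Rmax_r (Rabs x) (Rabs y)).
  destruct (Hl (x, (y, tt))) as (t & Ht & _ & C1).
  { simpl. assert (Q1 : Rabs x <= B) by lra. assert (Q2 : Rabs y <= B) by lra.
    apply Rabs_le_between in Q1, Q2. tauto. }
  exists t. split; [exact Ht|]. destruct t as (u & v & []). simpl in C1 |- *.
  destruct C1 as (C1 & C2 & _).
  eapply Rle_lt_trans; [apply Cmod_2Rmax|]. simpl.
  assert (S2 : sqrt 2 <= 2).
  { rewrite <- (sqrt_pow2 2) at 2 by lra. apply sqrt_le_1_alt. simpl. lra. }
  assert (S0 := sqrt_pos 2).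
  set (dd := pos (dl (u, v))) in *.
  assert (M1 : Rmax (Rabs (x + - u)) (Rabs (y + - v)) < dd / 2).
  { apply Rmax_case; [exact C1|exact C2]. }
  assert (M0 : 0 <= Rmax (Rabs (x + - u)) (Rabs (y + - v))).
  { eapply Rle_trans; [apply Rabs_pos|apply Rmax_l]. }
  nra. }
set (pt := fun t : Compactness.Tn 2 R => ((fst t, fst (snd t)) : C)).
destruct (list_argmax (fun t => phi (wt (pt t))) l (fun t => K (pt t))) as (t & Ht & Kt & Hmax).
{ destruct (Cov z0 Hz0) as (t & Ht & C1). exists t. split; [exact Ht|].
  apply NNPP. intros Hn. apply (proj2 (Hdl (pt t)) Hn z0 C1). exact Hz0. }
destruct (proj1 (Hdl (pt t)) Kt) as (Kw & _).
destruct (Cov _ Kw) as (s & Hs & C1).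
assert (Ks : K (pt s)).
{ apply NNPP. intros Hn. exact (proj2 (Hdl (pt s)) Hn _ C1 Kw). }
destruct (proj1 (Hdl (pt s)) Ks) as (_ & L). specialize (L _ C1).
specialize (Hmax s Hs Ks). simpl in Hmax. lra.
Qed.

Section MaximumPrinciple.
Context {V : NormedModule C_AbsRing}.

(** For h = r, -r, ir, -ir the sums of h and of h^2 both vanish, so only F(0) and the cubic
    remainders survive. *)
Lemma four_point_mean (F : C -> V) : taylor 3 F ->
  exists M d, 0 < d /\ 0 <= M /\ forall r, 0 < r < d ->
  4 * norm (F 0%C) <= norm (F (r, 0)) + norm (F (- r, 0)) + norm (F (0, r)) + norm (F (0, - r))
    + M * (r * r * r).
Proof.
intros H. destruct (taylor_3_bound F H) as (a1 & a2 & q & M & d & Hd & HF).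
assert (M0 : 0 <= M).
{ eapply Rle_trans; [|apply (HF 0%C)]; [apply norm_ge_0|rewrite Cmod_0; exact Hd]. }
exists (4 * M), d. split; [exact Hd|]. split; [lra|]. intros r Hr.
assert (m1 : Cmod (r, 0) = r) by (exact (eq_trans (Cmod_R r) (Rabs_pos_eq r (Rlt_le _ _ (proj1 Hr))))).
assert (m2 : Cmod (- r, 0) = r).
{ transitivity (Rabs r); [|apply Rabs_pos_eq; lra].
  change (Cmod (RtoC (- r)) = Rabs r). rewrite Cmod_R. apply Rabs_Ropp. }
assert (m3 : Cmod (0, r) = r).
{ eapply eq_trans; [|exact m1]. unfold Cmod. f_equal. simpl. ring. }
assert (m4 : Cmod (0, - r) = r).
{ eapply eq_trans; [|exact m1]. unfold Cmod. f_equal. simpl. ring. }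
destruct (HF (r, 0)) as [q1 e1]; [lra|]. destruct (HF (- r, 0)) as [q2 e2]; [lra|].
destruct (HF (0, r)) as [q3 e3]; [lra|]. destruct (HF (0, - r)) as [q4 e4]; [lra|].
set (h1 := (r, 0) : C) in *. set (h2 := (- r, 0) : C) in *.
set (h3 := (0, r) : C) in *. set (h4 := (0, - r) : C) in *.
set (E := plus (plus (scal (h1 * h1 * h1)%C (q h1)) (scal (h2 * h2 * h2)%C (q h2)))
               (plus (scal (h3 * h3 * h3)%C (q h3)) (scal (h4 * h4 * h4)%C (q h4)))).
assert (ID : scal (RtoC 4) (F 0%C) = minus (plus (plus (F h1) (F h2)) (plus (F h3) (F h4))) E).
{ rewrite e1, e2, e3, e4. unfold E. vring V; unfold h1, h2, h3, h4;
  apply injective_projections; simpl; ring. }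
assert (NE : norm E <= 4 * M * (r * r * r)).
{ assert (Q : forall h : C, Cmod h = r -> norm (q h) <= M -> norm (scal (h * h * h)%C (q h)) <= M * (r * r * r)).
  { intros h Eh Hq. rewrite norm_scal_C, !Cmod_mult, Eh, Rmult_comm.
    apply Rmult_le_compat_r; [|exact Hq]. repeat apply Rmult_le_pos; lra. }
  unfold E. eapply Rle_trans; [apply (@norm_triangle C_AbsRing V)|].
  eapply Rle_trans; [apply Rplus_le_compat; apply (@norm_triangle C_AbsRing V)|].
  assert (A1 := Q h1 m1 q1). assert (A2 := Q h2 m2 q2).
  assert (A3 := Q h3 m3 q3). assert (A4 := Q h4 m4 q4). lra. }
assert (N4 : norm (scal (RtoC 4) (F 0%C)) = 4 * norm (F 0%C)).
{ rewrite norm_scal_C, Cmod_R, Rabs_pos_eq by lra. reflexivity. }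
rewrite <- N4, ID. eapply Rle_trans; [apply norm_minus_le|].
apply Rplus_le_compat; [|exact NE].
eapply Rle_trans; [apply (@norm_triangle C_AbsRing V)|].
assert (A1 := norm_triangle (F h1) (F h2)). assert (A2 := norm_triangle (F h3) (F h4)). lra.
Qed.

Lemma Cmod_sqr (x y : R) : Cmod (x, y) * Cmod (x, y) = x * x + y * y.
Proof. unfold Cmod. simpl. rewrite sqrt_sqrt by nra. ring. Qed.

(* At an interior maximum of |F| + d |z|^2 the four point mean gains 4 d r^2,
   which beats the O(r^3) error. *)
Lemma maximum_principle (F : C -> V) (K bd : C -> Prop) (B M : R) :
  (forall z, ~ K z -> exists d, 0 < d /\ forall w, Cmod (w - z)%C < d -> ~ K w) ->
  (forall z, K z -> Cmod z <= B) ->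
  (forall z, K z -> taylor 3 (fun h => F (z + h)%C)) ->
  (forall z, K z -> ~ bd z -> exists d, 0 < d /\ forall w, Cmod (w - z)%C < d -> K w) ->
  (forall z, K z -> bd z -> norm (F z) <= M) ->
  forall z, K z -> norm (F z) <= M.
Proof.
intros Hcl HB HT Hint Hbd z Kz.
assert (M1 : forall dl, 0 < dl -> norm (F z) <= M + dl * (B * B)).
{ intros dl Hdl.
  set (phi := fun w : C => norm (F w) + dl * (Cmod w * Cmod w)).
  destruct (compact_max K B phi Hcl HB) as (m & Km & Hm); [|exists z; exact Kz|].
  - intros w Kw e He.
    destruct (taylor_1_lipschitz _ (taylor_le 1 3 _ (le_S _ _ (le_S _ _ (le_n _))) (HT w Kw))) as (L & d & Hd & HL).
    set (L' := Rmax L 0 + dl * (2 * Cmod w + 1)).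
    assert (L0 : 0 <= Rmax L 0) by apply Rmax_r.
    assert (P := Cmod_ge_0 w).
    assert (LP : 0 < L').
    { unfold L'. assert (0 < dl * (2 * Cmod w + 1)) by (apply Rmult_lt_0_compat; lra). lra. }
    exists (Rmin (Rmin d 1) (e / L')).
    split; [repeat apply Rmin_pos; try lra; apply Rdiv_lt_0_compat; lra|].
    intros v Hv. unfold phi.
    assert (Q1 : Cmod (v - w)%C < d).
    { eapply Rlt_le_trans; [exact Hv|]. eapply Rle_trans; apply Rmin_l. }
    assert (Q2 : Cmod (v - w)%C < 1).
    { eapply Rlt_le_trans; [exact Hv|]. eapply Rle_trans; [apply Rmin_l|apply Rmin_r]. }
    assert (Q3 : Cmod (v - w)%C < e / L').
    { eapply Rlt_le_trans; [exact Hv|apply Rmin_r]. }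
    specialize (HL _ Q1). simpl in HL.
    replace (w + (v - w))%C with v in HL by ring.
    replace (w + 0)%C with w in HL by ring.
    assert (T1 : norm (F v) <= norm (F w) + Rmax L 0 * Cmod (v - w)%C).
    { replace (F v) with (plus (F w) (minus (F v) (F w))) by (vring V).
      eapply Rle_trans; [apply (@norm_triangle C_AbsRing V)|]. apply Rplus_le_compat_l.
      eapply Rle_trans; [exact HL|]. apply Rmult_le_compat_r; [apply Cmod_ge_0|apply Rmax_l]. }
    assert (T2 : Cmod v <= Cmod w + Cmod (v - w)%C).
    { replace v with (w + (v - w))%C at 1 by ring. apply Cmod_triangle. }
    assert (P2 := Cmod_ge_0 (v - w)%C). assert (P3 := Cmod_ge_0 v).
    set (n := Cmod (v - w)%C) in *.
    assert (T3 : Cmod v * Cmod v <= Cmod w * Cmod w + n * (2 * Cmod w + 1)).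
    { apply Rle_trans with ((Cmod w + n) * (Cmod w + n)); [apply Rmult_le_compat; lra|nra]. }
    assert (T4 : n * L' < e).
    { apply (Rmult_lt_compat_r L') in Q3; [|exact LP].
      unfold Rdiv in Q3. rewrite Rmult_assoc, Rinv_l, Rmult_1_r in Q3 by lra. exact Q3. }
    unfold L' in T4. nra.
  - assert (Bd : bd m).
    { apply NNPP. intros Hn.
      destruct (Hint m Km Hn) as (d & Hd & HK).
      destruct (four_point_mean _ (HT m Km)) as (M3 & d3 & Hd3 & M3p & H3).
      (* Small enough for the four points to stay in K and for M3 r^3 to be less than 4 dl r^2. *)
      set (r := Rmin (Rmin d d3) (dl / (M3 + 1)) / 2).
      assert (D1 : 0 < dl / (M3 + 1)) by (apply Rdiv_lt_0_compat; lra).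
      assert (R0 : 0 < Rmin (Rmin d d3) (dl / (M3 + 1))) by (repeat apply Rmin_pos; assumption).
      assert (R1 : r < Rmin (Rmin d d3) (dl / (M3 + 1))) by (unfold r; lra).
      assert (R2 : 0 < r) by (unfold r; lra).
      assert (A1 := Rmin_l (Rmin d d3) (dl / (M3 + 1))).
      assert (A2 := Rmin_r (Rmin d d3) (dl / (M3 + 1))).
      assert (A3 := Rmin_l d d3). assert (A4 := Rmin_r d d3).
      assert (R3 : r * (M3 + 1) < dl).
      { assert (Q : r < dl / (M3 + 1)) by lra.
        apply (Rmult_lt_compat_r (M3 + 1)) in Q; [|lra].
        unfold Rdiv in Q. rewrite Rmult_assoc, Rinv_l, Rmult_1_r in Q by lra. exact Q. }
      assert (R4 : 0 < r < d3) by lra. specialize (H3 r R4). simpl in H3.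
      replace (m + 0)%C with m in H3 by ring.
      destruct m as [x y].
      assert (MM : forall a b, Cmod (a, b) = r -> norm (F ((x, y) + (a, b))%C)
         + dl * ((x + a) * (x + a) + (y + b) * (y + b)) <= norm (F (x, y)) + dl * (x * x + y * y)).
      { intros a b Hab. specialize (Hm ((x, y) + (a, b))%C). unfold phi in Hm.
        rewrite Cmod_sqr in Hm.
        change ((x, y) + (a, b))%C with ((x + a, y + b) : C) in Hm |- *.
        rewrite Cmod_sqr in Hm. apply Hm. apply HK.
        change (((x + a)%R, (y + b)%R) - (x, y))%C with ((x + a + - x, y + b + - y) : C).
        replace (x + a + - x) with a by ring. replace (y + b + - y) with b by ring. lra. }
      assert (m1 : Cmod (r, 0) = r) by (exact (eq_trans (Cmod_R r) (Rabs_pos_eq r (Rlt_le _ _ R2)))).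
      assert (m2 : Cmod (- r, 0) = r).
      { transitivity (Rabs r); [|apply Rabs_pos_eq; lra].
  change (Cmod (RtoC (- r)) = Rabs r). rewrite Cmod_R. apply Rabs_Ropp. }
      assert (m3 : Cmod (0, r) = r).
      { eapply eq_trans; [|exact m1]. unfold Cmod. f_equal. simpl. ring. }
      assert (m4 : Cmod (0, - r) = r).
      { eapply eq_trans; [|exact m1]. unfold Cmod. f_equal. simpl. ring. }
      assert (B1 := MM _ _ m1). assert (B2 := MM _ _ m2).
      assert (B3 := MM _ _ m3). assert (B4 := MM _ _ m4).
      set (s := M3 * (r * r * r)) in *.
      assert (s < r * r * (4 * dl)).
      { unfold s. assert (0 < r * r) by nra. assert (M3 * r < 4 * dl) by nra. nra. }
      nra. }
    specialize (Hm z Kz). unfold phi in Hm.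
    specialize (Hbd m Km Bd). assert (P := Cmod_ge_0 z). assert (P2 := Cmod_ge_0 m).
    assert (P3 := HB m Km). assert (0 <= Cmod z * Cmod z) by nra.
    assert (Cmod m * Cmod m <= B * B) by nra. nra. }
apply le_epsilon. intros e He.
assert (B2 : 0 <= B * B) by nra.
eapply Rle_trans; [apply (M1 (e / (B * B + 1)))|].
- apply Rdiv_lt_0_compat; lra.
- apply Rplus_le_compat_l. apply Rle_trans with (e / (B * B + 1) * (B * B + 1)).
  + apply Rmult_le_compat_l; [|lra]. left. apply Rdiv_lt_0_compat; lra.
  + right. field. lra.
Qed.
End MaximumPrinciple.

(** * Calculus of Banach space valued functions *)

Section Calculus.
Context {X : CBanach}.

Lemma norm_scal_X (c : C) (x : X) : norm (scal c x) = Cmod c * norm x.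
Proof. exact (norm_scal_C c x). Qed.

Lemma norm_minus_X (x y : X) : norm (minus x y) <= norm x + norm y.
Proof. exact (norm_minus_le x y). Qed.

(** Continuity on all of R through the norm of X, which [real_of X] shares; it yields integrability
    on every interval. *)
Definition cont (f : R -> X) : Prop :=
  forall t e, 0 < e -> exists d, 0 < d /\
    forall s, Rabs (s - t) < d -> norm (minus (f s) (f t)) < e.

Lemma cont_continuous (f : R -> X) t : cont f -> continuous (T := R_UniformSpace) (U := real_of X) f t.
Proof.
intros H. apply (filterlim_locally_ball_norm (K := R_AbsRing) (U := real_of X)).
intros e. destruct (H t e (cond_pos e)) as (d & Hd & Hs).
exists (mkposreal d Hd). intros s Hb. exact (Hs s Hb).
Qed.

Definition Int (f : R -> X) (a b : R) : X := RInt (V := real_of X) f a b.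

Lemma ex_Int (f : R -> X) a b : cont f -> ex_RInt (V := real_of X) f a b.
Proof.
intros H. apply ex_RInt_continuous. intros z _. apply cont_continuous, H.
Qed.

Lemma Int_point f a : Int f a a = zero.
Proof. exact (RInt_point (V := real_of X) a f). Qed.

Lemma Int_Chasles f a b c : cont f -> plus (Int f a b) (Int f b c) = Int f a c.
Proof. intros H. apply (RInt_Chasles (V := real_of X)); apply ex_Int, H. Qed.

Lemma Int_ext f g a b : a <= b -> (forall t, a <= t <= b -> f t = g t) -> Int f a b = Int g a b.
Proof.
intros Hab H. apply (RInt_ext (V := real_of X)). rewrite Rmin_left, Rmax_right by exact Hab.
intros x Hx. apply H. lra.
Qed.

Lemma Int_const (v : X) a b : Int (fun _ => v) a b = scal (RtoC (b - a)) v.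
Proof. exact (RInt_const (V := real_of X) a b v). Qed.

Lemma Int_norm_RInt f g a b : a <= b -> cont f -> (forall t, a <= t <= b -> norm (f t) <= g t) ->
  ex_RInt g a b -> norm (Int f a b) <= RInt g a b.
Proof.
intros Hab Hf H Hg.
apply (norm_RInt_le (V := real_of X) f g a b); [exact Hab| |apply RInt_correct, ex_Int, Hf|apply (RInt_correct (V:=R_CompleteNormedModule)), Hg].
exact H.
Qed.

Lemma Int_norm f a b M : a <= b -> cont f -> (forall t, a <= t <= b -> norm (f t) <= M) ->
  norm (Int f a b) <= M * (b - a).
Proof.
intros Hab Hf H. eapply Rle_trans.
- apply (Int_norm_RInt f (fun _ => M)); auto. apply ex_RInt_const.
- rewrite RInt_const. unfold scal; simpl; unfold mult; simpl. lra.
Qed.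

Lemma norm_zero' : norm (zero : X) = 0.
Proof. exact (@norm_zero C_AbsRing X). Qed.

Lemma norm_sym (x y : X) : norm (minus x y) = norm (minus y x).
Proof.
replace (minus y x) with (scal (RtoC (-1)) (minus x y)) by (vring X).
rewrite norm_scal_X, Cmod_R. unfold Rabs. destruct (Rcase_abs _); lra.
Qed.

Lemma norm_tri (x y : X) : norm (plus x y) <= norm x + norm y.
Proof. exact (@norm_triangle C_AbsRing X x y). Qed.

Lemma norm_dist (x y : X) : Rabs (norm x - norm y) <= norm (minus x y).
Proof.
assert (A1 : norm x <= norm y + norm (minus x y)).
{ eapply Rle_trans; [|apply norm_tri]. right. f_equal. vring X. }
assert (A2 : norm y <= norm x + norm (minus x y)).
{ rewrite norm_sym. eapply Rle_trans; [|apply norm_tri]. right. f_equal. vring X. }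
apply Rabs_le. lra.
Qed.

Lemma minus_zero_eq (x y : X) : norm (minus x y) <= 0 -> x = y.
Proof.
intros H. assert (E : minus x y = zero).
{ apply (@norm_eq_zero C_AbsRing X). apply Rle_antisym; [exact H|apply norm_ge_0]. }
replace x with (plus y (minus x y)) by (vring X). rewrite E. vring X.
Qed.

(** Derivative relative to a set D of times: one-sided at 0 when D is [half_line], the usual one
    when D is everything. *)
Definition dv (D : R -> Prop) (F : R -> X) (t : R) (v : X) : Prop :=
  forall e, 0 < e -> exists d, 0 < d /\ forall s, D s -> Rabs (s - t) < d ->
    norm (minus (minus (F s) (F t)) (scal (RtoC (s - t)) v)) <= e * Rabs (s - t).

(** N, the distance of F to F a, satisfies |N s - N t| <= |F s - F t|, so its derivative is 0
    although the norm need not be differentiable, and the scalar mean value theorem applies. The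
    clamp [cl] ensures that only values of F on [a, b] enter. *)
Lemma dv_constant (D : R -> Prop) F a b : a <= b -> (forall t, a <= t <= b -> D t) ->
  (forall t, a <= t <= b -> dv D F t zero) -> F b = F a.
Proof.
intros Hab HD H.
set (cl := fun s => Rmax a (Rmin b s)).
assert (Hcl : forall s, a <= cl s <= b).
{ intros s. unfold cl. split; [apply Rmax_l|]. apply Rmax_lub; [exact Hab|apply Rmin_l]. }
assert (Hin : forall s, a <= s <= b -> cl s = s).
{ intros s Hs. unfold cl. rewrite Rmin_right, Rmax_right; lra. }
assert (Hlip : forall s t, a <= t <= b -> Rabs (cl s - t) <= Rabs (s - t)).
{ intros s t Ht. unfold cl, Rmax, Rmin.
  destruct (Rle_dec b s); destruct (Rle_dec a _); unfold Rabs; repeat destruct (Rcase_abs _); lra. }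
set (N := fun s => norm (minus (F (cl s)) (F a))).
assert (DN : forall t, a <= t <= b -> is_derive N t 0).
{ intros t Ht. apply is_derive_Reals. intros e He.
  destruct (H t Ht (e / 2)) as (d & Hd & Hs); [lra|].
  exists (mkposreal d Hd). intros h Hh0 Hh. simpl in Hh.
  assert (E : Rabs (N (t + h) - N t) <= e / 2 * Rabs h).
  { unfold N. rewrite (Hin t Ht).
    eapply Rle_trans; [apply norm_dist|].
    replace (minus (minus (F (cl (t + h))) (F a)) (minus (F t) (F a)))
      with (minus (minus (F (cl (t + h))) (F t)) (scal (RtoC (cl (t + h) - t)) zero)) by (vring X).
    assert (L := Hlip (t + h) t Ht). replace (t + h - t) with h in L by ring.
    eapply Rle_trans; [apply Hs; [apply HD, Hcl|lra]|].
    apply Rmult_le_compat_l; lra. }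
  rewrite Rminus_0_r. unfold Rdiv at 1. rewrite Rabs_mult, Rabs_inv.
  assert (P : 0 < Rabs h) by (apply Rabs_pos_lt; exact Hh0).
  apply Rle_lt_trans with (e / 2 * Rabs h * / Rabs h).
  - apply Rmult_le_compat_r; [left; apply Rinv_0_lt_compat; exact P|exact E].
  - rewrite Rmult_assoc, Rinv_r by lra. lra. }
destruct (MVT_gen N a b (fun _ => 0)) as (c & _ & E).
- rewrite Rmin_left, Rmax_right by exact Hab. intros t Ht. apply DN; lra.
- rewrite Rmin_left, Rmax_right by exact Hab. intros t Ht.
  apply continuity_pt_filterlim. apply (ex_derive_continuous (K := R_AbsRing) (V := R_NormedModule)).
  exists 0. apply DN; exact Ht.
- unfold N in E. rewrite (Hin a), (Hin b) in E by lra.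
  apply minus_zero_eq.
  assert (Z : norm (minus (F a) (F a)) = 0) by exact (norm_minus_self (F a)). lra.
Qed.

Lemma dv_value D F t v w : v = w -> dv D F t v -> dv D F t w.
Proof. intros ->. auto. Qed.

Lemma dv_linear (L : X -> X) K D F t v :
  (forall x y, L (minus x y) = minus (L x) (L y)) -> (forall (c : C) x, L (scal c x) = scal c (L x)) ->
  (forall x, norm (L x) <= K * norm x) -> dv D F t v -> dv D (fun s => L (F s)) t (L v).
Proof.
intros H1 H2 HK H e He.
assert (P := Rle_abs K). assert (P' := Rabs_pos K).
destruct (H (e / (Rabs K + 1))) as (d & Hd & Hs); [apply Rdiv_lt_0_compat; lra|].
exists d. split; [exact Hd|]. intros s Ds Hst. specialize (Hs s Ds Hst).
rewrite <- H2, <- !H1. eapply Rle_trans; [apply HK|].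
set (n := norm _) in *. assert (N0 : 0 <= n) by apply norm_ge_0.
apply Rle_trans with ((Rabs K + 1) * n); [nra|].
apply Rle_trans with ((Rabs K + 1) * (e / (Rabs K + 1) * Rabs (s - t))).
- apply Rmult_le_compat_l; lra.
- right. field. lra.
Qed.

Lemma dv_scal (c : C) D F t v : dv D F t v -> dv D (fun s => scal c (F s)) t (scal c v).
Proof.
apply (dv_linear (fun x => scal c x) (Cmod c)).
- intros; vring X.
- intros; vring X.
- intros x. right. apply norm_scal_X.
Qed.

Lemma dv_plus D F G t v w : dv D F t v -> dv D G t w ->
  dv D (fun s => plus (F s) (G s)) t (plus v w).
Proof.
intros H H' e He. destruct (H (e / 2)) as (d & Hd & Hs); [lra|].
destruct (H' (e / 2)) as (d' & Hd' & Hs'); [lra|].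
exists (Rmin d d'). split; [apply Rmin_pos; assumption|]. intros s Ds Hst.
specialize (Hs s Ds (Rlt_le_trans _ _ _ Hst (Rmin_l _ _))).
specialize (Hs' s Ds (Rlt_le_trans _ _ _ Hst (Rmin_r _ _))).
replace (minus (minus (plus (F s) (G s)) (plus (F t) (G t))) (scal (RtoC (s - t)) (plus v w)))
  with (plus (minus (minus (F s) (F t)) (scal (RtoC (s - t)) v))
             (minus (minus (G s) (G t)) (scal (RtoC (s - t)) w))) by (vring X).
eapply Rle_trans; [apply norm_tri|]. lra.
Qed.

Lemma dv_minus D F G t v w : dv D F t v -> dv D G t w ->
  dv D (fun s => minus (F s) (G s)) t (minus v w).
Proof.
intros H H'. assert (E := dv_plus D F (fun s => scal (RtoC (-1)) (G s)) t v _ H (dv_scal (RtoC (-1)) D G t w H')).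
intros e He. destruct (E e He) as (d & Hd & Hs). exists d. split; [exact Hd|].
intros s Ds Hst. specialize (Hs s Ds Hst). eapply Rle_trans; [|exact Hs].
right. f_equal. vring X.
Qed.

Lemma dv_const D (x : X) t : dv D (fun _ => x) t zero.
Proof.
intros e He. exists 1. split; [lra|]. intros s _ _.
eapply Rle_trans; [right; transitivity (norm (zero : X)); [f_equal; vring X|exact norm_zero']|].
apply Rmult_le_pos; [lra|apply Rabs_pos].
Qed.

Lemma dv_ext D F G t v : (forall s, D s -> F s = G s) -> F t = G t -> dv D F t v -> dv D G t v.
Proof.
intros E Et H e He. destruct (H e He) as (d & Hd & Hs). exists d. split; [exact Hd|].
intros s Ds Hst. rewrite <- E, <- Et by exact Ds. auto.
Qed.

Lemma dv_continuous D F t v : dv D F t v -> forall e, 0 < e -> exists d, 0 < d /\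
  forall s, D s -> Rabs (s - t) < d -> norm (minus (F s) (F t)) < e.
Proof.
intros H e He. destruct (H 1 Rlt_0_1) as (d & Hd & Hs).
assert (P := norm_ge_0 v).
exists (Rmin d (e / (norm v + 2))).
split; [apply Rmin_pos; [exact Hd|apply Rdiv_lt_0_compat; lra]|].
intros s Ds Hst. specialize (Hs s Ds (Rlt_le_trans _ _ _ Hst (Rmin_l _ _))).
assert (Q := Rlt_le_trans _ _ _ Hst (Rmin_r _ _)).
replace (minus (F s) (F t)) with (plus (minus (minus (F s) (F t)) (scal (RtoC (s - t)) v)) (scal (RtoC (s - t)) v)) by (vring X).
eapply Rle_lt_trans; [apply norm_tri|]. rewrite (norm_scal_X (RtoC (s - t))), Cmod_R.
assert (R0 := Rabs_pos (s - t)).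
apply Rle_lt_trans with (Rabs (s - t) * (norm v + 1)); [lra|].
apply Rle_lt_trans with (e / (norm v + 2) * (norm v + 1)); [apply Rmult_le_compat_r; lra|].
apply Rlt_le_trans with (e / (norm v + 2) * (norm v + 2)).
- apply Rmult_lt_compat_l; [apply Rdiv_lt_0_compat; lra|lra].
- right. field. lra.
Qed.

Lemma Int_norm_abs f a b M : cont f -> (forall t, Rmin a b <= t <= Rmax a b -> norm (f t) <= M) ->
  norm (Int f a b) <= M * Rabs (b - a).
Proof.
intros Hf H. destruct (Rle_dec a b) as [L|L].
- rewrite Rabs_pos_eq by lra. apply Int_norm; auto. intros t Ht. apply H.
  rewrite Rmin_left, Rmax_right; lra.
- assert (E := Int_Chasles f a b a Hf). rewrite Int_point in E.
  replace (Int f a b) with (scal (RtoC (-1)) (Int f b a)).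
  2:{ replace (Int f a b) with (minus (plus (Int f a b) (Int f b a)) (Int f b a)) by (vring X).
      rewrite E. vring X. }
  rewrite norm_scal_X, Cmod_R, (Rabs_left (-1)), Rabs_left by lra.
  replace (- -1 * norm (Int f b a)) with (norm (Int f b a)) by ring.
  replace (- (b - a)) with (a - b) by ring.
  apply Int_norm; [lra|exact Hf|]. intros t Ht. apply H. rewrite Rmin_right, Rmax_left; lra.
Qed.

Lemma cont_minus_const (f : R -> X) v : cont f -> cont (fun t => minus (f t) v).
Proof.
intros H t e He. destruct (H t e He) as (d & Hd & Hs). exists d. split; [exact Hd|].
intros s Hst. replace (minus (minus (f s) v) (minus (f t) v)) with (minus (f s) (f t)) by (vring X). auto.
Qed.

Lemma Int_minus_const f v a b : cont f ->
  Int (fun t => minus (f t) v) a b = minus (Int f a b) (scal (RtoC (b - a)) v).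
Proof.
intros H. rewrite <- Int_const.
exact (RInt_minus (V := real_of X) f (fun _ => v) a b (ex_Int _ _ _ H) (ex_RInt_const _ _ _)).
Qed.

Lemma dv_Int D f a t : cont f -> dv D (fun s => Int f a s) t (f t).
Proof.
intros Hf e He. destruct (Hf t e He) as (d & Hd & Hs).
exists d. split; [exact Hd|]. intros s _ Hst.
replace (minus (Int f a s) (Int f a t)) with (Int f t s).
2:{ rewrite <- (Int_Chasles f a t s Hf). vring X. }
rewrite <- Int_minus_const by exact Hf.
apply Int_norm_abs; [apply cont_minus_const, Hf|].
intros r Hr. left. apply Hs.
revert Hr Hst. unfold Rmin, Rmax, Rabs.
destruct (Rle_dec t s); repeat destruct (Rcase_abs _); lra.
Qed.

(** F and the integral of f have the same derivative, so [dv_constant] applies to their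
    difference. *)
Lemma dv_FTC (D : R -> Prop) F f a b : a <= b -> (forall t, a <= t <= b -> D t) -> cont f ->
  (forall t, a <= t <= b -> dv D F t (f t)) -> minus (F b) (F a) = Int f a b.
Proof.
intros Hab HD Hf H.
assert (E : minus (F b) (Int f a b) = minus (F a) (Int f a a)).
{ apply (dv_constant D (fun t => minus (F t) (Int f a t)) a b Hab HD).
  intros t Ht. assert (Q := dv_minus D F (fun s => Int f a s) t _ _ (H t Ht) (dv_Int D f a t Hf)).
  replace (minus (f t) (f t)) with (zero : X) in Q by (vring X). exact Q. }
rewrite Int_point in E.
replace (F b) with (plus (minus (F b) (Int f a b)) (Int f a b)) by (vring X).
rewrite E. vring X.
Qed.

Lemma dv_norm_bound (D : R -> Prop) F f a b M : a <= b -> (forall t, a <= t <= b -> D t) -> cont f ->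
  (forall t, a <= t <= b -> dv D F t (f t)) -> (forall t, a <= t <= b -> norm (f t) <= M) ->
  norm (minus (F b) (F a)) <= M * (b - a).
Proof. intros Hab HD Hf H HM. rewrite (dv_FTC D F f) by assumption. apply Int_norm; assumption. Qed.

Lemma cont_plus f g : cont f -> cont g -> cont (fun t => plus (f t) (g t)).
Proof.
intros H H' t e He. destruct (H t (e / 2)) as (d & Hd & Hs); [lra|].
destruct (H' t (e / 2)) as (d' & Hd' & Hs'); [lra|].
exists (Rmin d d'). split; [apply Rmin_pos; assumption|]. intros s Hst.
specialize (Hs s (Rlt_le_trans _ _ _ Hst (Rmin_l _ _))).
specialize (Hs' s (Rlt_le_trans _ _ _ Hst (Rmin_r _ _))).
replace (minus (plus (f s) (g s)) (plus (f t) (g t))) with (plus (minus (f s) (f t)) (minus (g s) (g t))) by (vring X).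
eapply Rle_lt_trans; [apply norm_tri|]. lra.
Qed.

Lemma cont_const (v : X) : cont (fun _ => v).
Proof.
intros t e He. exists 1. split; [lra|]. intros s _. eapply Rle_lt_trans; [right; exact (norm_minus_self v)|exact He].
Qed.

Lemma Int_plus f g a b : cont f -> cont g ->
  Int (fun t => plus (f t) (g t)) a b = plus (Int f a b) (Int g a b).
Proof.
intros H H'. exact (RInt_plus (V := real_of X) f g a b (ex_Int _ _ _ H) (ex_Int _ _ _ H')).
Qed.

Lemma cont_Int f a : cont f -> cont (fun t => Int f a t).
Proof.
intros Hf t e He.
destruct (dv_continuous (fun _ => True) (fun t => Int f a t) t (f t) (dv_Int _ f a t Hf) e He)
  as (d & Hd & Hs). exists d. split; [exact Hd|]. intros s; apply Hs; exact I.
Qed.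
End Calculus.

Section IntegralLinear.
Context {X Y : CBanach}.
Variable L : X -> Y.
Variable K : R.
Hypothesis L_minus : forall x y, L (minus x y) = minus (L x) (L y).
Hypothesis L_scal : forall (c : C) x, L (scal c x) = scal c (L x).
Hypothesis L_norm : forall x, norm (L x) <= K * norm x.

Lemma cont_linear f : cont f -> cont (fun t => L (f t)).
Proof.
intros H t e He. assert (P := Rle_abs K). assert (P' := Rabs_pos K).
destruct (H t (e / (Rabs K + 1))) as (d & Hd & Hs); [apply Rdiv_lt_0_compat; lra|].
exists d. split; [exact Hd|]. intros s Hst. specialize (Hs s Hst).
rewrite <- L_minus. eapply Rle_lt_trans; [apply L_norm|].
set (n := norm _) in *. assert (N0 : 0 <= n) by apply norm_ge_0.
apply Rle_lt_trans with ((Rabs K + 1) * n); [nra|].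
apply Rlt_le_trans with ((Rabs K + 1) * (e / (Rabs K + 1))).
- apply Rmult_lt_compat_l; lra.
- right. field. lra.
Qed.

(** L commutes with differentiation, so [dv_FTC] recognises L of the integral as a primitive of L
    f. *)
Lemma Int_linear f a b : a <= b -> cont f -> L (Int f a b) = Int (fun t => L (f t)) a b.
Proof.
intros Hab Hf.
assert (L0 : L zero = zero).
{ replace (zero : X) with (scal (RtoC 0) (zero : X)) by (vring X). rewrite L_scal. vring Y. }
assert (H : minus (L (Int f a b)) (L (Int f a a)) = Int (fun t => L (f t)) a b).
{ apply (dv_FTC (fun _ => True) (fun t => L (Int f a t))); auto; [apply cont_linear, Hf|].
  intros t _ e He. assert (P := Rle_abs K). assert (P' := Rabs_pos K).
  destruct (dv_Int (fun _ => True) f a t Hf (e / (Rabs K + 1))) as (d & Hd & Hs); [apply Rdiv_lt_0_compat; lra|].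
  exists d. split; [exact Hd|]. intros s Ds Hst. specialize (Hs s Ds Hst).
  rewrite <- L_scal, <- !L_minus. eapply Rle_trans; [apply L_norm|].
  set (n := norm _) in *. assert (N0 : 0 <= n) by apply norm_ge_0.
  apply Rle_trans with ((Rabs K + 1) * n); [nra|].
  apply Rle_trans with ((Rabs K + 1) * (e / (Rabs K + 1) * Rabs (s - t))).
  - apply Rmult_le_compat_l; lra.
  - right. field. lra. }
rewrite <- H, Int_point, L0. vring Y.
Qed.
End IntegralLinear.

(** * The complex exponential and product rules *)

Notation CB := (C_CompleteNormedModule : CBanach).

Lemma Cmod_le_abs (a b : R) : Cmod (a, b) <= Rabs a + Rabs b.
Proof.
replace ((a, b) : C) with (RtoC a + RtoC b * Ci)%C by (apply injective_projections; simpl; ring).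
eapply Rle_trans; [apply Cmod_triangle|]. rewrite Cmod_mult, !Cmod_R.
replace (Cmod Ci) with 1; [lra|]. unfold Cmod, Ci. simpl.
replace (0 * (0 * 1) + 1 * (1 * 1)) with 1 by ring. symmetry; apply sqrt_1.
Qed.

Lemma Re_le_Cmod z : Rabs (Re z) <= Cmod z.
Proof. eapply Rle_trans; [|apply Rmax_Cmod]. apply Rmax_l. Qed.
Lemma Im_le_Cmod z : Rabs (Im z) <= Cmod z.
Proof. eapply Rle_trans; [|apply Rmax_Cmod]. apply Rmax_r. Qed.

Definition Cexp (z : C) : C := (exp (Re z) * cos (Im z), exp (Re z) * sin (Im z)).

Lemma Cexp_plus z w : Cexp (z + w)%C = (Cexp z * Cexp w)%C.
Proof.
destruct z as [a b], w as [c d]. unfold Cexp. simpl.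
rewrite exp_plus, cos_plus, sin_plus. apply injective_projections; simpl; ring.
Qed.

Lemma Cexp_0 : Cexp 0 = 1%C.
Proof.
unfold Cexp. simpl. rewrite exp_0, cos_0, sin_0. apply injective_projections; simpl; ring.
Qed.

Lemma Cmod_Cexp z : Cmod (Cexp z) = exp (Re z).
Proof.
unfold Cmod, Cexp. cbn [fst snd].
replace ((exp (Re z) * cos (Im z)) ^ 2 + (exp (Re z) * sin (Im z)) ^ 2)
  with (exp (Re z) * exp (Re z)).
- apply sqrt_square. left; apply exp_pos.
- assert (E := sin2_cos2 (Im z)). unfold Rsqr in E.
  transitivity (exp (Re z) * exp (Re z) * (sin (Im z) * sin (Im z) + cos (Im z) * cos (Im z))); [rewrite E; ring|ring].
Qed.

Lemma Cexp_inv z : (Cexp z * Cexp (- z) = 1)%C.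
Proof. rewrite <- Cexp_plus. replace (z + - z)%C with (RtoC 0) by ring. apply Cexp_0. Qed.

Lemma derive_eps (f : R -> R) t l : is_derive f t l -> forall e, 0 < e -> exists d, 0 < d /\
  forall s, Rabs (s - t) < d -> Rabs (f s - f t - (s - t) * l) <= e * Rabs (s - t).
Proof.
intros H e He. apply is_derive_Reals in H. destruct (H e He) as [d Hd].
exists d. split; [apply cond_pos|]. intros s Hs.
destruct (Req_dec s t) as [->|Hne].
- replace (f t - f t - (t - t) * l) with 0 by ring. rewrite Rminus_diag, Rabs_R0. lra.
- assert (Hh : s - t <> 0) by lra. specialize (Hd (s - t) Hh Hs).
  replace (t + (s - t)) with s in Hd by ring.
  replace (f s - f t - (s - t) * l) with (((f s - f t) / (s - t) - l) * (s - t)) by (field; exact Hh).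
  rewrite Rabs_mult. apply Rmult_le_compat_r; [apply Rabs_pos|]. lra.
Qed.

Lemma dv_pair D (f g : R -> R) t a b : is_derive f t a -> is_derive g t b ->
  dv (X := CB) D (fun s => (f s, g s) : C) t ((a, b) : C).
Proof.
intros Hf Hg e He.
destruct (derive_eps f t a Hf (e / 2)) as (d & Hd & H); [lra|].
destruct (derive_eps g t b Hg (e / 2)) as (d' & Hd' & H'); [lra|].
exists (Rmin d d'). split; [apply Rmin_pos; assumption|]. intros s _ Hs.
specialize (H s (Rlt_le_trans _ _ _ Hs (Rmin_l _ _))).
specialize (H' s (Rlt_le_trans _ _ _ Hs (Rmin_r _ _))).
change (Cmod (((f s, g s) : C) - ((f t, g t) : C) - (RtoC (s - t) * (a, b)))%C <= e * Rabs (s - t)).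
replace (((f s, g s) : C) - ((f t, g t) : C) - (RtoC (s - t) * (a, b)))%C
  with ((f s - f t - (s - t) * a, g s - g t - (s - t) * b) : C)
  by (apply injective_projections; simpl; ring).
eapply Rle_trans; [apply Cmod_le_abs|]. lra.
Qed.

Lemma dv_Cexp D (z : C) t :
  dv (X := CB) D (fun s => Cexp (z * RtoC s)) t (z * Cexp (z * RtoC t))%C.
Proof.
destruct z as [a b].
refine (dv_ext _ (fun s => (exp (a * s) * cos (b * s), exp (a * s) * sin (b * s)) : C) _ _ _ _ _ _).
- intros s _. unfold Cexp. simpl. replace (a * s - b * 0) with (a * s) by ring.
  replace (a * 0 + b * s) with (b * s) by ring. reflexivity.
- unfold Cexp. simpl. replace (a * t - b * 0) with (a * t) by ring.
  replace (a * 0 + b * t) with (b * t) by ring. reflexivity.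
- replace ((a, b) * Cexp ((a, b) * RtoC t))%C with
   ((a * (exp (a * t) * cos (b * t)) - b * (exp (a * t) * sin (b * t)),
     a * (exp (a * t) * sin (b * t)) + b * (exp (a * t) * cos (b * t))) : C).
  2:{ unfold Cexp. simpl. replace (a * t - b * 0) with (a * t) by ring.
      replace (a * 0 + b * t) with (b * t) by ring. apply injective_projections; simpl; ring. }
  apply dv_pair; auto_derive; auto; ring.
Qed.

Section Products.
Context {X : CBanach}.

Lemma dv_prod D (k : R -> C) (F : R -> X) t k' v : dv (X := CB) D k t k' -> dv D F t v ->
  dv D (fun s => scal (k s) (F s)) t (plus (scal k' (F t)) (scal (k t) v)).
Proof.
intros Hk HF e He.
set (n1 := norm (F t)). set (n2 := Cmod (k t)). set (n3 := Cmod k' + 1). set (n4 := norm v + 1).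
assert (P1 : 0 <= n1) by apply norm_ge_0. assert (P2 : 0 <= n2) by apply Cmod_ge_0.
assert (P3 : 0 < n3) by (unfold n3; assert (Q := Cmod_ge_0 k'); lra).
assert (P4 : 0 < n4) by (unfold n4; assert (Q := norm_ge_0 v); lra).
(* The two errors that are linear in e1 share e/3; the product of the two increments takes another
   e/3 through the radius. *)
set (e1 := Rmin 1 (e / (3 * (n1 + n2 + 1)))).
assert (E1 : 0 < e1). { apply Rmin_pos; [lra|]. apply Rdiv_lt_0_compat; nra. }
assert (E2 : e1 * (n1 + n2 + 1) <= e / 3).
{ apply Rle_trans with (e / (3 * (n1 + n2 + 1)) * (n1 + n2 + 1)).
  - apply Rmult_le_compat_r; [lra|apply Rmin_r].
  - right. field. lra. }
destruct (Hk e1 E1) as (d & Hd & H). destruct (HF e1 E1) as (d' & Hd' & H').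
exists (Rmin (Rmin d d') (e / (3 * (n3 * n4)))).
assert (P34 : 0 < n3 * n4) by nra.
split; [repeat apply Rmin_pos; try assumption; apply Rdiv_lt_0_compat; lra|].
intros s Ds Hs.
assert (Q1 := Rlt_le_trans _ _ _ Hs (Rmin_l _ _)). assert (Q2 := Rlt_le_trans _ _ _ Hs (Rmin_r _ _)).
specialize (H s Ds (Rlt_le_trans _ _ _ Q1 (Rmin_l _ _))).
specialize (H' s Ds (Rlt_le_trans _ _ _ Q1 (Rmin_r _ _))).
set (u := minus (minus (F s) (F t)) (scal (RtoC (s - t)) v)) in *.
set (w := (k s - k t - RtoC (s - t) * k')%C).
change (Cmod w <= e1 * Rabs (s - t)) in H.
set (D1 := (RtoC (s - t) * k' + w)%C). set (D2 := plus (scal (RtoC (s - t)) v) u).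
assert (ID : minus (minus (scal (k s) (F s)) (scal (k t) (F t))) (scal (RtoC (s - t)) (plus (scal k' (F t)) (scal (k t) v)))
  = plus (plus (scal w (F t)) (scal (k t) u)) (scal D1 D2)).
{ unfold D1, D2, u, w. generalize (F s) (F t) (k s) (k t). intros. vring X. }
set (r := Rabs (s - t)) in *. assert (r0 : 0 <= r) by apply Rabs_pos.
assert (B1 : Cmod D1 <= r * n3).
{ unfold D1. eapply Rle_trans; [apply Cmod_triangle|]. rewrite Cmod_mult, Cmod_R. fold r.
  assert (e1 <= 1) by apply Rmin_l. unfold n3. nra. }
assert (B2 : norm D2 <= r * n4).
{ unfold D2. eapply Rle_trans; [apply norm_tri|]. rewrite norm_scal_X, Cmod_R. fold r.
  assert (e1 <= 1) by apply Rmin_l. unfold n4. nra. }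
eapply Rle_trans; [right; exact (f_equal norm ID)|].
eapply Rle_trans; [apply norm_tri|].
eapply Rle_trans; [apply Rplus_le_compat_r, norm_tri|].
rewrite !norm_scal_X. fold n1 n2.
assert (B3 : Cmod D1 * norm D2 <= r * n3 * (r * n4)).
{ apply Rmult_le_compat; auto; [apply Cmod_ge_0|apply norm_ge_0]. }
assert (B4 : r * (n3 * n4) <= e / 3).
{ apply Rle_trans with (e / (3 * (n3 * n4)) * (n3 * n4)).
  - apply Rmult_le_compat_r; lra.
  - right. field. split; lra. }
assert (B5 : r * n3 * (r * n4) <= e / 3 * r) by nra.
assert (B6 : Cmod w * n1 <= e1 * r * n1) by (apply Rmult_le_compat_r; auto).
assert (B7 : n2 * norm u <= n2 * (e1 * r)) by (apply Rmult_le_compat_l; auto).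
assert (B8 : r * (e1 * (n1 + n2 + 1)) <= r * (e / 3)) by (apply Rmult_le_compat_l; lra).
assert (B9 : 0 <= r * e1) by (exact (Rmult_le_pos _ _ r0 (Rlt_le _ _ E1))).
assert (B10 : 0 <= e * r) by (exact (Rmult_le_pos _ _ (Rlt_le _ _ He) r0)). lra.
Qed.

Lemma cont_scal (k : R -> C) (f : R -> X) : cont (X := CB) k -> cont f -> cont (fun t => scal (k t) (f t)).
Proof.
intros Hk Hf t e He.
set (n1 := norm (f t) + 1). set (n2 := Cmod (k t)).
assert (P1 : 0 < n1) by (unfold n1; assert (Q := norm_ge_0 (f t)); lra).
assert (P2 : 0 <= n2) by apply Cmod_ge_0.
destruct (Hk t (e / (2 * n1))) as (d & Hd & H); [apply Rdiv_lt_0_compat; lra|].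
destruct (Hf t (Rmin 1 (e / (2 * (n2 + 1))))) as (d' & Hd' & H').
{ apply Rmin_pos; [lra|apply Rdiv_lt_0_compat; lra]. }
exists (Rmin d d'). split; [apply Rmin_pos; assumption|]. intros s Hs.
specialize (H s (Rlt_le_trans _ _ _ Hs (Rmin_l _ _))).
specialize (H' s (Rlt_le_trans _ _ _ Hs (Rmin_r _ _))).
change (Cmod (k s - k t)%C < e / (2 * n1)) in H.
set (a := (k s - k t)%C) in *. set (u := minus (f s) (f t)) in *.
assert (ID : minus (scal (k s) (f s)) (scal (k t) (f t)) = plus (scal a (f s)) (scal (k t) u)).
{ unfold a, u. generalize (k s) (k t). intros. vring X. }
assert (N1 : norm (f s) <= n1).
{ replace (f s) with (plus (f t) u) by (unfold u; vring X).
  eapply Rle_trans; [apply norm_tri|]. unfold n1. assert (Q := Rmin_l 1 (e / (2 * (n2 + 1)))). lra. }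
eapply Rle_lt_trans; [right; exact (f_equal norm ID)|].
eapply Rle_lt_trans; [apply norm_tri|]. rewrite !norm_scal_X. fold n2.
assert (Q := Rmin_r 1 (e / (2 * (n2 + 1)))).
assert (B1 : Cmod a * norm (f s) <= e / (2 * n1) * n1).
{ apply Rmult_le_compat; [apply Cmod_ge_0|apply norm_ge_0|lra|exact N1]. }
assert (B2 : n2 * norm u <= n2 * (e / (2 * (n2 + 1)))) by (apply Rmult_le_compat_l; lra).
assert (B3 : e / (2 * n1) * n1 = e / 2) by (field; lra).
assert (B4 : n2 * (e / (2 * (n2 + 1))) < e / 2).
{ apply Rlt_le_trans with ((n2 + 1) * (e / (2 * (n2 + 1)))).
  - apply Rmult_lt_compat_r; [apply Rdiv_lt_0_compat; lra|lra].
  - right. field. lra. }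
lra.
Qed.
End Products.

Lemma dv_cont {X : CBanach} (F : R -> X) (v : R -> X) : (forall t, dv (fun _ => True) F t (v t)) -> cont F.
Proof.
intros H t e He. destruct (dv_continuous _ _ _ _ (H t) e He) as (d & Hd & Hs).
exists d. split; [exact Hd|]. intros s; apply Hs; exact I.
Qed.

Lemma cont_Cexp z : cont (X := CB) (fun s => Cexp (z * RtoC s)).
Proof. exact (dv_cont (X := CB) _ _ (fun t => dv_Cexp _ z t)). Qed.

Lemma cont_of_R (f : R -> R) : (forall t, continuous f t) -> cont (X := CB) (fun t => RtoC (f t)).
Proof.
intros H t e He. specialize (H t).
destruct (proj1 (filterlim_locally_ball_norm (K := R_AbsRing) (U := R_NormedModule) (F := locally t) f (f t)) H
  (mkposreal e He)) as [d Hd].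
exists d. split; [apply cond_pos|]. intros s Hs. specialize (Hd s Hs).
change (Cmod (RtoC (f s) - RtoC (f t))%C < e).
replace (RtoC (f s) - RtoC (f t))%C with (RtoC (f s - f t)) by (apply injective_projections; simpl; ring).
rewrite Cmod_R. exact Hd.
Qed.

(* |e^{hx} - 1 - hx - h^2 x^2/2| <= |h|^3 x^3 e^{|h| x}, by integrating three times. *)
Lemma Cexp_taylor (h : C) (x : R) : 0 <= x ->
  Cmod (Cexp (h * RtoC x) - (1 + (h * RtoC x + h * h * RtoC (x * x / 2))))%C
    <= Cmod h * Cmod h * Cmod h * (x * x * x * exp (Cmod h * x)).
Proof.
intros Hx. set (c := Cmod h). assert (c0 : 0 <= c) by apply Cmod_ge_0.
set (E := exp (c * x)). assert (E0 : 0 < E) by apply exp_pos.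
assert (Ebound : forall y, 0 <= y <= x -> Cmod (Cexp (h * RtoC y)) <= E).
{ intros y Hy. rewrite Cmod_Cexp. unfold E.
  assert (L : Re (h * RtoC y) <= c * x).
  { replace (Re (h * RtoC y)) with (Re h * y) by (unfold Re; simpl; ring).
    assert (Q := Re_le_Cmod h). assert (Q' := Rle_abs (Re h)). fold c in Q. nra. }
  destruct L as [L| ->]; [left; apply exp_increasing; exact L|right; reflexivity]. }
assert (D0 : forall y, 0 <= y <= x -> Cmod (Cexp (h * RtoC y) - 1)%C <= c * E * y).
{ intros y Hy.
  assert (Q := dv_norm_bound (X := CB) (fun _ => True) (fun s => Cexp (h * RtoC s))
    (fun s => h * Cexp (h * RtoC s))%C 0 y (c * E)).
  assert (Q' := Q (proj1 Hy) (fun _ _ => I) (cont_scal (X := CB) (fun _ => h) _ (cont_const (X := CB) h) (cont_Cexp h))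
    (fun t _ => dv_Cexp _ h t)). clear Q.
  rewrite Rminus_0_r in Q'. eapply Rle_trans; [|apply Q'].
  - right. change (Cmod (Cexp (h * RtoC y) - 1) = Cmod (Cexp (h * RtoC y) - Cexp (h * RtoC 0)))%C.
    f_equal. f_equal. replace (h * RtoC 0)%C with (RtoC 0) by ring. rewrite Cexp_0. reflexivity.
  - intros t Ht. change (Cmod (h * Cexp (h * RtoC t))%C <= c * E). rewrite Cmod_mult. fold c.
    apply Rmult_le_compat_l; [exact c0|]. apply Ebound; lra. }
assert (dlin : forall t, dv (X := CB) (fun _ => True) (fun s => RtoC s) t (RtoC 1)).
{ intros t. apply (dv_pair _ (fun s => s) (fun _ => 0) t 1 0); auto_derive; auto. }
assert (dsq : forall t, dv (X := CB) (fun _ => True) (fun s => RtoC (s * s / 2)) t (RtoC t)).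
{ intros t. apply (dv_pair _ (fun s => s * s / 2) (fun _ => 0) t t 0); auto_derive; auto. field. }
assert (D1 : forall y, 0 <= y <= x -> Cmod (Cexp (h * RtoC y) - (1 + h * RtoC y))%C <= c * (c * E * x) * y).
{ intros y Hy.
  assert (Q := dv_norm_bound (X := CB) (fun _ => True) (fun s => Cexp (h * RtoC s) - h * RtoC s)%C
    (fun s => h * (Cexp (h * RtoC s) - 1))%C 0 y (c * (c * E * x)) (proj1 Hy) (fun _ _ => I)).
  assert (Q' := Q (cont_scal (X := CB) (fun _ => h) _ (cont_const (X := CB) h) (cont_minus_const (X := CB) _ (RtoC 1) (cont_Cexp h)))).
  clear Q. rewrite Rminus_0_r in Q'. eapply Rle_trans; [|apply Q'].
  - right. change (Cmod (Cexp (h * RtoC y) - (1 + h * RtoC y)) =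
      Cmod (Cexp (h * RtoC y) - h * RtoC y - (Cexp (h * RtoC 0) - h * RtoC 0)))%C.
    f_equal. replace (h * RtoC 0)%C with (RtoC 0) by ring. rewrite Cexp_0. ring.
  - intros t Ht. assert (W := dv_minus (X := CB) _ _ _ t _ _ (dv_Cexp (fun _ => True) h t) (dv_scal (X := CB) h _ _ _ _ (dlin t))).
    replace (h * (Cexp (h * RtoC t) - 1))%C with (minus (h * Cexp (h * RtoC t))%C (scal h (RtoC 1))); [exact W|].
    change (h * Cexp (h * RtoC t) - h * 1 = h * (Cexp (h * RtoC t) - 1))%C. ring.
  - intros t Ht. change (Cmod (h * (Cexp (h * RtoC t) - 1))%C <= c * (c * E * x)).
    rewrite Cmod_mult. fold c. apply Rmult_le_compat_l; [exact c0|].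
    eapply Rle_trans; [apply D0; lra|]. apply Rmult_le_compat_l; [nra|lra]. }
assert (Q := dv_norm_bound (X := CB) (fun _ => True) (fun s => Cexp (h * RtoC s) - (h * RtoC s + h * h * RtoC (s * s / 2)))%C
    (fun s => h * (Cexp (h * RtoC s) - (1 + h * RtoC s)))%C 0 x (c * (c * (c * E * x) * x)) Hx (fun _ _ => I)).
eapply Rle_trans; [|eapply Rle_trans; [apply Q|]].
- right. change (Cmod (Cexp (h * RtoC x) - (1 + (h * RtoC x + h * h * RtoC (x * x / 2)))) =
   Cmod (Cexp (h * RtoC x) - (h * RtoC x + h * h * RtoC (x * x / 2)) - (Cexp (h * RtoC 0) - (h * RtoC 0 + h * h * RtoC (0 * 0 / 2)))))%C.
  f_equal. replace (0 * 0 / 2) with 0 by field. replace (h * RtoC 0)%C with (RtoC 0) by ring. rewrite Cexp_0. ring.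
- apply (cont_scal (X := CB) (fun _ => h)); [exact (cont_const (X := CB) h)|].
  assert (CC := cont_plus (X := CB) _ _ (cont_minus_const (X := CB) _ (RtoC 1) (cont_Cexp h))
    (cont_scal (X := CB) (fun _ => - h)%C _ (cont_const (X := CB) (- h)%C) (dv_cont (X := CB) _ _ dlin))).
  intros t e He. destruct (CC t e He) as (d & Hd & Hs). exists d. split; [exact Hd|].
  intros s Hst. eapply Rle_lt_trans; [|exact (Hs s Hst)]. right.
  change (Cmod (Cexp (h * RtoC s) - (1 + h * RtoC s) - (Cexp (h * RtoC t) - (1 + h * RtoC t))) =
    Cmod (Cexp (h * RtoC s) - 1 + - h * RtoC s - (Cexp (h * RtoC t) - 1 + - h * RtoC t)))%C.
  f_equal. ring.
- intros t Ht. assert (W := dv_minus (X := CB) _ _ _ t _ _ (dv_Cexp (fun _ => True) h t)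
    (dv_plus (X := CB) _ _ _ _ _ _ (dv_scal (X := CB) h _ _ _ _ (dlin t)) (dv_scal (X := CB) (h * h)%C _ _ _ _ (dsq t)))).
  match type of W with dv _ _ _ ?v => replace (h * (Cexp (h * RtoC t) - (1 + h * RtoC t)))%C with v; [exact W|] end.
  change (h * Cexp (h * RtoC t) - (h * 1 + h * h * RtoC t) = h * (Cexp (h * RtoC t) - (1 + h * RtoC t)))%C. ring.
- intros t Ht. change (Cmod (h * (Cexp (h * RtoC t) - (1 + h * RtoC t)))%C <= c * (c * (c * E * x) * x)).
  rewrite Cmod_mult. fold c. apply Rmult_le_compat_l; [exact c0|].
  eapply Rle_trans; [apply D1; lra|]. apply Rmult_le_compat_l; [|lra].
  assert (0 <= c * E) by nra. assert (0 <= c * E * x) by nra. nra.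
- right. ring.
Qed.

(** * Bounded solutions of U' = z U - f *)

Section HalfLine.
Context {X : CBanach}.

(** Freezing f at f 0 for negative times turns continuity on the half-line into continuity on R, the
    hypothesis of the lemmas on [Int]. *)
Definition ext (f : R -> X) (t : R) : X := f (Rmax 0 t).

Lemma ext_eq f t : half_line t -> ext f t = f t.
Proof. intros H. unfold ext. rewrite Rmax_right; [reflexivity|exact H]. Qed.

Lemma continuous_onE (f : R -> X) : continuous_on half_line f <->
  forall t, half_line t -> forall e, 0 < e -> exists d, 0 < d /\
    forall s, half_line s -> Rabs (s - t) < d -> norm (minus (f s) (f t)) < e.
Proof.
split.
- intros H t Ht e He. specialize (H t Ht).
  destruct (proj1 (filterlim_locally_ball_norm (K := C_AbsRing) (U := X)
    (F := within half_line (locally t)) f (f t)) H (mkposreal e He)) as [d Hd].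
  exists d. split; [apply cond_pos|]. intros s Hs Hst. exact (Hd s Hst Hs).
- intros H t Ht. apply (filterlim_locally_ball_norm (K := C_AbsRing) (U := X)
    (F := within half_line (locally t))). intros e.
  destruct (H t Ht e (cond_pos e)) as (d & Hd & Hs). exists (mkposreal d Hd).
  intros s Hst Hs'. exact (Hs s Hs' Hst).
Qed.

Lemma cont_ext (f : R -> X) : continuous_on half_line f -> cont (ext f).
Proof.
intros H t e He. rewrite continuous_onE in H.
destruct (H (Rmax 0 t) (Rmax_l _ _) e He) as (d & Hd & Hs).
exists d. split; [exact Hd|]. intros s Hst. apply Hs; [apply Rmax_l|].
eapply Rle_lt_trans; [|exact Hst]. unfold Rmax.
destruct (Rle_dec 0 s), (Rle_dec 0 t); unfold Rabs; repeat destruct (Rcase_abs _); lra.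
Qed.

Lemma is_derivativeE (u v : BUC X) :
  is_derivative u v <-> forall t, half_line t -> dv half_line u t (v t).
Proof.
split.
- intros H t Ht e He. destruct (H t Ht) as [_ H2].
  destruct (H2 t) with (eps := mkposreal e He) as [d Hd].
  { intros P [d Hd]. exists d. intros y Hy _. apply Hd, Hy. }
  exists d. split; [apply cond_pos|]. intros s Hs Hst. exact (Hd s Hst Hs).
- intros H t Ht. split.
  + exact (is_linear_scal_l (K := R_AbsRing) (V := real_of X) (v t)).
  + intros x Hx. assert (E : t = x).
    { apply (ball_norm_eq (K := R_AbsRing) (V := R_NormedModule)). intros e.
      assert (L : locally x (fun y => ball x e y)) by (exists e; auto).
      destruct (Hx _ L) as [d Hd].
      assert (Q := Hd t (ball_center t d) Ht). apply ball_sym in Q. exact Q. }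
    subst x. intros e. destruct (H t Ht e (cond_pos e)) as (d & Hd & Hs).
    exists (mkposreal d Hd). intros s Hst Hs'. exact (Hs s Hs' Hst).
Qed.

Lemma cauchy_limit (F : R -> X) :
  (forall e, 0 < e -> exists A, forall s t, A < s -> A < t -> norm (minus (F s) (F t)) < e) ->
  exists L, forall e, 0 < e -> exists A, forall s, A < s -> norm (minus (F s) L) < e.
Proof.
intros H.
destruct (proj1 (filterlim_locally_cauchy (F := Rbar_locally p_infty) (U := X) F)) as [L HL].
- intros e. destruct (H e (cond_pos e)) as [A HA].
  exists (fun x => A < x). split; [exists A; auto|].
  intros s t Hs Ht. apply (norm_compat1 (K := C_AbsRing) (V := X)). apply HA; assumption.
- exists L. intros e He.
  destruct (proj1 (filterlim_locally_ball_norm (K := C_AbsRing) (U := X) (F := Rbar_locally p_infty) F L) HL (mkposreal e He)) as [A HA].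
  exists A. intros s Hs. exact (HA s Hs).
Qed.

(** U' = z U - f, that is (z - D) U = f with D = d/dt: off the imaginary axis a bounded solution
    represents the class [hat f z]. *)
Definition ode (z : C) (f U : R -> X) : Prop :=
  forall t, half_line t -> dv half_line U t (minus (scal z (U t)) (f t)).

Lemma cont_exp_mul z (f : R -> X) : cont f -> cont (fun s => scal (Cexp (z * RtoC s)) (f s)).
Proof. intros H. apply cont_scal; [apply cont_Cexp|exact H]. Qed.

(** The quotient on the right is nonnegative for either sign of Re z, so one statement serves both
    half-planes. *)
Lemma Cexp_int_bound z (f : R -> X) e s t : Re z <> 0 -> s <= t -> cont f ->
  (forall x, s <= x <= t -> norm (f x) <= e) ->
  norm (Int (fun x => scal (Cexp (- z * RtoC x)) (f x)) s t)
    <= e * ((exp (- Re z * s) - exp (- Re z * t)) / Re z).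
Proof.
intros Hz Hst Hf He.
assert (IR : is_RInt (fun x => e * exp (- Re z * x)) s t
   (minus (- e / Re z * exp (- Re z * t)) (- e / Re z * exp (- Re z * s)))).
{ apply (is_RInt_derive (V := R_CompleteNormedModule) (fun x => - e / Re z * exp (- Re z * x))).
  - intros x _. auto_derive; auto. unfold Rdiv. field. exact Hz.
  - intros x _. apply (ex_derive_continuous (K := R_AbsRing) (V := R_NormedModule)). auto_derive; auto. }
eapply Rle_trans; [apply (Int_norm_RInt _ (fun x => e * exp (- Re z * x))); auto|].
- apply cont_exp_mul, Hf.
- intros x Hx. rewrite norm_scal_X, Cmod_Cexp.
  replace (Re (- z * RtoC x)) with (- Re z * x) by (unfold Re; simpl; ring).
  rewrite Rmult_comm. apply Rmult_le_compat_r; [left; apply exp_pos|auto].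
- exists (minus (- e / Re z * exp (- Re z * t)) (- e / Re z * exp (- Re z * s))). exact IR.
- right. rewrite (is_RInt_unique _ _ _ _ IR). unfold minus, plus, opp; simpl. field. exact Hz.
Qed.

Lemma ode_variation z f U s t : half_line s -> s <= t -> continuous_on half_line f -> ode z f U ->
  minus (scal (Cexp (- z * RtoC t)) (U t)) (scal (Cexp (- z * RtoC s)) (U s))
  = opp (Int (fun x => scal (Cexp (- z * RtoC x)) (ext f x)) s t).
Proof.
intros Hs Hst Hf HU.
rewrite (dv_FTC half_line (fun x => scal (Cexp (- z * RtoC x)) (U x))
  (fun x => scal (RtoC (-1)) (scal (Cexp (- z * RtoC x)) (ext f x)))).
- rewrite <- (Int_linear (fun x => scal (RtoC (-1)) x) 1).
  + vring X.
  + intros; vring X.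
  + intros; vring X.
  + intros x. rewrite norm_scal_X, Cmod_R, Rabs_left by lra. lra.
  + exact Hst.
  + apply cont_exp_mul, cont_ext, Hf.
- exact Hst.
- intros x Hx. unfold half_line in *. lra.
- apply (cont_linear (fun x => scal (RtoC (-1)) x) 1).
  + intros; vring X.
  + intros x. rewrite norm_scal_X, Cmod_R, Rabs_left by lra. lra.
  + apply cont_exp_mul, cont_ext, Hf.
- intros x Hx. assert (Hx0 : half_line x) by (unfold half_line in *; lra).
  assert (Q := dv_prod half_line _ U x _ _ (dv_Cexp half_line (- z) x) (HU x Hx0)).
  rewrite (ext_eq f x Hx0).
  match type of Q with dv _ _ _ ?v => replace (scal (RtoC (-1)) (scal (Cexp (- z * RtoC x)) (f x))) with v; [exact Q|] end.
  generalize (Cexp (- z * RtoC x)). intros. vring X.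
Qed.

Lemma ode_growth z f U s t e : Re z <> 0 -> half_line s -> s <= t -> continuous_on half_line f ->
  ode z f U -> (forall x, s <= x <= t -> norm (f x) <= e) ->
  norm (minus (scal (Cexp (- z * RtoC t)) (U t)) (scal (Cexp (- z * RtoC s)) (U s)))
    <= e * ((exp (- Re z * s) - exp (- Re z * t)) / Re z).
Proof.
intros Hz Hs Hst Hf HU He. rewrite (ode_variation z f U s t Hs Hst Hf HU).
eapply Rle_trans; [|apply (Cexp_int_bound z (ext f) e s t Hz Hst (cont_ext _ Hf))].
- right. exact (norm_opp (K := C_AbsRing) (V := X) _).
- intros x Hx. rewrite ext_eq; [auto|]. unfold half_line in *. lra.
Qed.

Lemma Cexp_cancel z t (x : X) : x = scal (Cexp (z * RtoC t)) (scal (Cexp (- z * RtoC t)) x).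
Proof.
assert (E := Cexp_inv (z * RtoC t)). replace (- (z * RtoC t))%C with (- z * RtoC t)%C in E by ring.
revert E. generalize (Cexp (z * RtoC t)) (Cexp (- z * RtoC t)). intros a b E.
transitivity (scal (a * b)%C x); [rewrite E; vring X|vring X].
Qed.

Lemma norm_Cexp z t (x : X) : norm (scal (Cexp (z * RtoC t)) x) = exp (Re z * t) * norm x.
Proof.
rewrite norm_scal_X, Cmod_Cexp. f_equal. f_equal. unfold Re; simpl; ring.
Qed.

Lemma exp_small a e : 0 < e -> 0 < a -> exists t, 0 < t /\ forall s, t <= s -> exp (- a * s) <= e.
Proof.
intros He Ha. exists (Rmax 1 (- ln e / a)). split; [eapply Rlt_le_trans; [|apply Rmax_l]; lra|].
intros s Hs. assert (Q := Rle_trans _ _ _ (Rmax_r _ _) Hs).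
replace e with (exp (ln e)) by (apply exp_ln, He).
assert (L : - a * s <= ln e).
{ apply (Rmult_le_compat_l a) in Q; [|lra]. replace (a * (- ln e / a)) with (- ln e) in Q by (field; lra). lra. }
destruct L as [L| ->]; [left; apply exp_increasing, L|right; reflexivity].
Qed.

(** For Re z > 0 a bounded solution is controlled by its future: U(t) is compared with U(t + T),
    which enters with the small weight e^{-aT}. For Re z < 0 it is controlled by its past, from a
    time after which f is small. *)
Lemma ode_vanishing z f U M : Re z <> 0 -> continuous_on half_line f -> ode z f U ->
  (forall t, half_line t -> norm (U t) <= M) ->
  (forall e, 0 < e -> exists A, forall t, A < t -> norm (f t) < e) ->
  forall e, 0 < e -> exists A, forall t, A < t -> norm (U t) < e.
Proof.
intros Hz Hf HU HM He e e0.
assert (M0 : 0 <= M).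
{ eapply Rle_trans; [|apply (HM 0); apply Rle_refl]. apply norm_ge_0. }
set (a := Re z) in *.
assert (Pa : 0 < Rabs a) by (apply Rabs_pos_lt; exact Hz).
destruct (He (e * Rabs a / 4)) as [A HA]; [nra|].
destruct (exp_small (Rabs a) (e / (4 * (M + 1)))) as (T & HT & HT'); [apply Rdiv_lt_0_compat; lra|exact Pa|].
assert (Esm : forall s, T <= s -> exp (- Rabs a * s) * M < e / 2).
{ intros s Hs. apply Rle_lt_trans with (e / (4 * (M + 1)) * M); [apply Rmult_le_compat_r; auto|].
  apply Rle_lt_trans with (e / (4 * (M + 1)) * (M + 1)).
  - apply Rmult_le_compat_l; [left; apply Rdiv_lt_0_compat; lra|lra].
  - replace (e / (4 * (M + 1)) * (M + 1)) with (e / 4) by (field; lra). lra. }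
set (A' := Rmax 0 A).
assert (A1 : 0 <= A') by apply Rmax_l. assert (A2 : A <= A') by apply Rmax_r.
exists (A' + 1 + T). intros t Ht.
destruct (Rlt_dec 0 a) as [L|L].
- rewrite Rabs_pos_eq in * by lra.
  assert (Q := ode_growth z f U t (t + T) (e * a / 4) Hz).
  assert (Q1 : half_line t) by (unfold half_line; lra). specialize (Q Q1).
  assert (Q2 : t <= t + T) by lra. specialize (Q Q2 Hf HU).
  assert (Q3 : forall x, t <= x <= t + T -> norm (f x) <= e * a / 4).
  { intros x Hx. left. apply HA. lra. }
  specialize (Q Q3). fold a in Q.
  rewrite (Cexp_cancel z t (U t)), norm_Cexp. fold a.
  set (ut := scal (Cexp (- z * RtoC t)) (U t)) in *.
  set (uT := scal (Cexp (- z * RtoC (t + T))) (U (t + T))) in *.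
  assert (N1 : norm ut <= norm uT + norm (minus uT ut)).
  { eapply Rle_trans; [|apply norm_minus_X]. right. f_equal. vring X. }
  assert (N2 : norm uT <= exp (- a * (t + T)) * M).
  { unfold uT. rewrite norm_Cexp. replace (Re (- z)) with (- a) by (unfold a, Re; simpl; ring).
    apply Rmult_le_compat_l; [left; apply exp_pos|]. apply HM. unfold half_line; lra. }
  assert (E1 := exp_pos (a * t)).
  assert (E2 : exp (a * t) * exp (- a * (t + T)) = exp (- a * T)).
  { rewrite <- exp_plus. f_equal. ring. }
  assert (E3 : exp (a * t) * exp (- a * t) = 1).
  { rewrite <- exp_plus, <- exp_0. f_equal. ring. }
  specialize (Esm T (Rle_refl _)).
  apply Rle_lt_trans with (exp (a * t) * (exp (- a * (t + T)) * M + e * a / 4 * ((exp (- a * t) - exp (- a * (t + T))) / a))).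
  { apply Rmult_le_compat_l; lra. }
  replace (exp (a * t) * (exp (- a * (t + T)) * M + e * a / 4 * ((exp (- a * t) - exp (- a * (t + T))) / a)))
    with (exp (a * t) * exp (- a * (t + T)) * M + e / 4 * (exp (a * t) * exp (- a * t) - exp (a * t) * exp (- a * (t + T))))
    by (field; lra).
  rewrite E2, E3. assert (E4 := exp_pos (- a * T)). nra.
- assert (La : a < 0) by (unfold a in *; lra). rewrite Rabs_left in * by exact La.
  set (s := A' + 1).
  assert (Q1 : half_line s) by (unfold half_line, s; lra).
  assert (Q2 : s <= t) by (unfold s; lra).
  assert (Q3 : forall x, s <= x <= t -> norm (f x) <= e * - a / 4).
  { intros x Hx. left. apply HA. unfold s in Hx. lra. }
  assert (Q := ode_growth z f U s t (e * - a / 4) Hz Q1 Q2 Hf HU Q3). fold a in Q.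
  rewrite (Cexp_cancel z t (U t)), norm_Cexp. fold a.
  set (ut := scal (Cexp (- z * RtoC t)) (U t)) in *.
  set (us := scal (Cexp (- z * RtoC s)) (U s)) in *.
  assert (N1 : norm ut <= norm us + norm (minus ut us)).
  { eapply Rle_trans; [|apply norm_tri]. right. f_equal. vring X. }
  assert (N2 : norm us <= exp (- a * s) * M).
  { unfold us. rewrite norm_Cexp. replace (Re (- z)) with (- a) by (unfold a, Re; simpl; ring).
    apply Rmult_le_compat_l; [left; apply exp_pos|]. apply HM, Q1. }
  assert (E1 := exp_pos (a * t)).
  assert (E2 : exp (a * t) * exp (- a * s) = exp (- - a * (t - s))).
  { rewrite <- exp_plus. f_equal. ring. }
  assert (E3 : exp (a * t) * exp (- a * t) = 1).
  { rewrite <- exp_plus, <- exp_0. f_equal. ring. }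
  assert (ts : T <= t - s) by (unfold s; lra).
  specialize (Esm (t - s) ts).
  apply Rle_lt_trans with (exp (a * t) * (exp (- a * s) * M + e * - a / 4 * ((exp (- a * s) - exp (- a * t)) / a))).
  { apply Rmult_le_compat_l; lra. }
  replace (exp (a * t) * (exp (- a * s) * M + e * - a / 4 * ((exp (- a * s) - exp (- a * t)) / a)))
    with (exp (a * t) * exp (- a * s) * M + e / 4 * (exp (a * t) * exp (- a * t) - exp (a * t) * exp (- a * s)))
    by (field; lra).
  rewrite E2, E3. assert (E4 := exp_pos (- - a * (t - s))). nra.
Qed.

Lemma BUC_of_lipschitz (U : R -> X) M K : (forall t, half_line t -> norm (U t) <= M) -> 0 <= K ->
  (forall s t, half_line s -> s <= t -> norm (minus (U t) (U s)) <= K * (t - s)) ->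
  exists U' : BUC X, forall t, U' t = U t.
Proof.
intros HM K0 HK.
assert (uc : uniformly_continuous U).
{ intros e He. exists (e / (K + 1)). split; [apply Rdiv_lt_0_compat; lra|].
  assert (G : forall s t, half_line s -> s <= t -> Rabs (s - t) < e / (K + 1) -> norm (minus (U t) (U s)) < e).
  { intros s t Hs Hst Hd. eapply Rle_lt_trans; [apply HK; auto|].
    rewrite Rabs_minus_sym, Rabs_pos_eq in Hd by lra.
    apply Rle_lt_trans with ((K + 1) * (t - s)); [nra|].
    apply Rlt_le_trans with ((K + 1) * (e / (K + 1))); [apply Rmult_lt_compat_l; lra|].
    right. field. lra. }
  intros s t Hs Ht Hd. destruct (Rle_dec s t) as [L|L].
  - eapply Rle_lt_trans; [right; exact (norm_sym (U s) (U t))|]. auto.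
  - apply G; auto; [lra|]. rewrite Rabs_minus_sym. exact Hd. }
exists (@MkBUC X U (ex_intro _ M HM) uc). reflexivity.
Qed.

(** All solutions are e^{zt} (L - I(t)). For Re z > 0 boundedness forces L to be the integral of
    e^{-zs} f over the half-line. For Re z < 0 every L gives a bounded solution, and L = 0 gives the
    bound M / |Re z|. *)
Lemma ode_exists z f M : Re z <> 0 -> continuous_on half_line f ->
  (forall t, half_line t -> norm (f t) <= M) ->
  exists U : BUC X, ode z f U /\ forall t, half_line t -> norm (U t) <= M / Rabs (Re z).
Proof.
intros Hz Hf HM. set (a := Re z) in *.
assert (M0 : 0 <= M).
{ eapply Rle_trans; [|apply (HM 0); apply Rle_refl]. apply norm_ge_0. }
set (g := fun x => scal (Cexp (- z * RtoC x)) (ext f x)).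
assert (Cf : cont (ext f)) by (apply cont_ext, Hf).
assert (Cg : cont g) by (apply cont_exp_mul, Cf).
set (I := fun t => Int g 0 t).
assert (Ib : forall s t, half_line s -> s <= t ->
   norm (minus (I t) (I s)) <= M * ((exp (- a * s) - exp (- a * t)) / a)).
{ intros s t Hs Hst. unfold I. rewrite <- (Int_Chasles g 0 s t Cg).
  eapply Rle_trans; [|apply (Cexp_int_bound z (ext f) M s t Hz Hst Cf)].
  - right. f_equal. fold g. vring X.
  - intros x Hx. rewrite ext_eq; [apply HM|]; unfold half_line in *; lra. }
assert (HL : exists L, forall t, half_line t -> norm (minus L (I t)) <= exp (- a * t) * (M / Rabs a)).
{ destruct (Rlt_dec 0 a) as [La|La].
  - destruct (cauchy_limit I) as [L HL].
    + intros e He. destruct (exp_small a (e * a / (4 * (M + 1)))) as (T & HT & HT'); [|exact La|].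
      { apply Rdiv_lt_0_compat; nra. }
      exists T.
      assert (G : forall s t, T < s -> s <= t -> norm (minus (I t) (I s)) < e).
      { intros s t Hs Hst. eapply Rle_lt_trans; [apply Ib; unfold half_line; lra|].
        assert (E1 := HT' s (Rlt_le _ _ Hs)). assert (E2 := exp_pos (- a * t)).
        apply Rle_lt_trans with (M * (e * a / (4 * (M + 1)) / a)).
        - apply Rmult_le_compat_l; [exact M0|]. apply Rmult_le_compat_r; [left; apply Rinv_0_lt_compat; exact La|lra].
        - apply Rle_lt_trans with ((M + 1) * (e * a / (4 * (M + 1)) / a)).
          + apply Rmult_le_compat_r; [|lra]. left. repeat apply Rdiv_lt_0_compat; nra.
          + replace ((M + 1) * (e * a / (4 * (M + 1)) / a)) with (e / 4) by (field; lra). lra. }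
      intros s t Hs Ht. destruct (Rle_dec s t); [rewrite norm_sym|]; apply G; lra.
    + exists L. intros t Ht. rewrite Rabs_pos_eq by lra. apply le_epsilon. intros e He.
      destruct (HL e He) as [A HA]. set (s := Rmax t A + 1).
      assert (S1 := Rmax_l t A). assert (S2 := Rmax_r t A).
      assert (Q1 := HA s ltac:(unfold s; lra)).
      assert (Q2 := Ib t s Ht ltac:(unfold s; lra)).
      replace (minus L (I t)) with (minus (minus (I s) (I t)) (minus (I s) L)) by (vring X).
      eapply Rle_trans; [apply norm_minus_X|].
      assert (Q3 : M * ((exp (- a * t) - exp (- a * s)) / a) <= exp (- a * t) * (M / a)).
      { assert (E := exp_pos (- a * s)).
        apply Rle_trans with (M * (exp (- a * t) / a)); [|right; field; lra].
        apply Rmult_le_compat_l; [exact M0|]. apply Rmult_le_compat_r; [left; apply Rinv_0_lt_compat; exact La|lra]. }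
      lra.
  - assert (La' : a < 0) by (unfold a in *; lra). exists zero. intros t Ht.
    assert (Q := Ib 0 t (Rle_refl _) Ht).
    unfold I at 2 in Q. rewrite Int_point in Q. rewrite norm_sym.
    eapply Rle_trans; [exact Q|]. rewrite Rabs_left by exact La'. rewrite Rmult_0_r, exp_0.
    replace (M * ((1 - exp (- a * t)) / a)) with (exp (- a * t) * (M / - a) - M / - a) by (field; lra).
    assert (0 <= M / - a). { apply Rmult_le_pos; [exact M0|]. left. apply Rinv_0_lt_compat. lra. }
    lra. }
destruct HL as [L HL].
set (U := fun t => scal (Cexp (z * RtoC t)) (minus L (I t))).
assert (UM : forall t, half_line t -> norm (U t) <= M / Rabs a).
{ intros t Ht. unfold U. rewrite norm_Cexp. fold a.
  apply Rle_trans with (exp (a * t) * (exp (- a * t) * (M / Rabs a))).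
  - apply Rmult_le_compat_l; [left; apply exp_pos|auto].
  - rewrite <- Rmult_assoc, <- exp_plus. replace (a * t + - a * t) with 0 by ring. rewrite exp_0. lra. }
assert (dU : forall D t, dv D U t (minus (scal z (U t)) (ext f t))).
{ intros D t.
  assert (Q := dv_prod D _ _ t _ _ (dv_Cexp D z t) (dv_minus D _ _ t _ _ (dv_const D L t) (dv_Int D g 0 t Cg))).
  match type of Q with dv _ _ _ ?v => replace (minus (scal z (U t)) (ext f t)) with v; [exact Q|] end.
  cbv beta. rewrite (Cexp_cancel z t (ext f t)). unfold U, g, I, g.
  generalize (Cexp (z * RtoC t)) (scal (Cexp (- z * RtoC t)) (ext f t)). intros. vring X. }
assert (cU : cont U) by (exact (dv_cont U _ (dU _))).
assert (cv : cont (fun t => minus (scal z (U t)) (ext f t))).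
{ assert (Q := cont_plus _ _ (cont_scal (fun _ => z) U (cont_const (X := CB) z) cU)
    (cont_scal (fun _ => RtoC (-1)) _ (cont_const (X := CB) (RtoC (-1))) Cf)).
  intros t e He. destruct (Q t e He) as (d & Hd & Hs). exists d. split; [exact Hd|].
  intros s Hst. eapply Rle_lt_trans; [|exact (Hs s Hst)]. right. f_equal. vring X. }
set (K := Cmod z * (M / Rabs a) + M).
assert (Pa : 0 < Rabs a) by (apply Rabs_pos_lt; exact Hz).
assert (M1 : 0 <= M / Rabs a).
{ apply Rmult_le_pos; [exact M0|]. left. apply Rinv_0_lt_compat, Pa. }
assert (K0 : 0 <= K). { unfold K. assert (Q := Cmod_ge_0 z). nra. }
destruct (BUC_of_lipschitz U (M / Rabs a) K UM K0) as [U' HU'].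
{ intros s t Hs Hst.
  apply (dv_norm_bound (fun _ => True) U (fun t => minus (scal z (U t)) (ext f t))); auto.
  intros x Hx. assert (Hx0 : half_line x) by (unfold half_line in *; lra).
  eapply Rle_trans; [apply norm_minus_X|]. rewrite norm_scal_X. unfold K. apply Rplus_le_compat.
  - apply Rmult_le_compat_l; [apply Cmod_ge_0|]. auto.
  - rewrite ext_eq by exact Hx0. auto. }
exists U'. split.
- intros t Ht. rewrite HU', <- (ext_eq f t Ht).
  apply (dv_ext half_line U); [intros; symmetry; apply HU'|symmetry; apply HU'|apply dU].
- intros t Ht. rewrite HU'. auto.
Qed.
End HalfLine.

(** * The transform on BUC modulo C_0 *)

Section Quotient.
Context {X : CBanach}.
Notation Y := (quotient_space X).

Definition cls (f : BUC X) : Y := tilde f.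

Lemma cls_eq (f g : BUC X) : cls f = cls g <->
  forall e, 0 < e -> exists M, forall t, M < t -> norm (minus (f t) (g t)) < e.
Proof. unfold cls. rewrite <- eqC0E. apply tilde_eq. Qed.

Lemma cls_ex (y : Y) : exists f, y = cls f.
Proof. exact (tilde_ex y). Qed.

Lemma cls_plus f g : plus (cls f) (cls g) = cls (buc_plus f g).
Proof. exact (tilde_plus f g). Qed.

Lemma cls_scal (c : C) f : scal c (cls f) = cls (buc_scal c f).
Proof. exact (tilde_scal c f). Qed.

Lemma cls_pw (f g : BUC X) : (forall t, half_line t -> f t = g t) -> cls f = cls g.
Proof.
intros H. apply cls_eq. intros e He. exists 0. intros t Ht.
rewrite H by (unfold half_line; lra). eapply Rle_lt_trans; [right; exact (norm_minus_self (g t))|exact He].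
Qed.

Definition buc_minus (f g : BUC X) : BUC X := buc_plus f (buc_scal (RtoC (-1)) g).

Lemma buc_minusE (f g : BUC X) t : buc_minus f g t = minus (f t) (g t).
Proof. change (plus (f t) (scal (RtoC (-1)) (g t)) = minus (f t) (g t)). vring X. Qed.

Lemma cls_minus f g : minus (cls f) (cls g) = cls (buc_minus f g).
Proof.
unfold buc_minus. rewrite <- cls_plus, <- cls_scal. generalize (cls f) (cls g). intros. vring (quotient_space X).
Qed.

Lemma cls_norm (f : BUC X) M : (forall t, half_line t -> norm (f t) <= M) -> norm (cls f) <= M.
Proof.
intros H. eapply Rle_trans; [|apply (sup_norm_le H)].
change (quot_norm (tilde f) <= sup_norm f). apply quot_norm_spec. apply in_quot. reflexivity.
Qed.

Lemma cls_norm_rep (y : Y) e : 0 < e -> exists f, y = cls f /\ forall t, half_line t -> norm (f t) <= norm y + e.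
Proof.
intros He. destruct (quot_norm_spec y) as (_ & H & _). destruct (H e He) as (f & Hf & L).
exists f. split; [apply in_quot, Hf|]. intros t Ht.
eapply Rle_trans; [apply sup_norm_spec, Ht|]. left. exact L.
Qed.

Lemma buc_norm (f : BUC X) : exists M, 0 <= M /\ forall t, half_line t -> norm (f t) <= M.
Proof.
destruct (buc_bounded f) as [M HM]. exists M. split; [|exact HM].
eapply Rle_trans; [|apply (HM 0); apply Rle_refl]. apply norm_ge_0.
Qed.

Lemma buc_continuous (f : BUC X) : continuous_on half_line f.
Proof. exact (@uc_continuous X f). Qed.

Lemma cls_zero_vanishing f : cls f = zero <-> vanishing f.
Proof.
change (zero : Y) with (cls (buc_zero X)). rewrite cls_eq, vanishingE.
split; intros H e He; destruct (H e He) as [M HM]; exists M; intros t Ht; specialize (HM t Ht).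
- eapply Rle_lt_trans; [|exact HM]. right. f_equal. symmetry. exact (minus_zero_r (f t)).
- eapply Rle_lt_trans; [|exact HM]. right. f_equal. exact (minus_zero_r (f t)).
Qed.

Lemma ode_minus z (f g U W : R -> X) : ode z f U -> ode z g W ->
  ode (X := X) z (fun t => minus (f t) (g t)) (fun t => minus (U t) (W t)).
Proof.
intros H H' t Ht. assert (Q := dv_minus _ _ _ _ _ _ (H t Ht) (H' t Ht)).
match type of Q with dv _ _ _ ?v => match goal with |- dv _ _ _ ?w => replace w with v; [exact Q|] end end.
vring X.
Qed.

(** The difference of the solutions has a forcing that tends to 0, hence tends to 0 itself. This
    makes the solution operator well defined on classes. *)
Lemma ode_cls_unique z (f g : R -> X) (U W : BUC X) : Re z <> 0 ->
  continuous_on half_line f -> continuous_on half_line g -> ode z f U -> ode z g W ->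
  (forall e, 0 < e -> exists A, forall t, A < t -> norm (minus (f t) (g t)) < e) -> cls U = cls W.
Proof.
intros Hz Hf Hg HU HW H. apply cls_eq.
destruct (buc_norm U) as (M & _ & HM), (buc_norm W) as (M' & _ & HM').
apply (ode_vanishing z (fun t => minus (f t) (g t)) (fun t => minus (U t) (W t)) (M + M') Hz).
- apply continuous_onE. intros t Ht e He.
  destruct (proj1 (continuous_onE f) Hf t Ht (e / 2)) as (d & Hd & Hs); [lra|].
  destruct (proj1 (continuous_onE g) Hg t Ht (e / 2)) as (d' & Hd' & Hs'); [lra|].
  exists (Rmin d d'). split; [apply Rmin_pos; assumption|]. intros s Ds Hst.
  specialize (Hs s Ds (Rlt_le_trans _ _ _ Hst (Rmin_l _ _))).
  specialize (Hs' s Ds (Rlt_le_trans _ _ _ Hst (Rmin_r _ _))).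
  assert (ID : minus (minus (f s) (g s)) (minus (f t) (g t)) = minus (minus (f s) (f t)) (minus (g s) (g t))) by (vring X).
  eapply Rle_lt_trans; [right; exact (f_equal norm ID)|].
  eapply Rle_lt_trans; [apply norm_minus_X|]. lra.
- apply ode_minus; assumption.
- intros t Ht. eapply Rle_trans; [apply norm_minus_X|]. apply Rplus_le_compat; auto.
- exact H.
Qed.

(** Only the increments of u are asked to tend to 0, which also covers functions without a limit.
    For h within the modulus of continuity of v, h v(t) differs from u(t + h) - u(t) by at most e h
    / 2. *)
Lemma barbalat (u v : BUC X) : (forall t, half_line t -> dv half_line u t (v t)) ->
  (forall h e, 0 < h -> 0 < e -> exists A, forall t, A < t -> norm (minus (u (t + h)) (u t)) < e) ->
  forall e, 0 < e -> exists A, forall t, A < t -> norm (v t) < e.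
Proof.
intros Hd Hu e He.
destruct (buc_uc v (e := e / 2)) as (d & d0 & Hv); [lra|].
set (h := d / 2). assert (h0 : 0 < h) by (unfold h; lra).
destruct (Hu h (e * h / 2) h0) as (A & HA); [nra|].
exists (Rmax 0 A). intros t Ht.
assert (T0 := Rle_lt_trans _ _ _ (Rmax_l _ _) Ht). assert (TA := Rle_lt_trans _ _ _ (Rmax_r _ _) Ht).
assert (F : minus (u (t + h)) (u t) = Int (ext v) t (t + h)).
{ apply (dv_FTC half_line).
  - lra.
  - intros x Hx. unfold half_line. lra.
  - apply cont_ext, buc_continuous.
  - intros x Hx. rewrite ext_eq by (unfold half_line; lra). apply Hd. unfold half_line; lra. }
assert (G : norm (Int (fun x => minus (ext v x) (v t)) t (t + h)) <= e / 2 * (t + h - t)).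
{ apply Int_norm; [lra|apply cont_minus_const, cont_ext, buc_continuous|].
  intros x Hx. rewrite ext_eq by (unfold half_line; lra). left. apply Hv; unfold half_line; try lra.
  rewrite Rabs_pos_eq by lra. unfold h in Hx. lra. }
rewrite Int_minus_const in G by (apply cont_ext, buc_continuous). rewrite <- F in G.
replace (t + h - t) with h in G by ring.
set (q := minus (minus (u (t + h)) (u t)) (scal (RtoC h) (v t))).
change (norm q <= e / 2 * h) in G.
assert (E : scal (RtoC h) (v t) = minus (minus (u (t + h)) (u t)) q) by (unfold q; vring X).
assert (N : h * norm (v t) <= norm (minus (u (t + h)) (u t)) + norm q).
{ assert (Nh : norm (scal (RtoC h) (v t)) = h * norm (v t)).
  { eapply eq_trans; [exact (norm_scal_X (RtoC h) (v t))|]. rewrite Cmod_R, Rabs_pos_eq by lra. reflexivity. }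
  rewrite <- Nh. eapply Rle_trans; [right; exact (f_equal norm E)|].
  apply norm_minus_X. }
assert (A1 := HA t TA).
apply (Rmult_lt_reg_l h); [exact h0|].
eapply Rle_lt_trans; [exact N|]. lra.
Qed.

(** Two differentiable representatives of a class differ by a function with vanishing increments, so
    by [barbalat] their derivatives are in the same class and the choice in [D_tilde] is forced. *)
Lemma D_tilde_cls (u v : BUC X) : (forall t, half_line t -> dv half_line u t (v t)) ->
  dom (D_tilde X) (cls u) /\ op (D_tilde X) (cls u) = cls v.
Proof.
intros H.
assert (Hex : exists u' v', coset (cls u) u' /\ is_derivative u' v' /\ cls v = tilde v').
{ exists u, v. split; [apply in_quot; reflexivity|]. split; [apply is_derivativeE, H|reflexivity]. }
split.
- destruct Hex as (u' & v' & A1 & A2 & _). exists u', v'. auto.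
- simpl.
  match goal with |- epsilon ?i ?P = _ => assert (S0 := epsilon_spec i P) end.
  destruct S0 as (u' & v' & A1 & A2 & A3); [exists (cls v); exact Hex|].
  eapply eq_trans; [exact A3|]. change (cls v' = cls v).
  rewrite is_derivativeE in A2.
  assert (V := proj1 (eqC0E u u') A1).
  apply cls_eq.
  intros e He. destruct (barbalat (buc_minus u' u) (buc_minus v' v)) with (e := e) as [A HA].
  + intros t Ht. rewrite buc_minusE.
    apply (dv_ext half_line (fun s => minus (u' s) (u s))); [intros; symmetry; apply buc_minusE|symmetry; apply buc_minusE|].
    apply dv_minus; auto.
  + intros h e' Hh He'. destruct (V (e' / 2)) as [A HA]; [lra|]. exists A. intros t Ht.
    assert (B3 := HA t Ht). assert (TAh : A < t + h) by lra. assert (B4 := HA (t + h) TAh).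
    rewrite !buc_minusE.
    assert (ID : minus (minus (u' (t + h)) (u (t + h))) (minus (u' t) (u t)) =
      minus (minus (u t) (u' t)) (minus (u (t + h)) (u' (t + h)))) by (vring X).
    eapply Rle_lt_trans; [right; exact (f_equal norm ID)|].
    eapply Rle_lt_trans; [apply norm_minus_X|]. lra.
  + exact He.
  + exists A. intros t Ht. specialize (HA t Ht). rewrite buc_minusE in HA. exact HA.
Qed.

Lemma dom_D_tilde (y : Y) : dom (D_tilde X) y -> exists u v : BUC X, y = cls u /\
  (forall t, half_line t -> dv half_line u t (v t)) /\ op (D_tilde X) y = cls v.
Proof.
intros (u & v & A1 & A2). apply in_quot in A1. exists u, v. split; [exact A1|].
rewrite is_derivativeE in A2. split; [exact A2|]. rewrite A1. apply D_tilde_cls, A2.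
Qed.

(** The inverse sends the class of f to that of a bounded solution of [ode z f]. Its norm is at most
    1 / |Re z|, read off a representative whose sup-norm nearly attains the norm of the class. *)
Lemma resolvent_D_tilde z : Re z <> 0 -> exists S : bounded_operators Y, is_resolvent (D_tilde X) z S.
Proof.
intros Hz.
assert (Hy : forall y : Y, exists w : Y, forall f U : BUC X, y = cls f -> ode z f U -> w = cls U).
{ intros y. destruct (cls_ex y) as [f0 E0]. destruct (buc_norm f0) as (M & _ & HM).
  destruct (ode_exists z f0 M Hz (buc_continuous f0) HM) as (U0 & HU0 & _).
  exists (cls U0). intros f U Ef HU.
  apply (ode_cls_unique z f0 f U0 U Hz (buc_continuous _) (buc_continuous _) HU0 HU).
  apply cls_eq. congruence. }
set (S := fun y => proj1_sig (constructive_indefinite_description _ (Hy y))).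
assert (HS : forall f U : BUC X, ode z f U -> S (cls f) = cls U).
{ intros f U HU. unfold S. destruct (constructive_indefinite_description _ _) as [w Hw].
  exact (Hw f U eq_refl HU). }
assert (Sex : forall f : BUC X, exists U : BUC X, ode z f U).
{ intros f. destruct (buc_norm f) as (M & _ & HM).
  destruct (ode_exists z f M Hz (buc_continuous f) HM) as (U & HU & _). eauto. }
assert (Slin : is_linear S).
{ assert (P : 0 < Rabs (Re z)) by (apply Rabs_pos_lt; exact Hz).
  split.
  - intros x y. destruct (cls_ex x) as [f ->], (cls_ex y) as [g ->].
    destruct (Sex f) as [U HU], (Sex g) as [W HW].
    rewrite (HS f U HU), (HS g W HW), !cls_plus. apply HS. intros t Ht.
    assert (Q := dv_plus _ _ _ _ _ _ (HU t Ht) (HW t Ht)).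
    match type of Q with dv _ _ _ ?v => match goal with |- dv _ _ _ ?w => replace w with v; [exact Q|] end end.
    simpl. vring X.
  - intros c x. destruct (cls_ex x) as [f ->]. destruct (Sex f) as [U HU].
    rewrite (HS f U HU), !cls_scal. apply HS. intros t Ht.
    assert (Q := dv_scal c _ _ _ _ (HU t Ht)).
    match type of Q with dv _ _ _ ?v => match goal with |- dv _ _ _ ?w => replace w with v; [exact Q|] end end.
    simpl. vring X.
  - exists (/ Rabs (Re z)). split; [apply Rinv_0_lt_compat, P|]. intros x.
    apply le_epsilon. intros e He.
    destruct (cls_norm_rep x (e * Rabs (Re z))) as (f & Ex & Hf); [nra|].
    destruct (ode_exists z f _ Hz (buc_continuous f) Hf) as (U & HU & HUn).
    rewrite Ex at 1. rewrite (HS f U HU). eapply Rle_trans; [apply (cls_norm U _ HUn)|].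
    right. field. lra. }
exists (Blin Slin). intros x y. simpl. split.
- intros <-. destruct (cls_ex x) as [f ->]. destruct (Sex f) as [U HU]. rewrite (HS f U HU).
  destruct (D_tilde_cls U (buc_minus (buc_scal z U) f)) as [A1 A2].
  { intros t Ht. rewrite buc_minusE. exact (HU t Ht). }
  split; [exact A1|]. 
  eapply eq_trans; [apply (f_equal (fun w => minus (scal z (cls U)) w) A2)|].
  rewrite <- cls_minus, <- cls_scal. generalize (cls U) (cls f). intros. vring (quotient_space X).
- intros [A1 A2]. destruct (dom_D_tilde y A1) as (u & v & Ey & Hd & Eo).
  rewrite Ey. rewrite Ey in A2. rewrite Ey in Eo.
  assert (Ex : x = cls (buc_minus (buc_scal z u) v)).
  { rewrite <- A2, <- cls_minus, <- cls_scal, <- Eo. reflexivity. }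
  rewrite Ex. apply HS. intros t Ht.
  refine (dv_value _ _ _ _ _ _ (Hd t Ht)).
  assert (B := buc_minusE (buc_scal z u) v t).
  eapply eq_trans; [|exact (f_equal (minus (scal z (u t))) (eq_sym B))]. simpl. vring X.
Qed.

(** [Rz z (cls f)] is [hat f z], with the class itself as argument. *)
Definition Rz (z : C) (y : Y) : Y := blin_fun (resolvent (D_tilde X) z) y.

Lemma Rz_spec z : Re z <> 0 -> is_resolvent (D_tilde X) z (resolvent (D_tilde X) z).
Proof.
intros Hz. unfold resolvent. apply epsilon_spec. exact (resolvent_D_tilde z Hz).
Qed.

Lemma Rz_ode z (f U : BUC X) : Re z <> 0 -> ode z f U -> Rz z (cls f) = cls U.
Proof.
intros Hz HU. unfold Rz. apply (Rz_spec z Hz).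
destruct (D_tilde_cls U (buc_minus (buc_scal z U) f)) as [A1 A2].
{ intros t Ht. rewrite buc_minusE. exact (HU t Ht). }
split; [exact A1|].
eapply eq_trans; [apply (f_equal (fun w => minus (scal z (cls U)) w) A2)|].
rewrite <- cls_minus, <- cls_scal. generalize (cls U) (cls f). intros. vring (quotient_space X).
Qed.

Lemma Rz_norm z (y : Y) : Re z <> 0 -> norm (Rz z y) <= norm y / Rabs (Re z).
Proof.
intros Hz. assert (P : 0 < Rabs (Re z)) by (apply Rabs_pos_lt; exact Hz).
apply le_epsilon. intros e He.
destruct (cls_norm_rep y (e * Rabs (Re z))) as (f & Ex & Hf); [nra|].
destruct (ode_exists z f _ Hz (buc_continuous f) Hf) as (U & HU & HUn).
rewrite Ex at 1. rewrite (Rz_ode z f U Hz HU). eapply Rle_trans; [apply (cls_norm U _ HUn)|].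
right. field. lra.
Qed.

Lemma Rz_linear z : is_linear (Rz z).
Proof. apply blin_ok. Qed.

Lemma Rz_ode_ex z (f : BUC X) : Re z <> 0 -> exists U : BUC X, ode z f U /\ Rz z (cls f) = cls U.
Proof.
intros Hz. destruct (buc_norm f) as (M & _ & HM).
destruct (ode_exists z f M Hz (buc_continuous f) HM) as (U & HU & _).
exists U. split; [exact HU|apply Rz_ode; assumption].
Qed.

Lemma Rz_plus z x y : Rz z (plus x y) = plus (Rz z x) (Rz z y).
Proof. apply linear_plus, Rz_linear. Qed.
Lemma Rz_scal z (c : C) x : Rz z (scal c x) = scal c (Rz z x).
Proof. apply (linear_scal _ (Rz_linear z)). Qed.

(** The first resolvent identity with the factor w - z displayed: one step of the Taylor expansion
    of w |-> [Rz w y] at z. *)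
Lemma Rz_identity z w y : Re z <> 0 -> Re w <> 0 ->
  Rz w y = plus (Rz z y) (scal (w - z)%C (scal (RtoC (-1)) (Rz z (Rz w y)))).
Proof.
intros Hz Hw.
assert (E := proj1 (Rz_spec w Hw y (Rz w y)) eq_refl). destruct E as [E1 E2].
assert (F : Rz z (minus (scal z (Rz w y)) (op (D_tilde X) (Rz w y))) = Rz w y).
{ apply (Rz_spec z Hz). auto. }
rewrite <- F at 1.
replace (minus (scal z (Rz w y)) (op (D_tilde X) (Rz w y)))
  with (plus y (scal (z - w)%C (Rz w y))).
- rewrite Rz_plus, Rz_scal. generalize (Rz z y) (Rz z (Rz w y)). intros. vring (quotient_space X).
- rewrite <- E2 at 1. generalize (op (D_tilde X) (Rz w y)) (Rz w y). intros. vring (quotient_space X).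
Qed.

Lemma Rz_zero z y : Re z <> 0 -> Rz z y = zero -> y = zero.
Proof.
intros Hz H. destruct (Rz_ode_ex z (buc_zero X) Hz) as (U & _ & _).
assert (E := proj1 (Rz_spec z Hz y zero) H). destruct E as [_ E].
destruct (D_tilde_cls (buc_zero X) (buc_zero X)) as [_ A2].
{ intros t Ht. exact (dv_const _ zero t). }
rewrite <- E. change (op (D_tilde X) zero) with (op (D_tilde X) (cls (buc_zero X))).
rewrite A2. change (cls (buc_zero X)) with (zero : Y). vring (quotient_space X).
Qed.

Lemma taylor_linear n (L : Y -> Y) F : is_linear L -> taylor n F -> taylor n (fun h => L (F h)).
Proof.
intros HL. assert (Lp : forall x y, L (plus x y) = plus (L x) (L y)) by (apply linear_plus, HL).
assert (Ls : forall (c : C) x, L (scal c x) = scal c (L x)) by (intros; apply (linear_scal _ HL)).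
destruct (linear_norm L HL) as (K & K0 & HK).
revert F. induction n as [|n IH]; intros F.
- intros (M & d & Hd & H). exists (K * M), d. split; [exact Hd|]. intros h Hh.
  eapply Rle_trans; [apply HK|]. apply Rmult_le_compat_l; [lra|auto].
- intros (F1 & H1 & d & Hd & H). exists (fun h => L (F1 h)). split; [apply IH, H1|].
  exists d. split; [exact Hd|]. intros h Hh. rewrite (H h Hh), Lp, Ls. reflexivity.
Qed.

Lemma taylor_Rz n z y : Re z <> 0 -> taylor n (fun h => Rz (z + h)%C y).
Proof.
intros Hz. assert (P : 0 < Rabs (Re z)) by (apply Rabs_pos_lt; exact Hz).
assert (near : forall h : C, Cmod h < Rabs (Re z) / 2 -> Rabs (Re z) / 2 <= Rabs (Re (z + h)%C)).
{ intros h Hh. assert (Q := Re_le_Cmod h).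
  replace (Re (z + h)%C) with (Re z + Re h) by reflexivity.
  assert (T := Rabs_triang_inv (Re z) (- Re h)).
  rewrite Rabs_Ropp in T. replace (Re z - - Re h) with (Re z + Re h) in T by ring. lra. }
induction n as [|n IH].
- exists (norm y / (Rabs (Re z) / 2)), (Rabs (Re z) / 2). split; [lra|]. intros h Hh.
  specialize (near h Hh).
  eapply Rle_trans; [apply Rz_norm|].
  + intros E. rewrite E, Rabs_R0 in near. lra.
  + apply Rmult_le_compat_l; [apply norm_ge_0|]. apply Rinv_le_contravar; lra.
- exists (fun h => scal (RtoC (-1)) (Rz z (Rz (z + h)%C y))). split.
  + apply taylor_scal; [apply taylor_const|]. apply taylor_linear; [apply Rz_linear|exact IH].
  + exists (Rabs (Re z) / 2). split; [lra|]. intros h Hh. specialize (near h Hh).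
    replace (z + 0)%C with z by ring.
    rewrite (Rz_identity z (z + h)%C y Hz) at 1.
    * replace (z + h - z)%C with h by ring. reflexivity.
    * intros E. rewrite E, Rabs_R0 in near. lra.
Qed.
End Quotient.

(** * Isolated singularities and the spectral criterion *)

Lemma Cmod_rev_triangle (a b : C) : Cmod a - Cmod b <= Cmod (a + b)%C.
Proof.
assert (H := Cmod_triangle (a + b)%C (- b)%C). replace (a + b + - b)%C with a in H by ring.
rewrite Cmod_opp in H. lra.
Qed.

Lemma Cmod_dist_triangle (a b c : C) : Cmod (a - c)%C <= Cmod (a - b)%C + Cmod (b - c)%C.
Proof. replace (a - c)%C with ((a - b) + (b - c))%C by ring. apply Cmod_triangle. Qed.

Lemma Cmod_sym (a b : C) : Cmod (a - b)%C = Cmod (b - a)%C.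
Proof. rewrite <- Cmod_opp. f_equal. ring. Qed.

(** 1/(c + h) = 1/c + h (-1/c) (1/(c + h)), so the difference quotient is of the same kind. *)
Lemma taylor_inv n (c : C) : c <> 0%C -> taylor (V := C_NormedModule) n (fun h => / (c + h))%C.
Proof.
intros Hc. assert (P : 0 < Cmod c) by (apply Cmod_gt_0; exact Hc).
assert (near : forall h, Cmod h < Cmod c / 2 -> Cmod c / 2 <= Cmod (c + h)%C).
{ intros h Hh. assert (Q := Cmod_rev_triangle c h). lra. }
induction n as [|n IH].
- exists (/ (Cmod c / 2)), (Cmod c / 2). split; [lra|]. intros h Hh. specialize (near h Hh).
  change (Cmod (/ (c + h))%C <= / (Cmod c / 2)). rewrite Cmod_inv.
  + apply Rinv_le_contravar; lra.
  + intros E. rewrite E, Cmod_0 in near. lra.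
- exists (fun h => - / c * / (c + h))%C. split.
  + apply taylor_mult; [exact (taylor_const (V := C_NormedModule) n (- / c)%C)|exact IH].
  + exists (Cmod c / 2). split; [lra|]. intros h Hh. specialize (near h Hh).
    change (/ (c + h) = / (c + 0) + h * (- / c * / (c + h)))%C.
    assert (Hn : (c + h)%C <> 0%C). { intros E. rewrite E, Cmod_0 in near. lra. }
    replace (c + 0)%C with c by ring. field. auto.
Qed.

(* On the circle |v| = r one has v^2 + r^2 = 2 (Re v) v. *)
Lemma circle_factor (v : C) r : Cmod v = r -> (v * v + RtoC (r * r) = RtoC (2 * Re v) * v)%C.
Proof.
intros H. destruct v as [x y]. assert (E := Cmod_sqr x y). rewrite H in E. rewrite E.
apply injective_projections; simpl; ring.
Qed.

Section Isolated.
Context {V : NormedModule C_AbsRing}.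

Lemma minus_small_eq (x y : V) : (forall e, 0 < e -> norm (minus x y) < e) -> x = y.
Proof.
intros H. assert (E : minus x y = zero).
{ apply norm_eq_zero. apply Rle_antisym; [|apply norm_ge_0]. apply le_epsilon. intros e He.
  specialize (H e He). lra. }
replace x with (plus y (minus x y)) by (vring V). rewrite E. vring V.
Qed.

Lemma taylor_3_continuous (F : C -> V) z : taylor 3 (fun h => F (z + h)%C) ->
  forall e, 0 < e -> exists d, 0 < d /\ forall w, Cmod (w - z)%C < d -> norm (minus (F w) (F z)) < e.
Proof.
intros H e He.
destruct (taylor_1_lipschitz _ (taylor_le 1 3 _ (le_S _ _ (le_S _ _ (le_n _))) H)) as (L & d & Hd & HL).
assert (P := Rle_abs L). assert (P' := Rabs_pos L).
exists (Rmin d (e / (Rabs L + 1))). split; [apply Rmin_pos; [exact Hd|apply Rdiv_lt_0_compat; lra]|].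
intros w Hw. specialize (HL _ (Rlt_le_trans _ _ _ Hw (Rmin_l _ _))).
assert (Q := Rlt_le_trans _ _ _ Hw (Rmin_r _ _)).
replace (z + (w - z))%C with w in HL by ring. replace (z + 0)%C with z in HL by ring.
assert (N := Cmod_ge_0 (w - z)%C).
eapply Rle_lt_trans; [exact HL|].
apply Rle_lt_trans with ((Rabs L + 1) * Cmod (w - z)%C).
- apply Rmult_le_compat_r; lra.
- apply Rlt_le_trans with ((Rabs L + 1) * (e / (Rabs L + 1))); [apply Rmult_lt_compat_l; lra|].
  right. field. lra.
Qed.

(** Local extensions agree on the imaginary axis because each is the limit of g from the right. So G
    is defined there by that limit, without choosing among the extensions. *)
Lemma glue_extensions (g : C -> V) (P : C -> Prop) :
  (forall z, P z -> exists F d, 0 < d /\ forall w, Cmod (w - z)%C < d ->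
     taylor 3 (fun h => F (w + h)%C) /\ (Re w <> 0 -> F w = g w)) ->
  exists G, (forall z, P z -> taylor 3 (fun h => G (z + h)%C)) /\
            (forall z, Re z <> 0 -> G z = g z).
Proof.
intros H.
set (lim := fun (z : C) (l : V) => forall e, 0 < e -> exists d, 0 < d /\
  forall x, 0 < x < d -> norm (minus (g (z + RtoC x)%C) l) < e).
set (G := fun z : C => if Req_EM_T (Re z) 0 then epsilon (inhabits (zero : V)) (lim z) else g z).
exists G. split.
- intros z Pz. destruct (H z Pz) as (F & d & Hd & HF).
  assert (E : forall w, Cmod (w - z)%C < d -> F w = G w).
  { intros w Hw. destruct (HF w Hw) as [T Fg]. unfold G.
    destruct (Req_EM_T (Re w) 0) as [E|E]; [|auto].
    assert (L1 : lim w (F w)).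
    { intros e He. destruct (taylor_3_continuous F w T e He) as (d' & Hd' & Hc).
      exists (Rmin d' (d - Cmod (w - z)%C)). split; [apply Rmin_pos; lra|].
      intros x Hx. assert (X1 := Rlt_le_trans _ _ _ (proj2 Hx) (Rmin_l _ _)).
      assert (X2 := Rlt_le_trans _ _ _ (proj2 Hx) (Rmin_r _ _)).
      assert (Nx : Cmod (w + RtoC x - w)%C = x).
      { replace (w + RtoC x - w)%C with (RtoC x) by ring. rewrite Cmod_R, Rabs_pos_eq; lra. }
      rewrite <- (proj2 (HF (w + RtoC x)%C ltac:(
        eapply Rle_lt_trans; [apply (Cmod_dist_triangle _ w)|]; rewrite Nx; lra))).
      - apply Hc. lra.
      - replace (Re (w + RtoC x)%C) with (Re w + x) by reflexivity. lra. }
    assert (L2 := epsilon_spec (inhabits (zero : V)) (lim w) (ex_intro _ _ L1)).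
    apply minus_small_eq. intros e He.
    destruct (L1 (e / 2)) as (d1 & Hd1 & A1); [lra|].
    destruct (L2 (e / 2)) as (d2 & Hd2 & A2); [lra|].
    set (x := Rmin d1 d2 / 2). assert (X0 : 0 < Rmin d1 d2) by (apply Rmin_pos; assumption).
    assert (X1 := Rmin_l d1 d2). assert (X2 := Rmin_r d1 d2).
    specialize (A1 x ltac:(unfold x; lra)). specialize (A2 x ltac:(unfold x; lra)).
    set (gx := g (w + RtoC x)%C) in *. set (l := epsilon _ _) in *.
    replace (minus (F w) l) with (minus (minus gx l) (minus gx (F w))) by (vring V).
    eapply Rle_lt_trans; [apply norm_minus_le|]. lra. }
  destruct (HF z) as [T _].
  { replace (z - z)%C with (RtoC 0) by ring. rewrite Cmod_0. exact Hd. }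
  refine (taylor_ext 3 _ _ d Hd _ T). intros h Hh. apply E.
  replace (z + h - z)%C with h by ring. exact Hh.
- intros z Hz. unfold G. destruct (Req_EM_T (Re z) 0); [contradiction|reflexivity].
Qed.

Lemma annulus_closed (z0 : C) r rho z : ~ (r <= Cmod (z - z0)%C <= rho) ->
  exists d, 0 < d /\ forall w, Cmod (w - z)%C < d -> ~ (r <= Cmod (w - z0)%C <= rho).
Proof.
intros H. destruct (Rlt_dec (Cmod (z - z0)%C) r) as [L|L].
- exists (r - Cmod (z - z0)%C). split; [lra|]. intros w Hw.
  assert (Q := Cmod_dist_triangle w z z0). lra.
- exists (Cmod (z - z0)%C - rho). split; [lra|]. intros w Hw.
  assert (Q := Cmod_dist_triangle z w z0). rewrite (Cmod_sym z w) in Q. lra.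
Qed.

(** On the annulus r <= |v| <= rho, v = w - z0, G is multiplied by (v^2 + r^2)(v^2 + rho^2) / v. On
    either boundary circle one factor equals 2 (Re v) v by [circle_factor] and cancels the blow-up
    of K / |Re v|; the maximum principle carries the bound inside. *)
Lemma simple_pole_bound (G : C -> V) (z0 : C) rho K : 0 < rho -> Re z0 = 0 -> 0 <= K ->
  (forall w, 0 < Cmod (w - z0)%C <= rho -> taylor 3 (fun h => G (w + h)%C)) ->
  (forall w, Re w <> 0 -> norm (G w) <= K / Rabs (Re w)) ->
  forall w, 0 < Cmod (w - z0)%C <= rho / 2 -> norm (G w) <= 8 * K / Cmod (w - z0)%C.
Proof.
intros Hrho Hz0 HK HT HG w Hw.
(* With r half of |w - z0| <= rho / 2, each quadratic factor keeps at w at least 3/4 of its larger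
   term. *)
set (r := Cmod (w - z0)%C / 2). assert (r0 : 0 < r) by (unfold r; lra).
set (q := fun v : C => ((v * v + RtoC (r * r)) * (v * v + RtoC (rho * rho)) * / v)%C).
set (Q := fun x : C => scal (q (x - z0)%C) (G x)).
assert (Re0 : forall x : C, Re (x - z0)%C = Re x).
{ intros x. replace (Re (x - z0)%C) with (Re x - Re z0) by reflexivity. lra. }
assert (M : norm (Q w) <= 4 * K * (rho * rho)).
{ apply (maximum_principle Q (fun x => r <= Cmod (x - z0)%C <= rho)
   (fun x => Cmod (x - z0)%C = r \/ Cmod (x - z0)%C = rho) (rho + Cmod z0)).
  - apply annulus_closed.
  - intros z Hz. replace z with ((z - z0) + z0)%C by ring.
    eapply Rle_trans; [apply Cmod_triangle|]. lra.
  - intros z Hz. unfold Q, q.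
    assert (Hv : (z - z0)%C <> 0%C). { intros E. rewrite E, Cmod_0 in Hz. lra. }
    apply taylor_scal; [|apply HT; lra].
    refine (taylor_ext 3 (fun h => (((z - z0) + h) * ((z - z0) + h) + RtoC (r * r)) *
      (((z - z0) + h) * ((z - z0) + h) + RtoC (rho * rho)) * / ((z - z0) + h))%C _ 1 Rlt_0_1 _ _).
    + intros h _. replace (z + h - z0)%C with (z - z0 + h)%C by ring. reflexivity.
    + repeat first [apply taylor_inv; exact Hv|apply taylor_shift|exact (taylor_const (V := C_NormedModule) 3 _)
        |apply taylor_mult|apply taylor_add].
  - intros z Hz Hb. apply not_or_and in Hb.
    exists (Rmin (Cmod (z - z0)%C - r) (rho - Cmod (z - z0)%C)).
    split; [apply Rmin_pos; lra|]. intros x Hx.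
    assert (X1 := Rlt_le_trans _ _ _ Hx (Rmin_l _ _)). assert (X2 := Rlt_le_trans _ _ _ Hx (Rmin_r _ _)).
    assert (Y1 := Cmod_dist_triangle x z z0). assert (Y2 := Cmod_dist_triangle z x z0).
    rewrite (Cmod_sym z x) in Y2. lra.
  - intros z Hz Hb. unfold Q, q. rewrite norm_scal_C.
    set (v := (z - z0)%C) in *. assert (v0 : 0 < Cmod v) by lra.
    assert (Hv : v <> 0%C). { intros E. rewrite E, Cmod_0 in v0. lra. }
    assert (Hx : Re v = Re z) by (apply Re0).
    assert (C1 : forall s, 0 <= s <= rho -> Cmod (v * v + RtoC (s * s))%C <= 2 * (rho * rho)).
    { intros s Hs. eapply Rle_trans; [apply Cmod_triangle|]. rewrite Cmod_mult, Cmod_R, Rabs_pos_eq by nra. nra. }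
    assert (C2 : 2 * Rabs (Re z) * norm (G z) <= 2 * K).
    { destruct (Req_dec (Re z) 0) as [E|E].
      - rewrite E, Rabs_R0. assert (P := norm_ge_0 (G z)). lra.
      - specialize (HG z E). assert (P : 0 < Rabs (Re z)) by (apply Rabs_pos_lt; exact E).
        apply (Rmult_le_compat_l (2 * Rabs (Re z))) in HG; [|lra].
        eapply Rle_trans; [exact HG|]. right. field. lra. }
    assert (N0 := norm_ge_0 (G z)). assert (A0 := Rabs_pos (Re z)).
    rewrite !Cmod_mult, Cmod_inv by exact Hv.
    assert (C3 : forall s, Cmod v = s -> Cmod (v * v + RtoC (s * s))%C = 2 * Rabs (Re z) * Cmod v).
    { intros s Es. rewrite (circle_factor v s Es), Cmod_mult, Cmod_R, Hx, Rabs_mult, (Rabs_pos_eq 2) by lra. reflexivity. }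
    destruct Hb as [Hb|Hb].
    + rewrite (C3 r Hb). assert (B := C1 rho ltac:(lra)). set (b := Cmod (v * v + RtoC (rho * rho))%C) in *.
      assert (b0 : 0 <= b) by apply Cmod_ge_0.
      replace (2 * Rabs (Re z) * Cmod v * b * / Cmod v * norm (G z)) with (b * (2 * Rabs (Re z) * norm (G z))) by (field; lra).
      apply Rle_trans with (2 * (rho * rho) * (2 * K)); [|lra].
      apply Rmult_le_compat; auto. repeat apply Rmult_le_pos; lra.
    + rewrite (C3 rho Hb). assert (B := C1 r ltac:(lra)). set (b := Cmod (v * v + RtoC (r * r))%C) in *.
      assert (b0 : 0 <= b) by apply Cmod_ge_0.
      replace (b * (2 * Rabs (Re z) * Cmod v) * / Cmod v * norm (G z)) with (b * (2 * Rabs (Re z) * norm (G z))) by (field; lra).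
      apply Rle_trans with (2 * (rho * rho) * (2 * K)); [|lra].
      apply Rmult_le_compat; auto. repeat apply Rmult_le_pos; lra.
  - unfold r. lra. }
unfold Q, q in M. rewrite norm_scal_C in M.
set (v := (w - z0)%C) in *. assert (Hv : v <> 0%C). { intros E. rewrite E, Cmod_0 in Hw. lra. }
rewrite !Cmod_mult, Cmod_inv in M by exact Hv.
assert (L1 : 3 / 4 * (Cmod v * Cmod v) <= Cmod (v * v + RtoC (r * r))%C).
{ eapply Rle_trans; [|apply Cmod_rev_triangle]. rewrite Cmod_mult, Cmod_R, Rabs_pos_eq by nra. unfold r. nra. }
assert (L2 : 3 / 4 * (rho * rho) <= Cmod (v * v + RtoC (rho * rho))%C).
{ rewrite Cplus_comm. eapply Rle_trans; [|apply Cmod_rev_triangle]. rewrite Cmod_mult, Cmod_R, Rabs_pos_eq by nra. nra. }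
set (a := Cmod (v * v + RtoC (r * r))%C) in *. set (b := Cmod (v * v + RtoC (rho * rho))%C) in *.
set (c := Cmod v) in *. set (n := norm (G w)) in *. assert (n0 : 0 <= n) by apply norm_ge_0.
assert (c0 : 0 < c) by lra. assert (R2 : 0 < rho * rho) by nra.
assert (M2 : a * b * n <= 4 * K * (rho * rho) * c).
{ apply (Rmult_le_compat_r c) in M; [|lra].
  replace (a * b * / c * n * c) with (a * b * n) in M by (field; lra). exact M. }
assert (M3 : 3 / 4 * (c * c) * (3 / 4 * (rho * rho)) <= a * b) by (apply Rmult_le_compat; nra).
assert (M4 : 3 / 4 * (c * c) * (3 / 4 * (rho * rho)) * n <= 4 * K * (rho * rho) * c).
{ eapply Rle_trans; [|exact M2]. apply Rmult_le_compat_r; auto. }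
assert (M5 : 9 / 16 * (c * n) <= 4 * K).
{ apply (Rmult_le_reg_l (rho * rho * c)); [nra|]. lra. }
apply (Rmult_le_reg_l c); [exact c0|]. replace (c * (8 * K / c)) with (8 * K) by (field; lra). lra.
Qed.

(** Multiplication by z^2 + R^2 absorbs the bound K / |Re z| on the circle |z| = R, as in
    [simple_pole_bound]. The maximum principle then gives (R^2 - |z|^2) |H z| <= 2 R K with R
    arbitrary. *)
Lemma liouville (H : C -> V) K : 0 <= K -> (forall z, taylor 3 (fun h => H (z + h)%C)) ->
  (forall z, Re z <> 0 -> norm (H z) <= K / Rabs (Re z)) ->
  forall z, H z = zero.
Proof.
intros HK HT HB z. apply norm_eq_zero. apply Rle_antisym; [|apply norm_ge_0].
set (n := norm (H z)). assert (n0 : 0 <= n) by apply norm_ge_0. set (c := Cmod z). assert (c0 : 0 <= c) by apply Cmod_ge_0.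
assert (B : forall R, c < R -> (R * R - c * c) * n <= 2 * R * K).
{ intros R HR.
  assert (M : norm (scal (z * z + RtoC (R * R))%C (H z)) <= 2 * R * K).
  { apply (maximum_principle (fun x : C => scal (x * x + RtoC (R * R))%C (H x)) (fun x => Cmod x <= R) (fun x => Cmod x = R) R).
    - intros x Hx. exists (Cmod x - R). split; [lra|]. intros y Hy.
      assert (Q := Cmod_dist_triangle x y 0). rewrite (Cmod_sym x y) in Q.
      replace (x - 0)%C with x in Q by ring. replace (y - 0)%C with y in Q by ring. lra.
    - auto.
    - intros x _. apply taylor_scal; [|apply HT].
      repeat first [apply taylor_shift|exact (taylor_const (V := C_NormedModule) 3 _)|apply taylor_mult|apply taylor_add].
    - intros x Hx Hb. exists (R - Cmod x). split; [lra|]. intros y Hy.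
      assert (Q := Cmod_dist_triangle y x 0).
      replace (x - 0)%C with x in Q by ring. replace (y - 0)%C with y in Q by ring. lra.
    - intros x _ Hb. rewrite norm_scal_C, (circle_factor x R Hb), Cmod_mult, Cmod_R, Hb, Rabs_mult, (Rabs_pos_eq 2) by lra.
      destruct (Req_dec (Re x) 0) as [E|E].
      + rewrite E, Rabs_R0. nra.
      + specialize (HB x E). assert (P : 0 < Rabs (Re x)) by (apply Rabs_pos_lt; exact E).
        apply (Rmult_le_compat_l (2 * Rabs (Re x) * R)) in HB; [|nra].
        eapply Rle_trans; [exact HB|]. right. field. lra.
    - fold c. lra. }
  rewrite norm_scal_C in M. eapply Rle_trans; [|exact M]. apply Rmult_le_compat_r; [exact n0|].
  rewrite Cplus_comm. eapply Rle_trans; [|apply Cmod_rev_triangle]. rewrite Cmod_mult, Cmod_R, Rabs_pos_eq by nra. fold c. lra. }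
apply Rnot_lt_le. intros L. fold n in L.
(* This R gives R n > 4 K and c^2 <= R^2 / 4, against the consequence 3/4 R n <= 2 K of the
   bound. *)
set (R := 2 * c + 1 + 4 * K / n). assert (P : 0 <= 4 * K / n).
{ apply Rmult_le_pos; [lra|left; apply Rinv_0_lt_compat; exact L]. }
specialize (B R ltac:(unfold R; lra)).
assert (R1 : 2 * c + 1 <= R) by (unfold R; lra).
assert (R2 : 4 * K < R * n).
{ unfold R. replace ((2 * c + 1 + 4 * K / n) * n) with ((2 * c + 1) * n + 4 * K) by (field; lra). nra. }
assert (R3 : c * c <= R * R / 4) by nra.
assert (R4 : 3 / 4 * (R * R) * n <= 2 * R * K) by nra. 
assert (R5 : 3 / 4 * (R * n) <= 2 * K).
{ apply (Rmult_le_reg_l R); [lra|]. lra. }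
lra.
Qed.
End Isolated.

(** * Level sets of the exponential *)

Lemma Cmod_Cexp_le z x : 0 <= x -> Cmod (Cexp (z * RtoC x)) <= exp (Cmod z * x).
Proof.
intros Hx. rewrite Cmod_Cexp. replace (Re (z * RtoC x)) with (Re z * x) by (unfold Re; simpl; ring).
assert (Q := Re_le_Cmod z). assert (Q' := Rle_abs (Re z)).
assert (L : Re z * x <= Cmod z * x) by nra.
destruct L as [L| ->]; [left; apply exp_increasing, L|right; reflexivity].
Qed.

Lemma taylor_Cexp (z : C) x : 0 <= x ->
  taylor (V := C_NormedModule) 3 (fun h => Cexp ((z + h) * RtoC x)).
Proof.
intros Hx.
apply (taylor_ext (V := C_NormedModule) 3 (fun h => Cexp (z * RtoC x) * Cexp (h * RtoC x))%C _ 1 Rlt_0_1).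
- intros h _. rewrite <- Cexp_plus. f_equal. ring.
- apply taylor_mult; [exact (taylor_const (V := C_NormedModule) 3 _)|].
  apply (taylor_3_of_bound (V := C_NormedModule) _ (RtoC x) (RtoC (x * x / 2)) (x * x * x * exp x) 1 Rlt_0_1).
  intros h Hh. replace (0 * RtoC x)%C with (RtoC 0) by ring. rewrite Cexp_0.
  assert (Q := Cexp_taylor h x Hx).
  change (Cmod (Cexp (h * RtoC x) - (1 + (h * RtoC x + h * h * RtoC (x * x / 2))))%C
    <= x * x * x * exp x * (Cmod h * Cmod h * Cmod h)).
  eapply Rle_trans; [exact Q|]. rewrite Rmult_comm.
  assert (P := Cmod_ge_0 h). assert (E : exp (Cmod h * x) <= exp x).
  { assert (L : Cmod h * x <= x) by nra. destruct L as [L| ->]; [left; apply exp_increasing, L|right; reflexivity]. }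
  apply Rmult_le_compat_r; [repeat apply Rmult_le_pos; exact P|].
  apply Rmult_le_compat_l; [repeat apply Rmult_le_pos; exact Hx|exact E].
Qed.

Lemma Cexp_1_small w : Cexp w = 1%C -> Cmod w < 1 -> w = 0%C.
Proof.
intros E L. assert (R1 := Re_le_Cmod w). assert (I1 := Im_le_Cmod w).
assert (M := Cmod_Cexp w). rewrite E, Cmod_1 in M.
assert (R0 : Re w = 0).
{ destruct (Rtotal_order (Re w) 0) as [H|[H|H]]; [|exact H|].
  - apply exp_increasing in H. rewrite exp_0 in H. lra.
  - apply exp_increasing in H. rewrite exp_0 in H. lra. }
assert (S0 : sin (Im w) = 0).
{ apply (f_equal snd) in E. unfold Cexp in E. simpl in E. rewrite R0, exp_0 in E. lra. }
assert (I0 : Im w = 0).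
{ apply NNPP. intros H. assert (P := PI_RGT_0). assert (P3 := PI2_1).
  assert (Q : Rabs (Im w) < 1) by lra. apply Rabs_lt_between in Q.
  destruct (Rtotal_order (Im w) 0) as [G|[G|G]]; [|contradiction|].
  - assert (T : 0 < sin (- Im w)) by (apply sin_gt_0; lra). rewrite sin_neg in T. lra.
  - assert (T : 0 < sin (Im w)) by (apply sin_gt_0; lra). lra. }
apply injective_projections; [exact R0|exact I0].
Qed.

(** The punctured disc of radius d/2 about p contains at most one point of Z; if there is one, its
    distance to p is the radius. *)
Lemma separated_isolated (Z : C -> Prop) d (p : C) : 0 < d ->
  (forall z w, Z z -> Z w -> Cmod (z - w)%C < d -> z = w) ->
  exists r, 0 < r /\ forall z, 0 < Cmod (z - p)%C < r -> ~ Z z.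
Proof.
intros Hd H. destruct (classic (exists q, Z q /\ 0 < Cmod (q - p)%C < d / 2)) as [(q & Zq & Hq)|Hn].
- exists (Cmod (q - p)%C). split; [lra|]. intros z Hz Zz.
  assert (E : z = q).
  { apply H; auto. assert (T := Cmod_dist_triangle z p q). rewrite (Cmod_sym p q) in T. lra. }
  rewrite E in Hz. lra.
- exists (d / 2). split; [lra|]. intros z Hz Zz. apply Hn. exists z. auto.
Qed.

(** Two solutions closer than 1/s differ by some w with e^{ws} = 1 and |ws| < 1, hence w = 0. *)
Lemma Cexp_level_isolated s (tau p : C) : 0 < s -> tau <> 0%C ->
  exists r, 0 < r /\ forall z, 0 < Cmod (z - p)%C < r -> (Cexp (z * RtoC s) - tau)%C <> 0%C.
Proof.
intros Hs Ht. apply (separated_isolated (fun z => (Cexp (z * RtoC s) - tau)%C = 0%C) (/ s)); [apply Rinv_0_lt_compat; exact Hs|].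
intros z w Hz Hw L.
assert (Ez : Cexp (z * RtoC s) = tau).
{ replace (Cexp (z * RtoC s)) with (tau + (Cexp (z * RtoC s) - tau))%C by ring. rewrite Hz. ring. }
assert (Ew : Cexp (w * RtoC s) = tau).
{ replace (Cexp (w * RtoC s)) with (tau + (Cexp (w * RtoC s) - tau))%C by ring. rewrite Hw. ring. }
assert (E : ((z - w) * RtoC s = 0)%C).
{ apply Cexp_1_small.
  - assert (P : (Cexp (w * RtoC s) * Cexp ((z - w) * RtoC s) = Cexp (w * RtoC s))%C).
    { rewrite <- Cexp_plus, Ew, <- Ez. f_equal. ring. }
    rewrite Ew in P. replace (Cexp ((z - w) * RtoC s)) with (/ tau * (tau * Cexp ((z - w) * RtoC s)))%C by (field; exact Ht).
    rewrite P. field. exact Ht.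
  - rewrite Cmod_mult, Cmod_R, Rabs_pos_eq by lra.
    apply (Rmult_lt_compat_r s) in L; [|exact Hs]. rewrite Rinv_l in L by lra. exact L. }
assert (S0 : RtoC s <> 0%C). { intros F. apply RtoC_inj in F. lra. }
replace z with (w + (z - w))%C by ring.
replace (z - w)%C with (((z - w) * RtoC s) * / RtoC s)%C by (field; exact S0). rewrite E. ring.
Qed.

(** * Translations on the quotient *)

Section Translations.
Context {X : CBanach}.
Notation Y := (quotient_space X).

Lemma cont_shift (f : R -> X) c : cont f -> cont (fun x => f (x + c)).
Proof.
intros H t e He. destruct (H (t + c) e He) as (d & Hd & Hs). exists d. split; [exact Hd|].
intros s Hst. apply Hs. replace (s + c - (t + c)) with (s - t) by ring. exact Hst.
Qed.

Lemma Int_shift (f : R -> X) a b c : cont f -> Int (fun x => f (x + c)) a b = Int f (a + c) (b + c).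
Proof.
intros H.
assert (E := RInt_comp_lin (V := real_of X) f 1 c a b).
replace (1 * a + c) with (a + c) in E by ring. replace (1 * b + c) with (b + c) in E by ring.
specialize (E (ex_Int _ _ _ H)). eapply eq_trans; [|exact E].
apply (RInt_ext (V := real_of X)). intros x _. 
eapply eq_trans; [|symmetry; exact (@scal_one R_Ring (real_of X) _)]. f_equal. ring.
Qed.

Lemma shift_bounded (s : R) (u : BUC X) : 0 <= s -> Defs.bounded (fun t => u (t + s)).
Proof.
intros Hs. destruct (buc_bounded u) as [M HM]. exists M. intros t Ht. apply HM. unfold half_line in *. lra.
Qed.

Lemma shift_uc (s : R) (u : BUC X) : 0 <= s -> Defs.uniformly_continuous (fun t => u (t + s)).
Proof.
intros Hs e He. destruct (buc_uc u He) as (d & Hd & H). exists d. split; [exact Hd|].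
intros x y Hx Hy Hxy. apply H; unfold half_line in *; try lra.
replace (x + s - (y + s)) with (x - y) by ring. exact Hxy.
Qed.

(** Only s >= 0 maps the half-line into itself; for negative s the value u is a placeholder. *)
Definition shift (s : R) (u : BUC X) : BUC X :=
  match Rle_dec 0 s with
  | left Hs => MkBUC (shift_bounded s u Hs) (shift_uc s u Hs)
  | right _ => u
  end.

Lemma shiftE s (u : BUC X) t : 0 <= s -> shift s u t = u (t + s).
Proof. intros Hs. unfold shift. destruct (Rle_dec 0 s); [reflexivity|contradiction]. Qed.

Definition tdiff (s : R) (tau : C) (u : BUC X) : BUC X := buc_minus (shift s u) (buc_scal tau u).

Lemma tdiffE s tau (u : BUC X) t : 0 <= s -> tdiff s tau u t = minus (u (t + s)) (scal tau (u t)).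
Proof. intros Hs. unfold tdiff. rewrite buc_minusE, shiftE by exact Hs. reflexivity. Qed.

Lemma cls_shift s (f g : BUC X) : 0 <= s -> cls f = cls g -> cls (shift s f) = cls (shift s g).
Proof.
intros Hs H. apply cls_eq. intros e He. destruct (proj1 (cls_eq f g) H e He) as [M HM].
exists M. intros t Ht. rewrite !shiftE by exact Hs. apply HM. lra.
Qed.

Lemma cls_tdiff_eq s tau u : cls (tdiff s tau u) = minus (cls (shift s u)) (scal tau (cls u)).
Proof. unfold tdiff. rewrite <- cls_minus, <- cls_scal. reflexivity. Qed.

Lemma cls_tdiff s tau (f g : BUC X) : 0 <= s -> cls f = cls g -> cls (tdiff s tau f) = cls (tdiff s tau g).
Proof. intros Hs H. rewrite !cls_tdiff_eq, H, (cls_shift s f g Hs H). reflexivity. Qed.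

Lemma tdiff_comm s tau s' tau' u : 0 <= s -> 0 <= s' ->
  cls (tdiff s tau (tdiff s' tau' u)) = cls (tdiff s' tau' (tdiff s tau u)).
Proof.
intros Hs Hs'. apply cls_pw. intros t _. rewrite !tdiffE by assumption.
replace (t + s' + s) with (t + s + s') by ring. vring X.
Qed.

Fixpoint cpow_n (c : C) (n : nat) : C := match n with O => 1%C | S n => (c * cpow_n c n)%C end.

Lemma Cmod_cpow_n c n : Cmod c = 1 -> Cmod (cpow_n c n) = 1.
Proof. intros H. induction n as [|n IH]; simpl; [apply Cmod_1|]. rewrite Cmod_mult, H, IH. lra. Qed.

Lemma cls_shift_plus s (f g : BUC X) : 0 <= s -> cls (shift s (buc_plus f g)) = plus (cls (shift s f)) (cls (shift s g)).
Proof.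
intros Hs. rewrite cls_plus. apply cls_pw. intros t _. rewrite shiftE by exact Hs. simpl.
rewrite !shiftE by exact Hs. reflexivity.
Qed.

Lemma cls_shift_scal s c (f : BUC X) : 0 <= s -> cls (shift s (buc_scal c f)) = scal c (cls (shift s f)).
Proof.
intros Hs. rewrite cls_scal. apply cls_pw. intros t _. rewrite shiftE by exact Hs. simpl.
rewrite !shiftE by exact Hs. reflexivity.
Qed.

(* Powers of an isometry S grow linearly on a Jordan block, so (S - tau)^2 v = 0 forces (S - tau) v = 0. *)
Lemma tdiff_semisimple s tau v : 0 <= s -> Cmod tau = 1 ->
  cls (tdiff s tau (tdiff s tau v)) = zero -> cls (tdiff s tau v) = zero.
Proof.
intros Hs Ht H. set (z := tdiff s tau v) in *.
assert (Sz : cls (shift s z) = scal tau (cls z)).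
{ rewrite cls_tdiff_eq in H.
  replace (cls (shift s z)) with (plus (minus (cls (shift s z)) (scal tau (cls z))) (scal tau (cls z))).
  - rewrite H. vring (quotient_space X).
  - generalize (cls (shift s z)) (cls z). intros. vring (quotient_space X). }
assert (Sv : cls (shift s v) = plus (scal tau (cls v)) (cls z)).
{ unfold z. rewrite cls_tdiff_eq. generalize (cls (shift s v)) (cls v). intros. vring (quotient_space X). }
assert (step : forall (n : nat) w, cls (shift (INR (S n) * s) w) = cls (shift (INR n * s) (shift s w))).
{ intros n w. assert (P := pos_INR n). assert (P' := pos_INR (S n)). apply cls_pw. intros t _.
  rewrite !shiftE by nra. f_equal. rewrite S_INR. ring. }
assert (Gz : forall n, cls (shift (INR n * s) z) = scal (cpow_n tau n) (cls z)).
{ induction n as [|n IH].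
  - simpl. rewrite Rmult_0_l. transitivity (cls z); [|vring (quotient_space X)].
    apply cls_pw. intros t _. rewrite shiftE by lra. f_equal. ring.
  - assert (P := pos_INR n). rewrite step.
    rewrite (cls_shift _ _ (buc_scal tau z)); [|nra|rewrite Sz; apply cls_scal].
    rewrite cls_shift_scal by nra. rewrite IH. cbn [cpow_n]. vring (quotient_space X). }
(* The extra factor tau on the left avoids the exponent n - 1 in S^n v = tau^n v + n tau^(n-1) z. *)
assert (Gv : forall n, scal tau (cls (shift (INR n * s) v)) =
  plus (scal (tau * cpow_n tau n)%C (cls v)) (scal (RtoC (INR n) * cpow_n tau n)%C (cls z))).
{ induction n as [|n IH].
  - replace (cls (shift (INR 0 * s) v)) with (cls v).
    + simpl. vring (quotient_space X).
    + apply cls_pw. intros t _. simpl. rewrite Rmult_0_l, shiftE by lra. f_equal. ring.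
  - assert (P := pos_INR n). rewrite step.
    rewrite (cls_shift _ _ (buc_plus (buc_scal tau v) z)); [|nra|rewrite Sv, cls_scal; apply cls_plus].
    rewrite cls_shift_plus, cls_shift_scal by nra. rewrite Gz.
    eapply eq_trans; [exact (f_equal (fun w => scal tau (plus w (scal (cpow_n tau n) (cls z)))) IH)|].
    rewrite S_INR, RtoC_plus. cbn [cpow_n]. vring (quotient_space X). }
destruct (buc_norm v) as (M & M0 & HM).
assert (B : forall n, INR n * norm (cls z) <= 2 * M).
{ intros n. assert (P := pos_INR n). specialize (Gv n).
  assert (E : scal (RtoC (INR n) * cpow_n tau n)%C (cls z) =
    minus (scal tau (cls (shift (INR n * s) v))) (scal (tau * cpow_n tau n)%C (cls v))).
  { eapply eq_trans; [|exact (f_equal (fun w => minus w (scal (tau * cpow_n tau n)%C (cls v))) (eq_sym Gv))].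
    vring (quotient_space X). }
  assert (N : norm (scal (RtoC (INR n) * cpow_n tau n)%C (cls z)) = INR n * norm (cls z)).
  { rewrite norm_scal_C, Cmod_mult, Cmod_cpow_n, Cmod_R, Rabs_pos_eq by auto. ring. }
  rewrite <- N, E. eapply Rle_trans; [apply norm_minus_le|].
  rewrite !norm_scal_C, Cmod_mult, Cmod_cpow_n, Ht by exact Ht.
  assert (N1 : norm (cls v) <= M) by (apply cls_norm, HM).
  assert (N2 : norm (cls (shift (INR n * s) v)) <= M).
  { apply cls_norm. intros t Htt. rewrite shiftE by nra. apply HM. unfold half_line in *. nra. }
  lra. }
apply norm_eq_zero. apply Rle_antisym; [|apply norm_ge_0]. apply Rnot_lt_le. intros L.
destruct (nfloor_ex (2 * M / norm (cls z) + 1)) as (n & Hn1 & Hn2).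
{ assert (0 <= 2 * M / norm (cls z)) by (apply Rmult_le_pos; [lra|left; apply Rinv_0_lt_compat, L]). lra. }
specialize (B n). assert (2 * M / norm (cls z) < INR n) by lra.
assert (F : 2 * M / norm (cls z) * norm (cls z) < INR n * norm (cls z)) by (apply Rmult_lt_compat_r; assumption).
replace (2 * M / norm (cls z) * norm (cls z)) with (2 * M) in F by (field; lra). lra.
Qed.
End Translations.

(** * The transform of a translation difference *)

Section Window.
Context {X : CBanach}.
Notation Y := (quotient_space X).

Lemma Int_scal (c : C) (f : R -> X) a b : a <= b -> cont f ->
  Int (fun t => scal c (f t)) a b = scal c (Int f a b).
Proof.
intros Hab Hf. symmetry. apply (Int_linear (fun x => scal c x) (Cmod c)); auto.
- intros; vring X.
- intros; vring X.
- intros x. right. apply norm_scal_X.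
Qed.

Definition wint (s : R) (k : R -> C) (u : R -> X) (t : R) : X :=
  Int (fun x => scal (k x) (ext u (x + t))) 0 s.

Lemma wint_cont k (u : BUC X) t : cont (X := CB) k -> cont (fun x => scal (k x) (ext u (x + t))).
Proof. intros Hk. apply cont_scal; [exact Hk|]. apply cont_shift, cont_ext, buc_continuous. Qed.

Lemma wint_norm s k (u : BUC X) t B M : 0 <= s -> half_line t -> cont (X := CB) k ->
  (forall x, 0 <= x <= s -> Cmod (k x) <= B) -> (forall x, half_line x -> norm (u x) <= M) ->
  norm (wint s k u t) <= B * M * s.
Proof.
intros Hs Ht Hk HB HM. unfold wint. replace (B * M * s) with (B * M * (s - 0)) by ring.
apply Int_norm; [exact Hs|apply wint_cont, Hk|]. intros x Hx.
rewrite norm_scal_X. apply Rmult_le_compat; [apply Cmod_ge_0|apply norm_ge_0|auto|].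
apply HM. apply Rmax_l.
Qed.

Lemma wint_BUC s k (u : BUC X) B : 0 <= s -> cont (X := CB) k ->
  (forall x, 0 <= x <= s -> Cmod (k x) <= B) -> exists W : BUC X, forall t, W t = wint s k u t.
Proof.
intros Hs Hk HB. destruct (buc_norm u) as (M & M0 & HM).
assert (B0 : 0 <= B) by (eapply Rle_trans; [apply Cmod_ge_0|apply (HB 0); lra]).
assert (bd : Defs.bounded (wint s k u)).
{ exists (B * M * s). intros t Ht. apply wint_norm; assumption. }
assert (uc : Defs.uniformly_continuous (wint s k u)).
{ intros e He. destruct (buc_uc u (e := e / (B * s + 1))) as (d & Hd & H).
  { apply Rdiv_lt_0_compat; nra. }
  exists d. split; [exact Hd|]. intros t t' Ht Ht' Htt.
  assert (ID : minus (wint s k u t) (wint s k u t') =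
    Int (fun x => scal (k x) (minus (ext u (x + t)) (ext u (x + t')))) 0 s).
  { unfold wint.
    assert (E := Int_plus _ _ 0 s (wint_cont k u t Hk)
      (cont_scal (fun _ => RtoC (-1)) _ (cont_const (X := CB) (RtoC (-1))) (wint_cont k u t' Hk))).
    rewrite (Int_scal (RtoC (-1))) in E by (auto; apply wint_cont, Hk).
    transitivity (plus (Int (fun x => scal (k x) (ext u (x + t))) 0 s) (scal (RtoC (-1)) (Int (fun x => scal (k x) (ext u (x + t'))) 0 s))); [vring X|].
    eapply eq_trans; [symmetry; exact E|]. apply Int_ext; [exact Hs|]. intros x _. vring X. }
  eapply Rle_lt_trans; [right; exact (f_equal norm ID)|].
  eapply Rle_lt_trans; [apply (Int_norm _ 0 s (B * (e / (B * s + 1)))); [exact Hs| |]|].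
  - apply cont_scal; [exact Hk|].
    assert (Q := cont_plus _ _ (cont_shift (ext u) t (cont_ext u (buc_continuous u)))
      (cont_scal (fun _ => RtoC (-1)) _ (cont_const (X := CB) (RtoC (-1))) (cont_shift (ext u) t' (cont_ext u (buc_continuous u))))).
    intros x e' He'. destruct (Q x e' He') as (d' & Hd' & Hs'). exists d'. split; [exact Hd'|].
    intros y Hy. eapply Rle_lt_trans; [|exact (Hs' y Hy)]. right. f_equal. vring X.
  - intros x Hx. rewrite norm_scal_X. apply Rmult_le_compat; [apply Cmod_ge_0|apply norm_ge_0|auto|].
    left. rewrite !ext_eq by (unfold half_line in *; lra). apply H; unfold half_line in *; try lra.
    replace (x + t - (x + t')) with (t - t') by ring. exact Htt.
  - rewrite Rminus_0_r. apply Rlt_le_trans with ((B * s + 1) * (e / (B * s + 1))).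
    + assert (P : 0 < e / (B * s + 1)) by (apply Rdiv_lt_0_compat; nra). nra.
    + right. field. nra. }
exists (MkBUC bd uc). reflexivity.
Qed.

Definition ker (s : R) (z : C) (x : R) : C := Cexp (z * RtoC (s - x)).

Lemma ker_cont s z : cont (X := CB) (ker s z).
Proof.
apply (dv_cont (X := CB) _ (fun t => (RtoC 0 * Cexp (- z * RtoC t) + Cexp (z * RtoC s) * (- z * Cexp (- z * RtoC t)))%C)).
intros t. unfold ker.
assert (Q := dv_prod (X := CB) (fun _ => True) (fun _ => Cexp (z * RtoC s)) _ t _ _
  (dv_const (X := CB) _ (Cexp (z * RtoC s)) t) (dv_Cexp _ (- z)%C t)).
refine (dv_ext (X := CB) _ _ _ _ _ _ _ Q).
- intros x _. change (Cexp (z * RtoC s) * Cexp (- z * RtoC x) = Cexp (z * RtoC (s - x)))%C.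
  rewrite <- Cexp_plus. f_equal. rewrite RtoC_minus. ring.
- change (Cexp (z * RtoC s) * Cexp (- z * RtoC t) = Cexp (z * RtoC (s - t)))%C.
  rewrite <- Cexp_plus. f_equal. rewrite RtoC_minus. ring.
Qed.

Lemma ker_bound s z x : 0 <= x <= s -> Cmod (ker s z x) <= exp (Cmod z * s).
Proof.
intros Hx. unfold ker. eapply Rle_trans; [apply Cmod_Cexp_le; lra|].
assert (P := Cmod_ge_0 z). assert (L : Cmod z * (s - x) <= Cmod z * s) by nra.
destruct L as [L| ->]; [left; apply exp_increasing, L|right; reflexivity].
Qed.

Lemma window_exists s (u : BUC X) : 0 <= s -> exists E : C -> BUC X,
  (forall z t, E z t = wint s (ker s z) u t) /\ forall z, taylor 3 (fun h => cls (E (z + h)%C)).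
Proof.
intros Hs. destruct (buc_norm u) as (M & M0 & HM).
set (E := fun z => proj1_sig (constructive_indefinite_description _
   (wint_BUC s (ker s z) u (exp (Cmod z * s)) Hs (ker_cont s z) (ker_bound s z)))).
assert (HE : forall z t, E z t = wint s (ker s z) u t).
{ intros z t. unfold E. destruct (constructive_indefinite_description _ _) as [W HW]. apply HW. }
exists E. split; [exact HE|]. intros z.
(* [k1] and [k2] are the coefficients of h and h^2 in the kernel for z + h. *)
set (k1 := fun x => (RtoC (s - x) * ker s z x)%C).
set (k2 := fun x => (RtoC ((s - x) * (s - x) / 2) * ker s z x)%C).
set (B := exp (Cmod z * s)). assert (B0 : 0 < B) by apply exp_pos.
assert (cA : cont (X := CB) (fun x => RtoC (s - x))).
{ apply (cont_of_R (fun x => s - x)). intros t.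
  apply (ex_derive_continuous (K := R_AbsRing) (V := R_NormedModule)). auto_derive; auto. }
assert (cB : cont (X := CB) (fun x => RtoC ((s - x) * (s - x) / 2))).
{ apply (cont_of_R (fun x => (s - x) * (s - x) / 2)). intros t.
  apply (ex_derive_continuous (K := R_AbsRing) (V := R_NormedModule)). auto_derive; auto. }
assert (c1 : cont (X := CB) k1).
{ apply (cont_scal (X := CB)); [exact cA|apply ker_cont]. }
assert (c2 : cont (X := CB) k2).
{ apply (cont_scal (X := CB)); [exact cB|apply ker_cont]. }
destruct (wint_BUC s k1 u (s * B) Hs c1) as [W1 HW1].
{ intros x Hx. unfold k1. rewrite Cmod_mult, Cmod_R, Rabs_pos_eq by lra.
  apply Rmult_le_compat; [lra|apply Cmod_ge_0|lra|apply ker_bound, Hx]. }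
destruct (wint_BUC s k2 u (s * s * B) Hs c2) as [W2 HW2].
{ intros x Hx. unfold k2. rewrite Cmod_mult, Cmod_R, Rabs_pos_eq by nra.
  apply Rmult_le_compat; [nra|apply Cmod_ge_0|nra|apply ker_bound, Hx]. }
apply (taylor_3_of_bound _ (cls W1) (cls W2) (B * (s * s * s * exp s) * M * s) 1 Rlt_0_1).
intros h Hh. replace (z + 0)%C with z by ring.
assert (ID0 : minus (cls (E (z + h)%C)) (plus (cls (E z)) (plus (scal h (cls W1)) (scal (h * h)%C (cls W2)))) =
  cls (buc_minus (E (z + h)%C) (buc_plus (E z) (buc_plus (buc_scal h W1) (buc_scal (h * h)%C W2))))).
{ rewrite <- cls_minus, <- !cls_plus, <- !cls_scal. reflexivity. }
eapply Rle_trans; [right; exact (f_equal norm ID0)|]. clear ID0.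
eapply Rle_trans; [apply (cls_norm _ (B * (s * s * s * exp s) * (Cmod h * Cmod h * Cmod h) * M * s))|right; ring].
intros t Ht. rewrite buc_minusE. simpl. rewrite !HE, HW1, HW2.
set (rho := fun x => (ker s z x * (Cexp (h * RtoC (s - x)) - (1 + (h * RtoC (s - x) + h * h * RtoC ((s - x) * (s - x) / 2)))))%C).
assert (crho : cont (X := CB) rho).
{ apply (cont_scal (X := CB)); [apply ker_cont|].
  assert (Q := cont_plus (X := CB) _ _ (cont_minus_const (X := CB) _ (RtoC 1) (ker_cont s h))
    (cont_plus (X := CB) _ _
      (cont_scal (X := CB) (fun _ => (- h)%C) (fun x => RtoC (s - x)) (cont_const (X := CB) (- h)%C)
         cA)
      (cont_scal (X := CB) (fun _ => (- (h * h))%C) (fun x => RtoC ((s - x) * (s - x) / 2)) (cont_const (X := CB) (- (h * h))%C)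
         cB))).
  intros x e He. destruct (Q x e He) as (d & Hd & Hs'). exists d. split; [exact Hd|].
  intros y Hy. eapply Rle_lt_trans; [|exact (Hs' y Hy)]. right.
  match goal with |- @norm _ _ ?a = @norm _ _ ?b => change (Cmod a = Cmod b); f_equal end.
  unfold ker. 
  match goal with |- minus ?a ?b = minus (plus (minus ?c ?d) (plus ?e ?f)) (plus (minus ?g ?h) (plus ?k ?l)) =>
    change ((a - b = (c - d + (e + f)) - (g - h + (k + l)))%C) end.
  change (@scal C_Ring (CompleteNormedModule.ModuleSpace C_AbsRing CB)) with Cmult. ring. }
assert (ID : minus (wint s (ker s (z + h)%C) u t)
   (plus (wint s (ker s z) u t) (plus (scal h (wint s k1 u t)) (scal (h * h)%C (wint s k2 u t)))) = wint s rho u t).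
{ assert (L : wint s (ker s (z + h)%C) u t = plus (plus (wint s (ker s z) u t) (wint s rho u t))
     (plus (scal h (wint s k1 u t)) (scal (h * h)%C (wint s k2 u t)))).
  { unfold wint.
    assert (C0 := wint_cont (ker s z) u t (ker_cont s z)). assert (Cr := wint_cont rho u t crho).
    assert (C1 := wint_cont k1 u t c1). assert (C2 := wint_cont k2 u t c2).
    assert (D1 := cont_scal (fun _ => h) _ (cont_const (X := CB) h) C1).
    assert (D2 := cont_scal (fun _ => (h * h)%C) _ (cont_const (X := CB) (h * h)%C) C2).
    eapply eq_trans; [|exact (f_equal2 plus (Int_plus _ _ 0 s C0 Cr) (eq_trans (Int_plus _ _ 0 s D1 D2)
      (f_equal2 plus (Int_scal h _ 0 s Hs C1) (Int_scal (h * h)%C _ 0 s Hs C2))))].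
    eapply eq_trans; [|exact (Int_plus _ _ 0 s (cont_plus _ _ C0 Cr) (cont_plus _ _ D1 D2))].
    apply Int_ext; [exact Hs|]. intros x _.
    assert (K : ker s (z + h)%C x = (ker s z x * Cexp (h * RtoC (s - x)))%C).
    { unfold ker. rewrite <- Cexp_plus. f_equal. ring. }
    rewrite K. unfold rho, k1, k2. vring X. }
  rewrite L. vring X. }
eapply Rle_trans; [right; exact (f_equal norm ID)|].
apply wint_norm; auto. intros x Hx. unfold rho. rewrite Cmod_mult.
assert (Q := Cexp_taylor h (s - x) ltac:(lra)). assert (P := Cmod_ge_0 h).
rewrite Rmult_assoc. apply Rmult_le_compat; [apply Cmod_ge_0|apply Cmod_ge_0|apply ker_bound, Hx|].
eapply Rle_trans; [exact Q|]. rewrite (Rmult_comm (s * s * s * exp s)).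
apply Rmult_le_compat_l; [repeat apply Rmult_le_pos; exact P|].
assert (L : Cmod h * (s - x) <= s) by nra.
apply Rmult_le_compat; [repeat apply Rmult_le_pos; lra|left; apply exp_pos| |].
- apply Rmult_le_compat; [nra|lra|nra|lra].
- destruct L as [L| ->]; [left; apply exp_increasing, L|right; reflexivity].
Qed.

(* Variation of constants over a window of length s. *)
Lemma Rz_tdiff z s tau (u : BUC X) (E : BUC X) : Re z <> 0 -> 0 <= s ->
  (forall t, E t = wint s (ker s z) u t) ->
  Rz z (cls (tdiff s tau u)) = minus (scal (Cexp (z * RtoC s) - tau)%C (Rz z (cls u))) (cls E).
Proof.
intros Hz Hs HE. destruct (Rz_ode_ex z u Hz) as (U & HU & EU). rewrite EU.
assert (O : ode z (tdiff s tau u) (tdiff s tau U)).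
{ intros t Ht.
  assert (Hts : half_line (t + s)) by (unfold half_line in *; lra).
  assert (S1 : dv half_line (fun x => U (x + s)) t (minus (scal z (U (t + s))) (u (t + s)))).
  { intros e He. destruct (HU (t + s) Hts e He) as (d & Hd & H). exists d. split; [exact Hd|].
    intros x Hx Hxt. assert (H' := H (x + s)). replace (x + s - (t + s)) with (x - t) in H' by ring.
    apply H'; [unfold half_line in *; lra|exact Hxt]. }
  assert (S2 := dv_minus _ _ _ _ _ _ S1 (dv_scal tau _ _ _ _ (HU t Ht))).
  refine (dv_ext _ _ _ _ _ _ _ (dv_value _ _ _ _ _ _ S2)).
  - intros x _. rewrite tdiffE by exact Hs. reflexivity.
  - rewrite tdiffE by exact Hs. reflexivity.
  - rewrite !tdiffE by exact Hs. vring X. }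
rewrite (Rz_ode z _ _ Hz O). rewrite cls_tdiff_eq.
assert (SH : cls (shift s U) = minus (scal (Cexp (z * RtoC s)) (cls U)) (cls E)).
{ transitivity (cls (buc_minus (buc_scal (Cexp (z * RtoC s)) U) E)); [|rewrite <- cls_minus, <- cls_scal; reflexivity].
  apply cls_pw. intros t Ht. rewrite shiftE, buc_minusE, HE by exact Hs. simpl.
  assert (V := ode_variation z u U t (t + s) Ht ltac:(lra) (buc_continuous u) HU).
  set (A := Cexp (z * RtoC (t + s))).
  assert (V2 := f_equal (fun x => scal A x) V). cbv beta in V2.
  assert (I2 : scal A (opp (Int (fun x => scal (Cexp (- z * RtoC x)) (ext u x)) t (t + s))) = opp (wint s (ker s z) u t)).
  { assert (C0 : cont (fun x => scal (Cexp (- z * RtoC x)) (ext u x))) by (apply cont_exp_mul, cont_ext, buc_continuous).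
    assert (H1 : scal A (Int (fun x => scal (Cexp (- z * RtoC x)) (ext u x)) t (t + s)) = wint s (ker s z) u t).
    { replace t with (0 + t) at 1 by ring. replace (t + s) with (s + t) by ring.
      rewrite <- (Int_shift _ 0 s t C0). rewrite <- Int_scal; [|exact Hs|apply (cont_shift _ t C0)].
      unfold wint. apply Int_ext; [exact Hs|]. intros x _. unfold ker, A.
      assert (EE : Cexp (z * RtoC (s - x)) = (Cexp (z * RtoC (t + s)) * Cexp (- z * RtoC (x + t)))%C).
      { rewrite <- Cexp_plus. f_equal. rewrite RtoC_minus, !RtoC_plus. ring. }
      rewrite EE. generalize (Cexp (z * RtoC (t + s))) (Cexp (- z * RtoC (x + t))). intros. vring X. }
    rewrite <- H1. vring X. }
  assert (A1 : (A * Cexp (- z * RtoC (t + s)) = 1)%C).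
  { unfold A. rewrite <- Cexp_plus, <- Cexp_0. f_equal. ring. }
  assert (A2 : (A * Cexp (- z * RtoC t) = Cexp (z * RtoC s))%C).
  { unfold A. rewrite <- Cexp_plus. f_equal. rewrite RtoC_plus. ring. }
  assert (V3 : minus (scal (A * Cexp (- z * RtoC (t + s)))%C (U (t + s))) (scal (A * Cexp (- z * RtoC t))%C (U t))
     = opp (wint s (ker s z) u t)).
  { eapply eq_trans; [|eapply eq_trans; [exact V2|exact I2]].
    generalize (Cexp (- z * RtoC (t + s))) (Cexp (- z * RtoC t)). intros. vring X. }
  rewrite A1, A2 in V3.
  set (w := wint s (ker s z) u t) in *. set (a := Cexp (z * RtoC s)) in *.
  transitivity (plus (scal a (U t)) (minus (scal (RtoC 1) (U (t + s))) (scal a (U t)))); [vring X|].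
  eapply eq_trans; [exact (f_equal (fun v => plus (scal a (U t)) v) V3)|]. vring X. }
rewrite SH. generalize (Cexp (z * RtoC s)) (cls U) (cls E). intros. vring (quotient_space X).
Qed.
End Window.

(** * The spectral criterion *)

Section Spectral.
Context {X : CBanach}.
Notation Y := (quotient_space X).

Definition symbol (s : R) (tau z : C) : C := (Cexp (z * RtoC s) - tau)%C.

Lemma taylor_symbol s tau z : 0 <= s -> taylor (V := C_NormedModule) 3 (fun h => symbol s tau (z + h)%C).
Proof.
intros Hs. apply (taylor_add 3 _ (fun _ => (- tau)%C)); [apply taylor_Cexp, Hs|].
exact (taylor_const (V := C_NormedModule) 3 (- tau)%C).
Qed.

(* The transform of [w] is [b] times that of [u] up to an entire function. *)
Definition multiplied (b : C -> C) (u w : BUC X) : Prop :=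
  exists T : C -> Y, (forall z, taylor 3 (fun h => T (z + h)%C)) /\
    forall z, Re z <> 0 -> Rz z (cls w) = plus (scal (b z) (Rz z (cls u))) (T z).

Lemma multiplied_refl u : multiplied (fun _ => RtoC 1) u u.
Proof.
exists (fun _ => zero). split; [intros z; apply taylor_const|]. intros z _.
generalize (Rz z (cls u)). intros. vring (quotient_space X).
Qed.

(** By [Rz_tdiff] each difference multiplies the transform by its symbol up to an entire function;
    the previous entire correction is merely multiplied by the entire symbol. *)
Lemma multiplied_tdiff b u w s tau : 0 <= s -> multiplied b u w ->
  multiplied (fun z => (symbol s tau z * b z)%C) u (tdiff s tau w).
Proof.
intros Hs (T & HT & H). destruct (window_exists s w Hs) as (E & HE & TE).
exists (fun z => plus (scal (symbol s tau z) (T z)) (scal (RtoC (-1)) (cls (E z)))). split.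
- intros z. apply taylor_plus.
  + apply taylor_scal; [apply taylor_symbol, Hs|apply HT].
  + apply taylor_scal; [exact (taylor_const (V := C_NormedModule) 3 _)|apply TE].
- intros z Hz. rewrite (Rz_tdiff z s tau w (E z) Hz Hs (HE z)), (H z Hz). unfold symbol.
  generalize (Rz z (cls u)) (T z) (cls (E z)). intros. vring (quotient_space X).
Qed.

Lemma symbol_isolated s tau p : 0 < s -> Cmod tau = 1 ->
  exists r, 0 < r /\ forall z, 0 < Cmod (z - p)%C < r -> symbol s tau z <> 0%C.
Proof.
intros Hs Ht. apply Cexp_level_isolated; [exact Hs|]. intros E. rewrite E, Cmod_0 in Ht. lra.
Qed.

Lemma small_power (B : C -> C) p : taylor (V := C_NormedModule) 3 (fun h => B (p + h)%C) -> B p = 0%C ->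
  exists L d, 0 < d /\ 0 <= L /\ forall h, Cmod h < d -> Cmod (B (p + h)%C) <= L * Cmod h.
Proof.
intros H B0.
destruct (taylor_1_lipschitz (V := C_NormedModule) _ (taylor_le 1 3 _ (le_S _ _ (le_S _ _ (le_n _))) H)) as (L & d & Hd & HL).
exists (Rmax L 0), d. split; [exact Hd|]. split; [apply Rmax_r|]. intros h Hh. specialize (HL h Hh).
simpl in HL. replace (p + 0)%C with p in HL by ring. rewrite B0 in HL.
change (Cmod (B (p + h)%C - 0)%C <= L * Cmod h) in HL. replace (B (p + h) - 0)%C with (B (p + h)%C) in HL by ring.
eapply Rle_trans; [exact HL|]. apply Rmult_le_compat_r; [apply Cmod_ge_0|apply Rmax_l].
Qed.

(** G, the extension of the transform of u off the zeros of b, has at most simple poles there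
    because |hat u (z)| <= M / |Re z|. So b^4 G + T has third order expansions everywhere and equals
    the transform of w off the axis; Liouville's theorem makes it zero. *)
Lemma multiplied_vanishes (u w : BUC X) s tau : 0 < s -> Cmod tau = 1 ->
  (forall xi, xi <> 0 -> Cexp (0, xi) <> tau -> exists F d, 0 < d /\
     forall w, Cmod (w - (0, xi))%C < d -> taylor 3 (fun h => F (w + h)%C) /\ (Re w <> 0 -> F w = Rz w (cls u))) ->
  multiplied (fun z => let b := (symbol s 1 z * symbol 1 tau z)%C in (b * (b * (b * b)))%C) u w ->
  cls w = zero.
Proof.
intros Hs Ht Hext (T & HT & Hw).
set (b := fun z => (symbol s 1 z * symbol 1 tau z)%C).
assert (Tb : forall z, taylor (V := C_NormedModule) 3 (fun h => b (z + h)%C)).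
{ intros z. apply taylor_mult; apply taylor_symbol; lra. }
destruct (buc_norm u) as (M & M0 & HM).
assert (Nu : norm (cls u) <= M) by (apply cls_norm, HM).
destruct (glue_extensions (fun z => Rz z (cls u)) (fun z => Re z <> 0 \/ b z <> 0%C)) as (G & HG & EG).
{ intros z Hz. destruct (Req_EM_T (Re z) 0) as [E|E].
  - destruct Hz as [Hz|Hz]; [contradiction|].
    assert (Ez : z = (0, Im z)) by (apply injective_projections; [exact E|reflexivity]).
    rewrite Ez. apply Hext.
    (* b vanishes at 0 through the factor e^{sz} - 1, so xi = 0 is excluded. *)
    + intros I0. apply Hz. unfold b, symbol. rewrite Ez, I0.
      replace (((0, 0) : C) * RtoC s)%C with (RtoC 0) by (apply injective_projections; simpl; ring).
      rewrite Cexp_0. ring.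
    + intros Et. apply Hz. unfold b, symbol. rewrite Ez.
      replace (((0, Im z) : C) * RtoC 1)%C with ((0, Im z) : C) by (apply injective_projections; simpl; ring).
      rewrite Et. ring.
  - exists (fun z => Rz z (cls u)), (Rabs (Re z)). split; [apply Rabs_pos_lt, E|]. intros v Hv.
    split; [|reflexivity]. apply taylor_Rz. intros E0.
    assert (Q := Re_le_Cmod (v - z)%C). replace (Re (v - z)%C) with (Re v - Re z) in Q by reflexivity.
    rewrite E0, Rminus_0_l, Rabs_Ropp in Q. lra. }
set (H := fun z => plus (scal (b z * (b z * (b z * b z)))%C (G z)) (T z)).
assert (EH : forall z, Re z <> 0 -> H z = Rz z (cls w)).
{ intros z Hz. unfold H. rewrite (EG z Hz), (Hw z Hz). reflexivity. }
assert (TH : forall z, taylor 3 (fun h => H (z + h)%C)).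
{ intros p. apply taylor_plus; [|apply HT].
  destruct (classic (Re p <> 0 \/ b p <> 0%C)) as [Hp|Hp].
  - apply taylor_scal; [|apply HG, Hp]. exact (taylor_mult 3 _ _ (Tb p) (taylor_mult 3 _ _ (Tb p) (taylor_mult 3 _ _ (Tb p) (Tb p)))).
  - apply not_or_and in Hp. destruct Hp as [Hp1 Hp2].
    assert (Rp : Re p = 0) by (apply NNPP; exact Hp1). assert (bp : b p = 0%C) by (apply NNPP; exact Hp2).
    destruct (symbol_isolated s 1 p Hs Cmod_1) as (r1 & Hr1 & I1).
    destruct (symbol_isolated 1 tau p Rlt_0_1 Ht) as (r2 & Hr2 & I2).
    set (r := Rmin r1 r2 / 2). assert (Rm : 0 < Rmin r1 r2) by (apply Rmin_pos; assumption).
    assert (L1 := Rmin_l r1 r2). assert (L2 := Rmin_r r1 r2).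
    assert (r0 : 0 < r) by (unfold r; lra).
    assert (PB := simple_pole_bound G p r M r0 Rp M0).
    assert (PB1 : forall v, 0 < Cmod (v - p)%C <= r -> taylor 3 (fun h => G (v + h)%C)).
    { intros v Hv. apply HG. right. unfold b. apply Cmult_neq_0; [apply I1|apply I2]; unfold r in Hv; lra. }
    assert (PB2 : forall v, Re v <> 0 -> norm (G v) <= M / Rabs (Re v)).
    { intros v Hv. rewrite (EG v Hv). eapply Rle_trans; [apply Rz_norm, Hv|].
      apply Rmult_le_compat_r; [left; apply Rinv_0_lt_compat, Rabs_pos_lt, Hv|exact Nu]. }
    specialize (PB PB1 PB2).
    destruct (small_power b p (Tb p) bp) as (L & d & Hd & L0 & HL).
    (* b^4 = O(|h|^4) against the pole bound 8 M / |h| leaves a multiple of |h|^3, so both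
       coefficients of the expansion are zero. *)
    apply (taylor_3_of_bound _ zero zero (L * L * L * L * (8 * M)) (Rmin d (r / 2))); [apply Rmin_pos; lra|].
    intros h Hh. assert (H1 := Rlt_le_trans _ _ _ Hh (Rmin_l _ _)). assert (H2 := Rlt_le_trans _ _ _ Hh (Rmin_r _ _)).
    replace (p + 0)%C with p by ring. rewrite bp.
    set (g := G (p + h)%C). set (bb := b (p + h)%C) in *. set (gp := G p).
    assert (ID : minus (scal (bb * (bb * (bb * bb)))%C g)
      (plus (scal (0 * (0 * (0 * 0)))%C gp) (plus (scal h zero) (scal (h * h)%C zero))) = scal (bb * (bb * (bb * bb)))%C g)
      by (vring (quotient_space X)).
    eapply Rle_trans; [right; exact (f_equal norm ID)|]. rewrite norm_scal_C, !Cmod_mult.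
    specialize (HL h H1). fold bb in HL. set (c := Cmod h) in *.
    assert (c0 : 0 <= c) by apply Cmod_ge_0. set (m := Cmod bb) in *. assert (m0 : 0 <= m) by apply Cmod_ge_0.
    assert (g0 : 0 <= norm g) by apply norm_ge_0.
    destruct (Req_EM_T c 0) as [Ec|Ec].
    + assert (m = 0) by (rewrite Ec in HL; lra). rewrite Ec. replace m with 0 by auto. lra.
    + assert (cp : 0 < c) by lra.
      assert (PBh : norm g <= 8 * M / c).
      { assert (Q := PB (p + h)%C). replace (p + h - p)%C with h in Q by ring. apply Q. fold c. lra. }
      apply Rle_trans with (L * c * (L * c * (L * c * (L * c))) * (8 * M / c)).
      * assert (mm : m * m <= L * c * (L * c)) by (apply Rmult_le_compat; auto).
        assert (m3 : m * (m * m) <= L * c * (L * c * (L * c))) by (apply Rmult_le_compat; auto; nra).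
        apply Rmult_le_compat; auto; [repeat apply Rmult_le_pos; auto|].
        apply Rmult_le_compat; auto. repeat apply Rmult_le_pos; auto.
      * right. field. lra. }
destruct (buc_norm w) as (N & N0 & HN).
assert (Nw : norm (cls w) <= N) by (apply cls_norm, HN).
assert (R1 : Re 1%C <> 0) by (simpl; lra).
assert (Z := liouville H N N0 TH).
apply (Rz_zero 1%C (cls w) R1). rewrite <- EH by exact R1. apply Z.
intros z Hz. rewrite (EH z Hz). eapply Rle_trans; [apply Rz_norm, Hz|].
apply Rmult_le_compat_r; [left; apply Rinv_0_lt_compat, Rabs_pos_lt, Hz|exact Nw].
Qed.

Lemma tdiff4_semisimple s tau (v : BUC X) : 0 <= s -> Cmod tau = 1 ->
  cls (tdiff s tau (tdiff s tau (tdiff s tau (tdiff s tau v)))) = zero -> cls (tdiff s tau v) = zero.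
Proof. intros Hs Ht H. do 3 (apply (tdiff_semisimple s tau _ Hs Ht) in H). exact H. Qed.

(* A class fixed by all translations is an eigenvector of D_tilde for 0. *)
Lemma fixed_class (p : BUC X) x : 0 < x -> (forall s, 0 < s -> cls (tdiff s 1 p) = zero) ->
  scal (RtoC x) (Rz (RtoC x) (cls p)) = cls p.
Proof.
intros Hx H. assert (Hz : Re (RtoC x) <> 0) by (simpl; lra).
destruct (Rz_ode_ex (RtoC x) p Hz) as (U & HU & EU).
set (V := buc_minus (buc_scal (RtoC x) U) p).
assert (HV : forall t, half_line t -> dv half_line U t (V t)).
{ intros t Ht. refine (dv_value _ _ _ _ _ _ (HU t Ht)). unfold V. rewrite buc_minusE. reflexivity. }
(* The resolvent commutes with translations, so U inherits vanishing increments, and [barbalat]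
   gives U' = x U - p -> 0. *)
assert (HS : forall s, 0 < s -> cls (tdiff s 1 U) = zero).
{ intros s Hs. assert (O : ode (RtoC x) (tdiff s 1 p) (tdiff s 1 U)).
  { intros t Ht. assert (Hts : half_line (t + s)) by (unfold half_line in *; lra).
    assert (S1 : dv half_line (fun y => U (y + s)) t (minus (scal (RtoC x) (U (t + s))) (p (t + s)))).
    { intros e He. destruct (HU (t + s) Hts e He) as (d & Hd & Hs'). exists d. split; [exact Hd|].
      intros y Hy Hyt. assert (H' := Hs' (y + s)). replace (y + s - (t + s)) with (y - t) in H' by ring.
      apply H'; [unfold half_line in *; lra|exact Hyt]. }
    assert (S2 := dv_minus _ _ _ _ _ _ S1 (dv_scal 1%C _ _ _ _ (HU t Ht))).
    refine (dv_ext _ _ _ _ _ _ _ (dv_value _ _ _ _ _ _ S2)).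
    - intros y _. rewrite tdiffE by lra. reflexivity.
    - rewrite tdiffE by lra. reflexivity.
    - rewrite !tdiffE by lra. vring X. }
  rewrite <- (Rz_ode _ _ _ Hz O), (H s Hs).
  exact (linear_zero _ (Rz_linear _)). }
assert (V0 : cls V = zero).
{ apply cls_zero_vanishing, vanishingE. apply (barbalat U V HV).
  intros h e Hh He. assert (Q := HS h Hh). apply cls_zero_vanishing in Q. rewrite vanishingE in Q.
  destruct (Q e He) as [A HA]. exists A. intros t Ht. specialize (HA t Ht). rewrite tdiffE in HA by lra.
  eapply Rle_lt_trans; [|exact HA]. right. f_equal. vring X. }
rewrite EU. unfold V in V0. rewrite <- cls_minus, <- cls_scal in V0.
transitivity (plus (minus (scal (RtoC x) (cls U)) (cls p)) (cls p)).
- generalize (cls U) (cls p). intros. vring (quotient_space X).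
- eapply eq_trans; [exact (f_equal (fun v => plus v (cls p)) V0)|]. generalize (cls p). intros. vring (quotient_space X).
Qed.

(** The point xi = 0 is exempt from the extension hypothesis since S_s - 1 removes whatever
    singularity sits there. In the final limit at 0, for tau = 1 the symbol e^x - 1 = O(x)
    compensates |hat u (x)| <= M / x; for other tau the third hypothesis does this. *)
Theorem spectral_criterion (u : BUC X) (tau : C) : Cmod tau = 1 ->
  (forall xi, xi <> 0 -> Cexp (0, xi) <> tau -> exists F d, 0 < d /\
     forall w, Cmod (w - (0, xi))%C < d -> taylor 3 (fun h => F (w + h)%C) /\ (Re w <> 0 -> F w = Rz w (cls u))) ->
  (tau <> 1%C -> forall e, 0 < e -> exists d, 0 < d /\
     forall x, 0 < x < d -> x * norm (Rz (RtoC x) (cls u)) < e) ->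
  cls (tdiff 1 tau u) = zero.
Proof.
intros Ht Hext H0.
assert (Hfix : forall s, 0 < s -> cls (tdiff s 1 (tdiff 1 tau u)) = zero).
{ intros s Hs. assert (Hs' : 0 <= s) by lra. assert (H1 : 0 <= 1) by lra.
  set (p4 := tdiff 1 tau (tdiff 1 tau (tdiff 1 tau (tdiff 1 tau u)))).
  assert (W : cls (tdiff s 1 (tdiff s 1 (tdiff s 1 (tdiff s 1 p4)))) = zero).
  { apply (multiplied_vanishes u _ s tau Hs Ht Hext).
    assert (Q := multiplied_refl u).
    do 4 apply (multiplied_tdiff _ _ _ 1 tau H1) in Q.
    do 4 apply (multiplied_tdiff _ _ _ s 1 Hs') in Q.
    destruct Q as (T & HT & HQ). exists T. split; [exact HT|]. intros z Hz.
    eapply eq_trans; [exact (HQ z Hz)|]. apply f_equal2; [|reflexivity].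
    cbv zeta. generalize (symbol s 1 z) (symbol 1 tau z) (Rz z (cls u)). intros. vring (quotient_space X). }
  apply (tdiff4_semisimple s 1 p4 Hs' Cmod_1) in W.
  (* Moving S_s - 1 innermost by commutation exposes the fourth power of S_1 - tau, to which
     semisimplicity applies in turn. *)
  assert (C1 : cls (tdiff 1 tau (tdiff 1 tau (tdiff 1 tau (tdiff 1 tau (tdiff s 1 u))))) = zero).
  { rewrite <- W. unfold p4. symmetry.
    rewrite (tdiff_comm s 1 1 tau _ Hs' H1). apply cls_tdiff; [exact H1|].
    rewrite (tdiff_comm s 1 1 tau _ Hs' H1). apply cls_tdiff; [exact H1|].
    rewrite (tdiff_comm s 1 1 tau _ Hs' H1). apply cls_tdiff; [exact H1|].
    apply (tdiff_comm s 1 1 tau _ Hs' H1). }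
  apply (tdiff4_semisimple 1 tau _ H1 Ht) in C1.
  rewrite (tdiff_comm s 1 1 tau u Hs' H1). exact C1. }
set (p := tdiff 1 tau u) in *.
destruct (buc_norm u) as (M & M0 & HM).
assert (Nu : norm (cls u) <= M) by (apply cls_norm, HM).
destruct (window_exists 1 u ltac:(lra)) as (E & HE & _).
apply norm_eq_zero. apply Rle_antisym; [|apply norm_ge_0].
apply le_epsilon. intros e He. rewrite Rplus_0_l.
assert (G0 : exists d, 0 < d /\ forall x, 0 < x < d ->
   x * (Cmod (symbol 1 tau (RtoC x)) * norm (Rz (RtoC x) (cls u))) <= e / 2).
{ destruct (classic (tau = 1%C)) as [->|Hne].
  - destruct (small_power (symbol 1 1) 0%C (taylor_symbol 1 1 0%C ltac:(lra))) as (L & d & Hd & L0 & HL).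
    { unfold symbol. replace (0 * RtoC 1)%C with (RtoC 0) by ring. rewrite Cexp_0. ring. }
    exists (Rmin d (e / (2 * (L * M + 1)))).
    assert (LM : 0 <= L * M) by nra.
    split; [apply Rmin_pos; [exact Hd|apply Rdiv_lt_0_compat; lra]|].
    intros x [x0 Hx]. assert (X1 := Rlt_le_trans _ _ _ Hx (Rmin_l _ _)). assert (X2 := Rlt_le_trans _ _ _ Hx (Rmin_r _ _)).
    assert (Cx : Cmod (RtoC x) = x) by (rewrite Cmod_R, Rabs_pos_eq; lra).
    specialize (HL (RtoC x)). rewrite Cx in HL. specialize (HL X1). replace (0 + RtoC x)%C with (RtoC x) in HL by ring.
    assert (RN := Rz_norm (RtoC x) (cls u)). simpl Re in RN. rewrite Rabs_pos_eq in RN by lra. specialize (RN ltac:(lra)).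
    assert (RN2 : norm (Rz (RtoC x) (cls u)) <= M / x).
    { eapply Rle_trans; [exact RN|]. apply Rmult_le_compat_r; [left; apply Rinv_0_lt_compat; exact x0|exact Nu]. }
    apply Rle_trans with (x * (L * x * (M / x))).
    + apply Rmult_le_compat_l; [lra|]. apply Rmult_le_compat; [apply Cmod_ge_0|apply norm_ge_0|exact HL|exact RN2].
    + replace (x * (L * x * (M / x))) with (L * M * x) by (field; lra).
      apply Rle_trans with ((L * M + 1) * (e / (2 * (L * M + 1)))); [apply Rmult_le_compat; lra|].
      right. field. lra.
  - destruct (H0 Hne (e / (2 * (exp 1 + 1)))) as (d & Hd & Hx0).
    { apply Rdiv_lt_0_compat; [exact He|]. assert (P := exp_pos 1). lra. }
    exists (Rmin d 1). split; [apply Rmin_pos; lra|]. intros x [x0 Hx].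
    assert (X1 := Rlt_le_trans _ _ _ Hx (Rmin_l _ _)). assert (X2 := Rlt_le_trans _ _ _ Hx (Rmin_r _ _)).
    assert (S1 : Cmod (symbol 1 tau (RtoC x)) <= exp 1 + 1).
    { unfold symbol. eapply Rle_trans; [apply Cmod_triangle|]. rewrite Cmod_opp, Ht, Cmod_Cexp.
      apply Rplus_le_compat_r. left. apply exp_increasing. unfold Re; simpl. lra. }
    assert (P := exp_pos 1). specialize (Hx0 x (conj x0 X1)).
    assert (n0 := norm_ge_0 (Rz (RtoC x) (cls u))). set (n := norm (Rz (RtoC x) (cls u))) in *.
    apply Rle_trans with ((exp 1 + 1) * (x * n)).
    + replace (x * (Cmod (symbol 1 tau (RtoC x)) * n)) with (Cmod (symbol 1 tau (RtoC x)) * (x * n)) by ring.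
      apply Rmult_le_compat_r; [nra|exact S1].
    + apply Rle_trans with ((exp 1 + 1) * (e / (2 * (exp 1 + 1)))); [apply Rmult_le_compat_l; lra|].
      right. field. lra. }
destruct G0 as (d & Hd & HG0).
(* Bound for the integral over the window of length 1: for 0 < x < 1 its kernel is at most e. *)
set (K := exp 1 * M * 1). assert (K0 : 0 <= K). { unfold K. assert (P := exp_pos 1). nra. }
set (x := Rmin (Rmin d 1) (e / (2 * (K + 1))) / 2).
assert (P0 : 0 < e / (2 * (K + 1))) by (apply Rdiv_lt_0_compat; lra).
assert (P1 : 0 < Rmin (Rmin d 1) (e / (2 * (K + 1)))) by (repeat apply Rmin_pos; lra).
assert (L1 := Rmin_l (Rmin d 1) (e / (2 * (K + 1)))). assert (L2 := Rmin_r (Rmin d 1) (e / (2 * (K + 1)))).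
assert (L3 := Rmin_l d 1). assert (L4 := Rmin_r d 1).
assert (x0 : 0 < x) by (unfold x; lra). assert (xd : x < d) by (unfold x; lra).
assert (x1 : x < 1) by (unfold x; lra). assert (xe : x <= e / (2 * (K + 1))) by (unfold x; lra).
specialize (HG0 x (conj x0 xd)).
assert (Hz : Re (RtoC x) <> 0) by (simpl; lra).
rewrite <- (fixed_class p x x0 Hfix). unfold p.
rewrite (Rz_tdiff (RtoC x) 1 tau u (E (RtoC x)) Hz ltac:(lra) (HE _)).
rewrite norm_scal_C, Cmod_R, Rabs_pos_eq by lra.
assert (NE : norm (cls (E (RtoC x))) <= K).
{ apply cls_norm. intros t Htt. rewrite HE. apply wint_norm; [lra|exact Htt|apply ker_cont| |exact HM].
  intros y Hy. eapply Rle_trans; [apply ker_bound, Hy|]. rewrite Cmod_R, Rabs_pos_eq by lra.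
  left. apply exp_increasing. lra. }
assert (NN : norm (minus (scal (Cexp (RtoC x * RtoC 1) - tau)%C (Rz (RtoC x) (cls u))) (cls (E (RtoC x))))
   <= Cmod (symbol 1 tau (RtoC x)) * norm (Rz (RtoC x) (cls u)) + K).
{ eapply Rle_trans; [apply norm_minus_le|]. rewrite norm_scal_C. unfold symbol. lra. }
apply Rle_trans with (x * (Cmod (symbol 1 tau (RtoC x)) * norm (Rz (RtoC x) (cls u)) + K)).
- apply Rmult_le_compat_l; lra.
- assert (xK : x * K <= e / 2).
  { apply Rle_trans with (e / (2 * (K + 1)) * (K + 1)); [apply Rmult_le_compat; lra|]. right. field. lra. }
  rewrite Rmult_plus_distr_l. lra.
Qed.
End Spectral.

(** * Integrals over the line and complex powers *)

Section JointContinuity.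
Context {X : CBanach}.

Definition cont2 (K : R -> R -> X) : Prop :=
  forall x y e, 0 < e -> exists d, 0 < d /\
    forall x' y', Rabs (x' - x) < d -> Rabs (y' - y) < d -> norm (minus (K x' y') (K x y)) < e.

Lemma cont2_l K y : cont2 K -> cont (fun x => K x y).
Proof.
intros H x e He. destruct (H x y e He) as (d & Hd & Hs). exists d. split; [exact Hd|].
intros x' Hx. apply Hs; [exact Hx|]. rewrite Rminus_diag, Rabs_R0. exact Hd.
Qed.

Lemma cont2_flip K : cont2 K -> cont2 (fun x y => K y x).
Proof.
intros H x y e He. destruct (H y x e He) as (d & Hd & Hs). exists d. split; auto.
Qed.

Lemma cont2_r K x : cont2 K -> cont (K x).
Proof. intros H. exact (cont2_l (fun a b => K b a) x (cont2_flip K H)). Qed.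

(** Compactness of [c, d] makes the modulus in the first variable uniform in the second. *)
Lemma cont2_tube K x c d e : cont2 K -> 0 < e ->
  exists dl, 0 < dl /\ forall x' y, c <= y <= d -> Rabs (x' - x) < dl -> norm (minus (K x' y) (K x y)) < e.
Proof.
intros H He.
assert (H2 : forall y, exists dl : posreal, forall x' y', Rabs (x' - x) < dl -> Rabs (y' - y) < dl ->
   norm (minus (K x' y') (K x y)) < e / 2).
{ intros y. destruct (H x y (e / 2)) as (dl & Hdl & Hs); [lra|]. exists (mkposreal dl Hdl). exact Hs. }
set (dl := fun y => proj1_sig (constructive_indefinite_description _ (H2 y))).
destruct (compactness_value_1d c d dl) as (D & HD). exists D. split; [apply cond_pos|].
(* [compactness_value_1d] yields its cover under a double negation, so the strict inequality is
   proved by contradiction. *)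
intros x' y Hy Hx. apply Rnot_le_lt. intros L. apply (HD y Hy). intros (t & Ht & C1 & C2).
unfold dl in C1, C2. destruct (constructive_indefinite_description _ _) as (d0 & Hd0). simpl in C1, C2.
assert (A1 := Hd0 x' y ltac:(lra) C1).
assert (A2 := Hd0 x y ltac:(rewrite Rminus_diag, Rabs_R0; apply cond_pos) C1).
assert (ID : minus (K x' y) (K x y) = minus (minus (K x' y) (K x t)) (minus (K x y) (K x t))) by (vring X).
assert (N : norm (minus (K x' y) (K x y)) < e).
{ eapply Rle_lt_trans; [right; exact (f_equal norm ID)|].
  eapply Rle_lt_trans; [apply norm_minus_X|]. lra. }
lra.
Qed.

Lemma Int_minus f g a b : a <= b -> cont f -> cont g ->
  Int (fun t => minus (f t) (g t)) a b = minus (Int (X := X) f a b) (Int g a b).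
Proof.
intros Hab Hf Hg.
assert (E := Int_plus f (fun t => scal (RtoC (-1)) (g t)) a b Hf
  (cont_scal (fun _ => RtoC (-1)) g (cont_const (X := CB) (RtoC (-1))) Hg)).
rewrite Int_scal in E by assumption.
transitivity (plus (Int f a b) (scal (RtoC (-1)) (Int g a b))); [|vring X].
eapply eq_trans; [|exact E]. apply Int_ext; [exact Hab|]. intros; vring X.
Qed.

Lemma cont_minus (f g : R -> X) : cont f -> cont g -> cont (fun t => minus (f t) (g t)).
Proof.
intros Hf Hg.
assert (Q := cont_plus f (fun t => scal (RtoC (-1)) (g t)) Hf
  (cont_scal (fun _ => RtoC (-1)) g (cont_const (X := CB) (RtoC (-1))) Hg)).
intros t e He. destruct (Q t e He) as (d & Hd & Hs). exists d. split; [exact Hd|].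
intros s Hst. eapply Rle_lt_trans; [|exact (Hs s Hst)]. right. f_equal. vring X.
Qed.

Lemma Int_param_tube K x c d e : c <= d -> cont2 K -> 0 < e ->
  exists dl, 0 < dl /\ forall x', Rabs (x' - x) < dl ->
    norm (minus (Int (K x') c d) (Int (K x) c d)) <= e * (d - c).
Proof.
intros Hcd H He. destruct (cont2_tube K x c d e H He) as (dl & Hdl & Hs).
exists dl. split; [exact Hdl|]. intros x' Hx.
rewrite <- Int_minus by (auto; apply cont2_r, H).
apply Int_norm; [exact Hcd|apply cont_minus; apply cont2_r, H|].
intros y Hy. left. auto.
Qed.

Lemma cont_Int_param K c d : c <= d -> cont2 K -> cont (fun x => Int (K x) c d).
Proof.
intros Hcd H x e He. destruct (Int_param_tube K x c d (e / (d - c + 1)) Hcd H) as (dl & Hdl & Hs).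
{ apply Rdiv_lt_0_compat; lra. }
exists dl. split; [exact Hdl|]. intros x' Hx. eapply Rle_lt_trans; [apply Hs, Hx|].
apply Rlt_le_trans with (e / (d - c + 1) * (d - c + 1)).
- apply Rmult_lt_compat_l; [apply Rdiv_lt_0_compat; lra|lra].
- right. field. lra.
Qed.

(** As functions of the upper limit s of the x-integral both sides vanish at s = a and have
    derivative the integral of K s over [c, d]. *)
Lemma Int_fubini K a b c d : a <= b -> c <= d -> cont2 K ->
  Int (fun x => Int (K x) c d) a b = Int (fun y => Int (fun x => K x y) a b) c d.
Proof.
intros Hab Hcd H.
assert (H' := cont2_flip K H).
assert (C1 : cont (fun x => Int (K x) c d)) by (apply cont_Int_param; assumption).
assert (CI : forall p q, p <= q -> cont (fun y => Int (fun x => K x y) p q)).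
{ intros p q Hpq. exact (cont_Int_param (fun y x => K x y) p q Hpq H'). }
assert (E : minus (Int (fun y => Int (fun x => K x y) a b) c d) (Int (fun y => Int (fun x => K x y) a a) c d)
  = Int (fun x => Int (K x) c d) a b).
{ apply (dv_FTC (fun s => a <= s) (fun s => Int (fun y => Int (fun x => K x y) a s) c d)); auto; [intros; lra|].
  intros t Ht e He.
  destruct (cont2_tube K t c d (e / (d - c + 1)) H) as (dl & Hdl & Hs); [apply Rdiv_lt_0_compat; lra|].
  exists dl. split; [exact Hdl|]. intros s Ds Hst.
  (* Stated for an ordered pair p <= q near t, so that it serves increments of either sign. *)
  assert (small : forall p q, a <= p <= q -> (forall x, p <= x <= q -> Rabs (x - t) < dl) ->
     norm (minus (minus (Int (fun y => Int (fun x => K x y) a q) c d) (Int (fun y => Int (fun x => K x y) a p) c d))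
       (scal (RtoC (q - p)) (Int (K t) c d))) <= e * (q - p)).
  { intros p q Hpq Hx.
    assert (cq : cont (fun y => Int (fun x => K x y) p q)) by (apply CI; lra).
    assert (ID : minus (minus (Int (fun y => Int (fun x => K x y) a q) c d) (Int (fun y => Int (fun x => K x y) a p) c d))
       (scal (RtoC (q - p)) (Int (K t) c d)) =
       Int (fun y => minus (Int (fun x => K x y) p q) (scal (RtoC (q - p)) (K t y))) c d).
    { rewrite Int_minus; [|exact Hcd|exact cq|apply (cont_scal (fun _ => RtoC (q - p))); [apply (cont_const (X := CB))|apply cont2_r, H]].
      rewrite Int_scal by (auto; apply cont2_r, H).
      apply f_equal2; [|reflexivity].
      rewrite <- Int_minus; [|exact Hcd|apply CI; lra|apply CI; lra].
      apply Int_ext; [exact Hcd|]. intros y _.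
      rewrite <- (Int_Chasles (fun x => K x y) a p q (cont2_l K y H)). vring X. }
    eapply Rle_trans; [right; exact (f_equal norm ID)|].
    apply Rle_trans with (e / (d - c + 1) * (q - p) * (d - c)).
    - apply Int_norm; [exact Hcd| |].
      + apply cont_minus; [exact cq|].
        apply (cont_scal (fun _ => RtoC (q - p))); [apply (cont_const (X := CB))|apply cont2_r, H].
      + intros y Hy. rewrite <- Int_minus_const by (apply (cont2_l K y H)).
        apply Int_norm; [lra|apply cont_minus_const, (cont2_l K y H)|].
        intros x Hx'. left. apply Hs; auto.
    - apply Rle_trans with (e / (d - c + 1) * (q - p) * (d - c + 1)).
      + apply Rmult_le_compat_l; [|lra]. apply Rmult_le_pos; [|lra]. left. apply Rdiv_lt_0_compat; lra.
      + right. field. lra. }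
  destruct (Rle_dec t s) as [L|L].
  - rewrite (Rabs_pos_eq (s - t)) by lra. apply small; [lra|]. intros x Hx. apply Rabs_lt_between in Hst. apply Rabs_lt_between. lra.
  - assert (Q := small s t ltac:(lra) ltac:(intros x Hx; apply Rabs_lt_between in Hst; apply Rabs_lt_between; lra)).
    rewrite (Rabs_left (s - t)) by lra. replace (- (s - t)) with (t - s) by ring.
    eapply Rle_trans; [|exact Q]. right. rewrite norm_sym.
    set (A := Int (fun y => Int (fun x => K x y) a t) c d). set (B := Int (fun y => Int (fun x => K x y) a s) c d).
    f_equal. rewrite !RtoC_minus. vring X. }
rewrite <- E.
assert (Z : Int (fun y => Int (fun x => K x y) a a) c d = zero).
{ rewrite (Int_ext _ (fun _ => zero) c d Hcd); [rewrite Int_const; vring X|]. intros; apply Int_point. }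
rewrite Z. vring X.
Qed.

Lemma cont2_scal (k : R -> R -> C) (K : R -> R -> X) :
  (forall x y e, 0 < e -> exists d, 0 < d /\ forall x' y', Rabs (x' - x) < d -> Rabs (y' - y) < d ->
     Cmod (k x' y' - k x y)%C < e) -> cont2 K -> cont2 (fun x y => scal (k x y) (K x y)).
Proof.
intros Hk Hf x y e He.
set (n1 := norm (K x y) + 1). set (n2 := Cmod (k x y)).
assert (P1 : 0 < n1) by (unfold n1; assert (Q := norm_ge_0 (K x y)); lra).
assert (P2 : 0 <= n2) by apply Cmod_ge_0.
destruct (Hk x y (e / (2 * n1))) as (d & Hd & H); [apply Rdiv_lt_0_compat; lra|].
destruct (Hf x y (Rmin 1 (e / (2 * (n2 + 1))))) as (d' & Hd' & H').
{ apply Rmin_pos; [lra|apply Rdiv_lt_0_compat; lra]. }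
exists (Rmin d d'). split; [apply Rmin_pos; assumption|]. intros x' y' Hx Hy.
specialize (H x' y' (Rlt_le_trans _ _ _ Hx (Rmin_l _ _)) (Rlt_le_trans _ _ _ Hy (Rmin_l _ _))).
specialize (H' x' y' (Rlt_le_trans _ _ _ Hx (Rmin_r _ _)) (Rlt_le_trans _ _ _ Hy (Rmin_r _ _))).
set (a := (k x' y' - k x y)%C) in *. set (u := minus (K x' y') (K x y)) in *.
assert (ID : minus (scal (k x' y') (K x' y')) (scal (k x y) (K x y)) = plus (scal a (K x' y')) (scal (k x y) u)).
{ unfold a, u. generalize (k x' y') (k x y). intros. vring X. }
assert (N1 : norm (K x' y') <= n1).
{ replace (K x' y') with (plus (K x y) u) by (unfold u; vring X).
  eapply Rle_trans; [apply norm_tri|]. unfold n1. assert (Q := Rmin_l 1 (e / (2 * (n2 + 1)))). lra. }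
eapply Rle_lt_trans; [right; exact (f_equal norm ID)|].
eapply Rle_lt_trans; [apply norm_tri|]. rewrite !norm_scal_X. fold n2.
assert (Q := Rmin_r 1 (e / (2 * (n2 + 1)))).
assert (B1 : Cmod a * norm (K x' y') <= e / (2 * n1) * n1).
{ apply Rmult_le_compat; [apply Cmod_ge_0|apply norm_ge_0|lra|exact N1]. }
assert (B2 : n2 * norm u <= n2 * (e / (2 * (n2 + 1)))) by (apply Rmult_le_compat_l; lra).
assert (B3 : e / (2 * n1) * n1 = e / 2) by (field; lra).
assert (B4 : n2 * (e / (2 * (n2 + 1))) < e / 2).
{ apply Rlt_le_trans with ((n2 + 1) * (e / (2 * (n2 + 1)))).
  - apply Rmult_lt_compat_r; [apply Rdiv_lt_0_compat; lra|lra].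
  - right. field. lra. }
lra.
Qed.

Lemma cont2_of_l (f : R -> X) : cont f -> cont2 (fun x _ => f x).
Proof. intros H x y e He. destruct (H x e He) as (d & Hd & Hs). exists d. split; auto. Qed.
Lemma cont2_of_r (f : R -> X) : cont f -> cont2 (fun _ y => f y).
Proof. intros H x y e He. destruct (H y e He) as (d & Hd & Hs). exists d. split; auto. Qed.
End JointContinuity.

Lemma cont2_R (g : R -> R -> R) : (forall p : R * R, continuous (fun q : R * R => g (fst q) (snd q)) p) ->
  cont2 (X := CB) (fun x y => RtoC (g x y)).
Proof.
intros H x y e He.
destruct (proj1 (filterlim_locally_ball_norm (K := R_AbsRing) (U := R_NormedModule) (F := locally (x, y)) _ (g x y))
  (H (x, y)) (mkposreal e He)) as [d Hd].
exists d. split; [apply cond_pos|]. intros x' y' Hx Hy.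
assert (Q := Hd (x', y') (conj Hx Hy)). change (Cmod (RtoC (g x' y') - RtoC (g x y))%C < e).
rewrite <- RtoC_minus, Cmod_R. exact Q.
Qed.

Section Improper.
Context {X : CBanach}.

(* Both truncation points go to infinity independently; [II] is junk when there is no limit. *)
Definition is_II (phi : R -> X) (l : X) : Prop :=
  forall e, 0 < e -> exists A, 0 < A /\ forall a b, a <= - A -> A <= b -> norm (minus (Int phi a b) l) <= e.

Definition II (phi : R -> X) : X := epsilon (inhabits zero) (is_II phi).

Lemma is_II_unique phi l l' : is_II phi l -> is_II phi l' -> l = l'.
Proof.
intros H H'. apply minus_zero_eq. apply le_epsilon. intros e He. rewrite Rplus_0_l.
destruct (H (e / 2)) as (A & HA & HA'); [lra|]. destruct (H' (e / 2)) as (B & HB & HB'); [lra|].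
set (c := Rmax A B). assert (c1 := Rmax_l A B). assert (c2 := Rmax_r A B). fold c in c1, c2.
assert (Q := HA' (- c) c ltac:(lra) ltac:(lra)). assert (Q' := HB' (- c) c ltac:(lra) ltac:(lra)).
assert (ID : minus l l' = minus (minus (Int phi (- c) c) l') (minus (Int phi (- c) c) l)) by (vring X).
eapply Rle_trans; [right; exact (f_equal norm ID)|]. eapply Rle_trans; [apply norm_minus_X|]. lra.
Qed.

Lemma II_is phi l : is_II phi l -> II phi = l.
Proof.
intros H. apply (is_II_unique phi); [|exact H]. unfold II. apply epsilon_spec. eauto.
Qed.

Lemma is_II_ext f g l : (forall x, f x = g x) -> is_II f l -> is_II g l.
Proof. intros E H. replace g with f; [exact H|]. apply functional_extensionality, E. Qed.

Lemma is_II_plus f g l m : cont f -> cont g -> is_II f l -> is_II g m -> is_II (fun x => plus (f x) (g x)) (plus l m).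
Proof.
intros Cf Cg H H' e He. destruct (H (e / 2)) as (A & HA & HA'); [lra|]. destruct (H' (e / 2)) as (B & HB & HB'); [lra|].
exists (Rmax A B). assert (c1 := Rmax_l A B). assert (c2 := Rmax_r A B). split; [lra|]. intros a b Ha Hb.
rewrite (Int_plus f g a b Cf Cg).
assert (Q := HA' a b ltac:(lra) ltac:(lra)). assert (Q' := HB' a b ltac:(lra) ltac:(lra)).
assert (ID : minus (plus (Int f a b) (Int g a b)) (plus l m) = plus (minus (Int f a b) l) (minus (Int g a b) m)) by (vring X).
eapply Rle_trans; [right; exact (f_equal norm ID)|]. eapply Rle_trans; [apply norm_tri|]. lra.
Qed.

Lemma is_II_shift f l c : cont f -> is_II f l -> is_II (fun x => f (x + c)) l.
Proof.
intros Cf H e He. destruct (H e He) as (A & HA & HA'). exists (A + Rabs c).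
assert (P := Rabs_pos c). assert (P1 := Rle_abs c). assert (P2 := Rle_abs (- c)). rewrite Rabs_Ropp in P2.
split; [lra|]. intros a b Ha Hb. rewrite Int_shift by exact Cf. apply HA'; lra.
Qed.
End Improper.

Section ImproperLinear.
Context {X Z : CBanach}.
Lemma is_II_linear (L : X -> Z) K f l :
  (forall x y, L (minus x y) = minus (L x) (L y)) -> (forall (c : C) x, L (scal c x) = scal c (L x)) ->
  (forall x, norm (L x) <= K * norm x) -> cont f -> is_II f l -> is_II (fun x => L (f x)) (L l).
Proof.
intros H1 H2 H3 Cf H e He. assert (P := Rle_abs K). assert (P' := Rabs_pos K).
destruct (H (e / (Rabs K + 1))) as (A & HA & HA'); [apply Rdiv_lt_0_compat; lra|].
exists A. split; [exact HA|]. intros a b Ha Hb.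
rewrite <- (Int_linear L K H1 H2 H3 f a b ltac:(lra) Cf), <- H1.
eapply Rle_trans; [apply H3|]. specialize (HA' a b Ha Hb).
set (n := norm _) in *. assert (N0 : 0 <= n) by apply norm_ge_0.
apply Rle_trans with ((Rabs K + 1) * n); [nra|].
apply Rle_trans with ((Rabs K + 1) * (e / (Rabs K + 1))).
- apply Rmult_le_compat_l; lra.
- right. field. lra.
Qed.
End ImproperLinear.

Lemma is_II_scal {X : CBanach} (c : C) (f : R -> X) l : cont f -> is_II f l -> is_II (fun x => scal c (f x)) (scal c l).
Proof.
intros. apply (is_II_linear (fun x => scal c x) (Cmod c)); auto.
- intros; vring X.
- intros; vring X.
- intros x. right. apply norm_scal_X.
Qed.

Lemma is_II_scal_r {X : CBanach} (v : X) (k : R -> C) (l : C) : cont (X := CB) k -> is_II (X := CB) k l ->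
  is_II (fun x => scal (k x) v) (scal l v).
Proof.
intros. apply (is_II_linear (X := CB) (fun c : C => scal c v) (norm v)); auto.
- intros x y. change (minus x y) with (x - y)%C. vring X.
- intros c x. change (scal c x) with (c * x)%C. vring X.
- intros c. rewrite Rmult_comm. right. exact (norm_scal_X c v).
Qed.

Lemma Int_scal_r {X : CBanach} (v : X) (k : R -> C) a b : a <= b -> cont (X := CB) k ->
  Int (fun x => scal (k x) v) a b = scal (Int (X := CB) k a b) v.
Proof.
intros Hab Hk. symmetry. apply (Int_linear (X := CB) (fun c : C => scal c v) (norm v)); auto.
- intros x y. change (minus x y) with (x - y)%C. vring X.
- intros c x. change (scal c x) with (c * x)%C. vring X.
- intros c. rewrite Rmult_comm. right. exact (norm_scal_X c v).
Qed.

Lemma Int_RtoC (f : R -> R) a b : a <= b -> (forall t, continuous f t) ->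
  Int (X := CB) (fun t => RtoC (f t)) a b = RtoC (RInt f a b).
Proof.
intros Hab Hf.
assert (E := dv_FTC (X := CB) (fun _ => True) (fun t => RtoC (RInt f a t)) (fun t => RtoC (f t)) a b Hab
  (fun _ _ => I) (cont_of_R f Hf)).
assert (E0 : RInt f a a = 0) by exact (RInt_point (V := R_CompleteNormedModule) a f).
cbv beta in E. rewrite <- E.
- change (RtoC (RInt f a b) - RtoC (RInt f a a) = RtoC (RInt f a b))%C. rewrite E0. ring.
- intros t Ht. apply (dv_pair _ (fun t => RInt f a t) (fun _ => 0) t (f t) 0).
  + apply (is_derive_RInt (V := R_NormedModule) f (fun t => RInt f a t) a t); [|apply Hf].
    apply filter_forall. intros x. apply (RInt_correct (V := R_CompleteNormedModule)).
    apply (ex_RInt_continuous (V := R_CompleteNormedModule)). intros; apply Hf.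
  + apply (is_derive_const (K := R_AbsRing) (V := R_NormedModule)).
Qed.

Lemma continuous_ex_RInt (f : R -> R) a b : (forall t, continuous f t) -> ex_RInt f a b.
Proof. intros H. apply (ex_RInt_continuous (V := R_CompleteNormedModule)). intros; apply H. Qed.

Lemma is_II_le (f g : R -> R) (l m : C) : (forall t, continuous f t) -> (forall t, continuous g t) ->
  (forall x, f x <= g x) ->
  is_II (X := CB) (fun x => RtoC (f x)) l -> is_II (X := CB) (fun x => RtoC (g x)) m -> Re l <= Re m.
Proof.
intros Cf Cg Hle Hl Hm. apply le_epsilon. intros e He.
destruct (Hl (e / 2)) as (A & HA & HA'); [lra|]. destruct (Hm (e / 2)) as (B & HB & HB'); [lra|].
assert (c1 := Rmax_l A B). assert (c2 := Rmax_r A B). set (c := Rmax A B) in *.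
specialize (HA' (- c) c ltac:(lra) ltac:(lra)). specialize (HB' (- c) c ltac:(lra) ltac:(lra)).
rewrite Int_RtoC in HA' by (auto; lra). rewrite Int_RtoC in HB' by (auto; lra).
change (Cmod (RtoC (RInt f (- c) c) - l)%C <= e / 2) in HA'.
change (Cmod (RtoC (RInt g (- c) c) - m)%C <= e / 2) in HB'.
assert (Q1 := Re_le_Cmod (RtoC (RInt f (- c) c) - l)%C). assert (Q2 := Re_le_Cmod (RtoC (RInt g (- c) c) - m)%C).
replace (Re (RtoC (RInt f (- c) c) - l)%C) with (RInt f (- c) c - Re l) in Q1 by reflexivity.
replace (Re (RtoC (RInt g (- c) c) - m)%C) with (RInt g (- c) c - Re m) in Q2 by reflexivity.
assert (L : RInt f (- c) c <= RInt g (- c) c).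
{ apply RInt_le; [lra| | |auto]; apply continuous_ex_RInt; assumption. }
assert (Q3 := Rle_trans _ _ _ Q1 HA'). assert (Q4 := Rle_trans _ _ _ Q2 HB').
apply Rabs_le_between in Q3, Q4. lra.
Qed.

(** * Integrals dominated by r^(al-1) / (1 + r) *)

Section Weighted.
Variable al : R.
Hypothesis Hal : 0 < al < 1.

(** With r = e^x this is the density r^(al-1) / (1 + r) dr on (0, oo); it decays at least like
    e^{-bet |x|} at both ends. *)
Definition wgt (x : R) : R := exp (al * x) / (1 + exp x).
Definition bet : R := Rmin al (1 - al).

Lemma bet_pos : 0 < bet.
Proof. unfold bet. apply Rmin_pos; lra. Qed.

Lemma exp_le a b : a <= b -> exp a <= exp b.
Proof. intros [L| ->]; [left; apply exp_increasing, L|right; reflexivity]. Qed.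

Lemma wgt_pos x : 0 < wgt x.
Proof. unfold wgt. assert (P := exp_pos x). apply Rdiv_lt_0_compat; [apply exp_pos|lra]. Qed.

Lemma wgt_right x : 0 <= x -> wgt x <= exp (- bet * x).
Proof.
intros Hx. unfold wgt. assert (P := exp_pos x).
apply Rle_trans with (exp (al * x) / exp x).
- apply Rmult_le_compat_l; [left; apply exp_pos|]. apply Rinv_le_contravar; lra.
- unfold Rdiv. rewrite <- exp_Ropp, <- exp_plus. apply exp_le.
  assert (Q := Rmin_r al (1 - al)). fold bet in Q. nra.
Qed.

Lemma wgt_left x : x <= 0 -> wgt x <= exp (bet * x).
Proof.
intros Hx. unfold wgt. assert (P := exp_pos x).
apply Rle_trans with (exp (al * x) / 1).
- apply Rmult_le_compat_l; [left; apply exp_pos|]. apply Rinv_le_contravar; lra.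
- unfold Rdiv. rewrite Rinv_1, Rmult_1_r. apply exp_le.
  assert (Q := Rmin_l al (1 - al)). fold bet in Q. nra.
Qed.

Lemma exp_cont c x : continuous (fun y => exp (c * y)) x.
Proof. apply (ex_derive_continuous (K := R_AbsRing) (V := R_NormedModule)). auto_derive; auto. Qed.

Lemma exp_RInt c C0 a b : c <> 0 -> a <= b ->
  is_RInt (fun x => C0 * exp (c * x)) a b (C0 / c * (exp (c * b) - exp (c * a))).
Proof.
intros Hc Hab.
assert (IR : is_RInt (fun x => C0 * exp (c * x)) a b (minus (C0 / c * exp (c * b)) (C0 / c * exp (c * a)))).
{ apply (is_RInt_derive (V := R_CompleteNormedModule) (fun x => C0 / c * exp (c * x))).
  - intros x _. auto_derive; auto. field. exact Hc.
  - intros x _. apply (ex_derive_continuous (K := R_AbsRing) (V := R_NormedModule)). auto_derive; auto. }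
replace (C0 / c * (exp (c * b) - exp (c * a))) with (minus (C0 / c * exp (c * b)) (C0 / c * exp (c * a))); [exact IR|].
unfold minus, plus, opp; simpl. ring.
Qed.

Section Dominated.
Context {X : CBanach}.

Lemma tail_right (phi : R -> X) C0 A b : cont phi -> (forall x, norm (phi x) <= C0 * wgt x) -> 0 <= A <= b ->
  norm (Int phi A b) <= C0 / bet * exp (- bet * A).
Proof.
intros Hc Hd HA. assert (B := bet_pos).
assert (C0p : 0 <= C0).
{ specialize (Hd 0). assert (P := wgt_pos 0). assert (Q := norm_ge_0 (phi 0)). nra. }
assert (IR := exp_RInt (- bet) C0 A b ltac:(lra) ltac:(lra)).
eapply Rle_trans; [apply (Int_norm_RInt phi (fun x => C0 * exp (- bet * x))); [lra|exact Hc| |eexists; exact IR]|].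
- intros t Ht. eapply Rle_trans; [apply Hd|]. apply Rmult_le_compat_l; [exact C0p|]. apply wgt_right; lra.
- rewrite (is_RInt_unique _ _ _ _ IR). assert (P := exp_pos (- bet * b)).
  assert (Q : 0 <= C0 / bet) by (apply Rmult_le_pos; [exact C0p|left; apply Rinv_0_lt_compat, B]).
  replace (C0 / - bet * (exp (- bet * b) - exp (- bet * A))) with (C0 / bet * exp (- bet * A) - C0 / bet * exp (- bet * b)) by (field; lra).
  nra.
Qed.

Lemma tail_left (phi : R -> X) C0 A a : cont phi -> (forall x, norm (phi x) <= C0 * wgt x) -> 0 <= A -> a <= - A ->
  norm (Int phi a (- A)) <= C0 / bet * exp (- bet * A).
Proof.
intros Hc Hd HA Ha. assert (B := bet_pos).
assert (C0p : 0 <= C0).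
{ specialize (Hd 0). assert (P := wgt_pos 0). assert (Q := norm_ge_0 (phi 0)). nra. }
assert (IR := exp_RInt bet C0 a (- A) ltac:(lra) Ha).
eapply Rle_trans; [apply (Int_norm_RInt phi (fun x => C0 * exp (bet * x))); [lra|exact Hc| |eexists; exact IR]|].
- intros t Ht. eapply Rle_trans; [apply Hd|]. apply Rmult_le_compat_l; [exact C0p|]. apply wgt_left; lra.
- rewrite (is_RInt_unique _ _ _ _ IR). assert (P := exp_pos (bet * a)).
  assert (Q : 0 <= C0 / bet) by (apply Rmult_le_pos; [exact C0p|left; apply Rinv_0_lt_compat, B]).
  replace (bet * - A) with (- bet * A) by ring. nra.
Qed.

(** Two truncations differ by four tails beyond -A and A, whence the factor 4. *)
Lemma tail_both (phi : R -> X) C0 A a b a' b' : cont phi -> (forall x, norm (phi x) <= C0 * wgt x) -> 0 <= A ->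
  a <= - A -> A <= b -> a' <= - A -> A <= b' ->
  norm (minus (Int phi a b) (Int phi a' b')) <= 4 * (C0 / bet * exp (- bet * A)).
Proof.
intros Hc Hd HA Ha Hb Ha' Hb'.
assert (ID : minus (Int phi a b) (Int phi a' b') =
  plus (minus (Int phi a (- A)) (Int phi a' (- A))) (minus (Int phi A b) (Int phi A b'))).
{ rewrite <- (Int_Chasles phi a (- A) b Hc), <- (Int_Chasles phi (- A) A b Hc),
    <- (Int_Chasles phi a' (- A) b' Hc), <- (Int_Chasles phi (- A) A b' Hc). vring X. }
eapply Rle_trans; [right; exact (f_equal norm ID)|].
eapply Rle_trans; [apply norm_tri|].
eapply Rle_trans; [apply Rplus_le_compat; apply norm_minus_X|].
assert (T1 := tail_left phi C0 A a Hc Hd HA Ha). assert (T2 := tail_left phi C0 A a' Hc Hd HA Ha').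
assert (T3 := tail_right phi C0 A b Hc Hd ltac:(lra)). assert (T4 := tail_right phi C0 A b' Hc Hd ltac:(lra)). lra.
Qed.

Lemma tail_small C0 e : 0 <= C0 -> 0 < e -> exists A, 0 < A /\ 4 * (C0 / bet * exp (- bet * A)) <= e.
Proof.
intros HC He. assert (B := bet_pos).
assert (P0 : 0 <= C0 / bet) by (apply Rmult_le_pos; [exact HC|left; apply Rinv_0_lt_compat, B]).
destruct (exp_small bet (e / (4 * (C0 / bet + 1))) ltac:(apply Rdiv_lt_0_compat; lra) B) as (A & HA & HA').
exists A. split; [exact HA|]. specialize (HA' A (Rle_refl _)).
apply Rle_trans with (4 * ((C0 / bet + 1) * (e / (4 * (C0 / bet + 1))))).
- assert (P := exp_pos (- bet * A)). apply Rmult_le_compat_l; [lra|]. apply Rmult_le_compat; lra.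
- right. set (q := C0 / bet) in *. field. lra.
Qed.

Lemma II_dominated (phi : R -> X) C0 : cont phi -> (forall x, norm (phi x) <= C0 * wgt x) ->
  is_II phi (II phi) /\ norm (II phi) <= 4 * (C0 / bet) /\
  forall A a b, 0 <= A -> a <= - A -> A <= b -> norm (minus (Int phi a b) (II phi)) <= 4 * (C0 / bet * exp (- bet * A)).
Proof.
intros Hc Hd. assert (B := bet_pos).
assert (C0p : 0 <= C0).
{ specialize (Hd 0). assert (P := wgt_pos 0). assert (Q := norm_ge_0 (phi 0)). nra. }
destruct (cauchy_limit (fun s => Int phi (- s) s)) as [L HL].
{ intros e He. destruct (tail_small C0 (e / 2) C0p ltac:(lra)) as (A & HA & HA'). exists A.
  intros s t Hs Ht. eapply Rle_lt_trans; [apply (tail_both phi C0 A); auto; lra|]. lra. }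
assert (T : forall A a b, 0 <= A -> a <= - A -> A <= b -> norm (minus (Int phi a b) L) <= 4 * (C0 / bet * exp (- bet * A))).
{ intros A a b HA Ha Hb. apply le_epsilon. intros e He. destruct (HL e He) as [A' HA'].
  assert (c1 := Rmax_l A A'). assert (c2 := Rmax_r A A'). set (s := Rmax A A' + 1).
  assert (Q := HA' s ltac:(unfold s; lra)).
  assert (Q2 := tail_both phi C0 A a b (- s) s Hc Hd HA Ha Hb ltac:(unfold s; lra) ltac:(unfold s; lra)).
  assert (ID : minus (Int phi a b) L = plus (minus (Int phi a b) (Int phi (- s) s)) (minus (Int phi (- s) s) L)) by (vring X).
  eapply Rle_trans; [right; exact (f_equal norm ID)|]. eapply Rle_trans; [apply norm_tri|]. lra. }
assert (IL : is_II phi L).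
{ intros e He. destruct (tail_small C0 e C0p He) as (A & HA & HA'). exists A. split; [exact HA|].
  intros a b Ha Hb. eapply Rle_trans; [apply (T A); lra|exact HA']. }
rewrite (II_is phi L IL). split; [exact IL|]. split; [|exact T].
(* The empty interval [0, 0] turns the tail estimate at A = 0 into a bound for the whole
   integral. *)
assert (Q := T 0 0 0 (Rle_refl _) ltac:(lra) (Rle_refl _)). rewrite Int_point, Rmult_0_r, exp_0, Rmult_1_r in Q.
eapply Rle_trans; [|exact Q]. right. rewrite norm_sym. f_equal. vring X.
Qed.

Definition locally_dominated (K : R -> R -> X) : Prop :=
  forall T, exists C0, forall x t, t <= T -> norm (K x t) <= C0 * wgt x.

(** Domination makes the truncation error uniform for t <= T; this gives continuity in t and lets
    [Int_fubini] for truncated integrals pass to the limit. *)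
Lemma II_param (K : R -> R -> X) : cont2 K -> locally_dominated K ->
  cont (fun t => II (fun x => K x t)) /\
  forall T, 0 <= T -> is_II (fun x => Int (K x) 0 T) (Int (fun t => II (fun x => K x t)) 0 T).
Proof.
intros HK HD. assert (B := bet_pos).
assert (C0p : forall C0 T, (forall x t, t <= T -> norm (K x t) <= C0 * wgt x) -> 0 <= C0).
{ intros C0 T H. specialize (H 0 T (Rle_refl _)). assert (P := wgt_pos 0). assert (Q := norm_ge_0 (K 0 T)). nra. }
assert (Cc : cont (fun t => II (fun x => K x t))).
{ intros t e He. destruct (HD (t + 1)) as [C0 HC].
  destruct (tail_small C0 (e / 4) (C0p _ _ HC) ltac:(lra)) as (A & HA & HA').
  assert (Cp := cont_Int_param (fun y x => K x y) (- A) A ltac:(lra) (cont2_flip K HK)).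
  destruct (Cp t (e / 4)) as (d & Hd & Hs); [lra|].
  exists (Rmin d 1). split; [apply Rmin_pos; lra|]. intros s Hst.
  assert (S1 := Rlt_le_trans _ _ _ Hst (Rmin_l _ _)). assert (S2 := Rlt_le_trans _ _ _ Hst (Rmin_r _ _)).
  apply Rabs_lt_between in S2. specialize (Hs s S1).
  assert (T1 := proj2 (proj2 (II_dominated (fun x => K x s) C0 (cont2_l K s HK) (fun x => HC x s ltac:(lra)))) A (- A) A ltac:(lra) ltac:(lra) ltac:(lra)).
  assert (T2 := proj2 (proj2 (II_dominated (fun x => K x t) C0 (cont2_l K t HK) (fun x => HC x t ltac:(lra)))) A (- A) A ltac:(lra) ltac:(lra) ltac:(lra)).
  set (i1 := II (fun x => K x s)) in *. set (i2 := II (fun x => K x t)) in *.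
  set (j1 := Int (fun x => K x s) (- A) A) in *. set (j2 := Int (fun x => K x t) (- A) A) in *.
  assert (ID : minus i1 i2 = plus (minus (minus j2 i2) (minus j1 i1)) (minus j1 j2)) by (vring X).
  eapply Rle_lt_trans; [right; exact (f_equal norm ID)|].
  eapply Rle_lt_trans; [apply norm_tri|]. eapply Rle_lt_trans; [apply Rplus_le_compat_r, norm_minus_X|].
  lra. }
split; [exact Cc|]. intros T HT e He. destruct (HD T) as [C0 HC].
destruct (tail_small C0 (e / (T + 1)) (C0p _ _ HC) ltac:(apply Rdiv_lt_0_compat; lra)) as (A & HA & HA').
exists A. split; [exact HA|]. intros a b Ha Hb.
rewrite (Int_fubini K a b 0 T ltac:(lra) HT HK).
assert (Ci : cont (fun y => Int (fun x => K x y) a b)) by (apply (cont_Int_param (fun y x => K x y)); [lra|apply cont2_flip, HK]).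
rewrite <- Int_minus by assumption.
apply Rle_trans with (e / (T + 1) * (T - 0)).
- apply Int_norm; [exact HT|apply cont_minus; assumption|]. intros t Ht.
  eapply Rle_trans; [|exact HA'].
  apply (II_dominated (fun x => K x t) C0 (cont2_l K t HK) (fun x => HC x t ltac:(lra))); lra.
- apply Rle_trans with (e / (T + 1) * (T + 1)).
  + apply Rmult_le_compat_l; [left; apply Rdiv_lt_0_compat; lra|lra].
  + right. field. lra.
Qed.
End Dominated.
End Weighted.

Lemma Cexp_RtoC a : Cexp (RtoC a) = RtoC (exp a).
Proof. unfold Cexp. simpl. rewrite cos_0, sin_0. apply injective_projections; simpl; ring. Qed.

Lemma cont_inv (k : R -> C) : cont (X := CB) k -> (forall x, k x <> 0%C) -> cont (X := CB) (fun x => / k x)%C.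
Proof.
intros Hk Hn t e He. assert (P : 0 < Cmod (k t)) by (apply Cmod_gt_0, Hn).
destruct (Hk t (Rmin (Cmod (k t) / 2) (e * (Cmod (k t) * Cmod (k t)) / 2))) as (d & Hd & Hs).
{ apply Rmin_pos; [lra|]. apply Rdiv_lt_0_compat; [|lra]. repeat apply Rmult_lt_0_compat; lra. }
exists d. split; [exact Hd|]. intros s Hst. specialize (Hs s Hst).
change (Cmod (k s - k t)%C < Rmin (Cmod (k t) / 2) (e * (Cmod (k t) * Cmod (k t)) / 2)) in Hs.
assert (A1 := Rlt_le_trans _ _ _ Hs (Rmin_l _ _)). assert (A2 := Rlt_le_trans _ _ _ Hs (Rmin_r _ _)).
assert (B : Cmod (k t) / 2 <= Cmod (k s)).
{ assert (Q := Cmod_rev_triangle (k t) (k s - k t)%C). replace (k t + (k s - k t))%C with (k s) in Q by ring. lra. }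
change (Cmod (/ k s - / k t)%C < e).
replace (/ k s - / k t)%C with (- (k s - k t) * / (k s * k t))%C by (field; auto).
rewrite Cmod_mult, Cmod_opp, Cmod_inv, Cmod_mult by (apply Cmult_neq_0; auto).
set (a := Cmod (k s)) in *. set (b := Cmod (k t)) in *. set (m := Cmod (k s - k t)%C) in *.
assert (m0 : 0 <= m) by apply Cmod_ge_0.
apply Rle_lt_trans with (m * / (b / 2 * b)).
- apply Rmult_le_compat_l; [exact m0|]. apply Rinv_le_contravar; [nra|]. apply Rmult_le_compat_r; lra.
- apply (Rmult_lt_reg_r (b / 2 * b)); [nra|]. rewrite Rmult_assoc, Rinv_l, Rmult_1_r by nra. lra.
Qed.

Lemma cont_CB_mult (f g : R -> C) : cont (X := CB) f -> cont (X := CB) g -> cont (X := CB) (fun x => f x * g x)%C.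
Proof. exact (cont_scal (X := CB) f g). Qed.
Lemma cont_CB_plus (f g : R -> C) : cont (X := CB) f -> cont (X := CB) g -> cont (X := CB) (fun x => f x + g x)%C.
Proof. exact (cont_plus (X := CB) f g). Qed.
Lemma cont_CB_const (c : C) : cont (X := CB) (fun _ => c).
Proof. exact (cont_const (X := CB) c). Qed.
Lemma cont_CB_exp a : cont (X := CB) (fun x => RtoC (exp (a * x))).
Proof. apply (cont_of_R (fun x => exp (a * x))). intros t. apply exp_cont. Qed.

(** Let d > 0 bound m = |l + r| from below and L = |l|. Then L + 1 <= ((L + 1) / d) m, and adding r
    <= m + L gives 1 + r <= (1 + (L + 1) / d) m. *)
Lemma slit_lower (l : C) : slit_plane l -> exists k, 0 < k /\ forall r, 0 <= r -> k * (1 + r) <= Cmod (l + RtoC r)%C.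
Proof.
intros Hl.
assert (D : exists d, 0 < d /\ forall r, 0 <= r -> d <= Cmod (l + RtoC r)%C).
{ destruct l as [a b]. destruct (Req_EM_T b 0) as [E|E].
  - exists a. assert (Ha : 0 < a). { apply Rnot_le_lt. intros H. apply Hl. simpl. auto. }
    split; [exact Ha|]. intros r Hr. eapply Rle_trans; [|apply Re_le_Cmod]. simpl. rewrite Rabs_pos_eq; lra.
  - exists (Rabs b). split; [apply Rabs_pos_lt, E|]. intros r Hr. eapply Rle_trans; [|apply Im_le_Cmod].
    simpl. rewrite Rplus_0_r. lra. }
destruct D as (d & Hd & HD). assert (L0 := Cmod_ge_0 l). set (L := Cmod l) in *.
exists (/ (1 + (L + 1) / d)).
assert (P : 0 < (L + 1) / d) by (apply Rdiv_lt_0_compat; lra).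
split; [apply Rinv_0_lt_compat; lra|]. intros r Hr. specialize (HD r Hr).
assert (Q := Cmod_rev_triangle (RtoC r) l). rewrite Cplus_comm, Cmod_R, Rabs_pos_eq in Q by exact Hr. fold L in Q.
set (m := Cmod (l + RtoC r)%C) in *.
apply (Rmult_le_reg_l (1 + (L + 1) / d)); [lra|]. rewrite <- Rmult_assoc, Rinv_r, Rmult_1_l by lra.
assert (Q2 : L + 1 <= (L + 1) / d * m).
{ apply Rle_trans with ((L + 1) / d * d); [right; field; lra|]. apply Rmult_le_compat_l; lra. }
lra.
Qed.

(** * Stieltjes transforms and Balakrishnan's formula *)

Section Stieltjes.
Variable al : R.
Hypothesis Hal : 0 < al < 1.

Definition adm (C0 : R) (g : R -> C) : Prop := cont (X := CB) g /\ forall x, Cmod (g x) <= C0 * wgt al x.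

(** For |h| <= k/2 half of the lower bound k (1 + r) survives, and the division gains exactly the
    factor 1 / (1 + e^x) by which g may exceed the weight. *)
Lemma adm_div l k h (g : R -> C) C0 : 0 < k -> (forall r, 0 <= r -> k * (1 + r) <= Cmod (l + RtoC r)%C) ->
  Cmod h <= k / 2 -> cont (X := CB) g -> (forall x, Cmod (g x) <= C0 * ((1 + exp x) * wgt al x)) ->
  adm (2 / k * C0) (fun x => g x / (l + h + RtoC (exp x)))%C.
Proof.
intros Hk Hl Hh Hg HC.
assert (low : forall x, k / 2 * (1 + exp x) <= Cmod (l + h + RtoC (exp x))%C).
{ intros x. assert (P := exp_pos x). specialize (Hl (exp x) ltac:(lra)).
  replace (l + h + RtoC (exp x))%C with ((l + RtoC (exp x)) + h)%C by ring.
  assert (Q := Cmod_rev_triangle (l + RtoC (exp x))%C h). nra. }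
assert (nz : forall x, (l + h + RtoC (exp x))%C <> 0%C).
{ intros x E. specialize (low x). rewrite E, Cmod_0 in low. assert (P := exp_pos x). nra. }
split.
- apply cont_CB_mult; [exact Hg|]. apply cont_inv; [|exact nz].
  apply cont_CB_plus; [apply cont_CB_const|].
  intros t e He. destruct (cont_CB_exp 1 t e He) as (d & Hd & Hs). exists d. split; [exact Hd|].
  intros s Hst. specialize (Hs s Hst). rewrite !Rmult_1_l in Hs. exact Hs.
- intros x. unfold Cdiv. rewrite Cmod_mult, Cmod_inv by apply nz.
  assert (P := exp_pos x). assert (W := wgt_pos al x).
  apply Rle_trans with (C0 * ((1 + exp x) * wgt al x) * / (k / 2 * (1 + exp x))).
  + apply Rmult_le_compat; [apply Cmod_ge_0|left; apply Rinv_0_lt_compat; specialize (low x); nra|apply HC|].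
    apply Rinv_le_contravar; [nra|apply low].
  + right. field. split; lra.
Qed.

Lemma adm_plus C1 C2 g1 g2 : adm C1 g1 -> adm C2 g2 -> adm (C1 + C2) (fun x => g1 x + g2 x)%C.
Proof.
intros [A1 B1] [A2 B2]. split; [apply cont_CB_plus; assumption|]. intros x.
eapply Rle_trans; [apply Cmod_triangle|]. rewrite Rmult_plus_distr_r. apply Rplus_le_compat; auto.
Qed.

Lemma adm_scal c C1 g1 : adm C1 g1 -> adm (Cmod c * C1) (fun x => c * g1 x)%C.
Proof.
intros [A1 B1]. split; [apply cont_CB_mult; [apply cont_CB_const|exact A1]|]. intros x.
rewrite Cmod_mult, Rmult_assoc. apply Rmult_le_compat_l; [apply Cmod_ge_0|auto].
Qed.

(* Since 1/(l+h+r) = 1/(l+r) - h/((l+r)(l+h+r)), the difference quotients stay in the same class. *)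
Lemma taylor_stieltjes {V : NormedModule C_AbsRing} (Phi : (R -> C) -> V) K :
  (forall C1 C2 g1 g2, adm C1 g1 -> adm C2 g2 -> Phi (fun x => g1 x + g2 x)%C = plus (Phi g1) (Phi g2)) ->
  (forall c C1 g, adm C1 g -> Phi (fun x => c * g x)%C = scal c (Phi g)) ->
  (forall C1 g, adm C1 g -> norm (Phi g) <= K * C1) ->
  forall n l (g : R -> C) C0, slit_plane l -> cont (X := CB) g ->
  (forall x, Cmod (g x) <= C0 * ((1 + exp x) * wgt al x)) ->
  taylor n (fun h => Phi (fun x => g x / (l + h + RtoC (exp x)))%C).
Proof.
intros Hplus Hscal Hnorm n. induction n as [|n IH]; intros l g C0 Hl Hg HC;
  destruct (slit_lower l Hl) as (k & Hk & Hlow).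
- exists (K * (2 / k * C0)), (k / 2). split; [lra|]. intros h Hh. apply Hnorm.
  apply (adm_div l k h g C0 Hk Hlow); [lra|exact Hg|exact HC].
- assert (A0 := adm_div l k 0%C g C0 Hk Hlow ltac:(rewrite Cmod_0; lra) Hg HC).
  set (g' := fun x => (- (g x / (l + 0 + RtoC (exp x))))%C).
  exists (fun h => Phi (fun x => g' x / (l + h + RtoC (exp x)))%C).
  assert (Cg' : cont (X := CB) g').
  { assert (Q := cont_CB_mult _ _ (cont_CB_const (RtoC (-1))) (proj1 A0)).
    intros t e He. destruct (Q t e He) as (d & Hd & Hs). exists d. split; [exact Hd|].
    intros s Hst. eapply Rle_lt_trans; [|exact (Hs s Hst)]. right.
    unfold g'. match goal with |- @norm _ _ ?a = @norm _ _ ?b => change (Cmod a = Cmod b); f_equal end.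
    match goal with |- minus (- ?a)%C (- ?b)%C = minus (?c * ?a)%C (?c * ?b)%C => change (- a - - b = c * a - c * b)%C end. ring. }
  assert (Bg' : forall x, Cmod (g' x) <= 2 / k * C0 * ((1 + exp x) * wgt al x)).
  { intros x. unfold g'. rewrite Cmod_opp. eapply Rle_trans; [apply (proj2 A0)|].
    assert (P := exp_pos x). assert (W := wgt_pos al x).
    assert (N : 0 <= 2 / k * C0).
    { assert (Q := proj2 A0 x). assert (Q2 := Cmod_ge_0 (g x / (l + 0 + RtoC (exp x)))%C). nra. }
    apply Rmult_le_compat_l; [exact N|]. nra. }
  split; [apply (IH l g' (2 / k * C0) Hl Cg' Bg')|].
  exists (k / 2). split; [lra|]. intros h Hh.
  assert (A1 := adm_div l k h g' (2 / k * C0) Hk Hlow ltac:(lra) Cg' Bg').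
  rewrite <- (Hscal h _ _ A1), <- (Hplus _ _ _ _ A0 (adm_scal h _ _ A1)).
  f_equal. apply functional_extensionality. intros x. unfold g'.
  assert (low : forall h, Cmod h <= k / 2 -> (l + h + RtoC (exp x))%C <> 0%C).
  { intros h' Hh' E. assert (P := exp_pos x). specialize (Hlow (exp x) ltac:(lra)).
    assert (Q := Cmod_rev_triangle (l + RtoC (exp x))%C h').
    replace (l + RtoC (exp x) + h')%C with (l + h' + RtoC (exp x))%C in Q by ring. rewrite E, Cmod_0 in Q. nra. }
  assert (N1 := low h ltac:(lra)). assert (N0 := low 0%C ltac:(rewrite Cmod_0; lra)).
  replace (l + 0 + RtoC (exp x))%C with (l + RtoC (exp x))%C in * by ring.
  field. auto.
Qed.

(* Balakrishnan's integral for l^(al - 1), up to a constant factor. *)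
Definition gk (l : C) (x : R) : C := (RtoC (exp (al * x)) / (l + RtoC (exp x)))%C.
Definition pfun (l : C) : C := II (X := CB) (gk l).

Lemma gk_num x : Cmod (RtoC (exp (al * x))) <= 1 * ((1 + exp x) * wgt al x).
Proof.
rewrite Cmod_R, Rabs_pos_eq by (left; apply exp_pos). unfold wgt. assert (P := exp_pos x).
right. unfold wgt. field. lra.
Qed.

Lemma gk_adm l : slit_plane l -> exists C0, adm C0 (gk l).
Proof.
intros Hl. destruct (slit_lower l Hl) as (k & Hk & Hlow). exists (2 / k * 1).
destruct (adm_div l k 0%C (fun x => RtoC (exp (al * x))) 1 Hk Hlow ltac:(rewrite Cmod_0; lra) (cont_CB_exp al) gk_num) as [A1 A2].
assert (E : gk l = (fun x => RtoC (exp (al * x)) / (l + 0 + RtoC (exp x)))%C).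
{ apply functional_extensionality. intros x. unfold gk. f_equal. ring. }
rewrite E. split; assumption.
Qed.

Lemma adm_II C0 g : adm C0 g -> is_II (X := CB) g (II (X := CB) g).
Proof. intros [A1 A2]. exact (proj1 (II_dominated al Hal (X := CB) g C0 A1 A2)). Qed.

Lemma taylor_pfun n l : slit_plane l -> taylor (V := C_NormedModule) n (fun h => pfun (l + h)%C).
Proof.
intros Hl. unfold pfun, gk.
apply (taylor_stieltjes (V := C_NormedModule) (II (X := CB)) (4 / bet al)) with (g := fun x => RtoC (exp (al * x))) (C0 := 1); auto.
- intros C1 C2 g1 g2 H1 H2. apply II_is.
  exact (is_II_plus (X := CB) g1 g2 _ _ (proj1 H1) (proj1 H2) (adm_II _ _ H1) (adm_II _ _ H2)).
- intros c C1 g H1. apply II_is. exact (is_II_scal (X := CB) c g _ (proj1 H1) (adm_II _ _ H1)).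
- intros C1 g [H1 H2]. eapply Rle_trans; [exact (proj1 (proj2 (II_dominated al Hal (X := CB) g C1 H1 H2)))|].
  right. unfold Rdiv. ring.
- apply cont_CB_exp.
- apply gk_num.
Qed.

Lemma slit_scale rho l : 0 < rho -> slit_plane l -> slit_plane (RtoC rho * l)%C.
Proof.
intros Hr Hl [H1 H2]. apply Hl. simpl in H1, H2.
assert (E1 : rho * Im l = 0) by (unfold Im; lra). assert (E2 : rho * Re l <= 0) by (unfold Re; lra).
split.
- apply Rmult_integral in E1. destruct E1; [lra|assumption].
- apply Rnot_lt_le. intros L. assert (0 < rho * Re l) by (apply Rmult_lt_0_compat; assumption). lra.
Qed.

(** The substitution r -> rho r, a translation of x by ln rho, shows that l |-> l [pfun] l is
    homogeneous of degree al under positive factors. *)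
Lemma pfun_scale rho l : 0 < rho -> slit_plane l ->
  (RtoC rho * l * pfun (RtoC rho * l) = RtoC (exp (al * ln rho)) * (l * pfun l))%C.
Proof.
intros Hr Hl.
destruct (gk_adm l Hl) as [C0 HC]. destruct (gk_adm _ (slit_scale rho l Hr Hl)) as [C1 HC1].
assert (S1 := is_II_shift (X := CB) _ _ (ln rho) (proj1 HC1) (adm_II _ _ HC1)).
assert (E : pfun (RtoC rho * l)%C = (RtoC (exp (al * ln rho) / rho) * pfun l)%C).
{ apply (is_II_unique (X := CB) (fun x => gk (RtoC rho * l)%C (x + ln rho))); [exact S1|].
  refine (is_II_ext _ _ _ _ (is_II_scal (X := CB) (RtoC (exp (al * ln rho) / rho)) (gk l) _ (proj1 HC) (adm_II _ _ HC))).
  intros x. change (RtoC (exp (al * ln rho) / rho) * gk l x = gk (RtoC rho * l) (x + ln rho))%C. unfold gk.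
  assert (P := exp_pos x).
  assert (N : (l + RtoC (exp x))%C <> 0%C).
  { destruct (slit_lower l Hl) as (k & Hk & Hlow). intros E. specialize (Hlow (exp x) ltac:(lra)). rewrite E, Cmod_0 in Hlow. nra. }
  assert (R0 : RtoC rho <> 0%C). { intros F. apply RtoC_inj in F. lra. }
  rewrite Rmult_plus_distr_l, !exp_plus, exp_ln by exact Hr.
  rewrite RtoC_div, !RtoC_mult by lra.
  replace (RtoC rho * l + RtoC (exp x) * RtoC rho)%C with (RtoC rho * (l + RtoC (exp x)))%C by ring.
  field. auto. }
rewrite E, RtoC_div by lra. 
assert (R0 : RtoC rho <> 0%C). { intros F. apply RtoC_inj in F. lra. }
field. exact R0.
Qed.

End Stieltjes.

Lemma dv_comp_C D (F : C -> C) (k : R -> C) t k' Dz :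
  (forall e, 0 < e -> exists d, 0 < d /\ forall h, Cmod h < d ->
     Cmod (F (k t + h) - F (k t) - h * Dz)%C <= e * Cmod h) ->
  dv (X := CB) D k t k' -> dv (X := CB) D (fun s => F (k s)) t (k' * Dz)%C.
Proof.
intros HF Hk e He.
set (L := Cmod k' + 1). assert (L0 : 0 < L) by (unfold L; assert (P := Cmod_ge_0 k'); lra).
set (m := Cmod Dz). assert (m0 : 0 <= m) by apply Cmod_ge_0.
destruct (HF (e / (2 * L))) as (d1 & Hd1 & H1); [apply Rdiv_lt_0_compat; lra|].
destruct (Hk (Rmin 1 (e / (2 * (m + 1))))) as (d2 & Hd2 & H2); [apply Rmin_pos; [lra|apply Rdiv_lt_0_compat; lra]|].
exists (Rmin d2 (d1 / L)). split; [apply Rmin_pos; [exact Hd2|apply Rdiv_lt_0_compat; lra]|].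
intros s Ds Hst. assert (S1 := Rlt_le_trans _ _ _ Hst (Rmin_l _ _)). assert (S2 := Rlt_le_trans _ _ _ Hst (Rmin_r _ _)).
specialize (H2 s Ds S1). set (r := Rabs (s - t)) in *. assert (r0 : 0 <= r) by apply Rabs_pos.
change (Cmod (k s - k t - RtoC (s - t) * k')%C <= Rmin 1 (e / (2 * (m + 1))) * r) in H2.
set (h := (k s - k t)%C) in *. set (q := (h - RtoC (s - t) * k')%C) in *.
assert (M1 := Rmin_l 1 (e / (2 * (m + 1)))). assert (M2 := Rmin_r 1 (e / (2 * (m + 1)))).
assert (Hh : Cmod h <= L * r).
{ replace h with (RtoC (s - t) * k' + q)%C by (unfold q; ring). eapply Rle_trans; [apply Cmod_triangle|].
  rewrite Cmod_mult, Cmod_R. fold r. unfold L. nra. }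
assert (Hh1 : Cmod h < d1).
{ eapply Rle_lt_trans; [exact Hh|]. apply (Rmult_lt_compat_l L) in S2; [|exact L0].
  replace (L * (d1 / L)) with d1 in S2 by (field; lra). exact S2. }
specialize (H1 h Hh1). replace (k t + h)%C with (k s) in H1 by (unfold h; ring).
change (Cmod (F (k s) - F (k t) - RtoC (s - t) * (k' * Dz))%C <= e * r).
replace (F (k s) - F (k t) - RtoC (s - t) * (k' * Dz))%C with ((F (k s) - F (k t) - h * Dz) + q * Dz)%C by (unfold q; ring).
eapply Rle_trans; [apply Cmod_triangle|]. rewrite Cmod_mult. fold m.
assert (B1 : e / (2 * L) * Cmod h <= e / 2 * r).
{ apply Rle_trans with (e / (2 * L) * (L * r)).
  - apply Rmult_le_compat_l; [left; apply Rdiv_lt_0_compat; lra|exact Hh].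
  - right. field. lra. }
assert (B2 : Cmod q * m <= e / 2 * r).
{ apply Rle_trans with (e / (2 * (m + 1)) * r * (m + 1)).
  - apply Rmult_le_compat; [apply Cmod_ge_0|exact m0| |lra]. eapply Rle_trans; [exact H2|]. apply Rmult_le_compat_r; lra.
  - right. field. lra. }
lra.
Qed.

Lemma taylor_2_derivative (F : C -> C) z : taylor (V := C_NormedModule) 2 (fun h => F (z + h)%C) ->
  exists Dz, forall e, 0 < e -> exists d, 0 < d /\ forall h, Cmod h < d ->
     Cmod (F (z + h) - F z - h * Dz)%C <= e * Cmod h.
Proof.
intros (F1 & (F2 & (M & d2 & Hd2 & H2) & d1 & Hd1 & H1) & d0 & Hd0 & H0).
exists (F1 0%C). intros e He. 
assert (PM := Rle_abs M). assert (PM' := Rabs_pos M).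
exists (Rmin (Rmin d0 d1) (Rmin d2 (e / (Rabs M + 1)))).
split; [repeat apply Rmin_pos; try assumption; apply Rdiv_lt_0_compat; lra|]. intros h Hh.
assert (A1 := Rmin_l (Rmin d0 d1) (Rmin d2 (e / (Rabs M + 1)))). assert (A2 := Rmin_r (Rmin d0 d1) (Rmin d2 (e / (Rabs M + 1)))).
assert (A3 := Rmin_l d0 d1). assert (A4 := Rmin_r d0 d1).
assert (A5 := Rmin_l d2 (e / (Rabs M + 1))). assert (A6 := Rmin_r d2 (e / (Rabs M + 1))).
specialize (H0 h ltac:(lra)). specialize (H1 h ltac:(lra)). specialize (H2 h ltac:(lra)).
cbv beta in H0. replace (z + 0)%C with z in H0 by ring.
change (F (z + h)%C = F z + h * F1 h)%C in H0. change (F1 h = F1 0%C + h * F2 h)%C in H1.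
rewrite H0, H1. replace (F z + h * (F1 0 + h * F2 h) - F z - h * F1 0)%C with (h * (h * F2 h))%C by ring.
rewrite !Cmod_mult. change (Cmod (F2 h) <= M) in H2. assert (P := Cmod_ge_0 h). assert (P2 := Cmod_ge_0 (F2 h)).
rewrite (Rmult_comm e). apply Rmult_le_compat_l; [exact P|].
apply Rle_trans with (e / (Rabs M + 1) * (Rabs M + 1)); [apply Rmult_le_compat; lra|]. right. field. lra.
Qed.

Lemma slit_unit th : - PI < th < PI -> slit_plane (Cexp (Ci * RtoC th)).
Proof.
intros Hth [H1 H2]. unfold Cexp in H1, H2. simpl in H1, H2.
replace (0 * th - 1 * 0) with 0 in * by ring. replace (0 * 0 + 1 * th) with th in * by ring.
rewrite exp_0, Rmult_1_l in *.
destruct (Rtotal_order th 0) as [L|[L|L]].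
- assert (T : 0 < sin (- th)) by (apply sin_gt_0; lra). rewrite sin_neg in T. lra.
- rewrite L, cos_0 in H2. lra.
- assert (T : 0 < sin th) by (apply sin_gt_0; lra). lra.
Qed.

(** The angle PI would force Im z = 0 and Re z <= 0, which the slit excludes; the sign of Im z
    decides the branch of acos. *)
Lemma polar_form z : slit_plane z -> - PI < Carg z < PI /\ z = (RtoC (Cmod z) * Cexp (Ci * RtoC (Carg z)))%C.
Proof.
intros Hz. destruct z as [x y].
assert (Hn : ((x, y) : C) <> 0%C). { intros E. apply Hz. rewrite E. simpl. lra. }
assert (Pm : 0 < Cmod (x, y)) by (apply Cmod_gt_0, Hn). set (m := Cmod (x, y)) in *.
assert (Sq := Cmod_sqr x y). fold m in Sq.
assert (Bx : -1 <= x / m <= 1).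
{ assert (Q := Re_le_Cmod (x, y)). simpl in Q. fold m in Q. apply Rabs_le_between in Q.
  split; apply (Rmult_le_reg_r m); try exact Pm; replace (x / m * m) with x by (field; lra); lra. }
assert (AB := acos_bound (x / m)).
assert (CA := cos_acos (x / m) Bx). assert (SA := sin_acos (x / m) Bx).
assert (Sy : sqrt (1 - (x / m)²) = Rabs y / m).
{ replace (1 - (x / m)²) with ((Rabs y / m)²).
  - apply sqrt_Rsqr. apply Rmult_le_pos; [apply Rabs_pos|left; apply Rinv_0_lt_compat, Pm].
  - unfold Rsqr. replace (Rabs y / m * (Rabs y / m)) with (Rabs y * Rabs y / (m * m)) by (field; lra).
    replace (Rabs y * Rabs y) with (y * y) by (unfold Rabs; destruct (Rcase_abs y); ring).
    replace (y * y) with (m * m - x * x) by lra. field. lra. }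
assert (NP : y <= 0 -> y = 0 -> acos (x / m) < PI \/ x <= 0).
{ intros _ _. destruct (Rle_dec x 0); [right; assumption|left]. destruct (proj2 AB) as [L|E]; [exact L|].
  rewrite E, cos_PI in CA. assert (0 < x / m) by (apply Rdiv_lt_0_compat; lra). lra. }
assert (strict : acos (x / m) < PI).
{ destruct (proj2 AB) as [L|E]; [exact L|]. exfalso. apply Hz. simpl.
  rewrite E, cos_PI in CA. rewrite E, sin_PI in SA. rewrite Sy in SA.
  assert (y0 : Rabs y = 0). { apply (Rmult_eq_reg_r (/ m)); [|apply Rinv_neq_0_compat; lra]. unfold Rdiv in SA. lra. }
  split; [apply NNPP; intros F; apply Rabs_no_R0 in F; contradiction|].
  replace x with (x / m * m) by (field; lra). rewrite <- CA. lra. }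
unfold Carg. fold m. simpl Re. simpl Im. unfold Cexp.
destruct (Rle_dec 0 y) as [Hy|Hy].
- split; [lra|]. rewrite (Rabs_pos_eq y Hy) in Sy.
  apply injective_projections; simpl; rewrite ?Rmult_0_l, ?Rmult_0_r, ?Rmult_1_l, ?Rminus_0_r, ?Rplus_0_l, ?exp_0, ?Rmult_1_l, ?CA, ?SA, ?Sy; field; lra.
- assert (P0 : 0 < acos (x / m)).
  { destruct (proj1 AB) as [L|E]; [exact L|]. exfalso. rewrite <- E, sin_0, Sy in SA.
    assert (0 < Rabs y / m) by (apply Rdiv_lt_0_compat; [apply Rabs_pos_lt; lra|exact Pm]). lra. }
  split; [lra|]. rewrite (Rabs_left y) in Sy by lra.
  apply injective_projections; simpl; rewrite ?Rmult_0_l, ?Rmult_0_r, ?Rmult_1_l, ?Rminus_0_r, ?Rplus_0_l, ?exp_0, ?cos_neg, ?sin_neg, ?Rmult_1_l, ?CA, ?SA, ?Sy; field; lra.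
Qed.

Lemma slit_neq_0 z : slit_plane z -> z <> 0%C.
Proof. intros Hz E. apply Hz. rewrite E. simpl. lra. Qed.

Lemma cpow_slit z a : slit_plane z ->
  cpow z a = (RtoC (exp (a * ln (Cmod z))) * Cexp (Ci * RtoC (a * Carg z)))%C.
Proof.
intros Hz. unfold cpow. destruct (Ceq_dec z 0) as [E|_]; [exfalso; exact (slit_neq_0 z Hz E)|].
unfold Rpower, Cexp. f_equal. apply injective_projections; simpl;
  rewrite ?Rmult_0_l, ?Rmult_0_r, ?Rmult_1_l, ?Rminus_0_r, ?Rplus_0_l, ?exp_0, ?Rmult_1_l; reflexivity.
Qed.

Lemma cpow_1 z : slit_plane z -> cpow z 1 = z.
Proof.
intros Hz. rewrite (cpow_slit z 1 Hz), !Rmult_1_l. destruct (polar_form z Hz) as [_ E].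
rewrite exp_ln by (apply Cmod_gt_0, slit_neq_0, Hz). symmetry. exact E.
Qed.

Lemma is_II_real (f : R -> R) l : (forall t, continuous f t) -> is_II (X := CB) (fun x => RtoC (f x)) l -> l = RtoC (Re l).
Proof.
intros Cf Hl. apply injective_projections; [reflexivity|]. simpl. change (Im l = 0).
apply NNPP. intros Hn. assert (P : 0 < Rabs (Im l)) by (apply Rabs_pos_lt, Hn).
destruct (Hl (Rabs (Im l) / 2)) as (A & HA & H); [lra|].
specialize (H (- A) A ltac:(lra) ltac:(lra)). rewrite (Int_RtoC f (- A) A ltac:(lra) Cf) in H.
change (Cmod (RtoC (RInt f (- A) A) - l)%C <= Rabs (Im l) / 2) in H.
assert (Q := Rle_trans _ _ _ (Im_le_Cmod _) H).
replace (Im (RtoC (RInt f (- A) A) - l)%C) with (- Im l) in Q.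
- rewrite Rabs_Ropp in Q. lra.
- unfold Im. simpl. ring.
Qed.

Section Power.
Variable al : R.
Hypothesis Hal : 0 < al < 1.

Lemma slit_1 : slit_plane 1%C.
Proof. intros [_ H]. simpl in H. lra. Qed.

(** The Taylor expansion provides some derivative Dz of l |-> l [pfun] l. Along the ray h = l s the
    homogeneity computes it, which is Euler's relation l Dz = al l pfun(l). *)
Lemma pfun_derivative l : slit_plane l -> forall e, 0 < e -> exists d, 0 < d /\ forall h, Cmod h < d ->
  Cmod ((l + h) * pfun al (l + h) - l * pfun al l - h * (RtoC al * pfun al l))%C <= e * Cmod h.
Proof.
intros Hl.
assert (T : taylor (V := C_NormedModule) 2 (fun h => (l + h) * pfun al (l + h))%C).
{ apply taylor_mult; [apply taylor_shift|apply taylor_pfun; assumption]. }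
destruct (taylor_2_derivative (fun z => z * pfun al z)%C l T) as [Dz HD].
assert (E : Dz = (RtoC al * pfun al l)%C).
{ assert (Z : (l * Dz - RtoC al * (l * pfun al l))%C = 0%C).
  { apply Cmod_eq_0. apply Rle_antisym; [|apply Cmod_ge_0]. apply le_epsilon. intros e He. rewrite Rplus_0_l.
    set (n1 := Cmod l). set (n2 := Cmod (l * pfun al l)%C).
    assert (p1 : 0 < n1) by (apply Cmod_gt_0, slit_neq_0, Hl). assert (p2 : 0 <= n2) by apply Cmod_ge_0.
    destruct (HD (e / (2 * n1))) as (d & Hd & H); [apply Rdiv_lt_0_compat; lra|].
    assert (dr : is_derive (fun s => exp (al * ln (1 + s))) 0 al).
    { auto_derive; [lra|]. rewrite Rplus_0_r, ln_1, Rmult_0_r, exp_0. field. }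
    destruct (derive_eps _ 0 al dr (e / (2 * (n2 + 1)))) as (d' & Hd' & H'); [apply Rdiv_lt_0_compat; lra|].
    set (s := Rmin (Rmin 1 d') (d / n1) / 2).
    assert (s1 : 0 < Rmin (Rmin 1 d') (d / n1)) by (repeat apply Rmin_pos; try lra; apply Rdiv_lt_0_compat; lra).
    assert (M1 := Rmin_l (Rmin 1 d') (d / n1)). assert (M2 := Rmin_r (Rmin 1 d') (d / n1)).
    assert (M3 := Rmin_l 1 d'). assert (M4 := Rmin_r 1 d').
    assert (s0 : 0 < s) by (unfold s; lra). assert (sd : s < d / n1) by (unfold s; lra). assert (sd' : s < d') by (unfold s; lra).
    specialize (H' s). rewrite Rminus_0_r, (Rabs_pos_eq s) in H' by lra. specialize (H' sd').
    rewrite Rplus_0_r, ln_1, Rmult_0_r, exp_0 in H'.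
    specialize (H (l * RtoC s)%C). rewrite Cmod_mult, Cmod_R, (Rabs_pos_eq s) in H by lra. fold n1 in H.
    assert (hd : n1 * s < d).
    { apply (Rmult_lt_compat_l n1) in sd; [|exact p1]. replace (n1 * (d / n1)) with d in sd by (field; lra). exact sd. }
    specialize (H hd).
    replace (l + l * RtoC s)%C with (RtoC (1 + s) * l)%C in H by (rewrite RtoC_plus; ring).
    rewrite (pfun_scale al Hal (1 + s) l ltac:(lra) Hl) in H.
    set (w := (l * pfun al l)%C) in *. set (phi := exp (al * ln (1 + s))) in *.
    assert (ID : (RtoC s * (l * Dz - RtoC al * w) = RtoC (phi - 1 - s * al) * w - (RtoC phi * w - w - l * RtoC s * Dz))%C).
    { rewrite !RtoC_minus, RtoC_mult. ring. }
    assert (N : s * Cmod (l * Dz - RtoC al * w)%C <= e / (2 * (n2 + 1)) * s * n2 + e / (2 * n1) * (n1 * s)).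
    { rewrite <- (Rabs_pos_eq s) at 1 by lra. rewrite <- Cmod_R, <- Cmod_mult, ID.
      eapply Rle_trans; [apply Cmod_triangle|]. rewrite Cmod_opp, Cmod_mult, Cmod_R. fold n2.
      apply Rplus_le_compat; [|exact H]. apply Rmult_le_compat_r; [exact p2|exact H']. }
    apply (Rmult_le_reg_l s); [exact s0|]. eapply Rle_trans; [exact N|].
    replace (e / (2 * n1) * (n1 * s)) with (e / 2 * s) by (field; lra).
    assert (B : e / (2 * (n2 + 1)) * s * n2 <= e / 2 * s).
    { apply Rle_trans with (e / (2 * (n2 + 1)) * s * (n2 + 1)); [|right; field; lra].
      apply Rmult_le_compat_l; [|lra]. apply Rmult_le_pos; [left; apply Rdiv_lt_0_compat; lra|lra]. }
    lra. }
  assert (l0 := slit_neq_0 l Hl).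
  replace Dz with (/ l * (l * Dz - RtoC al * (l * pfun al l)) + RtoC al * pfun al l)%C by (field; exact l0).
  rewrite Z. ring. }
rewrite E in HD. exact HD.
Qed.

(* th |-> e^{-i al th} P(e^{i th}) has derivative zero, because l P'(l) = al P(l). *)
Lemma pfun_unit th : - PI < th < PI ->
  (Cexp (Ci * RtoC th) * pfun al (Cexp (Ci * RtoC th)) = pfun al 1 * Cexp (Ci * RtoC (al * th)))%C.
Proof.
intros Hth. assert (PP := PI_RGT_0).
set (Fz := fun z => (z * pfun al z)%C). set (k := fun t => Cexp (Ci * RtoC t)).
set (w := (- (Ci * RtoC al))%C).
assert (D0 : forall t, - PI < t < PI -> dv (X := CB) (fun s => - PI < s < PI) (fun s => Cexp (w * RtoC s) * Fz (k s))%C t zero).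
{ intros t Ht.
  assert (S1 := slit_unit t Ht).
  assert (Q := dv_comp_C (fun s => - PI < s < PI) Fz k t _ _ (pfun_derivative _ S1) (dv_Cexp _ Ci t)).
  assert (Q2 := dv_prod (X := CB) _ _ _ t _ _ (dv_Cexp (fun s => - PI < s < PI) w t) Q).
  refine (dv_value (X := CB) _ _ _ _ _ _ Q2).
  change (w * Cexp (w * RtoC t) * Fz (k t) + Cexp (w * RtoC t) * (Ci * Cexp (Ci * RtoC t) * (RtoC al * pfun al (k t))) = 0)%C.
  unfold Fz, k, w. ring. }
assert (Ev : (Cexp (w * RtoC th) * Fz (k th) = Cexp (w * RtoC 0) * Fz (k 0))%C).
{ destruct (Rle_dec 0 th) as [L|L].
  - apply (dv_constant (X := CB) (fun s => - PI < s < PI) (fun s => Cexp (w * RtoC s) * Fz (k s))%C 0 th L).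
    + intros t Ht. lra.
    + intros t Ht. apply D0. lra.
  - symmetry. apply (dv_constant (X := CB) (fun s => - PI < s < PI) (fun s => Cexp (w * RtoC s) * Fz (k s))%C th 0 ltac:(lra)).
    + intros t Ht. lra.
    + intros t Ht. apply D0. lra. }
assert (k0 : k 0 = 1%C). { unfold k. replace (Ci * RtoC 0)%C with (RtoC 0) by ring. apply Cexp_0. }
replace (w * RtoC 0)%C with (RtoC 0) in Ev by ring. rewrite k0, Cexp_0 in Ev.
change (Fz (k th) = pfun al 1 * Cexp (Ci * RtoC (al * th)))%C.
assert (I1 : (Cexp (Ci * RtoC (al * th)) * Cexp (w * RtoC th) = 1)%C).
{ rewrite <- Cexp_plus, <- Cexp_0. f_equal. unfold w. rewrite RtoC_mult. ring. }
replace (Fz (k th)) with ((Cexp (Ci * RtoC (al * th)) * Cexp (w * RtoC th)) * Fz (k th))%C by (rewrite I1; ring).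
rewrite <- Cmult_assoc, Ev. unfold Fz. ring.
Qed.

(** The modulus is handled by [pfun_scale], the angle by [pfun_unit]. This is Balakrishnan's formula
    z^(al-1) = pfun(z) / pfun(1). *)
Lemma pfun_cpow z : slit_plane z -> (z * pfun al z = pfun al 1 * cpow z al)%C.
Proof.
intros Hz. destruct (polar_form z Hz) as [Hth E].
assert (Pm : 0 < Cmod z) by (apply Cmod_gt_0, slit_neq_0, Hz).
rewrite E at 1 2. rewrite (pfun_scale al Hal (Cmod z) _ Pm (slit_unit _ Hth)).
rewrite (pfun_unit _ Hth), (cpow_slit z al Hz). ring.
Qed.

Definition wr (x : R) : R := exp (al * x) / (1 + exp x).

Lemma gk_1 x : gk al 1 x = RtoC (wr x).
Proof.
unfold gk, wr. assert (P := exp_pos x). rewrite RtoC_div, RtoC_plus by lra. reflexivity.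
Qed.

Lemma wr_cont x : continuous wr x.
Proof.
apply (ex_derive_continuous (K := R_AbsRing) (V := R_NormedModule)). unfold wr. auto_derive.
assert (P := exp_pos x). lra.
Qed.

Lemma is_II_wr : is_II (X := CB) (fun x => RtoC (wr x)) (pfun al 1).
Proof.
destruct (gk_adm al Hal 1%C slit_1) as [C0 HC].
refine (is_II_ext _ _ _ gk_1 _). exact (adm_II al Hal C0 _ HC).
Qed.

(** The integral over [0, 1] is some m > 0 and the rest is nonnegative, while the truncation error
    is kept below m/2. *)
Lemma pfun_1_pos : 0 < Re (pfun al 1).
Proof.
set (m := RInt wr 0 1).
assert (Wp : forall x, 0 < wr x). { intros x. unfold wr. assert (P := exp_pos x). apply Rdiv_lt_0_compat; [apply exp_pos|lra]. }
assert (m0 : 0 < m).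
{ apply RInt_gt_0; [lra|intros; apply Wp|]. intros; apply wr_cont. }
destruct (is_II_wr (m / 2)) as (A & HA & H); [lra|].
set (b := Rmax 1 A). assert (b1 := Rmax_l 1 A). assert (b2 := Rmax_r 1 A). fold b in b1, b2.
specialize (H (- A) b ltac:(lra) b2). rewrite (Int_RtoC wr (- A) b ltac:(lra) wr_cont) in H.
change (Cmod (RtoC (RInt wr (- A) b) - pfun al 1)%C <= m / 2) in H.
assert (Q := Rle_trans _ _ _ (Re_le_Cmod _) H).
replace (Re (RtoC (RInt wr (- A) b) - pfun al 1)%C) with (RInt wr (- A) b - Re (pfun al 1)) in Q by reflexivity.
assert (ex : forall p q, ex_RInt wr p q) by (intros; apply continuous_ex_RInt, wr_cont).
assert (ge : forall p q, p <= q -> 0 <= RInt wr p q).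
{ intros p q L. apply RInt_ge_0; [exact L|apply ex|]. intros; left; apply Wp. }
assert (C1 := RInt_Chasles wr (- A) 0 b (ex _ _) (ex _ _)). assert (C2 := RInt_Chasles wr 0 1 b (ex _ _) (ex _ _)).
unfold plus in C1, C2; simpl in C1, C2. fold m in C2.
assert (g1 := ge (- A) 0 ltac:(lra)). assert (g2 := ge 1 b b1). apply Rabs_le_between in Q. lra.
Qed.

Lemma pfun_1_real : pfun al 1 = RtoC (Re (pfun al 1)).
Proof. exact (is_II_real _ _ wr_cont is_II_wr). Qed.
End Power.

(** * Relaxation equations and fractional integrals *)

Section Relaxation.
Context {X : CBanach}.

(* The solution of y' = phi - r y, y(0) = 0; [Yc] freezes it at negative times. *)
Definition Y0 (r : R) (phi : R -> X) (t : R) : X :=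
  scal (Cexp (- RtoC r * RtoC t)) (Int (fun s => scal (Cexp (- - RtoC r * RtoC s)) (phi s)) 0 t).
Definition Yc (r : R) (phi : R -> X) (t : R) : X := Y0 r phi (Rmax 0 t).

Lemma Yc_eq r phi t : 0 <= t -> Yc r phi t = Y0 r phi t.
Proof. intros H. unfold Yc. rewrite Rmax_right by exact H. reflexivity. Qed.

Lemma Y0_0 r phi : Y0 r phi 0 = zero.
Proof. unfold Y0. rewrite Int_point. vring X. Qed.

Lemma Y0_dv D r phi t : cont phi -> dv D (Y0 r phi) t (minus (phi t) (scal (RtoC r) (Y0 r phi t))).
Proof.
intros Hp.
assert (Cg : cont (fun s => scal (Cexp (- - RtoC r * RtoC s)) (phi s))) by (apply cont_exp_mul, Hp).
assert (Q := dv_prod D _ _ t _ _ (dv_Cexp D (- RtoC r) t) (dv_Int D _ 0 t Cg)).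
refine (dv_value _ _ _ _ _ _ Q). cbv beta.
assert (E := Cexp_cancel (- RtoC r)%C t (phi t)).
eapply eq_trans; [|exact (f_equal (fun v => minus v (scal (RtoC r) (Y0 r phi t))) (eq_sym E))].
unfold Y0. generalize (Cexp (- RtoC r * RtoC t)) (scal (Cexp (- - RtoC r * RtoC t)) (phi t)). intros. vring X.
Qed.

Lemma Y0_cont r phi : cont phi -> cont (Y0 r phi).
Proof. intros Hp. exact (dv_cont _ _ (fun t => Y0_dv _ r phi t Hp)). Qed.

Lemma Yc_cont r phi : cont phi -> cont (Yc r phi).
Proof.
intros Hp t e He. destruct (Y0_cont r phi Hp (Rmax 0 t) e He) as (d & Hd & Hs). exists d. split; [exact Hd|].
intros s Hst. apply Hs. eapply Rle_lt_trans; [|exact Hst]. unfold Rmax.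
destruct (Rle_dec 0 s), (Rle_dec 0 t); unfold Rabs; repeat destruct (Rcase_abs _); lra.
Qed.

Lemma Y0_kernel r phi t : 0 <= t -> cont phi ->
  Y0 r phi t = Int (fun s => scal (RtoC (exp (- r * (t - s)))) (phi s)) 0 t.
Proof.
intros Ht Hp. unfold Y0. rewrite <- Int_scal; [|exact Ht|apply cont_exp_mul, Hp].
apply Int_ext; [exact Ht|]. intros s _.
assert (E : (Cexp (- RtoC r * RtoC t) * Cexp (- - RtoC r * RtoC s))%C = RtoC (exp (- r * (t - s)))).
{ rewrite <- Cexp_plus, <- Cexp_RtoC. f_equal. rewrite RtoC_mult, RtoC_minus, RtoC_opp. ring. }
rewrite <- E. generalize (Cexp (- RtoC r * RtoC t)) (Cexp (- - RtoC r * RtoC s)). intros. vring X.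
Qed.

Lemma Y0_bound_inv r phi t M : 0 < r -> 0 <= t -> cont phi -> (forall s, 0 <= s <= t -> norm (phi s) <= M) ->
  norm (Y0 r phi t) <= M / r.
Proof.
intros Hr Ht Hp HM. assert (M0 : 0 <= M).
{ eapply Rle_trans; [apply (norm_ge_0 (phi 0))|apply (HM 0); lra]. }
unfold Y0. rewrite norm_Cexp.
assert (Q := Cexp_int_bound (- RtoC r)%C phi M 0 t).
replace (Re (- RtoC r)) with (- r) in * by reflexivity.
specialize (Q ltac:(lra) Ht Hp HM). rewrite Rmult_0_r, exp_0 in Q.
apply Rle_trans with (exp (- r * t) * (M * ((1 - exp (- - r * t)) / - r))).
- apply Rmult_le_compat_l; [left; apply exp_pos|exact Q].
- assert (E : exp (- r * t) * exp (- - r * t) = 1).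
  { rewrite <- exp_plus, <- exp_0. f_equal. ring. }
  replace (exp (- r * t) * (M * ((1 - exp (- - r * t)) / - r)))
    with (M / r * (exp (- r * t) * exp (- - r * t)) - M / r * exp (- r * t)) by (field; lra).
  rewrite E. assert (P := exp_pos (- r * t)).
  assert (0 <= M / r) by (apply Rmult_le_pos; [exact M0|left; apply Rinv_0_lt_compat, Hr]). nra.
Qed.

Lemma kernel_cont (r t : R) : cont (X := CB) (fun s => RtoC (exp (- r * (t - s)))).
Proof.
apply (cont_of_R (fun s => exp (- r * (t - s)))). intros s.
apply (ex_derive_continuous (K := R_AbsRing) (V := R_NormedModule)). auto_derive; auto.
Qed.

Lemma Y0_bound_lin r phi t M : 0 <= r -> 0 <= t -> cont phi -> (forall s, 0 <= s <= t -> norm (phi s) <= M) ->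
  norm (Y0 r phi t) <= M * t.
Proof.
intros Hr Ht Hp HM. rewrite Y0_kernel by assumption. replace (M * t) with (M * (t - 0)) by ring.
apply Int_norm; [exact Ht|apply cont_scal; [apply kernel_cont|exact Hp]|]. intros s Hs.
rewrite norm_scal_X, Cmod_R, Rabs_pos_eq by (left; apply exp_pos).
assert (L : exp (- r * (t - s)) <= 1). { rewrite <- exp_0. apply exp_le. nra. }
assert (Q := HM s Hs). assert (N := norm_ge_0 (phi s)). apply Rle_trans with (1 * norm (phi s)); [apply Rmult_le_compat_r; assumption|lra].
Qed.

(** The bound M / r serves r >= 1 and M t serves r < 1; together they decay like 1 / (1 + r), which
    matches the weight. *)
Lemma Y0_bound r phi t T M : 0 < r -> 0 <= t <= T -> cont phi -> (forall s, 0 <= s <= T -> norm (phi s) <= M) ->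
  norm (Y0 r phi t) <= 2 * M * Rmax 1 T / (1 + r).
Proof.
intros Hr Ht Hp HM. assert (M0 : 0 <= M).
{ eapply Rle_trans; [apply (norm_ge_0 (phi 0))|apply (HM 0); lra]. }
assert (T1 := Rmax_l 1 T). assert (T2 := Rmax_r 1 T). set (m := Rmax 1 T) in *.
destruct (Rle_dec 1 r) as [L|L].
- eapply Rle_trans; [apply (Y0_bound_inv r phi t M Hr ltac:(lra) Hp); intros; apply HM; lra|].
  apply (Rmult_le_reg_r (r * (1 + r))); [nra|].
  replace (M / r * (r * (1 + r))) with (M * (1 + r)) by (field; lra).
  replace (2 * M * m / (1 + r) * (r * (1 + r))) with (2 * M * m * r) by (field; lra).
  assert (Mr : 0 <= M * r) by (apply Rmult_le_pos; lra).
  assert (B1 : M * r * 1 <= M * r * m) by (apply Rmult_le_compat_l; lra).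
  assert (B2 : M * 1 <= M * r) by (apply Rmult_le_compat_l; lra). lra.
- eapply Rle_trans; [apply (Y0_bound_lin r phi t M ltac:(lra) ltac:(lra) Hp); intros; apply HM; lra|].
  apply (Rmult_le_reg_r (1 + r)); [lra|].
  replace (2 * M * m / (1 + r) * (1 + r)) with (2 * M * m) by (field; lra).
  assert (Mt : M * t <= M * m) by (apply Rmult_le_compat_l; lra).
  assert (M1 : 0 <= M * m) by (apply Rmult_le_pos; lra).
  assert (M2 : M * t * (1 + r) <= M * m * 2) by (apply Rmult_le_compat; try lra; apply Rmult_le_pos; lra). lra.
Qed.

(** Since r |Y| <= M, the derivative phi - r Y is at most 2 M, uniformly in r. *)
Lemma Y0_lipschitz r phi s t T M : 0 < r -> 0 <= s <= t -> t <= T -> cont phi ->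
  (forall x, 0 <= x <= T -> norm (phi x) <= M) -> norm (minus (Y0 r phi t) (Y0 r phi s)) <= 2 * M * (t - s).
Proof.
intros Hr Hs Ht Hp HM.
apply (dv_norm_bound (fun _ => True) (Y0 r phi) (fun x => minus (phi x) (scal (RtoC r) (Y0 r phi x)))); auto; [lra| | |].
- apply cont_minus; [exact Hp|]. apply (cont_scal (fun _ => RtoC r)); [apply cont_CB_const|apply Y0_cont, Hp].
- intros x _. apply Y0_dv, Hp.
- intros x Hx. eapply Rle_trans; [apply norm_minus_X|]. rewrite norm_scal_X, Cmod_R, Rabs_pos_eq by lra.
  assert (B := Y0_bound_inv r phi x M Hr ltac:(lra) Hp ltac:(intros; apply HM; lra)).
  assert (Q : r * norm (Y0 r phi x) <= M).
  { apply (Rmult_le_compat_l r) in B; [|lra]. replace (r * (M / r)) with M in B by (field; lra). exact B. }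
  assert (N := HM x ltac:(lra)). lra.
Qed.

Lemma Y0_eq r phi t : 0 <= t -> cont phi ->
  Y0 r phi t = minus (Int phi 0 t) (scal (RtoC r) (Int (Y0 r phi) 0 t)).
Proof.
intros Ht Hp.
assert (Cs : cont (fun x => scal (RtoC r) (Y0 r phi x))) by (apply (cont_scal (fun _ => RtoC r)); [apply cont_CB_const|apply Y0_cont, Hp]).
assert (E := dv_FTC (fun _ => True) (Y0 r phi) (fun x => minus (phi x) (scal (RtoC r) (Y0 r phi x))) 0 t Ht
  (fun _ _ => I) (cont_minus _ _ Hp Cs) (fun x _ => Y0_dv _ r phi x Hp)).
rewrite (Int_minus phi _ 0 t Ht Hp Cs), (Int_scal (RtoC r) _ 0 t Ht (Y0_cont r phi Hp)), Y0_0 in E.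
rewrite <- E. vring X.
Qed.

Lemma Y0_unique r phi F T : 0 <= T -> cont phi -> F 0 = zero ->
  (forall t, 0 <= t <= T -> dv half_line F t (minus (phi t) (scal (RtoC r) (F t)))) -> F T = Y0 r phi T.
Proof.
intros HT Hp H0 HF.
assert (E : minus (scal (Cexp (- - RtoC r * RtoC T)) (F T)) (scal (Cexp (- - RtoC r * RtoC 0)) (F 0)) =
  Int (fun s => scal (Cexp (- - RtoC r * RtoC s)) (phi s)) 0 T).
{ apply (dv_FTC half_line (fun s => scal (Cexp (- - RtoC r * RtoC s)) (F s))); [exact HT| |apply cont_exp_mul, Hp|].
  - intros t Ht. unfold half_line. lra.
  - intros t Ht. assert (Q := dv_prod half_line _ _ t _ _ (dv_Cexp half_line (- - RtoC r) t) (HF t Ht)).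
    refine (dv_value _ _ _ _ _ _ Q). generalize (Cexp (- - RtoC r * RtoC t)). intros. vring X. }
rewrite H0 in E. rewrite (Cexp_cancel (- RtoC r)%C T (F T)). unfold Y0. rewrite <- E.
generalize (Cexp (- RtoC r * RtoC T)) (Cexp (- - RtoC r * RtoC T)) (Cexp (- - RtoC r * RtoC 0)). intros. vring X.
Qed.

(** The integral of [Y0 r phi] satisfies the relaxation equation whose forcing is the integral of
    phi, so uniqueness identifies the two. *)
Lemma Y0_Int r phi T : 0 <= T -> cont phi ->
  Y0 r (fun t => Int phi 0 t) T = Int (Y0 r phi) 0 T.
Proof.
intros HT Hp. symmetry. apply (Y0_unique r (fun t => Int phi 0 t) (fun t => Int (Y0 r phi) 0 t) T HT (cont_Int phi 0 Hp)).
- apply Int_point.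
- intros t Ht. refine (dv_value _ _ _ _ _ _ (dv_Int half_line (Y0 r phi) 0 t (Y0_cont r phi Hp))).
  apply Y0_eq; [lra|exact Hp].
Qed.

Lemma Rmax_lip s t : Rabs (Rmax 0 s - Rmax 0 t) <= Rabs (s - t).
Proof.
unfold Rmax. destruct (Rle_dec 0 s), (Rle_dec 0 t); unfold Rabs; repeat destruct (Rcase_abs _); lra.
Qed.

Lemma cont2_exp_kernel (t : R) : cont2 (X := CB) (fun x s => RtoC (exp (- exp x * (t - s)))).
Proof.
apply (cont2_R (fun x s => exp (- exp x * (t - s)))). intros p.
apply (continuous_comp (fun q : R * R => - exp (fst q) * (t - snd q)) exp).
- apply (continuous_mult (K := R_AbsRing) (fun q : R * R => - exp (fst q)) (fun q : R * R => t - snd q)).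
  + apply (continuous_opp (V := R_NormedModule) (fun q : R * R => exp (fst q))).
    apply (continuous_comp (fun q : R * R => fst q) exp); [apply continuous_fst|].
    apply (ex_derive_continuous (K := R_AbsRing) (V := R_NormedModule)). auto_derive; auto.
  + apply (continuous_minus (V := R_NormedModule) (fun _ : R * R => t) (fun q : R * R => snd q)).
    * apply continuous_const.
    * apply continuous_snd.
- apply (ex_derive_continuous (K := R_AbsRing) (V := R_NormedModule)). auto_derive; auto.
Qed.

(** The Lipschitz bound in t is uniform in r, so only continuity in x at the fixed time t0 remains,
    and there [Y0] is an integral with a parameter. *)
Lemma cont2_Yc phi : cont phi -> cont2 (fun x t => Yc (exp x) phi t).
Proof.
intros Hp x t e He.
set (t0 := Rmax 0 t). assert (Ht0 : 0 <= t0) by apply Rmax_l.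
assert (HM : exists M, 0 <= M /\ forall s, 0 <= s <= t0 + 1 -> norm (phi s) <= M).
{ destruct (continuity_ab_maj (fun s => norm (phi s)) 0 (t0 + 1) ltac:(lra)) as (s0 & Hs0 & _).
  - intros s _. apply continuity_pt_locally. intros eps.
    destruct (Hp s eps (cond_pos eps)) as (d & Hd & Hs). exists (mkposreal d Hd). intros y Hy.
    eapply Rle_lt_trans; [apply norm_dist|]. apply Hs. exact Hy.
  - exists (norm (phi s0)). split; [apply norm_ge_0|]. exact Hs0. }
destruct HM as (M & M0 & HM).
assert (K2 : cont2 (fun x s => scal (RtoC (exp (- exp x * (t0 - s)))) (phi s))).
{ apply cont2_scal; [exact (cont2_exp_kernel t0)|exact (cont2_of_r phi Hp)]. }
destruct (cont_Int_param _ 0 t0 Ht0 K2 x (e / 2)) as (d & Hd & H1); [lra|].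
set (d2 := e / (2 * (2 * M + 1))).
assert (d20 : 0 < d2) by (apply Rdiv_lt_0_compat; lra).
exists (Rmin d (Rmin 1 d2)). split; [repeat apply Rmin_pos; lra|]. intros x' t' Hx Ht.
assert (A1 := Rmin_l d (Rmin 1 d2)). assert (A2 := Rmin_r d (Rmin 1 d2)).
assert (A3 := Rmin_l 1 d2). assert (A4 := Rmin_r 1 d2).
specialize (H1 x' ltac:(lra)). rewrite <- !Y0_kernel in H1 by assumption.
unfold Yc. fold t0. set (s0 := Rmax 0 t'). assert (Hs0 : 0 <= s0) by apply Rmax_l.
assert (Q := Rmax_lip t' t). fold s0 t0 in Q.
assert (L : norm (minus (Y0 (exp x') phi s0) (Y0 (exp x') phi t0)) <= 2 * M * Rabs (s0 - t0)).
{ assert (E := exp_pos x').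
  assert (B : Rabs (s0 - t0) < 1) by lra. apply Rabs_lt_between in B.
  destruct (Rle_dec t0 s0) as [Ls|Ls].
  - rewrite Rabs_pos_eq by lra. apply (Y0_lipschitz _ phi t0 s0 (t0 + 1)); auto; lra.
  - rewrite norm_sym, Rabs_left by lra. replace (- (s0 - t0)) with (t0 - s0) by ring.
    apply (Y0_lipschitz _ phi s0 t0 (t0 + 1)); auto; lra. }
assert (ID : minus (Y0 (exp x') phi s0) (Y0 (exp x) phi t0) =
  plus (minus (Y0 (exp x') phi s0) (Y0 (exp x') phi t0)) (minus (Y0 (exp x') phi t0) (Y0 (exp x) phi t0))) by (vring X).
eapply Rle_lt_trans; [right; exact (f_equal norm ID)|].
eapply Rle_lt_trans; [apply norm_tri|].
assert (B2 : 2 * M * Rabs (s0 - t0) <= e / 2).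
{ apply Rle_trans with ((2 * M + 1) * d2).
  - apply Rmult_le_compat; try lra. apply Rabs_pos.
  - right. unfold d2. field. lra. }
lra.
Qed.

Lemma cont_bounded_on (phi : R -> X) T : cont phi -> exists M, 0 <= M /\ forall s, 0 <= s <= T -> norm (phi s) <= M.
Proof.
intros Hp. assert (T1 := Rmax_l 0 T). assert (T2 := Rmax_r 0 T).
destruct (continuity_ab_maj (fun s => norm (phi s)) 0 (Rmax 0 T) T1) as (s0 & Hs0 & _).
- intros s _. apply continuity_pt_locally. intros eps.
  destruct (Hp s eps (cond_pos eps)) as (d & Hd & Hs). exists (mkposreal d Hd). intros y Hy.
  eapply Rle_lt_trans; [apply norm_dist|]. apply Hs. exact Hy.
- exists (norm (phi s0)). split; [apply norm_ge_0|]. intros s Hs. apply Hs0. lra.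
Qed.

Variable al : R.
Hypothesis Hal : 0 < al < 1.

(** By [Y0_bound] relaxation gains 1 / (1 + r), so g may exceed the weight by the factor 1 + r. *)
Lemma Yc_family (g : R -> C) C0 phi : cont (X := CB) g -> cont phi ->
  (forall x, Cmod (g x) <= C0 * ((1 + exp x) * wgt al x)) ->
  cont2 (fun x t => scal (g x) (Yc (exp x) phi t)) /\
  locally_dominated al (fun x t => scal (g x) (Yc (exp x) phi t)).
Proof.
intros Hg Hp HC. split.
- apply cont2_scal; [exact (cont2_of_l (X := CB) g Hg)|apply cont2_Yc, Hp].
- intros T. destruct (cont_bounded_on phi (Rmax 0 T) Hp) as (M & M0 & HM).
  exists (C0 * (2 * M * Rmax 1 (Rmax 0 T))). intros x t Ht. rewrite norm_scal_X.
  assert (P := exp_pos x). assert (W := wgt_pos al x).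
  assert (B : norm (Yc (exp x) phi t) <= 2 * M * Rmax 1 (Rmax 0 T) / (1 + exp x)).
  { unfold Yc. apply Y0_bound; auto. split; [apply Rmax_l|]. apply Rle_max_compat_l, Ht. }
  eapply Rle_trans; [apply Rmult_le_compat; [apply Cmod_ge_0|apply norm_ge_0|apply HC|exact B]|].
  right. field. lra.
Qed.
End Relaxation.

(** * Power kernels and the Gamma function *)

Section Kernels.
Variable a : R.
Hypothesis Ha : 0 < a <= 1.

Definition pw (x : R) : R := if Rle_dec x 0 then 0 else exp (a * ln x).

Lemma pw_neg x : x <= 0 -> pw x = 0.
Proof. intros H. unfold pw. destruct (Rle_dec x 0); [reflexivity|contradiction]. Qed.
Lemma pw_pos x : 0 < x -> pw x = exp (a * ln x).
Proof. intros H. unfold pw. destruct (Rle_dec x 0); [lra|reflexivity]. Qed.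
Lemma pw_ge0 x : 0 <= pw x.
Proof. unfold pw. destruct (Rle_dec x 0); [lra|left; apply exp_pos]. Qed.
Lemma pw_gt0 x : 0 < x -> 0 < pw x.
Proof. intros H. rewrite pw_pos by exact H. apply exp_pos. Qed.

Lemma pw_le x y : x <= y -> pw x <= pw y.
Proof.
intros H. destruct (Rle_dec x 0) as [L|L]; [rewrite (pw_neg x L); apply pw_ge0|].
rewrite !pw_pos by lra. apply exp_le. apply Rmult_le_compat_l; [lra|].
destruct H as [H| ->]; [left; apply ln_increasing; lra|lra].
Qed.

Lemma pw_small e : 0 < e -> exists d, 0 < d /\ forall x, x <= d -> pw x <= e.
Proof.
intros He. exists (exp (ln e / a)). split; [apply exp_pos|]. intros x Hx.
eapply Rle_trans; [apply pw_le, Hx|]. rewrite pw_pos by apply exp_pos. rewrite ln_exp.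
replace (a * (ln e / a)) with (ln e) by (field; lra). rewrite exp_ln; lra.
Qed.

Lemma is_derive_pw x : 0 < x -> is_derive pw x (a * exp ((a - 1) * ln x)).
Proof.
intros Hx. apply (is_derive_ext_loc (fun y => exp (a * ln y))).
- exists (mkposreal x Hx). intros y Hy. symmetry. apply pw_pos.
  change (Rabs (y - x) < x) in Hy. apply Rabs_lt_between in Hy. lra.
- auto_derive; [exact Hx|]. replace ((a - 1) * ln x) with (a * ln x - ln x) by ring.
  unfold Rminus. rewrite exp_plus, exp_Ropp, exp_ln by exact Hx. field. lra.
Qed.

Lemma continuous_eps (f : R -> R) t : (forall e, 0 < e -> exists d, 0 < d /\ forall s, Rabs (s - t) < d -> Rabs (f s - f t) < e) ->
  continuous f t.
Proof.
intros H. apply (filterlim_locally_ball_norm (K := R_AbsRing) (U := R_NormedModule)). intros e.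
destruct (H e (cond_pos e)) as (d & Hd & Hs). exists (mkposreal d Hd). intros s Hst. apply Hs. exact Hst.
Qed.

Lemma pw_cont x : continuous pw x.
Proof.
destruct (Rlt_dec 0 x) as [L|L].
- apply (ex_derive_continuous (K := R_AbsRing) (V := R_NormedModule)). eexists. apply is_derive_pw, L.
- apply continuous_eps. intros e He. rewrite (pw_neg x) by lra.
  destruct (pw_small (e / 2)) as (d & Hd & H); [lra|]. exists d. split; [exact Hd|].
  intros s Hs. rewrite Rminus_0_r, Rabs_pos_eq by apply pw_ge0. apply Rabs_lt_between in Hs.
  assert (Q := H s ltac:(lra)). lra.
Qed.

Lemma pw_exp_cont x : continuous (fun y => pw y * exp (- y)) x.
Proof.
apply (continuous_mult (K := R_AbsRing) pw (fun y => exp (- y))); [apply pw_cont|].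
apply (ex_derive_continuous (K := R_AbsRing) (V := R_NormedModule)). auto_derive; auto.
Qed.

(** The lower incomplete Gamma function of parameter a + 1. *)
Definition igam (t : R) : R := RInt (fun x => pw x * exp (- x)) 0 t.

Lemma pw_affine x : 0 <= x -> pw x <= 1 + x.
Proof.
intros Hx. destruct (Rle_dec x 1) as [L|L].
- apply Rle_trans with (pw 1); [apply pw_le, L|]. rewrite pw_pos, ln_1, Rmult_0_r, exp_0 by lra. lra.
- rewrite pw_pos by lra. apply Rle_trans with (exp (1 * ln x)).
  + apply exp_le. apply Rmult_le_compat_r; [|lra]. rewrite <- ln_1. left. apply ln_increasing; lra.
  + rewrite Rmult_1_l, exp_ln by lra. lra.
Qed.

Lemma igam_mono s t : s <= t -> igam s <= igam t.
Proof.
intros Hst. unfold igam.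
assert (ex : forall p q, ex_RInt (fun x => pw x * exp (- x)) p q) by (intros; apply continuous_ex_RInt, pw_exp_cont).
assert (C1 := RInt_Chasles (fun x => pw x * exp (- x)) 0 s t (ex _ _) (ex _ _)). unfold plus in C1; simpl in C1.
assert (P : 0 <= RInt (fun x => pw x * exp (- x)) s t).
{ apply RInt_ge_0; [exact Hst|apply ex|]. intros x _. apply Rmult_le_pos; [apply pw_ge0|left; apply exp_pos]. }
lra.
Qed.

Lemma igam_bound t : 0 <= t -> igam t <= 2.
Proof.
intros Ht. unfold igam.
assert (IR : is_RInt (fun x => (1 + x) * exp (- x)) 0 t (minus (- (2 + t) * exp (- t)) (- (2 + 0) * exp (- 0)))).
{ apply (is_RInt_derive (V := R_CompleteNormedModule) (fun x => - (2 + x) * exp (- x))).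
  - intros x _. auto_derive; auto. ring.
  - intros x _. apply (ex_derive_continuous (K := R_AbsRing) (V := R_NormedModule)). auto_derive; auto. }
apply Rle_trans with (RInt (fun x => (1 + x) * exp (- x)) 0 t).
- apply RInt_le; [exact Ht|apply continuous_ex_RInt, pw_exp_cont|eexists; exact IR|].
  intros x Hx. apply Rmult_le_compat_r; [left; apply exp_pos|apply pw_affine; lra].
- rewrite (is_RInt_unique _ _ _ _ IR). unfold minus, plus, opp; simpl. rewrite Ropp_0, exp_0.
  assert (P := exp_pos (- t)). nra.
Qed.

Lemma igam_limit : exists L, 0 < L /\ (forall t, 0 <= t -> igam t <= L) /\
  forall e, 0 < e -> exists A, 0 < A /\ forall t, A <= t -> L - e < igam t.
Proof.
destruct (completeness (fun y => exists t, 0 <= t /\ y = igam t)) as [L [HL1 HL2]].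
- exists 2. intros y (t & Ht & ->). apply igam_bound, Ht.
- exists (igam 0), 0. split; [lra|reflexivity].
- exists L. assert (B : forall t, 0 <= t -> igam t <= L) by (intros t Ht; apply HL1; eauto).
  split.
  + apply Rlt_le_trans with (igam 1); [|apply B; lra]. unfold igam. apply RInt_gt_0; [lra| |intros; apply pw_exp_cont].
    intros x Hx. apply Rmult_lt_0_compat; [apply pw_gt0; lra|apply exp_pos].
  + split; [exact B|]. intros e He. apply NNPP. intros Hn.
    assert (Q : L <= L - e); [|lra]. apply HL2. intros y (t & Ht & ->). apply Rnot_lt_le. intros Hl.
    apply Hn. exists (t + 1). split; [lra|]. intros s Hs. assert (M := igam_mono t s ltac:(lra)). lra.
Qed.

(** Integration by parts turns the integral of s^(a-1) e^{-s}, singular at 0, into that of s^a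
    e^{-s}. This is Gamma(a + 1) = a Gamma(a), to which [igam] increases. *)
Lemma Gamma_igam : 0 < Gamma a /\ (forall t, 0 <= t -> igam t <= a * Gamma a) /\
  forall e, 0 < e -> exists A, 0 < A /\ forall t, A <= t -> a * Gamma a - e < igam t.
Proof.
destruct igam_limit as (L & HL & HB & HA).
assert (G : Gamma a = L / a).
{ unfold Gamma. apply (is_RInt_gen_unique (V := R_CompleteNormedModule)).
  (* A primitive of s^(a-1) e^{-s} on s > 0. *)
  set (F := fun s => pw s * exp (- s) / a + igam s / a).
  assert (IF : forall u v, 0 < u <= v -> is_RInt (fun s => Rpower s (a - 1) * exp (- s)) u v (minus (F v) (F u))).
  { intros u v Huv. apply (is_RInt_derive (V := R_CompleteNormedModule) F).
    - rewrite Rmin_left, Rmax_right by lra. intros x Hx.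
      assert (D1 : is_derive igam x (pw x * exp (- x))).
      { apply (is_derive_RInt (V := R_NormedModule) (fun x => pw x * exp (- x)) igam 0); [|apply pw_exp_cont].
        apply filter_forall. intros y. apply (RInt_correct (V := R_CompleteNormedModule)).
        apply continuous_ex_RInt, pw_exp_cont. }
      assert (D2 := is_derive_pw x ltac:(lra)).
      evar_last.
      { unfold F. apply (is_derive_plus (K := R_AbsRing) (V := R_NormedModule)).
        - apply (is_derive_ext (fun s => scal (/ a) (pw s * exp (- s)))); [intros; unfold scal; simpl; unfold mult; simpl; field; lra|].
          apply (is_derive_scal (fun s => pw s * exp (- s)) x (/ a)).
          apply (is_derive_mult pw (fun s => exp (- s)) x _ (- exp (- x)) D2); [auto_derive; auto; ring|intros; apply Rmult_comm].
        - apply (is_derive_ext (fun s => scal (/ a) (igam s))); [intros; unfold scal; simpl; unfold mult; simpl; field; lra|].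
          apply (is_derive_scal igam x (/ a) _ D1). }
      unfold plus, scal, mult; simpl; unfold mult; simpl. unfold Rpower. field. lra.
    - rewrite Rmin_left, Rmax_right by lra. intros x Hx.
      apply (ex_derive_continuous (K := R_AbsRing) (V := R_NormedModule)). unfold Rpower. auto_derive. lra. }
  intros P [eps HP].
  assert (E0 : 0 < eps) by apply cond_pos.
  destruct (HA (eps * a / 4)) as (A & HA0 & HA1); [nra|].
  assert (tail : exists A2, 0 < A2 /\ forall s, A2 <= s -> pw s * exp (- s) <= eps * a / 4).
  { destruct (exp_small (1/2) (eps * a / 16)) as (A2 & HA2 & HA3); [nra|lra|]. exists A2. split; [exact HA2|]. intros s Hs.
    assert (Q1 := pw_affine s ltac:(lra)). assert (Q2 := HA3 s Hs).
    assert (Q3 : 1 + s <= 4 * exp (1/2 * s)).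
    { assert (T := exp_ineq1_le (1/2 * s)). lra. }
    assert (Q4 : exp (- s) = exp (- (1/2) * s) * exp (- (1/2) * s)).
    { rewrite <- exp_plus. f_equal. field. }
    assert (Q5 : exp (1/2 * s) * exp (- (1/2) * s) = 1).
    { rewrite <- exp_plus, <- exp_0. f_equal. ring. }
    rewrite Q4. set (w := exp (- (1/2) * s)) in *. set (v := exp (1/2 * s)) in *.
    assert (w0 : 0 < w) by apply exp_pos. assert (p0 := pw_ge0 s).
    apply Rle_trans with (4 * v * (w * w)); [apply Rmult_le_compat_r; nra|].
    replace (4 * v * (w * w)) with (4 * (v * w) * w) by ring. rewrite Q5. lra. }
  destruct tail as (A2 & HA2 & HA3).
  destruct (pw_small (eps * a / 4)) as (d1 & Hd1 & Hd1'); [nra|].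
  assert (ic : continuous igam 0).
  { apply (ex_derive_continuous (K := R_AbsRing) (V := R_NormedModule)). exists (pw 0 * exp (- 0)).
    apply (is_derive_RInt (V := R_NormedModule) (fun x => pw x * exp (- x)) igam 0); [|apply pw_exp_cont].
    apply filter_forall. intros y. apply (RInt_correct (V := R_CompleteNormedModule)).
    apply continuous_ex_RInt, pw_exp_cont. }
  assert (P0 : 0 < eps * a / 4) by nra.
  destruct (proj1 (filterlim_locally_ball_norm (K := R_AbsRing) (U := R_NormedModule) (F := locally 0) igam (igam 0)) ic
    (mkposreal _ P0)) as [d2 Hd2].
  assert (i0 : igam 0 = 0) by exact (RInt_point (V := R_CompleteNormedModule) 0 _).
  (* For u < d and v > B each of the four boundary contributions is at most eps a / 4. *)
  set (d := Rmin 1 (Rmin d1 d2)). assert (m1 := Rmin_l 1 (Rmin d1 d2)). assert (m2 := Rmin_r 1 (Rmin d1 d2)).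
  assert (m3 := Rmin_l d1 d2). assert (m4 := Rmin_r d1 d2).
  assert (d0 : 0 < d) by (unfold d; repeat apply Rmin_pos; try lra; apply cond_pos).
  set (B := Rmax 1 (Rmax A A2)). assert (n1 := Rmax_l 1 (Rmax A A2)). assert (n2 := Rmax_r 1 (Rmax A A2)).
  assert (n3 := Rmax_l A A2). assert (n4 := Rmax_r A A2).
  apply (Filter_prod _ _ _ (fun u => 0 < u < d) (fun v => B < v)).
  - exists (mkposreal d d0). intros y Hy Hy0. change (Rabs (y - 0) < d) in Hy.
    rewrite Rminus_0_r, Rabs_pos_eq in Hy by lra. lra.
  - exists B. auto.
  - intros u v Hu Hv. exists (minus (F v) (F u)). split; [apply IF; unfold B, d in *; simpl; lra|].
    apply HP. change (Rabs (minus (F v) (F u) - L / a) < eps).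
    unfold minus, plus, opp; simpl. unfold F.
    assert (e1 : 0 <= pw v * exp (- v) <= eps * a / 4).
    { split; [apply Rmult_le_pos; [apply pw_ge0|left; apply exp_pos]|]. apply HA3. unfold B in Hv. lra. }
    assert (e2 : L - eps * a / 4 < igam v <= L).
    { split; [apply HA1|apply HB]; unfold B in Hv; lra. }
    assert (e3 : 0 <= pw u * exp (- u) <= eps * a / 4).
    { split; [apply Rmult_le_pos; [apply pw_ge0|left; apply exp_pos]|].
      assert (T := Hd1' u ltac:(unfold d in Hu; lra)). assert (T2 : exp (- u) <= 1) by (rewrite <- exp_0; apply exp_le; lra).
      assert (T3 := pw_ge0 u). assert (T4 := exp_pos (- u)). nra. }
    assert (e4 : Rabs (igam u) < eps * a / 4).
    { assert (T := Hd2 u). simpl in T. unfold ball_norm in T. simpl in T.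
      rewrite i0 in T. change (Rabs (u - 0) < d2 -> Rabs (igam u - 0) < eps * a / 4) in T. rewrite !Rminus_0_r in T.
      apply T. rewrite Rabs_pos_eq by lra. unfold d in Hu. lra. }
    apply Rabs_lt_between in e4.
    replace (pw v * exp (- v) / a + igam v / a + - (pw u * exp (- u) / a + igam u / a) - L / a)
      with ((pw v * exp (- v) + (igam v - L) - pw u * exp (- u) - igam u) / a) by (field; lra).
    unfold Rdiv. rewrite Rabs_mult, (Rabs_pos_eq (/ a)) by (left; apply Rinv_0_lt_compat; lra).
    apply (Rmult_lt_reg_r a); [lra|]. rewrite Rmult_assoc, Rinv_l, Rmult_1_r by lra.
    apply Rabs_lt_between. lra. }
rewrite G. replace (a * (L / a)) with L by (field; lra).
split; [apply Rdiv_lt_0_compat; lra|]. split; [exact HB|exact HA].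
Qed.

Definition GG : R := Gamma a.
Lemma GG_pos : 0 < GG.
Proof. exact (proj1 Gamma_igam). Qed.

(** x^a / Gamma(1 + a), the kernel of J^(1+a). *)
Definition k1 (x : R) : R := pw x / (a * GG).
(** The kernel x^(a-1) / Gamma(a) of J^a for x >= d, replaced below d by x^a / (d Gamma(a)), which
    is continuous and vanishes at 0. Its primitive [KK d] approximates [k1]. *)
Definition kd (d x : R) : R := pw x / Rmax x d / GG.
Definition KK (d x : R) : R := RInt (kd d) 0 x.

Lemma k1_ge0 x : 0 <= k1 x.
Proof.
unfold k1. assert (P := GG_pos). apply Rmult_le_pos; [apply pw_ge0|left; apply Rinv_0_lt_compat; nra].
Qed.
Lemma k1_neg x : x <= 0 -> k1 x = 0.
Proof. intros H. unfold k1. rewrite pw_neg by exact H. unfold Rdiv. ring. Qed.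
Lemma k1_le x y : x <= y -> k1 x <= k1 y.
Proof.
intros H. unfold k1. assert (P := GG_pos). apply Rmult_le_compat_r; [left; apply Rinv_0_lt_compat; nra|apply pw_le, H].
Qed.
Lemma k1_cont x : continuous k1 x.
Proof.
apply (continuous_mult (K := R_AbsRing) pw (fun _ => / (a * GG))); [apply pw_cont|apply continuous_const].
Qed.
Lemma k1_small e : 0 < e -> exists d, 0 < d < 1 /\ k1 d < e.
Proof.
intros He. assert (P := GG_pos). assert (Q : 0 < a * GG) by nra.
destruct (pw_small (e * (a * GG) / 2)) as (d & Hd & H); [nra|].
exists (Rmin d (1/2)). assert (m1 := Rmin_l d (1/2)). assert (m2 := Rmin_r d (1/2)).
split; [split; [apply Rmin_pos; lra|lra]|]. unfold k1.
apply (Rmult_lt_reg_r (a * GG)); [exact Q|]. unfold Rdiv at 1. rewrite Rmult_assoc, Rinv_l, Rmult_1_r by lra.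
specialize (H _ m1). nra.
Qed.

Lemma kd_neg d x : x <= 0 -> kd d x = 0.
Proof. intros H. unfold kd. rewrite pw_neg by exact H. unfold Rdiv. ring. Qed.

Lemma Rmax_cont d x : continuous (fun y => Rmax y d) x.
Proof.
apply continuous_eps. intros e He. exists e. split; [exact He|]. intros s Hs.
eapply Rle_lt_trans; [|exact Hs]. unfold Rmax. destruct (Rle_dec s d), (Rle_dec x d); unfold Rabs; repeat destruct (Rcase_abs _); lra.
Qed.

Lemma kd_cont d x : 0 < d -> continuous (kd d) x.
Proof.
intros Hd. assert (M := Rmax_r x d).
apply (continuous_mult (K := R_AbsRing) (fun x => pw x / Rmax x d) (fun _ => / GG)); [|apply continuous_const].
apply (continuous_mult (K := R_AbsRing) pw (fun x => / Rmax x d)); [apply pw_cont|].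
apply (continuous_comp (fun x => Rmax x d) Rinv); [apply Rmax_cont|].
apply (ex_derive_continuous (K := R_AbsRing) (V := R_NormedModule)). auto_derive. lra.
Qed.

Lemma kd_ge0 d x : 0 < d -> 0 <= kd d x.
Proof.
intros Hd. unfold kd. assert (P := GG_pos). assert (M := Rmax_r x d).
apply Rmult_le_pos; [apply Rmult_le_pos; [apply pw_ge0|]|]; left; apply Rinv_0_lt_compat; lra.
Qed.

Lemma kd_eq d x : 0 < d <= x -> kd d x = Rpower x (a - 1) / GG.
Proof.
intros Hx. unfold kd. rewrite Rmax_left, pw_pos by lra. unfold Rpower.
replace ((a - 1) * ln x) with (a * ln x + - ln x) by ring.
rewrite exp_plus, exp_Ropp, exp_ln by lra. reflexivity.
Qed.

Lemma KK_derive d x : 0 < d -> is_derive (KK d) x (kd d x).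
Proof.
intros Hd. apply (is_derive_RInt (V := R_NormedModule) (kd d) (KK d) 0); [|apply kd_cont, Hd].
apply filter_forall. intros y. apply (RInt_correct (V := R_CompleteNormedModule)).
apply continuous_ex_RInt. intros; apply kd_cont, Hd.
Qed.

Lemma KK_0 d : KK d 0 = 0.
Proof. exact (RInt_point (V := R_CompleteNormedModule) 0 _). Qed.

Lemma KK_mono d x y : 0 < d -> x <= y -> KK d x <= KK d y.
Proof.
intros Hd H. assert (ex : forall p q, ex_RInt (kd d) p q) by (intros; apply continuous_ex_RInt; intros; apply kd_cont, Hd).
assert (C1 := RInt_Chasles (kd d) 0 x y (ex _ _) (ex _ _)). unfold plus in C1; simpl in C1.
assert (P : 0 <= RInt (kd d) x y) by (apply RInt_ge_0; auto; intros; apply kd_ge0, Hd). unfold KK. lra.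
Qed.

Lemma KK_neg d x : 0 < d -> x <= 0 -> KK d x = 0.
Proof.
intros Hd Hx. unfold KK. rewrite (RInt_ext (V := R_CompleteNormedModule) (kd d) (fun _ => 0)).
- rewrite RInt_const. unfold scal; simpl; unfold mult; simpl. ring.
- rewrite Rmin_right, Rmax_left by exact Hx. intros y Hy. apply kd_neg. lra.
Qed.

Lemma k1_derive x : 0 < x -> is_derive k1 x (Rpower x (a - 1) / GG).
Proof.
intros Hx. assert (P := GG_pos).
apply (is_derive_ext (fun s => scal (/ (a * GG)) (pw s))); [intros; unfold scal, k1; simpl; unfold mult; simpl; unfold Rdiv; ring|].
evar_last; [apply (is_derive_scal pw x (/ (a * GG)) _ (is_derive_pw x Hx))|].
unfold scal; simpl; unfold mult; simpl. unfold Rpower. field. split; lra.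
Qed.

(* k1 - KK d increases on [0, d] and is constant afterwards. *)
Lemma KK_k1 d x : 0 < d -> 0 <= x -> 0 <= k1 x - KK d x <= k1 d.
Proof.
intros Hd Hx. set (D := fun y => k1 y - KK d y).
assert (DD : forall y, 0 < y -> is_derive D y (Rpower y (a - 1) / GG - kd d y)).
{ intros y Hy. apply (is_derive_minus (K := R_AbsRing) (V := R_NormedModule) k1 (KK d)); [apply k1_derive, Hy|apply KK_derive, Hd]. }
assert (Dc : forall y, continuity_pt D y).
{ intros y. apply continuity_pt_filterlim.
  apply (continuous_minus (V := R_NormedModule) k1 (KK d)); [apply k1_cont|].
  apply (ex_derive_continuous (K := R_AbsRing) (V := R_NormedModule)). eexists. apply KK_derive, Hd. }
assert (mono : forall p q, 0 <= p -> p <= q -> D p <= D q).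
{ intros p q Hp Hq. destruct (MVT_gen D p q (fun y => Rpower y (a - 1) / GG - kd d y)) as (c & Hc & E).
  - rewrite Rmin_left, Rmax_right by exact Hq. intros y Hy. apply DD. lra.
  - intros; apply Dc.
  - rewrite Rmin_left, Rmax_right in Hc by exact Hq.
    assert (NN : 0 <= (Rpower c (a - 1) / GG - kd d c) * (q - p)).
    { apply Rmult_le_pos; [|lra]. assert (G0 := GG_pos).
      destruct (Rle_dec c 0) as [L|L].
      - rewrite kd_neg by exact L. assert (R0 : 0 < Rpower c (a - 1)) by apply exp_pos.
        assert (0 < Rpower c (a - 1) / GG) by (apply Rdiv_lt_0_compat; assumption). lra.
      - assert (c0 : 0 < c) by lra.
        assert (E2 : Rpower c (a - 1) = pw c / c).
        { rewrite pw_pos by exact c0. unfold Rpower. replace ((a - 1) * ln c) with (a * ln c + - ln c) by ring.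
          rewrite exp_plus, exp_Ropp, exp_ln by exact c0. reflexivity. }
        rewrite E2. unfold kd. assert (M := Rmax_l c d).
        assert (T : pw c / Rmax c d <= pw c / c).
        { apply Rmult_le_compat_l; [apply pw_ge0|]. apply Rinv_le_contravar; lra. }
        assert (T2 : pw c / Rmax c d / GG <= pw c / c / GG).
        { apply Rmult_le_compat_r; [left; apply Rinv_0_lt_compat; exact G0|exact T]. }
        lra. }
    lra. }
assert (D0 : D 0 = 0). { unfold D. rewrite KK_0, k1_neg by lra. ring. }
split; [rewrite <- D0; apply mono; lra|].
assert (up : D d <= k1 d).
{ unfold D. assert (Q := KK_mono d 0 d Hd ltac:(lra)). rewrite KK_0 in Q. lra. }
destruct (Rle_dec x d) as [L|L].
- eapply Rle_trans; [apply (mono x d Hx L)|exact up].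
- assert (E : D x = D d).
  { destruct (MVT_gen D d x (fun y => Rpower y (a - 1) / GG - kd d y)) as (c & Hc & E).
    - rewrite Rmin_left, Rmax_right by lra. intros y Hy. apply DD. lra.
    - intros; apply Dc.
    - rewrite Rmin_left, Rmax_right in Hc by lra. rewrite kd_eq in E by lra. lra. }
  change (D x <= k1 d). lra.
Qed.
End Kernels.

(** * The fractional integral as a limit of regular convolutions *)

Section FractionalIntegral.
Context {X : CBanach}.
Variable a : R.
Hypothesis Ha : 0 < a <= 1.

Lemma cont2_diff (f : R -> R) : (forall x, continuous f x) -> cont2 (X := CB) (fun t s => RtoC (f (t - s))).
Proof.
intros Hf. apply (cont2_R (fun t s => f (t - s))). intros p.
apply (continuous_comp (fun q : R * R => fst q - snd q) f); [|apply Hf].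
apply (continuous_minus (V := R_NormedModule) (fun q : R * R => fst q) (fun q : R * R => snd q)).
- apply continuous_fst.
- apply continuous_snd.
Qed.

Lemma cont2_conv (f : R -> R) (m : R -> X) : (forall x, continuous f x) -> cont m ->
  cont2 (fun t s => scal (RtoC (f (t - s))) (m s)).
Proof. intros Hf Hm. apply cont2_scal; [exact (cont2_diff f Hf)|exact (cont2_of_r m Hm)]. Qed.

Lemma cont_conv (f : R -> R) (m : R -> X) t : (forall x, continuous f x) -> cont m ->
  cont (fun s => scal (RtoC (f (t - s))) (m s)).
Proof. intros Hf Hm. exact (cont2_r _ t (cont2_conv f m Hf Hm)). Qed.

Lemma RInt_kd_reflect M d t b c : 0 < d ->
  is_RInt (fun s => M * kd a d (t - s)) b c (M * (KK a d (t - b) - KK a d (t - c))).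
Proof.
intros Hd. evar_last.
- apply (is_RInt_derive (V := R_CompleteNormedModule) (fun s => - M * KK a d (t - s))).
  + intros x _. apply (is_derive_ext (fun s => scal (- M) (KK a d (t - s)))); [intros; reflexivity|].
    evar_last.
    * apply (is_derive_scal (fun s => KK a d (t - s)) x (- M)).
      apply (is_derive_comp (K := R_AbsRing) (V := R_NormedModule) (KK a d) (fun s => t - s)); [apply KK_derive; assumption|].
      auto_derive; [exact I|reflexivity].
    * unfold scal; simpl; unfold mult; simpl. ring.
  + intros x _. apply (continuous_mult (K := R_AbsRing) (fun _ => M) (fun s => kd a d (t - s))); [apply continuous_const|].
    apply (continuous_comp (fun s => t - s) (kd a d)); [|apply kd_cont; assumption].
    apply (ex_derive_continuous (K := R_AbsRing) (V := R_NormedModule)). auto_derive; exact I.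
- unfold minus, plus, opp; simpl. ring.
Qed.

Lemma kd_int_bound (m : R -> X) M d t b c : 0 < d -> b <= c <= t -> cont m ->
  (forall s, b <= s <= c -> norm (m s) <= M) ->
  norm (Int (fun s => scal (RtoC (kd a d (t - s))) (m s)) b c) <= M * k1 a (t - b).
Proof.
intros Hd Hbc Hm HM.
assert (M0 : 0 <= M). { eapply Rle_trans; [apply (norm_ge_0 (m b))|apply HM; lra]. }
apply Rle_trans with (M * (KK a d (t - b) - KK a d (t - c))).
- rewrite <- (is_RInt_unique _ _ _ _ (RInt_kd_reflect M d t b c Hd)).
  apply Int_norm_RInt; [lra|apply cont_conv; [intros; apply kd_cont; assumption|exact Hm]| |].
  + intros s Hs. rewrite norm_scal_X, Cmod_R, Rabs_pos_eq by (apply kd_ge0; assumption).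
    assert (Q := HM s Hs). assert (P := kd_ge0 a Ha d (t - s) Hd).
    rewrite Rmult_comm. apply Rmult_le_compat_r; assumption.
  + eexists. apply RInt_kd_reflect, Hd.
- apply Rmult_le_compat_l; [exact M0|].
  assert (Q := KK_k1 a Ha d (t - b) Hd ltac:(lra)).
  assert (Q2 := KK_mono a Ha d 0 (t - c) Hd ltac:(lra)). rewrite KK_0 in Q2. lra.
Qed.

Definition conv_kd (d : R) (m : R -> X) (t : R) : X := Int (fun s => scal (RtoC (kd a d (t - s))) (m s)) 0 t.

(** On [0, b] the kernel with parameter t - b is the true singular one, so this compares J^a
    truncated at b with a regular convolution. The kernels agree for s <= t - d; each remaining
    piece is at most M k1(d), the primitive of [kd] being below [k1]. *)
Lemma conv_kd_gap (m : R -> X) M d t b : 0 < d -> 0 <= b < t -> t - d <= b -> cont m ->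
  (forall s, 0 <= s <= t -> norm (m s) <= M) ->
  norm (minus (Int (fun s => scal (RtoC (kd a (t - b) (t - s))) (m s)) 0 b) (conv_kd d m t)) <= 2 * M * k1 a d.
Proof.
intros Hd Hb Htd Hm HM.
set (p := Rmax 0 (t - d)). assert (p0 : 0 <= p) by apply Rmax_l. assert (p1 : t - d <= p) by apply Rmax_r.
assert (p2 : p <= b) by (apply Rmax_lub; lra).
assert (M0 : 0 <= M). { eapply Rle_trans; [apply (norm_ge_0 (m 0))|apply HM; lra]. }
assert (C1 : cont (fun s => scal (RtoC (kd a (t - b) (t - s))) (m s))).
{ apply cont_conv; [intros; apply kd_cont; [exact Ha|lra]|exact Hm]. }
assert (C2 : cont (fun s => scal (RtoC (kd a d (t - s))) (m s))).
{ apply cont_conv; [intros; apply kd_cont; assumption|exact Hm]. }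
unfold conv_kd. rewrite <- (Int_Chasles _ 0 p b C1), <- (Int_Chasles _ 0 p t C2).
assert (E : Int (fun s => scal (RtoC (kd a (t - b) (t - s))) (m s)) 0 p = Int (fun s => scal (RtoC (kd a d (t - s))) (m s)) 0 p).
{ unfold p, Rmax. destruct (Rle_dec 0 (t - d)) as [L|L].
  - apply Int_ext; [lra|]. intros s Hs. do 2 f_equal. rewrite !kd_eq; try assumption; try lra; reflexivity.
  - rewrite !Int_point. reflexivity. }
rewrite E.
assert (B1 := kd_int_bound m M (t - b) t p b ltac:(lra) ltac:(lra) Hm ltac:(intros; apply HM; lra)).
assert (B2 := kd_int_bound m M d t p t Hd ltac:(lra) Hm ltac:(intros; apply HM; lra)).
assert (K1 := k1_le a Ha (t - p) d ltac:(lra)).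
assert (K2 : M * k1 a (t - p) <= M * k1 a d) by (apply Rmult_le_compat_l; assumption).
revert B1 B2. generalize (Int (fun s => scal (RtoC (kd a (t - b) (t - s))) (m s)) p b).
generalize (Int (fun s => scal (RtoC (kd a d (t - s))) (m s)) p t).
generalize (Int (fun s => scal (RtoC (kd a d (t - s))) (m s)) 0 p). intros x y z B1 B2.
assert (ID : minus (plus x z) (plus x y) = minus z y) by (vring X).
eapply Rle_trans; [right; exact (f_equal norm ID)|]. eapply Rle_trans; [apply norm_minus_X|]. lra.
Qed.

(* q is the fractional integral of m: the limit of the convolutions with the truncated kernels [kd]. *)
Definition fracint (m q : R -> X) : Prop := forall T, 0 <= T -> exists C, 0 <= C /\
  forall d, 0 < d < 1 -> forall t, 0 <= t <= T -> norm (minus (q t) (conv_kd d m t)) <= C * k1 a d.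

(** By [conv_kd_gap] the truncated integrals are Cauchy as b -> t, and the same estimate passes to
    the limit with the rate k1(d). *)
Lemma J_fracint (u : R -> X) : continuous_on half_line u -> fracint (ext u) (J a u).
Proof.
intros Hu. assert (Hm := cont_ext u Hu). set (m := ext u) in *.
intros T HT. destruct (cont_bounded_on m T Hm) as (M & M0 & HM).
exists (2 * M + 1). split; [lra|]. intros d Hd t Ht.
assert (K0 := k1_ge0 a Ha d).
apply Rle_trans with (2 * M * k1 a d); [|nra].
unfold J. destruct (Rlt_dec 0 t) as [L|L].
- set (I := fun b => Int (fun s => scal (RtoC (kd a (t - b) (t - s))) (m s)) 0 b).
  assert (G : forall d b, 0 < d -> 0 <= b < t -> t - d <= b -> norm (minus (I b) (conv_kd d m t)) <= 2 * M * k1 a d).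
  { intros d' b Hd' Hb Hb'. apply (conv_kd_gap m M d' t b Hd' Hb Hb' Hm). intros s Hs. apply HM. lra. }
  assert (near : forall d s, 0 < d -> / t < s -> / d < s -> 0 <= t - / s < t /\ t - d <= t - / s).
  { intros d' s Hd' H1 H2. assert (0 < / t) by (apply Rinv_0_lt_compat; lra). assert (0 < / d') by (apply Rinv_0_lt_compat; lra).
    assert (0 < / s) by (apply Rinv_0_lt_compat; lra).
    assert (/ s <= t) by (rewrite <- (Rinv_inv t); apply Rinv_le_contravar; lra).
    assert (/ s <= d') by (rewrite <- (Rinv_inv d'); apply Rinv_le_contravar; lra). lra. }
  (* The variable s with b = t - 1/s turns the limit at t from the left into one at infinity. *)
  destruct (cauchy_limit (fun s => I (t - / s))) as [l Hl].
  { intros e He. destruct (k1_small a Ha (e / (4 * M + 1))) as (d' & Hd' & HK); [apply Rdiv_lt_0_compat; lra|].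
    exists (Rmax (/ t) (/ d')). assert (m1 := Rmax_l (/ t) (/ d')). assert (m2 := Rmax_r (/ t) (/ d')).
    intros s s' Hs Hs'.
    destruct (near d' s) as [N1 N2]; try lra. destruct (near d' s') as [N1' N2']; try lra.
    assert (G1 := G d' (t - / s) ltac:(lra) N1 N2). assert (G2 := G d' (t - / s') ltac:(lra) N1' N2').
    revert G1 G2. generalize (I (t - / s)) (I (t - / s')) (conv_kd d' m t). intros x y z G1 G2.
    assert (ID : minus x y = minus (minus x z) (minus y z)) by (vring X).
    eapply Rle_lt_trans; [right; exact (f_equal norm ID)|]. eapply Rle_lt_trans; [apply norm_minus_X|].
    assert (K' := k1_ge0 a Ha d').
    assert (S : (4 * M + 1) * k1 a d' < e).
    { apply (Rmult_lt_compat_l (4 * M + 1)) in HK; [|lra]. replace ((4 * M + 1) * (e / (4 * M + 1))) with e in HK by (field; lra). exact HK. }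
    lra. }
  assert (Hl2 : forall e, 0 < e -> exists b0, b0 < t /\ 0 <= b0 /\ forall b, b0 < b < t -> norm (minus (I b) l) < e).
  { intros e He. destruct (Hl e He) as (B & HB).
    set (B' := Rmax 1 (Rmax B (/ t))). assert (n1 := Rmax_l 1 (Rmax B (/ t))). assert (n2 := Rmax_r 1 (Rmax B (/ t))).
    assert (n3 := Rmax_l B (/ t)). assert (n4 := Rmax_r B (/ t)). fold B' in n1, n2.
    assert (Bp : 0 < / B') by (apply Rinv_0_lt_compat; lra).
    assert (Bt : / B' <= t). { rewrite <- (Rinv_inv t). apply Rinv_le_contravar; [apply Rinv_0_lt_compat; lra|lra]. }
    exists (t - / B'). split; [lra|]. split; [lra|]. intros b Hb.
    assert (Q : b = t - / / (t - b)) by (rewrite Rinv_inv; ring).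
    rewrite Q. apply HB. apply Rle_lt_trans with B'; [lra|].
    rewrite <- (Rinv_inv B'). apply Rinv_lt_contravar; [apply Rmult_lt_0_compat; lra|lra]. }
  assert (E : RInt_gen (V := real_of X)
      (fun tau => scal (V := real_of X) (Rpower (t - tau) (a - 1) / Gamma a) (u tau)) (at_point 0) (at_left t) = l).
  { apply (is_RInt_gen_unique (V := real_of X)). intros P [eps HP].
    destruct (Hl2 eps (cond_pos eps)) as (b0 & Hb0 & Hb1 & Hb2).
    apply (Filter_prod _ _ _ (fun x => x = 0) (fun b => b0 < b < t)).
    - reflexivity.
    - assert (P0 : 0 < t - b0) by lra. exists (mkposreal _ P0). intros b Hb Hbt. change (Rabs (b - t) < t - b0) in Hb.
      rewrite Rabs_left in Hb by lra. lra.
    - intros x b Hx Hb. rewrite Hx. exists (I b). split.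
      + simpl. apply (is_RInt_ext (V := real_of X) (fun s => scal (RtoC (kd a (t - b) (t - s))) (m s))).
        * rewrite Rmin_left, Rmax_right by lra. intros s Hs. rewrite kd_eq by (try assumption; lra).
          unfold m. rewrite ext_eq by (unfold half_line; lra). reflexivity.
        * apply (RInt_correct (V := real_of X)). apply ex_Int. apply cont_conv; [intros; apply kd_cont; [exact Ha|lra]|exact Hm].
      + apply HP. apply (norm_compat1 (V := real_of X)). apply Hb2. exact Hb. }
  rewrite E. apply le_epsilon. intros e He.
  destruct (Hl2 e He) as (b0 & Hb0 & Hb1 & Hb2).
  set (b := Rmax ((b0 + t) / 2) (t - d)).
  assert (b1 := Rmax_l ((b0 + t) / 2) (t - d)). assert (b2 := Rmax_r ((b0 + t) / 2) (t - d)). fold b in b1, b2.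
  assert (b3 : b < t) by (apply Rmax_lub_lt; lra).
  assert (G1 := G d b ltac:(lra) ltac:(lra) b2). assert (G2 := Hb2 b ltac:(lra)).
  revert G1 G2. generalize (I b) (conv_kd d m t). intros x y G1 G2.
  assert (ID : minus l y = minus (minus x y) (minus x l)) by (vring X).
  eapply Rle_trans; [right; exact (f_equal norm ID)|]. eapply Rle_trans; [apply norm_minus_X|]. lra.
- assert (t0 : t = 0) by lra. subst t. unfold conv_kd. rewrite Int_point.
  assert (ID : minus (zero : X) zero = zero) by (vring X).
  eapply Rle_trans; [right; exact (f_equal norm ID)|]. eapply Rle_trans; [right; exact norm_zero'|]. apply Rmult_le_pos; lra.
Qed.

Lemma fracint_ext (m m' q q' : R -> X) : (forall t, half_line t -> m t = m' t) -> (forall t, half_line t -> q t = q' t) ->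
  fracint m q -> fracint m' q'.
Proof.
intros E1 E2 H T HT. destruct (H T HT) as (C & C0 & HC). exists C. split; [exact C0|]. intros d Hd t Ht.
rewrite <- E2 by (unfold half_line; lra).
replace (conv_kd d m' t) with (conv_kd d m t); [apply HC; assumption|].
apply Int_ext; [lra|]. intros s Hs. f_equal. apply E1. unfold half_line. lra.
Qed.

Lemma fracint_plus (m m' q q' : R -> X) : cont m -> cont m' -> fracint m q -> fracint m' q' ->
  fracint (fun t => plus (m t) (m' t)) (fun t => plus (q t) (q' t)).
Proof.
intros Hm Hm' H H' T HT. destruct (H T HT) as (C & C0 & HC). destruct (H' T HT) as (C' & C0' & HC').
exists (C + C'). split; [lra|]. intros d Hd t Ht. specialize (HC d Hd t Ht). specialize (HC' d Hd t Ht).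
assert (E : conv_kd d (fun t => plus (m t) (m' t)) t = plus (conv_kd d m t) (conv_kd d m' t)).
{ unfold conv_kd. rewrite <- Int_plus by (apply cont_conv; [intros; apply kd_cont; [exact Ha|lra]|assumption]).
  apply Int_ext; [lra|]. intros s _. generalize (RtoC (kd a d (t - s))). intros. vring X. }
rewrite E. revert HC HC'. generalize (q t) (q' t) (conv_kd d m t) (conv_kd d m' t). intros x y z w HC HC'.
assert (ID : minus (plus x y) (plus z w) = plus (minus x z) (minus y w)) by (vring X).
eapply Rle_trans; [right; exact (f_equal norm ID)|]. eapply Rle_trans; [apply norm_tri|]. lra.
Qed.

Lemma fracint_linear (L : X -> X) K m q :
  (forall x y, L (minus x y) = minus (L x) (L y)) -> (forall (c : C) x, L (scal c x) = scal c (L x)) ->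
  (forall x, norm (L x) <= K * norm x) -> cont m -> fracint m q -> fracint (fun t => L (m t)) (fun t => L (q t)).
Proof.
intros Lm Ls Lb Hm H T HT. destruct (H T HT) as (C & C0 & HC). exists (Rabs K * C).
assert (K0 := Rabs_pos K). split; [apply Rmult_le_pos; assumption|]. intros d Hd t Ht. specialize (HC d Hd t Ht).
assert (E : conv_kd d (fun t => L (m t)) t = L (conv_kd d m t)).
{ unfold conv_kd. rewrite (Int_linear L K Lm Ls Lb _ 0 t ltac:(lra)) by (apply cont_conv; [intros; apply kd_cont; [exact Ha|lra]|exact Hm]).
  apply Int_ext; [lra|]. intros s _. symmetry. apply Ls. }
rewrite E, <- Lm. eapply Rle_trans; [apply Lb|].
assert (N := norm_ge_0 (minus (q t) (conv_kd d m t))).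
rewrite Rmult_assoc. apply Rle_trans with (Rabs K * norm (minus (q t) (conv_kd d m t))).
- apply Rmult_le_compat_r; [exact N|apply Rle_abs].
- apply Rmult_le_compat_l; assumption.
Qed.

(* Integrating the fractional integral once more makes the kernel continuous: J^1 J^a m = J^(1+a) m. *)
Lemma fracint_Int m q T : 0 <= T -> cont m -> cont q -> fracint m q ->
  Int q 0 T = Int (fun s => scal (RtoC (k1 a (T - s))) (m s)) 0 T.
Proof.
intros HT Hm Hq H. destruct (H T HT) as (C & C0 & HC).
destruct (cont_bounded_on m T Hm) as (M & M0 & HM).
assert (Ck : cont (fun s => scal (RtoC (k1 a (T - s))) (m s))) by (apply cont_conv; [intros; apply k1_cont, Ha|exact Hm]).
assert (B : forall d, 0 < d < 1 ->
  norm (minus (Int q 0 T) (Int (fun s => scal (RtoC (k1 a (T - s))) (m s)) 0 T)) <= (C + M) * T * k1 a d).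
{ intros d Hd. assert (d0 : 0 < d) by lra.
  assert (K2 : cont2 (fun t s => scal (RtoC (kd a d (t - s))) (m s))) by (apply cont2_conv; [intros; apply kd_cont; assumption|exact Hm]).
  (* [kd] vanishes for negative arguments, so the inner integral may extend over all of [0, T] and
     Fubini be used on a square. *)
  set (Bf := fun t => Int (fun s => scal (RtoC (kd a d (t - s))) (m s)) 0 T).
  assert (CB0 : cont Bf) by (apply (cont_Int_param _ 0 T HT K2)).
  assert (EB : forall t, 0 <= t <= T -> Bf t = conv_kd d m t).
  { intros t Ht. unfold Bf, conv_kd. rewrite <- (Int_Chasles _ 0 t T) by (apply (cont2_r _ t K2)).
    rewrite (Int_ext (fun s => scal (RtoC (kd a d (t - s))) (m s)) (fun _ => zero) t T); [| lra|].
    - rewrite Int_const. generalize (Int (fun s => scal (RtoC (kd a d (t - s))) (m s)) 0 t). intros. vring X.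
    - intros s Hs. rewrite (kd_neg a d) by lra. vring X. }
  assert (F : Int Bf 0 T = Int (fun s => scal (RtoC (KK a d (T - s))) (m s)) 0 T).
  { unfold Bf. rewrite (Int_fubini _ 0 T 0 T HT HT K2). apply Int_ext; [exact HT|]. intros s Hs.
    rewrite (Int_scal_r (m s) (fun t => RtoC (kd a d (t - s))) 0 T HT (cont2_l _ s (cont2_diff _ (fun x => kd_cont a Ha d x d0)))).
    f_equal. assert (cc : forall t, continuous (fun x => kd a d (x - s)) t).
    { intros t. apply (continuous_comp (fun x => x - s) (kd a d)); [|apply kd_cont; assumption].
      apply (ex_derive_continuous (K := R_AbsRing) (V := R_NormedModule)). auto_derive; exact I. }
    rewrite (Int_RtoC (fun t => kd a d (t - s)) 0 T HT cc). f_equal.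
    assert (IR : is_RInt (fun t => kd a d (t - s)) 0 T (minus (KK a d (T - s)) (KK a d (0 - s)))).
    { apply (is_RInt_derive (V := R_CompleteNormedModule) (fun t => KK a d (t - s))).
      - intros x _. evar_last.
        + apply (is_derive_comp (K := R_AbsRing) (V := R_NormedModule) (KK a d) (fun t => t - s)); [apply KK_derive; assumption|].
          auto_derive; [exact I|reflexivity].
        + unfold scal; simpl; unfold mult; simpl. ring.
      - intros x _. apply cc. }
    rewrite (is_RInt_unique _ _ _ _ IR), (KK_neg a d (0 - s)) by lra. unfold minus, plus, opp; simpl. ring. }
  assert (CK : cont (fun s => scal (RtoC (KK a d (T - s))) (m s))).
  { apply cont_conv; [|exact Hm]. intros x. apply (ex_derive_continuous (K := R_AbsRing) (V := R_NormedModule)).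
    eexists. apply KK_derive; assumption. }
  assert (E1 : norm (minus (Int q 0 T) (Int Bf 0 T)) <= C * k1 a d * (T - 0)).
  { rewrite <- Int_minus by assumption. apply Int_norm; [exact HT|apply cont_minus; assumption|].
    intros t Ht. rewrite EB by exact Ht. apply HC; assumption. }
  assert (E2 : norm (minus (Int Bf 0 T) (Int (fun s => scal (RtoC (k1 a (T - s))) (m s)) 0 T)) <= M * k1 a d * (T - 0)).
  { rewrite F, <- Int_minus by assumption. apply Int_norm; [exact HT|apply cont_minus; assumption|].
    intros s Hs. assert (Q := KK_k1 a Ha d (T - s) d0 ltac:(lra)).
    assert (ID : minus (scal (RtoC (KK a d (T - s))) (m s)) (scal (RtoC (k1 a (T - s))) (m s)) =
      scal (RtoC (KK a d (T - s) - k1 a (T - s))) (m s)).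
    { rewrite RtoC_minus. generalize (RtoC (KK a d (T - s))) (RtoC (k1 a (T - s))). intros. vring X. }
    eapply Rle_trans; [right; exact (f_equal norm ID)|]. rewrite norm_scal_X, Cmod_R.
    rewrite Rmult_comm. apply Rmult_le_compat; [apply norm_ge_0|apply Rabs_pos|apply HM; exact Hs|].
    rewrite Rabs_left1; lra. }
  revert E1 E2. generalize (Int q 0 T) (Int Bf 0 T) (Int (fun s => scal (RtoC (k1 a (T - s))) (m s)) 0 T). intros x y z E1 E2.
  assert (ID : minus x z = plus (minus x y) (minus y z)) by (vring X).
  eapply Rle_trans; [right; exact (f_equal norm ID)|]. eapply Rle_trans; [apply norm_tri|]. lra. }
apply minus_zero_eq. apply le_epsilon. intros e He. rewrite Rplus_0_l.
destruct (k1_small a Ha (e / ((C + M) * T + 1))) as (d & Hd & HK).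
{ apply Rdiv_lt_0_compat; [exact He|]. assert (0 <= (C + M) * T) by (apply Rmult_le_pos; lra). lra. }
assert (P : 0 <= (C + M) * T) by (apply Rmult_le_pos; lra).
assert (K0 := k1_ge0 a Ha d).
assert (S : ((C + M) * T + 1) * k1 a d < e).
{ apply (Rmult_lt_compat_l ((C + M) * T + 1)) in HK; [|lra].
  replace (((C + M) * T + 1) * (e / ((C + M) * T + 1))) with e in HK by (field; lra). exact HK. }
eapply Rle_trans; [apply (B d Hd)|]. lra.
Qed.
End FractionalIntegral.

Lemma continuous_of_cont (f : R -> R) : cont (X := CB) (fun x => RtoC (f x)) -> forall t, continuous f t.
Proof.
intros H t. apply continuous_eps. intros e He. destruct (H t e He) as (d & Hd & Hs). exists d. split; [exact Hd|].
intros s Hst. specialize (Hs s Hst). change (Cmod (RtoC (f s) - RtoC (f t))%C < e) in Hs.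
rewrite <- RtoC_minus, Cmod_R in Hs. exact Hs.
Qed.

Lemma exp_weight_cont r t (phi : R -> R) : (forall s, continuous phi s) ->
  forall s, continuous (fun s => exp (- r * (t - s)) * phi s) s.
Proof.
intros Hp s. apply (continuous_mult (K := R_AbsRing) (fun s => exp (- r * (t - s))) phi); [|apply Hp].
apply (ex_derive_continuous (K := R_AbsRing) (V := R_NormedModule)). auto_derive; exact I.
Qed.

Lemma Y0_real r (phi : R -> R) t : 0 <= t -> (forall s, continuous phi s) ->
  Y0 (X := CB) r (fun s => RtoC (phi s)) t = RtoC (RInt (fun s => exp (- r * (t - s)) * phi s) 0 t).
Proof.
intros Ht Hp. rewrite Y0_kernel; [|exact Ht|exact (cont_of_R phi Hp)].
rewrite <- Int_RtoC; [|exact Ht|].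
- apply Int_ext; [exact Ht|]. intros s _. symmetry. exact (RtoC_mult _ _).
- exact (exp_weight_cont r t phi Hp).
Qed.

(** * The convolution identity J^(1-al) J^(1+al) = J^2 *)

Section Convolution.
Variable al : R.
Hypothesis Hal : 0 < al < 1.
Let Ha : 0 < al <= 1.
Proof. lra. Qed.

Definition kc (s : R) : C := RtoC (k1 al s).
Lemma kc_cont : cont (X := CB) kc.
Proof. exact (cont_of_R _ (k1_cont al Ha)). Qed.

(** The integral of r^(al-1) against the relaxation of s^al / Gamma(1 + al) at time 1. Its value is
    Gamma(al) Gamma(1 - al), but it is identified only through [kappa_pfun]. *)
Definition kappa : C := II (X := CB) (fun x => scal (RtoC (exp (al * x))) (Yc (X := CB) (exp x) kc 1)).

Lemma exp_family : forall x, Cmod (RtoC (exp (al * x))) <= 1 * ((1 + exp x) * wgt al x).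
Proof. exact (gk_num al Hal). Qed.

Lemma kappa_is : is_II (X := CB) (fun x => scal (RtoC (exp (al * x))) (Yc (X := CB) (exp x) kc 1)) kappa.
Proof.
destruct (Yc_family (X := CB) al Hal (fun x => RtoC (exp (al * x))) 1 kc (cont_CB_exp al) kc_cont exp_family) as [F1 F2].
destruct (F2 1) as [C0 HC0].
apply (II_dominated al Hal (X := CB) _ C0); [exact (cont2_l _ 1 F1)|]. intros x. apply HC0. lra.
Qed.

Lemma k1_scale y s : 0 < y -> k1 al (y * s) = exp (al * ln y) * k1 al s.
Proof.
intros Hy. unfold k1. destruct (Rle_dec s 0) as [L|L].
- rewrite !pw_neg; [unfold Rdiv; ring|exact L|nra].
- rewrite !pw_pos; [|lra|apply Rmult_lt_0_compat; lra].
  rewrite ln_mult, Rmult_plus_distr_l, exp_plus by lra. unfold Rdiv. ring.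
Qed.

(** Homogeneity of [k1]: the substitution s -> y s trades the time y for the rate r y. *)
Lemma Y0_kc_scale r y : 0 < y ->
  Y0 (X := CB) r kc y = (RtoC (y * exp (al * ln y)) * Y0 (X := CB) (r * y) kc 1)%C.
Proof.
intros Hy. unfold kc. rewrite !Y0_real; try lra; try (intros; apply k1_cont, Ha).
rewrite <- RtoC_mult. f_equal.
set (g := fun s => exp (- r * (y - s)) * k1 al s).
assert (gc : forall s, continuous g s).
{ exact (exp_weight_cont r y _ (k1_cont al Ha)). }
assert (E := RInt_comp_lin (V := R_CompleteNormedModule) g y 0 0 1 (continuous_ex_RInt _ _ _ gc)).
replace (y * 0 + 0) with 0 in E by ring. replace (y * 1 + 0) with y in E by ring. rewrite <- E.
assert (E3 := RInt_scal (V := R_CompleteNormedModule) (fun s => exp (- (r * y) * (1 - s)) * k1 al s) 0 1 (y * exp (al * ln y))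
  (continuous_ex_RInt _ _ _ (exp_weight_cont (r * y) 1 _ (k1_cont al Ha)))).
unfold scal at 2 in E3; simpl in E3; unfold mult in E3; simpl in E3. rewrite <- E3.
apply RInt_ext. intros x _. unfold g, scal; simpl; unfold mult; simpl. rewrite Rplus_0_r, k1_scale by exact Hy.
replace (- r * (y - y * x)) with (- (r * y) * (1 - x)) by ring. ring.
Qed.

(** Scaling the time by y is absorbed by translating x by ln y, and exactly one factor y is left
    over. *)
Lemma is_II_kc y : is_II (X := CB) (fun x => scal (RtoC (exp (al * x))) (Yc (X := CB) (exp x) kc y)) (kappa * RtoC (Rmax 0 y))%C.
Proof.
unfold Yc at 1. set (t := Rmax 0 y). assert (Ht : 0 <= t) by apply Rmax_l.
destruct Ht as [Ht|Ht].
- assert (S := is_II_shift _ _ (ln t) (cont2_l _ 1 (proj1 (Yc_family (X := CB) al Hal (fun x => RtoC (exp (al * x))) 1 kc (cont_CB_exp al) kc_cont exp_family))) kappa_is).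
  assert (cS : cont (X := CB) (fun x => scal (RtoC (exp (al * (x + ln t)))) (Yc (X := CB) (exp (x + ln t)) kc 1))).
  { exact (cont_shift (X := CB) _ (ln t) (cont2_l _ 1 (proj1 (Yc_family (X := CB) al Hal (fun x => RtoC (exp (al * x))) 1 kc (cont_CB_exp al) kc_cont exp_family)))). }
  assert (S2 := is_II_scal (RtoC t) _ _ cS S).
  rewrite Cmult_comm. refine (is_II_ext _ _ _ _ S2). intros x. cbv beta.
  rewrite Yc_eq by lra. rewrite (Y0_kc_scale (exp x) t Ht), exp_plus, exp_ln by exact Ht.
  rewrite Rmult_plus_distr_l, exp_plus. generalize (Y0 (X := CB) (exp x * t) kc 1). intros w.
  change ((RtoC t * (RtoC (exp (al * x) * exp (al * ln t)) * w) = RtoC (exp (al * x)) * (RtoC (t * exp (al * ln t)) * w))%C).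
  rewrite !RtoC_mult. ring.
- rewrite <- Ht. intros e He. exists 1. split; [lra|]. intros u v Hu Hv.
  assert (E : Int (X := CB) (fun x => scal (RtoC (exp (al * x))) (Y0 (X := CB) (exp x) kc 0)) u v = zero).
  { rewrite (Int_ext _ (fun _ => zero) u v); [| lra|].
    - rewrite Int_const. change (RtoC (v - u) * 0 = 0)%C. ring.
    - intros x _. rewrite Y0_0. change (RtoC (exp (al * x)) * 0 = 0)%C. ring. }
  rewrite E. change (Cmod (0 - kappa * RtoC 0)%C <= e). replace (0 - kappa * RtoC 0)%C with (RtoC 0) by ring.
  rewrite Cmod_R, Rabs_R0. lra.
Qed.

Context {X : CBanach}.

(** Exchanging the integrations lets the relaxation act on the kernel [k1] instead of on the
    convolution; [k1] vanishes for negative arguments, so its integral effectively starts at w. *)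
Lemma Y0_convolution r (m Phi : R -> X) t : 0 <= t -> cont m -> cont Phi ->
  (forall s, 0 <= s <= t -> Phi s = Int (fun w => scal (RtoC (k1 al (s - w))) (m w)) 0 s) ->
  Y0 r Phi t = Int (fun w => scal (Y0 (X := CB) r kc (t - w)) (m w)) 0 t.
Proof.
intros Ht Hm HPhi E. rewrite Y0_kernel by assumption.
assert (K2 : cont2 (fun s w => scal (RtoC (k1 al (s - w))) (m w))) by (apply cont2_conv; [apply k1_cont, Ha|exact Hm]).
set (K := fun s w => scal (RtoC (exp (- r * (t - s)))) (scal (RtoC (k1 al (s - w))) (m w))).
assert (KC : cont2 K).
{ apply cont2_scal; [|exact K2]. exact (cont2_of_l (X := CB) _ (kernel_cont r t)). }
rewrite (Int_ext _ (fun s => Int (K s) 0 t) 0 t Ht).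
- rewrite (Int_fubini K 0 t 0 t Ht Ht KC). apply Int_ext; [exact Ht|]. intros w Hw.
  assert (gc : forall x, continuous (fun s => exp (- r * (t - s)) * k1 al (s - w)) x).
  { apply (exp_weight_cont r t (fun s => k1 al (s - w))). intros x.
    apply (continuous_comp (fun s => s - w) (k1 al)); [|apply k1_cont, Ha].
    apply (ex_derive_continuous (K := R_AbsRing) (V := R_NormedModule)). auto_derive; exact I. }
  rewrite (Int_ext _ (fun s => scal (RtoC (exp (- r * (t - s)) * k1 al (s - w))) (m w)) 0 t Ht).
  + rewrite (Int_scal_r (m w) _ 0 t Ht (cont_of_R _ gc)). f_equal. rewrite Int_RtoC by assumption.
    unfold kc. rewrite Y0_real; [|lra|intros; apply k1_cont, Ha]. f_equal.
    set (g := fun s => exp (- r * (t - s)) * k1 al (s - w)).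
    assert (ex : forall p q, ex_RInt g p q) by (intros; apply continuous_ex_RInt; exact gc).
    rewrite <- (RInt_Chasles (V := R_CompleteNormedModule) g 0 w t (ex _ _) (ex _ _)).
    rewrite (RInt_ext (V := R_CompleteNormedModule) g (fun _ => 0) 0 w).
    * rewrite RInt_const.
      assert (E2 := RInt_comp_lin (V := R_CompleteNormedModule) g 1 w 0 (t - w) (ex _ _)).
      replace (1 * 0 + w) with w in E2 by ring. replace (1 * (t - w) + w) with t in E2 by ring. rewrite <- E2.
      rewrite (RInt_ext (V := R_CompleteNormedModule) (fun y => scal 1 (g (1 * y + w))) (fun s => exp (- r * (t - w - s)) * k1 al s)).
      -- unfold plus, scal; simpl; unfold mult; simpl. ring.
      -- intros x _. unfold g, scal; simpl; unfold mult; simpl.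
         replace (1 * x + w - w) with x by ring. replace (- r * (t - (1 * x + w))) with (- r * (t - w - x)) by ring. ring.
    * rewrite Rmin_left, Rmax_right by lra. intros x Hx. unfold g. rewrite k1_neg by lra. apply Rmult_0_r.
  + intros s _. unfold K. rewrite RtoC_mult. generalize (RtoC (exp (- r * (t - s)))) (RtoC (k1 al (s - w))). intros. vring X.
- intros s Hs. unfold K. rewrite (Int_scal _ _ 0 t Ht (cont2_r _ s K2)). f_equal. rewrite (E s Hs).
  rewrite <- (Int_Chasles _ 0 s t (cont2_r _ s K2)).
  rewrite (Int_ext (fun w => scal (RtoC (k1 al (s - w))) (m w)) (fun _ => zero) s t); [|lra|].
  + rewrite Int_const. generalize (Int (fun w => scal (RtoC (k1 al (s - w))) (m w)) 0 s). intros. vring X.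
  + intros w Hw. rewrite k1_neg by lra. vring X.
Qed.

(** The integral of r^(al-1) e^{-rt} over r is Gamma(al) t^(-al), so integrating relaxations against
    r^(al-1) amounts to J^(1-al) up to a constant. On Phi = J^(1+al) m it therefore produces the
    kernel t - w of J^2. *)
Lemma is_II_convolution (m Phi : R -> X) t : 0 <= t -> cont m -> cont Phi ->
  (forall s, 0 <= s <= t -> Phi s = Int (fun w => scal (RtoC (k1 al (s - w))) (m w)) 0 s) ->
  is_II (fun x => scal (RtoC (exp (al * x))) (Y0 (exp x) Phi t)) (scal kappa (Int (fun w => scal (RtoC (t - w)) (m w)) 0 t)).
Proof.
intros Ht Hm HPhi E.
destruct (Yc_family (X := CB) al Hal (fun x => RtoC (exp (al * x))) 1 kc (cont_CB_exp al) kc_cont exp_family) as [F1 F2].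
set (H := fun x s => scal (RtoC (exp (al * x))) (Yc (X := CB) (exp x) kc s)) in *.
(* Clamping w at 0 keeps the time t - w at most t, so a single domination constant serves all w. *)
set (K := fun x w => scal (H x (t - Rmax 0 w) : C) (m (Rmax 0 w))).
assert (K2 : cont2 K).
{ apply cont2_scal.
  - intros x y e He. destruct (F1 x (t - Rmax 0 y) e He) as (d & Hd & Hs). exists d. split; [exact Hd|].
    intros x' y' Hx Hy. apply Hs; [exact Hx|]. replace (t - Rmax 0 y' - (t - Rmax 0 y)) with (- (Rmax 0 y' - Rmax 0 y)) by ring.
    rewrite Rabs_Ropp. eapply Rle_lt_trans; [apply Rmax_lip|exact Hy].
  - exact (cont2_of_r _ (cont_ext m (proj2 (continuous_onE m) (fun s _ e He => let (d, Hd) := Hm s e He in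
      ex_intro _ d (conj (proj1 Hd) (fun s' _ => proj2 Hd s')))))). }
assert (LD : locally_dominated al K).
{ intros T. destruct (F2 t) as [C0 HC0]. destruct (cont_bounded_on m (Rmax 0 T) Hm) as (M & M0 & HM).
  exists (C0 * M). intros x w Hw. unfold K. rewrite norm_scal_X.
  assert (B1 := HC0 x (t - Rmax 0 w) ltac:(assert (Q := Rmax_l 0 w); lra)).
  assert (B2 := HM (Rmax 0 w) (conj (Rmax_l 0 w) (Rle_max_compat_l _ _ 0 Hw))).
  change (Cmod (H x (t - Rmax 0 w)) <= C0 * wgt al x) in B1.
  replace (C0 * M * wgt al x) with (C0 * wgt al x * M) by ring.
  apply Rmult_le_compat; [apply Cmod_ge_0|apply norm_ge_0|exact B1|exact B2]. }
destruct (II_param al Hal K K2 LD) as [_ P]. specialize (P t Ht).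
rewrite <- (Int_scal kappa _ 0 t Ht) by (apply (cont_conv (fun y => y) m t); [intros; apply continuous_id|exact Hm]).
rewrite (Int_ext (fun w => scal kappa (scal (RtoC (t - w)) (m w))) (fun w => II (fun x => K x w)) 0 t Ht).
- refine (is_II_ext _ _ _ _ P). intros x. rewrite (Y0_convolution (exp x) m Phi t Ht Hm HPhi E).
  rewrite <- Int_scal; [|exact Ht|].
  + apply Int_ext; [exact Ht|]. intros w Hw. unfold K, H. rewrite Rmax_right, Yc_eq by lra.
    generalize (Y0 (X := CB) (exp x) kc (t - w)). intros c. 
    change (scal (RtoC (exp (al * x)) * c)%C (m w) = scal (RtoC (exp (al * x))) (scal (c : C) (m w))). vring X.
  + apply (cont_scal (fun w => Y0 (X := CB) (exp x) kc (t - w))); [|exact Hm].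
    intros w e He. destruct (Y0_cont (X := CB) (exp x) kc kc_cont (t - w) e He) as (d & Hd & Hs). exists d. split; [exact Hd|].
    intros s Hst. apply Hs. replace (t - s - (t - w)) with (- (s - w)) by ring. rewrite Rabs_Ropp. exact Hst.
- intros w Hw. symmetry. apply II_is. unfold K. rewrite Rmax_right by lra.
  assert (Q := is_II_kc (t - w)). rewrite Rmax_right in Q by lra.
  assert (R1 := is_II_scal_r (m w) _ _ (cont2_l _ (t - w) F1) Q).
  replace (scal kappa (scal (RtoC (t - w)) (m w))) with (scal (kappa * RtoC (t - w))%C (m w)); [exact R1|].
  generalize (RtoC (t - w)) kappa. intros. vring X.
Qed.
End Convolution.

Lemma RInt_exp_exp r t s : 0 < r -> 0 <= s ->
  is_RInt (fun x => exp (- r * (t - x)) * exp x) s t ((exp t - exp (- r * (t - s)) * exp s) / (1 + r)).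
Proof.
intros Hr Hs. evar_last.
- apply (is_RInt_derive (V := R_CompleteNormedModule) (fun x => exp (- r * (t - x)) * exp x / (1 + r))).
  + intros x _. auto_derive; [exact I|]. unfold Rminus. field. lra.
  + intros x _. apply (ex_derive_continuous (K := R_AbsRing) (V := R_NormedModule)). auto_derive; exact I.
- unfold minus, plus, opp; simpl. replace (- r * (t - t)) with 0 by ring. rewrite exp_0. field. lra.
Qed.

Lemma affine_exp_small e : 0 < e -> exists T, 0 < T /\ forall t, T <= t -> (1 + t) * exp (- t) <= e.
Proof.
intros He. destruct (exp_small (1/2) (e / 2)) as (T & HT & H); [lra|lra|]. exists T. split; [exact HT|].
intros t Ht. specialize (H t Ht).
assert (Q : 1 + t <= 2 * exp (1/2 * t)) by (assert (W := exp_ineq1_le (1/2 * t)); lra).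
assert (E : exp (1/2 * t) * exp (- t) = exp (- (1/2) * t)) by (rewrite <- exp_plus; f_equal; field).
apply Rle_trans with (2 * exp (1/2 * t) * exp (- t)); [apply Rmult_le_compat_r; [left; apply exp_pos|exact Q]|].
rewrite Rmult_assoc, E. lra.
Qed.

(** * The normalising constant *)

Section Normalization.
Variable al : R.
Hypothesis Hal : 0 < al < 1.
Let Ha : 0 < al <= 1.
Proof. lra. Qed.

Lemma igam_cont x : continuous (igam al) x.
Proof.
apply (ex_derive_continuous (K := R_AbsRing) (V := R_NormedModule)). exists (pw al x * exp (- x)).
apply (is_derive_RInt (V := R_NormedModule) (fun x => pw al x * exp (- x)) (igam al) 0); [|apply pw_exp_cont, Ha].
apply filter_forall. intros y. apply (RInt_correct (V := R_CompleteNormedModule)).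
apply continuous_ex_RInt, pw_exp_cont, Ha.
Qed.

(* J^(1+al) applied to the exponential. *)
Definition jexp (s : R) : R := exp s * igam al s / (al * GG al).

Lemma GG_al_pos : 0 < al * GG al.
Proof. assert (P := GG_pos al Ha). apply Rmult_lt_0_compat; lra. Qed.

Lemma jexp_cont s : continuous jexp s.
Proof.
apply (continuous_mult (K := R_AbsRing) (fun s => exp s * igam al s) (fun _ => / (al * GG al))); [|apply continuous_const].
apply (continuous_mult (K := R_AbsRing) exp (igam al)); [|apply igam_cont].
apply (ex_derive_continuous (K := R_AbsRing) (V := R_NormedModule)). auto_derive; exact I.
Qed.

(** The substitution x = s - w turns the convolution into e^s times an incomplete Gamma integral. *)
Lemma jexp_conv s : 0 <= s -> RtoC (jexp s) = Int (X := CB) (fun w => scal (RtoC (k1 al (s - w))) (RtoC (exp w) : CB)) 0 s.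
Proof.
intros Hs. rewrite (Int_ext (X := CB) _ (fun w => RtoC (k1 al (s - w) * exp w)) 0 s Hs).
- assert (gc : forall x, continuous (fun x => k1 al x * exp (s - x)) x).
  { intros x. apply (continuous_mult (K := R_AbsRing) (k1 al) (fun x => exp (s - x))); [apply k1_cont, Ha|].
    apply (ex_derive_continuous (K := R_AbsRing) (V := R_NormedModule)). auto_derive; exact I. }
  assert (gc' : forall x, continuous (fun w => k1 al (s - w) * exp w) x).
  { intros x. apply (continuous_mult (K := R_AbsRing) (fun w => k1 al (s - w)) exp).
    - apply (continuous_comp (fun w => s - w) (k1 al)); [|apply k1_cont, Ha].
      apply (ex_derive_continuous (K := R_AbsRing) (V := R_NormedModule)). auto_derive; exact I.
    - apply (ex_derive_continuous (K := R_AbsRing) (V := R_NormedModule)). auto_derive; exact I. }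
  rewrite Int_RtoC by assumption. f_equal.
  assert (E := RInt_comp_lin (V := R_CompleteNormedModule) (fun x => k1 al x * exp (s - x)) (-1) s 0 s (continuous_ex_RInt _ _ _ gc)).
  replace (-1 * 0 + s) with s in E by ring. replace (-1 * s + s) with 0 in E by ring.
  assert (S := opp_RInt_swap (V := R_CompleteNormedModule) (fun x => k1 al x * exp (s - x)) 0 s (continuous_ex_RInt _ _ _ gc)).
  rewrite <- E in S.
  assert (E2 : RInt (fun w => -1 * (k1 al (s - w) * exp w)) 0 s = -1 * RInt (fun w => k1 al (s - w) * exp w) 0 s).
  { exact (RInt_scal (V := R_CompleteNormedModule) (fun w => k1 al (s - w) * exp w) 0 s (-1) (continuous_ex_RInt _ _ _ gc')). }
  rewrite (RInt_ext (V := R_CompleteNormedModule) (fun y => scal (-1) (k1 al (-1 * y + s) * exp (s - (-1 * y + s))))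
    (fun y => -1 * (k1 al (s - y) * exp y))) in S.
  + rewrite E2 in S. unfold opp in S; simpl in S.
    assert (E3 : RInt (fun x => exp s / (al * GG al) * (pw al x * exp (- x))) 0 s = exp s / (al * GG al) * igam al s).
    { exact (RInt_scal (V := R_CompleteNormedModule) (fun x => pw al x * exp (- x)) 0 s (exp s / (al * GG al))
        (continuous_ex_RInt _ _ _ (pw_exp_cont al Ha))). }
    rewrite (RInt_ext (V := R_CompleteNormedModule) (fun x => exp s / (al * GG al) * (pw al x * exp (- x)))
      (fun x => k1 al x * exp (s - x))) in E3.
    * rewrite E3 in S. unfold jexp. lra.
    * intros x _. unfold k1. replace (s - x) with (s + - x) by ring. rewrite exp_plus.
      match goal with |- ?x = ?y => change (@eq R x y) end. unfold Rdiv. ring.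
  + intros x _. replace (-1 * x + s) with (s - x) by ring. replace (s - (s - x)) with x by ring. reflexivity.
- intros w _. symmetry. exact (RtoC_mult _ _).
Qed.

Lemma jexp_le s : 0 <= s -> 0 <= jexp s <= exp s.
Proof.
intros Hs. assert (P := GG_al_pos). assert (E := exp_pos s).
assert (B := proj1 (proj2 (Gamma_igam al Ha)) s Hs). fold (GG al) in B.
assert (I0 : 0 <= igam al s).
{ assert (Q := igam_mono al Ha 0 s Hs). assert (i0 : igam al 0 = 0) by exact (RInt_point (V := R_CompleteNormedModule) 0 _). lra. }
assert (Q : 0 <= igam al s / (al * GG al) <= 1).
{ split; [apply Rmult_le_pos; [exact I0|left; apply Rinv_0_lt_compat, P]|].
  apply (Rmult_le_reg_r (al * GG al)); [exact P|]. unfold Rdiv. rewrite Rmult_assoc, Rinv_l by lra. lra. }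
unfold jexp, Rdiv. rewrite Rmult_assoc. fold (igam al s / (al * GG al)). nra.
Qed.

Lemma jexp_ge e : 0 < e -> exists S, 0 <= S /\ forall s, S <= s -> (1 - e) * exp s <= jexp s.
Proof.
intros He. assert (P := GG_al_pos).
destruct (proj2 (proj2 (Gamma_igam al Ha)) (e * (al * GG al))) as (S & HS & H); [apply Rmult_lt_0_compat; assumption|].
exists S. split; [lra|]. intros s Hs. specialize (H s Hs). fold (GG al) in H.
assert (Q : 1 - e <= igam al s / (al * GG al)).
{ apply (Rmult_le_reg_r (al * GG al)); [exact P|]. unfold Rdiv. rewrite Rmult_assoc, Rinv_l by lra. lra. }
unfold jexp, Rdiv. rewrite Rmult_assoc. fold (igam al s / (al * GG al)). assert (E := exp_pos s). nra.
Qed.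

(** The relaxation of [jexp] at rate r. As t grows, e^{-t} times it tends to 1 / (1 + r), which is
    the link between [kappa] and [pfun]. *)
Definition yexp (r t : R) : R := RInt (fun s => exp (- r * (t - s)) * jexp s) 0 t.

Lemma yexp_le r t : 0 < r -> 0 <= t -> yexp r t <= exp t * / (1 + r).
Proof.
intros Hr Ht. assert (IR := RInt_exp_exp r t 0 Hr ltac:(lra)).
apply Rle_trans with (RInt (fun s => exp (- r * (t - s)) * exp s) 0 t).
- apply RInt_le; [exact Ht|apply continuous_ex_RInt, exp_weight_cont, jexp_cont|eexists; exact IR|].
  intros s Hs. apply Rmult_le_compat_l; [left; apply exp_pos|apply jexp_le; lra].
- rewrite (is_RInt_unique _ _ _ _ IR). apply Rmult_le_compat_r; [left; apply Rinv_0_lt_compat; lra|].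
  assert (P := exp_pos (- r * (t - 0))). assert (Q := exp_pos 0). nra.
Qed.

Lemma yexp_ge r t S e : 0 < r -> 0 <= S <= t -> e < 1 -> (forall s, S <= s -> (1 - e) * exp s <= jexp s) ->
  (1 - e) * (exp t - exp S) * / (1 + r) <= yexp r t.
Proof.
intros Hr HS He H. assert (IR := RInt_exp_exp r t S Hr ltac:(lra)).
assert (ex : forall p q, ex_RInt (fun s => exp (- r * (t - s)) * jexp s) p q).
{ intros. apply continuous_ex_RInt, exp_weight_cont, jexp_cont. }
unfold yexp. rewrite <- (RInt_Chasles (V := R_CompleteNormedModule) _ 0 S t (ex _ _) (ex _ _)). unfold plus; simpl.
assert (P1 : 0 <= RInt (fun s => exp (- r * (t - s)) * jexp s) 0 S).
{ apply RInt_ge_0; [lra|apply ex|]. intros s Hs. apply Rmult_le_pos; [left; apply exp_pos|apply jexp_le; lra]. }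
assert (IR2 : is_RInt (fun x => (1 - e) * (exp (- r * (t - x)) * exp x)) S t ((1 - e) * ((exp t - exp (- r * (t - S)) * exp S) / (1 + r)))).
{ exact (is_RInt_scal (V := R_NormedModule) _ S t (1 - e) _ IR). }
assert (P2 : RInt (fun x => (1 - e) * (exp (- r * (t - x)) * exp x)) S t <= RInt (fun s => exp (- r * (t - s)) * jexp s) S t).
{ apply RInt_le; [lra|eexists; exact IR2|apply ex|]. intros s Hs. assert (Q := H s ltac:(lra)). assert (E := exp_pos (- r * (t - s))). nra. }
rewrite (is_RInt_unique _ _ _ _ IR2) in P2.
assert (P3 : (1 - e) * (exp t - exp S) * / (1 + r) <= (1 - e) * ((exp t - exp (- r * (t - S)) * exp S) / (1 + r))).
{ unfold Rdiv. rewrite <- Rmult_assoc. apply Rmult_le_compat_r; [left; apply Rinv_0_lt_compat; lra|].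
  apply Rmult_le_compat_l; [lra|]. assert (E : exp (- r * (t - S)) <= 1) by (rewrite <- exp_0; apply exp_le; nra).
  assert (E2 := exp_pos S). nra. }
lra.
Qed.

(** [is_II_convolution] for m = exp, where J^2 exp = e^t - 1 - t. *)
Lemma is_II_yexp t : 0 <= t -> is_II (X := CB) (fun x => RtoC (exp (al * x) * yexp (exp x) t)) (kappa al * RtoC (exp t - 1 - t))%C.
Proof.
intros Ht.
assert (Cm : cont (X := CB) (fun w => RtoC (exp w))).
{ apply (cont_of_R exp). intros x. apply (ex_derive_continuous (K := R_AbsRing) (V := R_NormedModule)). auto_derive; exact I. }
assert (Q := is_II_convolution (X := CB) al Hal (fun w => RtoC (exp w)) (fun s => RtoC (jexp s)) t Ht Cm (cont_of_R jexp jexp_cont)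
  (fun s Hs => jexp_conv s (proj1 Hs))).
assert (E : Int (X := CB) (fun w => scal (RtoC (t - w)) (RtoC (exp w) : CB)) 0 t = RtoC (exp t - 1 - t)).
{ assert (gc : forall x, continuous (fun w => (t - w) * exp w) x).
  { intros x. apply (ex_derive_continuous (K := R_AbsRing) (V := R_NormedModule)). auto_derive; exact I. }
  rewrite (Int_ext (X := CB) _ (fun w => RtoC ((t - w) * exp w)) 0 t Ht) by (intros; symmetry; exact (RtoC_mult _ _)).
  rewrite Int_RtoC by assumption. f_equal.
  assert (IR : is_RInt (fun w => (t - w) * exp w) 0 t (minus ((t + 1 - t) * exp t) ((t + 1 - 0) * exp 0))).
  { apply (is_RInt_derive (V := R_CompleteNormedModule) (fun w => (t + 1 - w) * exp w)).
    - intros x _. auto_derive; [exact I|ring].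
    - intros x _. apply gc. }
  rewrite (is_RInt_unique _ _ _ _ IR). unfold minus, plus, opp; simpl. rewrite exp_0. ring. }
assert (Q2 : is_II (X := CB) (fun x => scal (RtoC (exp (al * x))) (Y0 (X := CB) (exp x) (fun s => RtoC (jexp s)) t)) (kappa al * RtoC (exp t - 1 - t))%C).
{ rewrite <- E. exact Q. }
refine (is_II_ext _ _ _ _ Q2). intros x.
rewrite (Y0_real (exp x) jexp t Ht jexp_cont). symmetry. exact (RtoC_mult _ _).
Qed.

Lemma yexp_cont t : 0 <= t -> forall x, continuous (fun x => exp (al * x) * yexp (exp x) t) x.
Proof.
intros Ht. apply continuous_of_cont.
assert (F := cont2_l _ t (proj1 (Yc_family (X := CB) al Hal (fun x => RtoC (exp (al * x))) 1 _ (cont_CB_exp al) (cont_of_R jexp jexp_cont) (exp_family al Hal)))).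
intros x e He. destruct (F x e He) as (d & Hd & Hs). exists d. split; [exact Hd|]. intros s Hst. specialize (Hs s Hst).
assert (E : forall s, scal (RtoC (exp (al * s))) (Yc (X := CB) (exp s) (fun s => RtoC (jexp s)) t) = RtoC (exp (al * s) * yexp (exp s) t)).
{ intros y. rewrite Yc_eq by exact Ht. rewrite (Y0_real (exp y) jexp t Ht jexp_cont). symmetry. exact (RtoC_mult _ _). }
rewrite !E in Hs. exact Hs.
Qed.

Lemma is_II_wr_scal c : is_II (X := CB) (fun x => RtoC (c * wr al x)) (RtoC c * pfun al 1)%C.
Proof.
assert (Q := is_II_scal (X := CB) (RtoC c) _ _ (cont_of_R _ (wr_cont al Hal)) (is_II_wr al Hal)).
refine (is_II_ext _ _ _ _ Q). intros x. symmetry. exact (RtoC_mult _ _).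
Qed.

Lemma wr_scal_cont c x : continuous (fun x => c * wr al x) x.
Proof. apply (continuous_mult (K := R_AbsRing) (fun _ => c) (wr al)); [apply continuous_const|apply (wr_cont al Hal)]. Qed.

Lemma Re_mult_real z c : Re (z * RtoC c)%C = Re z * c.
Proof. unfold Re. simpl. ring. Qed.

Lemma kappa_upper t : 0 <= t -> Re (kappa al) * (exp t - 1 - t) <= exp t * Re (pfun al 1).
Proof.
intros Ht. rewrite <- Re_mult_real, (Rmult_comm (exp t)), <- Re_mult_real, Cmult_comm.
rewrite (Cmult_comm (pfun al 1)). rewrite (Cmult_comm (RtoC (exp t - 1 - t))).
refine (is_II_le _ _ _ _ (yexp_cont t Ht) (wr_scal_cont (exp t)) _ (is_II_yexp t Ht) (is_II_wr_scal (exp t))).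
intros x. assert (Q := yexp_le (exp x) t (exp_pos x) Ht). unfold wr.
replace (exp t * (exp (al * x) / (1 + exp x))) with (exp (al * x) * (exp t * / (1 + exp x))) by (unfold Rdiv; ring).
apply Rmult_le_compat_l; [left; apply exp_pos|exact Q].
Qed.

Lemma kappa_lower t S e : 0 <= S <= t -> e < 1 -> (forall s, S <= s -> (1 - e) * exp s <= jexp s) ->
  (1 - e) * (exp t - exp S) * Re (pfun al 1) <= Re (kappa al) * (exp t - 1 - t).
Proof.
intros HS He H. rewrite <- Re_mult_real, (Rmult_comm ((1 - e) * (exp t - exp S))), <- Re_mult_real.
rewrite (Cmult_comm (pfun al 1)).
refine (is_II_le _ _ _ _ (wr_scal_cont ((1 - e) * (exp t - exp S))) (yexp_cont t ltac:(lra)) _ (is_II_wr_scal _) (is_II_yexp t ltac:(lra))).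
intros x. assert (Q := yexp_ge (exp x) t S e (exp_pos x) HS He H). unfold wr.
replace ((1 - e) * (exp t - exp S) * (exp (al * x) / (1 + exp x))) with (exp (al * x) * ((1 - e) * (exp t - exp S) * / (1 + exp x))) by (unfold Rdiv; ring).
apply Rmult_le_compat_l; [left; apply exp_pos|exact Q].
Qed.

(** After division by e^t, the upper and lower bounds for [yexp] squeeze kappa to the integral of
    r^(al-1) / (1 + r), which is [pfun] at 1. *)
Lemma kappa_pfun : kappa al = pfun al 1.
Proof.
assert (KR : kappa al = RtoC (Re (kappa al))).
(* At t = 1 the identity says that kappa (e - 2) is real, and e - 2 is not 0; so real parts are all
   there is to compare. *)
{ assert (Q := is_II_real _ _ (yexp_cont 1 ltac:(lra)) (is_II_yexp 1 ltac:(lra))).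
  assert (c0 : exp 1 - 1 - 1 <> 0). { assert (W := exp_ineq1 1 ltac:(lra)). lra. }
  rewrite Re_mult_real, RtoC_mult in Q.
  assert (c1 : RtoC (exp 1 - 1 - 1) <> 0%C) by (intros E; apply c0; exact (RtoC_inj _ _ E)).
  assert (Q2 := f_equal (fun z => (z * / RtoC (exp 1 - 1 - 1))%C) Q). cbv beta in Q2.
  rewrite <- !Cmult_assoc, Cinv_r, !Cmult_1_r in Q2 by exact c1. exact Q2. }
rewrite KR, (pfun_1_real al Hal). f_equal.
set (k := Re (kappa al)). set (p := Re (pfun al 1)). assert (p0 : 0 < p) by exact (pfun_1_pos al Hal).
assert (X1 : forall t, exp t * exp (- t) = 1) by (intros; rewrite <- exp_plus, <- exp_0; f_equal; ring).
apply Rle_antisym; apply le_epsilon; intros e He.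
- destruct (affine_exp_small (e / (Rabs k + 1))) as (T & HT & H).
  { assert (P := Rabs_pos k). apply Rdiv_lt_0_compat; lra. }
  specialize (H T ltac:(lra)). assert (U := kappa_upper T ltac:(lra)). fold k p in U.
  assert (P := exp_pos (- T)). apply (Rmult_le_compat_r (exp (- T))) in U; [|lra].
  replace (k * (exp T - 1 - T) * exp (- T)) with (k * (exp T * exp (- T)) - k * ((1 + T) * exp (- T))) in U by ring.
  replace (exp T * p * exp (- T)) with (p * (exp T * exp (- T))) in U by ring. rewrite X1 in U.
  assert (q0 : 0 <= (1 + T) * exp (- T)) by (apply Rmult_le_pos; lra).
  assert (B : k * ((1 + T) * exp (- T)) <= e).
  { apply Rle_trans with ((Rabs k + 1) * (e / (Rabs k + 1))).
    - assert (P1 := Rabs_pos k). assert (P2 := Rle_abs k). apply Rle_trans with ((Rabs k + 1) * ((1 + T) * exp (- T))).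
      + apply Rmult_le_compat_r; lra.
      + apply Rmult_le_compat_l; lra.
    - right. field. assert (P1 := Rabs_pos k). lra. }
  lra.
- assert (K0 := Rabs_pos k).
  (* Chosen so that the losses 2 p d and |k| d together stay below e. *)
  set (d := Rmin (1/2) (e / (2 * p + Rabs k + 1))).
  assert (d0 : 0 < d) by (apply Rmin_pos; [lra|apply Rdiv_lt_0_compat; lra]).
  assert (d1 : d <= 1/2) by apply Rmin_l.
  assert (d2 : (2 * p + Rabs k + 1) * d <= e).
  { apply Rle_trans with ((2 * p + Rabs k + 1) * (e / (2 * p + Rabs k + 1))).
    - apply Rmult_le_compat_l; [lra|apply Rmin_r].
    - right. field. lra. }
  destruct (jexp_ge d d0) as (S & HS & HJ).
  destruct (affine_exp_small d d0) as (T1 & HT1 & H1).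
  destruct (exp_small 1 (d * exp (- S))) as (T2 & HT2 & H2).
  { apply Rmult_lt_0_compat; [exact d0|apply exp_pos]. } { lra. }
  set (t := S + T1 + T2). specialize (H1 t ltac:(unfold t; lra)). specialize (H2 t ltac:(unfold t; lra)).
  replace (- (1) * t) with (- t) in H2 by ring.
  assert (L := kappa_lower t S d ltac:(unfold t; lra) ltac:(lra) HJ). fold k p in L.
  assert (P := exp_pos (- t)). apply (Rmult_le_compat_r (exp (- t))) in L; [|lra].
  replace (k * (exp t - 1 - t) * exp (- t)) with (k * (exp t * exp (- t)) - k * ((1 + t) * exp (- t))) in L by ring.
  replace ((1 - d) * (exp t - exp S) * p * exp (- t)) with ((1 - d) * p * (exp t * exp (- t) - exp S * exp (- t))) in L by ring.
  rewrite X1 in L.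
  assert (q0 : 0 <= (1 + t) * exp (- t)) by (apply Rmult_le_pos; [unfold t; lra|lra]).
  assert (B1 : - (Rabs k * d) <= k * ((1 + t) * exp (- t))).
  { assert (W := Rle_abs (- k)). rewrite Rabs_Ropp in W.
    assert (W2 : - k * ((1 + t) * exp (- t)) <= Rabs k * d); [|lra].
    apply Rle_trans with (Rabs k * ((1 + t) * exp (- t))); [apply Rmult_le_compat_r; lra|apply Rmult_le_compat_l; lra]. }
  assert (B2 : exp S * exp (- t) <= d).
  { apply (Rmult_le_compat_l (exp S)) in H2; [|left; apply exp_pos].
    replace (exp S * (d * exp (- S))) with (d * (exp S * exp (- S))) in H2 by ring. rewrite X1 in H2. lra. }
  assert (B3 : (1 - d) * p * (1 - d) <= (1 - d) * p * (1 - exp S * exp (- t))).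
  { apply Rmult_le_compat_l; [apply Rmult_le_pos; lra|lra]. }
  assert (B4 : 0 <= p * (d * d)) by (apply Rmult_le_pos; [lra|apply Rmult_le_pos; lra]).
  lra.
Qed.
End Normalization.

(** * The divided difference of the fractional derivative *)

Lemma norm_is_II {X : CBanach} (f : R -> X) (g : R -> R) l m : cont f -> (forall t, continuous g t) ->
  (forall x, norm (f x) <= g x) -> is_II f l -> is_II (X := CB) (fun x => RtoC (g x)) m -> norm l <= Re m.
Proof.
intros Cf Cg Hle Hl Hm. apply le_epsilon. intros e He.
destruct (Hl (e / 2)) as (A & HA & HA'); [lra|]. destruct (Hm (e / 2)) as (B & HB & HB'); [lra|].
assert (c1 := Rmax_l A B). assert (c2 := Rmax_r A B). set (c := Rmax A B) in *.
specialize (HA' (- c) c ltac:(lra) ltac:(lra)). specialize (HB' (- c) c ltac:(lra) ltac:(lra)).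
rewrite Int_RtoC in HB' by (auto; lra).
change (Cmod (RtoC (RInt g (- c) c) - m)%C <= e / 2) in HB'.
assert (Q2 := Re_le_Cmod (RtoC (RInt g (- c) c) - m)%C).
replace (Re (RtoC (RInt g (- c) c) - m)%C) with (RInt g (- c) c - Re m) in Q2 by reflexivity.
assert (L : norm (Int f (- c) c) <= RInt g (- c) c).
{ apply Int_norm_RInt; [lra|exact Cf|auto|apply continuous_ex_RInt, Cg]. }
assert (Q4 := Rle_trans _ _ _ Q2 HB'). apply Rabs_le_between in Q4.
assert (T : norm l <= norm (Int f (- c) c) + norm (minus (Int f (- c) c) l)).
{ assert (D := norm_dist (Int f (- c) c) l). apply Rabs_le_between in D. lra. }
lra.
Qed.

Section StieltjesOperator.
Variable al : R.
Hypothesis Hal : 0 < al < 1.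
Context {X : CBanach}.

(** The integral over x of g r (D + r)^-1 q with r = e^x. Since r (D + r)^-1 is bounded by 1 for
    every r, domination of g by the weight is enough. *)
Definition wint_op (g : R -> C) (q : R -> X) (t : R) : X :=
  II (fun x => scal (g x * RtoC (exp x))%C (Yc (exp x) q t)).

Lemma exp_factor_cont (g : R -> C) : cont (X := CB) g -> cont (X := CB) (fun x => g x * RtoC (exp x))%C.
Proof.
intros Hg. apply cont_CB_mult; [exact Hg|]. apply (cont_of_R exp). intros x.
apply (ex_derive_continuous (K := R_AbsRing) (V := R_NormedModule)). auto_derive; exact I.
Qed.

Lemma wgt_le_1 x : wgt al x <= 1.
Proof.
assert (B := bet_pos al Hal). destruct (Rle_dec 0 x) as [L|L].
- eapply Rle_trans; [apply (wgt_right al x L)|]. rewrite <- exp_0. apply exp_le. nra.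
- eapply Rle_trans; [apply (wgt_left al x)|]; [lra|]. rewrite <- exp_0. apply exp_le. nra.
Qed.

Section Bounds.
Variables (g : R -> C) (C0 : R) (q : R -> X) (M : R).
Hypothesis Hg : adm al C0 g.
Hypothesis Hq : cont q.
Hypothesis HM : forall s, 0 <= s -> norm (q s) <= M.

Lemma wint_op_integrand_cont t : cont (fun x => scal (g x * RtoC (exp x))%C (Yc (exp x) q t)).
Proof.
apply (cont_scal (fun x => g x * RtoC (exp x))%C); [apply exp_factor_cont, Hg|].
exact (cont2_l _ t (cont2_Yc q Hq)).
Qed.

Lemma wint_op_integrand_bound t x : norm (scal (g x * RtoC (exp x))%C (Yc (exp x) q t)) <= M * Cmod (g x).
Proof.
rewrite norm_scal_X, Cmod_mult, Cmod_R, Rabs_pos_eq by (left; apply exp_pos).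
assert (E := exp_pos x).
assert (B : norm (Yc (exp x) q t) <= M / exp x).
{ unfold Yc. apply Y0_bound_inv; [exact E|apply Rmax_l|exact Hq|]. intros s Hs. apply HM. lra. }
apply (Rmult_le_compat_l (exp x)) in B; [|lra]. replace (exp x * (M / exp x)) with M in B by (field; lra).
rewrite Rmult_assoc, Rmult_comm. apply Rmult_le_compat_r; [apply Cmod_ge_0|exact B].
Qed.

Lemma adm_nonneg : 0 <= C0.
Proof.
assert (P := proj2 Hg 0). assert (Q := Cmod_ge_0 (g 0)). assert (W := wgt_pos al 0).
apply (Rmult_le_reg_r (wgt al 0)); [exact W|]. lra.
Qed.

Lemma M_nonneg : 0 <= M.
Proof. eapply Rle_trans; [apply (norm_ge_0 (q 0))|apply HM; lra]. Qed.

Lemma wint_op_dominated t x : norm (scal (g x * RtoC (exp x))%C (Yc (exp x) q t)) <= M * C0 * wgt al x.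
Proof.
eapply Rle_trans; [apply wint_op_integrand_bound|]. rewrite Rmult_assoc.
apply Rmult_le_compat_l; [apply M_nonneg|apply Hg].
Qed.

Lemma wint_op_is t : is_II (fun x => scal (g x * RtoC (exp x))%C (Yc (exp x) q t)) (wint_op g q t).
Proof. apply (II_dominated al Hal _ (M * C0) (wint_op_integrand_cont t) (wint_op_dominated t)). Qed.

Lemma wint_op_norm t : norm (wint_op g q t) <= 4 * (M * C0 / bet al).
Proof. apply (II_dominated al Hal _ (M * C0) (wint_op_integrand_cont t) (wint_op_dominated t)). Qed.

(* The tails are uniformly small and the truncated integrals are Lipschitz. *)
Lemma wint_op_uc e : 0 < e -> exists d, 0 < d /\ forall s t, 0 <= s <= t -> t - s < d ->
  norm (minus (wint_op g q t) (wint_op g q s)) < e.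
Proof.
intros He. assert (M0 := M_nonneg). assert (C00 := adm_nonneg).
destruct (tail_small al Hal (M * C0) (e / 4)) as (A & HA & HT); [apply Rmult_le_pos; assumption|lra|].
set (K := C0 * exp A * (2 * M) * (2 * A)).
assert (EA := exp_pos A).
assert (K0 : 0 <= K) by (unfold K; repeat apply Rmult_le_pos; lra).
exists (e / (4 * (K + 1))). split; [apply Rdiv_lt_0_compat; lra|]. intros s t Hs Hst.
assert (T := fun t => proj2 (proj2 (II_dominated al Hal _ (M * C0) (wint_op_integrand_cont t) (wint_op_dominated t))) A (- A) A
  ltac:(lra) ltac:(lra) ltac:(lra)).
assert (T1 := T t). assert (T2 := T s).
assert (D : norm (minus (Int (fun x => scal (g x * RtoC (exp x))%C (Yc (exp x) q t)) (- A) A)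
   (Int (fun x => scal (g x * RtoC (exp x))%C (Yc (exp x) q s)) (- A) A)) <= K * (t - s)).
{ rewrite <- Int_minus; [|lra|apply wint_op_integrand_cont|apply wint_op_integrand_cont].
  replace (K * (t - s)) with (C0 * exp A * (2 * M * (t - s)) * (A - - A)) by (unfold K; ring).
  apply Int_norm; [lra|apply cont_minus; apply wint_op_integrand_cont|]. intros x Hx.
  assert (ID : minus (scal (g x * RtoC (exp x))%C (Yc (exp x) q t)) (scal (g x * RtoC (exp x))%C (Yc (exp x) q s)) =
    scal (g x * RtoC (exp x))%C (minus (Yc (exp x) q t) (Yc (exp x) q s))).
  { generalize (g x * RtoC (exp x))%C. intros. vring X. }
  eapply Rle_trans; [right; exact (f_equal norm ID)|].
  rewrite norm_scal_X, Cmod_mult, Cmod_R, Rabs_pos_eq by (left; apply exp_pos).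
  rewrite !Yc_eq by lra.
  assert (E1 : exp x <= exp A) by (apply exp_le; lra). assert (E2 := exp_pos x).
  assert (G1 : Cmod (g x) <= C0).
  { eapply Rle_trans; [apply Hg|]. assert (W := wgt_le_1 x). nra. }
  assert (L := Y0_lipschitz (exp x) q s t t M E2 Hs ltac:(lra) Hq ltac:(intros; apply HM; lra)).
  apply Rmult_le_compat; [apply Rmult_le_pos; [apply Cmod_ge_0|lra]|apply norm_ge_0| |exact L].
  apply Rmult_le_compat; [apply Cmod_ge_0|lra|exact G1|exact E1]. }
assert (S : K * (t - s) <= e / 4).
{ apply Rle_trans with ((K + 1) * (e / (4 * (K + 1)))); [apply Rmult_le_compat; lra|right; field; lra]. }
fold (wint_op g q t) in T1. fold (wint_op g q s) in T2.
revert T1 T2 D. generalize (Int (fun x => scal (g x * RtoC (exp x))%C (Yc (exp x) q t)) (- A) A)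
  (Int (fun x => scal (g x * RtoC (exp x))%C (Yc (exp x) q s)) (- A) A) (wint_op g q t) (wint_op g q s).
intros p1 p2 w1 w2 T1 T2 D.
assert (ID : minus w1 w2 = plus (minus p1 p2) (minus (minus p2 w2) (minus p1 w1))) by (vring X).
eapply Rle_lt_trans; [right; exact (f_equal norm ID)|].
eapply Rle_lt_trans; [apply norm_tri|].
assert (N := norm_minus_X (minus p2 w2) (minus p1 w1)). lra.
Qed.
End Bounds.

Lemma wint_op_BUC (g : R -> C) C0 (u : BUC X) : adm al C0 g -> exists W : BUC X, forall t, W t = wint_op g (ext u) t.
Proof.
intros Hg. destruct (buc_norm u) as (M & M0 & HM).
assert (Hq := cont_ext u (buc_continuous u)).
assert (HM' : forall s, 0 <= s -> norm (ext u s) <= M) by (intros s Hs; rewrite ext_eq by exact Hs; apply HM, Hs).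
assert (Hb : Defs.bounded (wint_op g (ext u))).
{ exists (4 * (M * C0 / bet al)). intros t _. exact (wint_op_norm g C0 (ext u) M Hg Hq HM' t). }
assert (Hu : Defs.uniformly_continuous (wint_op g (ext u))).
{ intros e He. destruct (wint_op_uc g C0 (ext u) M Hg Hq HM' e He) as (d & Hd & H). exists d. split; [exact Hd|].
  intros s t Hs Ht Hst. unfold half_line in Hs, Ht. destruct (Rle_dec s t) as [L|L].
  - eapply Rle_lt_trans; [right; apply norm_sym|]. apply H; [lra|]. rewrite Rabs_left1 in Hst; lra.
  - apply H; [lra|]. rewrite Rabs_pos_eq in Hst; lra. }
exists (MkBUC Hb Hu). reflexivity.
Qed.

(** Made total in g by choice, because [taylor_stieltjes] takes a map on all densities; for
    admissible g it is [wint_op]. *)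
Definition wbuc (u : BUC X) (g : R -> C) : BUC X :=
  epsilon (inhabits (buc_zero X)) (fun W => forall t, W t = wint_op g (ext u) t).

Lemma wbucE u g C0 t : adm al C0 g -> wbuc u g t = wint_op g (ext u) t.
Proof.
intros Hg. unfold wbuc. 
exact (epsilon_spec (inhabits (buc_zero X)) (fun W : BUC X => forall t, W t = wint_op g (ext u) t) (wint_op_BUC g C0 u Hg) t).
Qed.

Lemma wbuc_taylor n l (u : BUC X) : slit_plane l -> taylor n (fun h => cls (wbuc u (gk al (l + h)%C))).
Proof.
intros Hl. destruct (buc_norm u) as (M & M0 & HM).
assert (Hq := cont_ext u (buc_continuous u)).
assert (HM' : forall s, 0 <= s -> norm (ext u s) <= M) by (intros s Hs; rewrite ext_eq by exact Hs; apply HM, Hs).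
apply (taylor_stieltjes al Hal (fun g => cls (wbuc u g)) (4 * M / bet al)) with (C0 := 1) (g := fun x => RtoC (exp (al * x))).
- intros C1 C2 g1 g2 H1 H2. rewrite cls_plus. apply cls_pw. intros t _.
  change (wbuc u (fun x => g1 x + g2 x)%C t = plus (wbuc u g1 t) (wbuc u g2 t)).
  rewrite (wbucE _ _ _ _ H1), (wbucE _ _ _ _ H2), (wbucE _ _ _ _ (adm_plus al _ _ _ _ H1 H2)).
  apply II_is. refine (is_II_ext _ _ _ _ (is_II_plus _ _ _ _ (wint_op_integrand_cont g1 C1 (ext u) H1 Hq t)
    (wint_op_integrand_cont g2 C2 (ext u) H2 Hq t) (wint_op_is g1 C1 _ M H1 Hq HM' t) (wint_op_is g2 C2 _ M H2 Hq HM' t))).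
  intros x. cbv beta. generalize (Yc (exp x) (ext u) t) (RtoC (exp x)) (g1 x) (g2 x). intros. vring X.
- intros c C1 g1 H1. rewrite cls_scal. apply cls_pw. intros t _.
  change (wbuc u (fun x => c * g1 x)%C t = scal c (wbuc u g1 t)).
  rewrite (wbucE _ _ _ _ H1), (wbucE _ _ _ _ (adm_scal al c _ _ H1)).
  apply II_is. refine (is_II_ext _ _ _ _ (is_II_scal c _ _ (wint_op_integrand_cont g1 C1 (ext u) H1 Hq t) (wint_op_is g1 C1 _ M H1 Hq HM' t))).
  intros x. cbv beta. generalize (Yc (exp x) (ext u) t) (RtoC (exp x)) (g1 x). intros. vring X.
- intros C1 g1 H1. apply cls_norm. intros t _. rewrite (wbucE _ _ _ _ H1).
  eapply Rle_trans; [apply (wint_op_norm g1 C1 _ M H1 Hq HM')|]. right. unfold Rdiv. ring.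
- exact Hl.
- apply cont_CB_exp.
- exact (gk_num al Hal).
Qed.

Lemma Yc_linear (L : X -> X) K r (q : R -> X) t :
  (forall x y, L (minus x y) = minus (L x) (L y)) -> (forall (c : C) x, L (scal c x) = scal c (L x)) ->
  (forall x, norm (L x) <= K * norm x) -> cont q -> Yc r (fun s => L (q s)) t = L (Yc r q t).
Proof.
intros Lm Ls Lb Hq. unfold Yc, Y0. rewrite Ls. f_equal.
rewrite (Int_linear L K Lm Ls Lb _ 0 _ (Rmax_l 0 t) (cont_exp_mul _ q Hq)).
apply Int_ext; [apply Rmax_l|]. intros s _. symmetry. apply Ls.
Qed.

Lemma wint_op_linear (L : X -> X) K g C0 (q : R -> X) M t :
  (forall x y, L (minus x y) = minus (L x) (L y)) -> (forall (c : C) x, L (scal c x) = scal c (L x)) ->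
  (forall x, norm (L x) <= K * norm x) -> adm al C0 g -> cont q -> (forall s, 0 <= s -> norm (q s) <= M) ->
  wint_op g (fun s => L (q s)) t = L (wint_op g q t).
Proof.
intros Lm Ls Lb Hg Hq HM. apply II_is.
refine (is_II_ext _ _ _ _ (is_II_linear L K _ _ Lm Ls Lb (wint_op_integrand_cont g C0 q Hg Hq t) (wint_op_is g C0 q M Hg Hq HM t))).
intros x. cbv beta. rewrite (Yc_linear L K _ _ _ Lm Ls Lb Hq). apply Ls.
Qed.
End StieltjesOperator.

(** * Functions determined by their integrals *)

Section IntegralUniqueness.
Context {X : CBanach}.

(** If h t were not 0, h would stay within |h t| / 2 of h t on a short interval to the right, over
    which its integral could not vanish. *)
Lemma Int_zero_inj (h : R -> X) t : 0 <= t -> cont h -> (forall T, 0 <= T -> Int h 0 T = zero) -> h t = zero.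
Proof.
intros Ht Hc H. assert (N0 := norm_ge_0 (h t)).
destruct (Req_dec (norm (h t)) 0) as [Z|Z]; [exact (@norm_eq_zero C_AbsRing X _ Z)|]. exfalso.
destruct (Hc t (norm (h t) / 2)) as (d & Hd & Hs); [lra|].
assert (E : Int h t (t + d / 2) = zero).
{ assert (C := Int_Chasles h 0 t (t + d / 2) Hc). rewrite (H t Ht), (H (t + d / 2)) in C by lra.
  rewrite <- C. generalize (Int h t (t + d / 2)). intros. vring X. }
assert (M := Int_minus_const h (h t) t (t + d / 2) Hc). rewrite E in M.
assert (B : norm (Int (fun s => minus (h s) (h t)) t (t + d / 2)) <= norm (h t) / 2 * (t + d / 2 - t)).
{ apply Int_norm; [lra|apply cont_minus_const, Hc|]. intros s Hst. left. apply Hs. rewrite Rabs_pos_eq; lra. }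
assert (ID : norm (minus zero (scal (RtoC (t + d / 2 - t)) (h t))) = (t + d / 2 - t) * norm (h t)).
{ eapply eq_trans; [|apply (eq_trans (norm_scal_X (RtoC (- (t + d / 2 - t))) (h t)))].
  - f_equal. rewrite RtoC_opp. generalize (RtoC (t + d / 2 - t)) (h t). intros. vring X.
  - rewrite Cmod_R, Rabs_Ropp, Rabs_pos_eq by lra. reflexivity. }
assert (B2 : norm (minus zero (scal (RtoC (t + d / 2 - t)) (h t))) <= norm (h t) / 2 * (t + d / 2 - t)).
{ eapply Rle_trans; [right; exact (f_equal norm (eq_sym M))|exact B]. }
rewrite ID in B2. assert (d / 2 * norm (h t) > 0) by (apply Rmult_lt_0_compat; lra). lra.
Qed.

Lemma Int_inj (f g : R -> X) t : 0 <= t -> cont f -> cont g -> (forall T, 0 <= T -> Int f 0 T = Int g 0 T) -> f t = g t.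
Proof.
intros Ht Hf Hg H.
assert (Z : minus (f t) (g t) = zero).
{ apply (Int_zero_inj (fun t => minus (f t) (g t)) t Ht (cont_minus f g Hf Hg)). intros T HT.
  rewrite Int_minus by assumption. rewrite (H T HT). generalize (Int g 0 T). intros. vring X. }
apply minus_zero_eq. eapply Rle_trans; [right; exact (f_equal norm Z)|]. right. exact norm_zero'.
Qed.

(** Cauchy's formula for repeated integration: s times the integral of m, minus the integral of w
    m(w), has derivative the integral of m. *)
Lemma Int_repeated (m : R -> X) t : 0 <= t -> cont m ->
  Int (fun w => scal (RtoC (t - w)) (m w)) 0 t = Int (fun s => Int m 0 s) 0 t.
Proof.
intros Ht Hm.
assert (Cw : cont (fun w => scal (RtoC w) (m w))).
{ apply (cont_scal (fun w => RtoC w)); [|exact Hm]. apply (cont_of_R (fun w => w)). intros; apply continuous_id. }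
assert (E := dv_FTC (fun _ => True) (fun s => minus (scal (RtoC s) (Int m 0 s)) (Int (fun w => scal (RtoC w) (m w)) 0 s))
  (fun s => Int m 0 s) 0 t Ht (fun _ _ => I) (cont_Int m 0 Hm)).
assert (Ct : cont (fun w => scal (RtoC t) (m w))) by (apply (cont_scal (fun _ => RtoC t)); [apply cont_CB_const|exact Hm]).
rewrite <- E.
- rewrite !Int_point. rewrite (Int_ext _ (fun w => minus (scal (RtoC t) (m w)) (scal (RtoC w) (m w))) 0 t Ht).
  + eapply eq_trans; [exact (Int_minus (fun w => scal (RtoC t) (m w)) (fun w => scal (RtoC w) (m w)) 0 t Ht Ct Cw)|].
    rewrite (Int_scal _ _ 0 t Ht Hm). generalize (Int m 0 t) (Int (fun w => scal (RtoC w) (m w)) 0 t) (RtoC t) (RtoC 0). intros. vring X.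
  + intros w _. rewrite RtoC_minus. generalize (RtoC t) (RtoC w). intros. vring X.
- intros s Hs.
  assert (D1 : dv (X := CB) (fun _ => True) (fun s => RtoC s) s (RtoC 1)).
  { apply (dv_pair _ (fun s => s) (fun _ => 0) s 1 0); auto_derive; auto. }
  refine (dv_value _ _ _ _ _ _ (dv_minus _ _ _ _ _ _ (dv_prod _ _ _ s _ _ D1 (dv_Int _ m 0 s Hm)) (dv_Int _ _ 0 s Cw))).
  generalize (Int m 0 s) (RtoC s) (m s). intros. vring X.
Qed.
End IntegralUniqueness.

(** * The equation satisfied by the divided difference *)

Section FractionalIdentity.
Variable al : R.
Hypothesis Hal : 0 < al < 1.
Let Ha : 0 < al <= 1.
Proof. lra. Qed.
Context {X : CBanach}.

Lemma pfun_1_neq_0 : pfun al 1 <> 0%C.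
Proof. intros E. assert (P := pfun_1_pos al Hal). rewrite E in P. simpl in P. lra. Qed.

Lemma is_II_minus (f g : R -> X) l m : cont f -> cont g -> is_II f l -> is_II g m ->
  is_II (fun x => minus (f x) (g x)) (minus l m).
Proof.
intros Cf Cg Hf Hg.
assert (Cg' : cont (fun x => scal (RtoC (-1)) (g x))) by (apply (cont_scal (fun _ => RtoC (-1))); [apply cont_CB_const|exact Cg]).
assert (Q := is_II_plus _ _ _ _ Cf Cg' Hf (is_II_scal (RtoC (-1)) g m Cg Hg)).
replace (minus l m) with (plus l (scal (RtoC (-1)) m)) by (vring X).
refine (is_II_ext _ _ _ _ Q). intros x. cbv beta. generalize (f x) (g x). intros. vring X.
Qed.

(* With J the integral from 0, the three facts used are J E = pfun(1) J J m (the convolution identity),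
   W = E - l G and J W = pfun(l) J q - G; eliminating E and G leaves an equation for W alone. *)
Lemma wint_op_ode (l : C) (m : R -> X) (q0 : BUC X) : slit_plane l -> cont m -> fracint al m q0 ->
  forall t, half_line t ->
  dv half_line (fun t => scal (/ pfun al 1)%C (wint_op (gk al l) (ext q0) t)) t
    (plus (scal l (scal (/ pfun al 1)%C (wint_op (gk al l) (ext q0) t))) (minus (m t) (scal (cpow l al) (q0 t)))).
Proof.
intros Hl Hm Hq0. set (q := ext q0). assert (Hq : cont q) by (apply cont_ext, buc_continuous).
assert (Fq : fracint al m q).
{ apply (fracint_ext al m m q0 q); auto. intros t Ht. symmetry. apply ext_eq, Ht. }
destruct (gk_adm al Hal l Hl) as [C1 Hg].
assert (C10 : 0 <= C1) by (apply (adm_nonneg al (gk al l) C1 Hg)).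
assert (JJ := cont_Int q 0 Hq). set (Jq := fun t => Int q 0 t) in *.
assert (Jm := cont_Int m 0 Hm).
destruct (Yc_family al Hal (fun x => RtoC (exp (al * x))) 1 q (cont_CB_exp al) Hq (exp_family al Hal)) as [E1 E2].
destruct (II_param al Hal _ E1 E2) as [E3 E4]. set (E := fun t => II (fun x => scal (RtoC (exp (al * x))) (Yc (exp x) q t))) in *.
assert (bG : forall x, Cmod (gk al l x) <= C1 * ((1 + exp x) * wgt al x)).
{ intros x. eapply Rle_trans; [apply Hg|]. apply Rmult_le_compat_l; [exact C10|].
  assert (W := wgt_pos al x). assert (P := exp_pos x). nra. }
destruct (Yc_family al Hal (gk al l) C1 q (proj1 Hg) Hq bG) as [G1 G2].
set (G := fun t => II (fun x => scal (gk al l x) (Yc (exp x) q t))).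
assert (G3 : forall t, is_II (fun x => scal (gk al l x) (Yc (exp x) q t)) (G t)).
{ intros t. destruct (G2 t) as [C2 HC2]. apply (II_dominated al Hal _ C2 (cont2_l _ t G1)). intros x. apply HC2. lra. }
assert (E5 : forall t, is_II (fun x => scal (RtoC (exp (al * x))) (Yc (exp x) q t)) (E t)).
{ intros t. destruct (E2 t) as [C2 HC2]. apply (II_dominated al Hal _ C2 (cont2_l _ t E1)). intros x. apply HC2. lra. }
assert (bW : forall x, Cmod (gk al l x * RtoC (exp x))%C <= C1 * ((1 + exp x) * wgt al x)).
{ intros x. rewrite Cmod_mult, Cmod_R, Rabs_pos_eq by (left; apply exp_pos).
  assert (W := wgt_pos al x). assert (P := exp_pos x). assert (Q := proj2 Hg x). 
  apply Rle_trans with (C1 * wgt al x * exp x); [apply Rmult_le_compat_r; lra|].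
  assert (0 <= C1 * wgt al x) by (apply Rmult_le_pos; lra). lra. }
destruct (Yc_family al Hal (fun x => gk al l x * RtoC (exp x))%C C1 q (exp_factor_cont _ (proj1 Hg)) Hq bW) as [W1 W2].
destruct (II_param al Hal _ W1 W2) as [W3 W4].
set (W := wint_op (gk al l) q). change (cont W) in W3.
(* The convolution identity is available only for the integral of E; [Int_inj] removes that
   integration. *)
assert (EJ : forall T, 0 <= T -> E T = scal (pfun al 1) (Int m 0 T)).
{ intros T0 HT0.
  assert (Cs : cont (fun t => scal (pfun al 1) (Int m 0 t))) by (apply (cont_scal (fun _ => pfun al 1)); [apply cont_CB_const|exact Jm]).
  apply (Int_inj E (fun t => scal (pfun al 1) (Int m 0 t)) T0 HT0 E3 Cs). intros T HT.
  rewrite (Int_scal _ _ 0 T HT Jm), <- (Int_repeated m T HT Hm), <- (kappa_pfun al Hal).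
  refine (is_II_unique _ _ _ (E4 T HT) _).
  refine (is_II_ext _ _ _ _ (is_II_convolution al Hal m Jq T HT Hm JJ _)).
  - intros x. rewrite (Int_scal _ _ 0 T HT (Yc_cont (exp x) q Hq)). f_equal.
    unfold Jq. rewrite (Y0_Int (exp x) q T HT Hq). apply Int_ext; [exact HT|]. intros s Hs. symmetry. apply Yc_eq. lra.
  - intros s Hs. apply (fracint_Int al Ha); auto. lra. }
(* From the integrated relaxation equation r J Y = J q - Y. *)
assert (WJ : forall T, 0 <= T -> Int W 0 T = minus (scal (pfun al l) (Jq T)) (G T)).
{ intros T HT. refine (is_II_unique _ _ _ (W4 T HT) _).
  refine (is_II_ext _ _ _ _ (is_II_minus _ _ _ _ _ (cont2_l _ T G1) (is_II_scal_r (Jq T) _ _ (proj1 Hg) (adm_II al Hal C1 _ Hg)) (G3 T))).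
  - intros x. cbv beta. rewrite (Int_scal _ _ 0 T HT (Yc_cont (exp x) q Hq)).
    rewrite (Yc_eq (exp x) q T HT), (Y0_eq (exp x) q T HT Hq).
    rewrite (Int_ext (Yc (exp x) q) (Y0 (exp x) q) 0 T HT) by (intros s Hs; apply Yc_eq; lra).
    unfold Jq. generalize (Int q 0 T) (Int (Y0 (exp x) q) 0 T) (RtoC (exp x)) (gk al l x). intros. vring X.
  - apply (cont_scal (gk al l) (fun _ => Jq T)); [exact (proj1 Hg)|apply cont_const]. }
(* From r / (l + r) = 1 - l / (l + r). *)
assert (WE : forall t, W t = minus (E t) (scal l (G t))).
{ intros t. unfold W, wint_op. apply II_is.
  refine (is_II_ext _ _ _ _ (is_II_minus _ _ _ _ (cont2_l _ t E1) _ (E5 t) (is_II_scal l _ _ (cont2_l _ t G1) (G3 t)))).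
  - intros x. cbv beta.
    assert (ID : (gk al l x * RtoC (exp x))%C = (RtoC (exp (al * x)) - l * gk al l x)%C).
    { destruct (slit_lower l Hl) as (k & Hk & Hk'). specialize (Hk' (exp x) ltac:(left; apply exp_pos)).
      assert (NZ : (l + RtoC (exp x))%C <> 0%C).
      { intros Z. rewrite Z, Cmod_0 in Hk'. assert (P := exp_pos x). assert (0 < k * (1 + exp x)) by (apply Rmult_lt_0_compat; lra). lra. }
      unfold gk. field. exact NZ. }
    rewrite ID. generalize (Yc (exp x) q t) (gk al l x) (RtoC (exp (al * x))). intros. vring X.
  - apply (cont_scal (fun _ => l)); [apply cont_CB_const|exact (cont2_l _ t G1)]. }
set (Z := fun t => scal (/ pfun al 1)%C (W t)).
assert (CZ : cont Z) by (apply (cont_scal (fun _ => / pfun al 1)%C); [apply cont_CB_const|exact W3]).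
set (r := fun t => plus (scal l (Z t)) (minus (m t) (scal (cpow l al) (q t)))).
assert (Cq : cont (fun t => scal (cpow l al) (q t))) by (apply (cont_scal (fun _ => cpow l al)); [apply cont_CB_const|exact Hq]).
assert (CZl : cont (fun t => scal l (Z t))) by (apply (cont_scal (fun _ => l)); [apply cont_CB_const|exact CZ]).
assert (Cr : cont r) by (apply cont_plus; [exact CZl|apply cont_minus; [exact Hm|exact Cq]]).
(* Exhibiting Z as an integral gives its derivative without differentiating under the improper
   integral. *)
assert (ZJ : forall T, 0 <= T -> Int r 0 T = Z T).
{ intros T HT. 
  assert (ER : Int r 0 T = plus (scal l (Int Z 0 T)) (minus (Int m 0 T) (scal (cpow l al) (Int q 0 T)))).
  { exact (eq_trans (Int_plus _ _ 0 T CZl (cont_minus _ _ Hm Cq)) (f_equal2 plus (Int_scal l Z 0 T HT CZ)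
      (eq_trans (Int_minus m _ 0 T HT Hm Cq) (f_equal (minus (Int m 0 T)) (Int_scal (cpow l al) q 0 T HT Hq))))). }
  rewrite ER. unfold Z at 2. rewrite (WE T), (EJ T HT).
  unfold Z. rewrite (Int_scal _ _ 0 T HT W3), (WJ T HT).
  assert (P := pfun_cpow al Hal l Hl). assert (P1 := pfun_1_neq_0).
  assert (PL : cpow l al = (/ pfun al 1 * (l * pfun al l))%C) by (rewrite P; field; exact P1).
  rewrite PL. change (Int q 0 T) with (Jq T).
  assert (P2 : (/ pfun al 1 * pfun al 1)%C = 1%C) by (apply Cinv_l, P1).
  assert (P3 : scal (/ pfun al 1)%C (scal (pfun al 1) (Int m 0 T)) = Int m 0 T).
  { rewrite scal_assoc. eapply eq_trans; [exact (f_equal (fun c : C => scal c (Int m 0 T)) P2)|]. exact (scal_one (Int m 0 T)). }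
  transitivity (minus (scal (/ pfun al 1)%C (scal (pfun al 1) (Int m 0 T))) (scal (/ pfun al 1)%C (scal l (G T)))).
  - rewrite P3. generalize (Int m 0 T) (Jq T) (G T) (pfun al l) (/ pfun al 1)%C. intros. vring X.
  - generalize (scal (pfun al 1) (Int m 0 T)) (G T) (/ pfun al 1)%C. intros. vring X. }
intros t Ht.
change (dv half_line Z t (plus (scal l (Z t)) (minus (m t) (scal (cpow l al) (q0 t))))).
assert (Et : q0 t = q t) by (symmetry; apply ext_eq, Ht). rewrite Et.
refine (dv_ext _ (fun T => Int r 0 T) Z t _ _ _ (dv_Int half_line r 0 t Cr)).
- intros s Hs. apply ZJ. exact Hs.
- apply ZJ. exact Ht.
Qed.

(** The integrand is at most M times the positive density [gk], whose integral at l = x is x^(al-1)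
    pfun(1) by homogeneity. *)
Lemma wint_op_real_bound (q : R -> X) M x t : 0 < x -> cont q -> (forall s, 0 <= s -> norm (q s) <= M) ->
  x * norm (scal (/ pfun al 1)%C (wint_op (gk al (RtoC x)) q t)) <= M * exp (al * ln x).
Proof.
intros Hx Hq HM.
assert (Hs : slit_plane (RtoC x)) by (unfold slit_plane; simpl; lra).
destruct (gk_adm al Hal (RtoC x) Hs) as [C1 Hg].
assert (p1 := pfun_1_pos al Hal). assert (pr := pfun_1_real al Hal).
set (g := fun y => M * (exp (al * y) / (x + exp y))).
assert (gE : forall y, RtoC (g y) = (RtoC M * gk al (RtoC x) y)%C).
{ intros y. assert (P := exp_pos y). unfold g, gk. rewrite RtoC_mult, RtoC_div, RtoC_plus by lra. reflexivity. }
assert (B : norm (wint_op (gk al (RtoC x)) q t) <= Re (RtoC M * pfun al (RtoC x))%C).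
{ refine (norm_is_II _ g _ _ (wint_op_integrand_cont al _ C1 q Hg Hq t) _ _ (wint_op_is al Hal _ C1 q M Hg Hq HM t) _).
  - intros y. assert (P := exp_pos y). apply (ex_derive_continuous (K := R_AbsRing) (V := R_NormedModule)). unfold g. auto_derive. lra.
  - intros y. eapply Rle_trans; [apply (wint_op_integrand_bound _ q M Hq HM)|].
    right. unfold g, gk. assert (P := exp_pos y). assert (P2 := exp_pos (al * y)).
    rewrite <- RtoC_plus, <- RtoC_div, Cmod_R, Rabs_pos_eq; [reflexivity| |lra].
    left. apply Rdiv_lt_0_compat; lra.
  - refine (is_II_ext _ _ _ (fun y => eq_sym (gE y)) _). exact (is_II_scal (X := CB) (RtoC M) (gk al (RtoC x)) _ (proj1 Hg) (adm_II al Hal C1 _ Hg)). }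
assert (S := pfun_scale al Hal x 1%C Hx slit_1). rewrite !Cmult_1_r, !Cmult_1_l in S.
assert (S2 : x * Re (pfun al (RtoC x)) = exp (al * ln x) * Re (pfun al 1)).
{ assert (S3 := f_equal Re S). unfold Re in *. simpl in S3. lra. }
assert (N : Cmod (/ pfun al 1)%C = / Re (pfun al 1)).
{ rewrite Cmod_inv by exact pfun_1_neq_0. rewrite pr at 1. rewrite Cmod_R, Rabs_pos_eq by lra. reflexivity. }
rewrite norm_scal_X, N.
assert (B2 : Re (RtoC M * pfun al (RtoC x))%C = M * Re (pfun al (RtoC x))) by (unfold Re; simpl; ring).
rewrite B2 in B.
apply Rle_trans with (x * (/ Re (pfun al 1) * (M * Re (pfun al (RtoC x))))).
- apply Rmult_le_compat_l; [lra|]. apply Rmult_le_compat_l; [left; apply Rinv_0_lt_compat; lra|exact B].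
- right. replace (x * (/ Re (pfun al 1) * (M * Re (pfun al (RtoC x))))) with (/ Re (pfun al 1) * M * (x * Re (pfun al (RtoC x)))) by ring.
  rewrite S2. field. lra.
Qed.
End FractionalIdentity.

Lemma pw_1 x : 0 <= x -> pw 1 x = x.
Proof.
intros [Hx| <-]; [|apply pw_neg; lra]. rewrite pw_pos by exact Hx. rewrite Rmult_1_l. apply exp_ln, Hx.
Qed.

Lemma igam_1 t : 0 <= t -> igam 1 t = 1 - (1 + t) * exp (- t).
Proof.
intros Ht. unfold igam.
rewrite (RInt_ext (V := R_CompleteNormedModule) _ (fun x => x * exp (- x))).
- assert (IR : is_RInt (fun x => x * exp (- x)) 0 t (minus (- (1 + t) * exp (- t)) (- (1 + 0) * exp (- 0)))).
  { apply (is_RInt_derive (V := R_CompleteNormedModule) (fun x => - (1 + x) * exp (- x))).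
    - intros x _. auto_derive; [exact I|ring].
    - intros x _. apply (ex_derive_continuous (K := R_AbsRing) (V := R_NormedModule)). auto_derive; exact I. }
  rewrite (is_RInt_unique _ _ _ _ IR). unfold minus, plus, opp; simpl. rewrite Ropp_0, exp_0. ring.
- rewrite Rmin_left, Rmax_right by exact Ht. intros x Hx. rewrite pw_1 by lra. reflexivity.
Qed.

Lemma GG_1 : GG 1 = 1.
Proof.
destruct (Gamma_igam 1 ltac:(lra)) as (P & B & L). rewrite Rmult_1_l in B, L. fold (GG 1) in P, B, L.
apply Rle_antisym; apply le_epsilon; intros e He.
- destruct (L e He) as (A & HA & H). specialize (H A ltac:(lra)). rewrite igam_1 in H by lra.
  assert (0 <= (1 + A) * exp (- A)) by (apply Rmult_le_pos; [lra|left; apply exp_pos]). lra.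
- destruct (affine_exp_small e He) as (T & HT & H). specialize (H T ltac:(lra)). specialize (B T ltac:(lra)).
  rewrite igam_1 in B by lra. lra.
Qed.

(** If l + h were on the slit, r = -Re (l + h) >= 0 would give l + r = -h, against the lower bound k
    (1 + r) with |h| < k. *)
Lemma slit_near l : slit_plane l -> exists d, 0 < d /\ forall h, Cmod h < d -> slit_plane (l + h)%C.
Proof.
intros Hl. destruct (slit_lower l Hl) as (k & Hk & H). exists k. split; [exact Hk|]. intros h Hh [H1 H2].
assert (E : (l + RtoC (- Re (l + h)))%C = (- h)%C).
{ apply injective_projections.
  - unfold Re. simpl. ring.
  - unfold Im in H1. simpl in *. lra. }
specialize (H (- Re (l + h)%C) ltac:(lra)). rewrite E, Cmod_opp in H. nra.
Qed.

(** For a < 1 Balakrishnan's formula expresses the power through [pfun], whose expansions are known;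
    the argument function is never differentiated. *)
Lemma cpow_taylor a n l : 0 < a <= 1 -> slit_plane l -> taylor (V := C_NormedModule) n (fun h => cpow (l + h)%C a).
Proof.
intros Ha Hl. destruct (slit_near l Hl) as (d & Hd & Hs).
assert (Tl : taylor (V := C_NormedModule) n (fun h => l + h)%C).
{ exact (taylor_plus n (fun _ => l) (fun h => h) (taylor_const (V := C_NormedModule) n l) (taylor_id n)). }
destruct (Rlt_dec a 1) as [L|L].
- assert (P1 := pfun_1_neq_0 a ltac:(lra)).
  refine (taylor_ext n _ _ d Hd _ (taylor_mult n (fun _ => (/ pfun a 1)%C) _ (taylor_const (V := C_NormedModule) n (/ pfun a 1)%C)
    (taylor_mult n _ _ Tl (taylor_pfun a ltac:(lra) n l Hl)))).
  intros h Hh. cbv beta. rewrite (pfun_cpow a ltac:(lra) _ (Hs h Hh)). match goal with |- ?x = ?y => change (@eq C x y) end. field. exact P1.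
- refine (taylor_ext n _ _ d Hd _ Tl). intros h Hh. replace a with 1 by lra. symmetry. apply cpow_1, Hs, Hh.
Qed.

(** * The divided difference for all exponents up to 1 *)

Section Hop.
Context {X : CBanach}.
Variable a : R.
Hypothesis Ha : 0 < a <= 1.

(** For a = 1 the kernel [k1] is the identity, so by Cauchy's formula q and the integral of m have
    equal integrals over every [0, T]. *)
Lemma fracint_1 (m : R -> X) (q : BUC X) : cont m -> fracint 1 m q -> forall t, half_line t -> q t = Int m 0 t.
Proof.
intros Hm Hq t Ht.
assert (Cq : cont (ext q)) by (apply cont_ext, buc_continuous).
assert (Fq : fracint 1 m (ext q)).
{ apply (fracint_ext 1 m m q (ext q)); auto. intros s Hs. symmetry. apply ext_eq, Hs. }
rewrite <- (ext_eq q t Ht).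
apply (Int_inj (ext q) (fun t => Int m 0 t) t Ht Cq (cont_Int m 0 Hm)). intros T HT.
rewrite (fracint_Int 1 ltac:(lra) m (ext q) T HT Hm Cq Fq), <- (Int_repeated m T HT Hm).
apply Int_ext; [exact HT|]. intros s Hs. do 2 f_equal. unfold k1. rewrite pw_1, GG_1 by lra. field.
Qed.

(* [hop l] is the divided difference (l^a - D^a) / (l - D), D = d/dt: up to a constant, the integral of
   r^a / ((l + r) (D + r)) dr over r = e^x, where 1 / (D + r) is [Y0 r]. *)
Definition hop (l : C) (u : BUC X) : BUC X :=
  if Rlt_dec a 1 then buc_scal (/ pfun a 1)%C (wbuc u (gk a l)) else u.

Lemma hop_lt l u t : a < 1 -> slit_plane l -> hop l u t = scal (/ pfun a 1)%C (wint_op (gk a l) (ext u) t).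
Proof.
intros H Hl. unfold hop. destruct (Rlt_dec a 1) as [L|L]; [|contradiction].
destruct (gk_adm a ltac:(lra) l Hl) as [C1 Hg].
exact (f_equal (fun v => scal (/ pfun a 1)%C v) (wbucE a ltac:(lra) u _ C1 t Hg)).
Qed.

Lemma hop_1 l u : ~ a < 1 -> hop l u = u.
Proof. intros H. unfold hop. destruct (Rlt_dec a 1) as [L|L]; [contradiction|reflexivity]. Qed.

Lemma hop_taylor n l u : slit_plane l -> taylor n (fun h => cls (hop (l + h)%C u)).
Proof.
intros Hl. destruct (Rlt_dec a 1) as [L|L].
- assert (Q := taylor_scal n (fun _ => (/ pfun a 1)%C) _ (taylor_const (V := C_NormedModule) n (/ pfun a 1)%C) (wbuc_taylor a ltac:(lra) n l u Hl)).
  refine (taylor_ext n _ _ 1 Rlt_0_1 _ Q). intros h _. cbv beta. rewrite cls_scal.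
  unfold hop. destruct (Rlt_dec a 1); [reflexivity|contradiction].
- refine (taylor_ext n _ _ 1 Rlt_0_1 _ (taylor_const n (cls u))). intros h _. rewrite hop_1 by exact L. reflexivity.
Qed.

Lemma hop_linear (L : X -> X) K l (u v : BUC X) t :
  (forall x y, L (minus x y) = minus (L x) (L y)) -> (forall (c : C) x, L (scal c x) = scal c (L x)) ->
  (forall x, norm (L x) <= K * norm x) -> slit_plane l -> half_line t ->
  (forall t, half_line t -> v t = L (u t)) -> hop l v t = L (hop l u t).
Proof.
intros Lm Ls Lb Hl Ht E. destruct (Rlt_dec a 1) as [H|H].
- rewrite !hop_lt by assumption. rewrite Ls. f_equal.
  destruct (gk_adm a ltac:(lra) l Hl) as [C1 Hg]. destruct (buc_norm u) as (M & M0 & HM).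
  assert (EE : ext v = (fun s => L (ext u s))).
  { apply functional_extensionality. intros s. apply E. unfold half_line. apply Rmax_l. }
  rewrite EE. apply (wint_op_linear a ltac:(lra) L K _ C1 (ext u) M t Lm Ls Lb Hg); [apply cont_ext, buc_continuous|].
  intros s Hs. rewrite ext_eq by exact Hs. apply HM, Hs.
- rewrite !hop_1 by exact H. apply E, Ht.
Qed.

(** With m = D^a q this reads (D - l) H_l q = D^a q - l^a q, the defining property of the divided
    difference. For a = 1, H_l is the identity. *)
Lemma hop_ode l (m : R -> X) (q : BUC X) : slit_plane l -> cont m -> fracint a m q -> forall t, half_line t ->
  dv half_line (hop l q) t (plus (scal l (hop l q t)) (minus (m t) (scal (cpow l a) (q t)))).
Proof.
intros Hl Hm Hq t Ht. destruct (Rlt_dec a 1) as [H|H].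
- assert (Q := wint_op_ode a ltac:(lra) l m q Hl Hm Hq t Ht).
  rewrite <- (hop_lt l q t H Hl) in Q.
  refine (dv_ext _ _ _ _ _ _ _ Q); [intros s Hs|]; symmetry; apply hop_lt; assumption.
- assert (a1 : a = 1) by lra. rewrite (hop_1 l q H). subst a. rewrite (cpow_1 l Hl).
  assert (E := fracint_1 m q Hm Hq).
  assert (ID : m t = plus (scal l (q t)) (minus (m t) (scal l (q t)))) by (vring X).
  refine (dv_value _ _ _ _ _ ID _).
  refine (dv_ext _ _ _ _ _ _ _ (dv_Int half_line m 0 t Hm)); [intros s Hs|]; symmetry; apply E; assumption.
Qed.

(** x |H_x u| is at most M x^a with M a bound for u; this is the first of the three terms in
    [abelian_at_0]. *)
Lemma hop_small (u : BUC X) e : 0 < e -> exists d, 0 < d /\ forall x, 0 < x < d -> x * norm (cls (hop (RtoC x) u)) < e.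
Proof.
intros He. destruct (buc_norm u) as (M & M0 & HM).
destruct (pw_small a Ha (e / (2 * (M + 1)))) as (d & Hd & H); [apply Rdiv_lt_0_compat; lra|].
exists (Rmin 1 d). assert (m1 := Rmin_l 1 d). assert (m2 := Rmin_r 1 d). split; [apply Rmin_pos; lra|]. intros x Hx.
assert (B : M * pw a x < e).
{ specialize (H x ltac:(lra)). assert (P := pw_ge0 a x).
  apply Rle_lt_trans with ((M + 1) * (e / (2 * (M + 1)))); [apply Rmult_le_compat; lra|].
  replace ((M + 1) * (e / (2 * (M + 1)))) with (e / 2) by (field; lra). lra. }
apply Rle_lt_trans with (M * pw a x); [|exact B]. apply (Rmult_le_reg_r (/ x)); [apply Rinv_0_lt_compat; lra|].
replace (x * norm (cls (hop (RtoC x) u)) * / x) with (norm (cls (hop (RtoC x) u))) by (field; lra).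
apply cls_norm. intros t Ht. apply (Rmult_le_reg_l x); [lra|].
replace (x * (M * pw a x * / x)) with (M * pw a x) by (field; lra).
assert (Hs : slit_plane (RtoC x)) by (unfold slit_plane; simpl; lra).
destruct (Rlt_dec a 1) as [L|L].
- rewrite hop_lt by assumption. rewrite pw_pos by lra.
  apply (wint_op_real_bound a ltac:(lra)); [lra|apply cont_ext, buc_continuous|].
  intros s Hs'. rewrite ext_eq by exact Hs'. apply HM, Hs'.
- rewrite hop_1 by exact L. assert (a1 : a = 1) by lra. rewrite a1, pw_1 by lra.
  rewrite (Rmult_comm M). apply Rmult_le_compat_l; [lra|apply HM, Ht].
Qed.
End Hop.

(** * The resolvent formula *)

Section Lift.
Context {X : CBanach}.
Notation Op := (bounded_operators X).

Definition ap (S : Op) (x : X) : X := blin_fun S x.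

Lemma ap_plus S x y : ap S (plus x y) = plus (ap S x) (ap S y).
Proof. exact (linear_plus _ (blin_ok S) x y). Qed.
Lemma ap_scal S (c : C) x : ap S (scal c x) = scal c (ap S x).
Proof. exact (linear_scal _ (blin_ok S) c x). Qed.
Lemma ap_minus S x y : ap S (minus x y) = minus (ap S x) (ap S y).
Proof.
assert (E : minus x y = plus x (scal (RtoC (-1)) y)) by (vring X).
rewrite E, ap_plus, ap_scal. vring X.
Qed.
Lemma ap_norm S x : norm (ap S x) <= norm S * norm x.
Proof. exact (proj1 (op_norm_spec S) x). Qed.

Lemma ap_small S x e : 0 < e -> norm x < e / (norm S + 1) -> norm (ap S x) < e.
Proof.
intros He H. assert (N := norm_ge_0 S). assert (P := norm_ge_0 x). eapply Rle_lt_trans; [apply ap_norm|].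
apply Rle_lt_trans with ((norm S + 1) * norm x); [apply Rmult_le_compat_r; lra|].
apply Rlt_le_trans with ((norm S + 1) * (e / (norm S + 1))).
- apply Rmult_lt_compat_l; lra.
- right. field. lra.
Qed.

Lemma bmap_bounded S (u : BUC X) : Defs.bounded (fun t => ap S (u t)).
Proof.
destruct (buc_norm u) as (M & M0 & HM). exists (norm S * M). intros t Ht.
eapply Rle_trans; [apply ap_norm|]. apply Rmult_le_compat_l; [apply norm_ge_0|apply HM, Ht].
Qed.

Lemma bmap_uc S (u : BUC X) : Defs.uniformly_continuous (fun t => ap S (u t)).
Proof.
intros e He. assert (N := norm_ge_0 S).
destruct (buc_uc u (e := e / (norm S + 1))) as (d & Hd & H); [apply Rdiv_lt_0_compat; lra|].
exists d. split; [exact Hd|]. intros s t Hs Ht Hst. specialize (H s t Hs Ht Hst).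
rewrite <- ap_minus. apply ap_small; assumption.
Qed.

Definition bmap (S : Op) (u : BUC X) : BUC X := MkBUC (bmap_bounded S u) (bmap_uc S u).
(** S acting pointwise on a class through its chosen representative; [lift_cls] shows that any other
    gives the same result. *)
Definition lift (S : Op) (y : quotient_space X) : quotient_space X := cls (bmap S (repr y)).

Lemma bmap_cls S u v : cls u = cls v -> cls (bmap S u) = cls (bmap S v).
Proof.
intros E. apply cls_eq. intros e He. assert (N := norm_ge_0 S).
destruct (proj1 (cls_eq u v) E (e / (norm S + 1))) as (M & HM); [apply Rdiv_lt_0_compat; lra|].
exists M. intros t Ht. specialize (HM t Ht). change (norm (minus (ap S (u t)) (ap S (v t))) < e).
rewrite <- ap_minus. apply ap_small; assumption.
Qed.

Lemma lift_cls S u : lift S (cls u) = cls (bmap S u).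
Proof. apply bmap_cls. exact (tilde_repr (cls u)). Qed.

Lemma lift_plus S y z : lift S (plus y z) = plus (lift S y) (lift S z).
Proof.
destruct (cls_ex y) as [u ->]. destruct (cls_ex z) as [v ->]. rewrite cls_plus, !lift_cls, cls_plus.
apply cls_pw. intros t _. exact (ap_plus S (u t) (v t)).
Qed.

Lemma lift_scal S (c : C) y : lift S (scal c y) = scal c (lift S y).
Proof.
destruct (cls_ex y) as [u ->]. rewrite cls_scal, !lift_cls, cls_scal.
apply cls_pw. intros t _. exact (ap_scal S c (u t)).
Qed.

Lemma lift_op_plus S T y : lift (plus S T) y = plus (lift S y) (lift T y).
Proof.
destruct (cls_ex y) as [u ->]. rewrite !lift_cls, cls_plus. apply cls_pw. intros t _. reflexivity.
Qed.

Lemma lift_op_scal (c : C) S y : lift (scal c S) y = scal c (lift S y).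
Proof.
destruct (cls_ex y) as [u ->]. rewrite !lift_cls, cls_scal. apply cls_pw. intros t _. reflexivity.
Qed.

Lemma lift_norm S y : norm (lift S y) <= norm S * norm y.
Proof.
apply le_epsilon. intros e He. assert (N := norm_ge_0 S).
destruct (cls_norm_rep y (e / (norm S + 1))) as (u & E & Hu); [apply Rdiv_lt_0_compat; lra|].
rewrite E at 1. rewrite lift_cls. apply Rle_trans with (norm S * (norm y + e / (norm S + 1))).
- apply cls_norm. intros t Ht. change (norm (ap S (u t)) <= norm S * (norm y + e / (norm S + 1))).
  eapply Rle_trans; [apply ap_norm|]. apply Rmult_le_compat_l; [exact N|apply Hu, Ht].
- rewrite Rmult_plus_distr_l. apply Rplus_le_compat_l.
  apply Rle_trans with ((norm S + 1) * (e / (norm S + 1))).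
  + apply Rmult_le_compat_r; [left; apply Rdiv_lt_0_compat|]; lra.
  + right. field. lra.
Qed.

Lemma taylor_lift n (S : C -> Op) (y : C -> quotient_space X) : taylor n S -> taylor n y -> taylor n (fun h => lift (S h) (y h)).
Proof.
assert (B : forall (S : Op) y, norm (lift S y) <= 1 * norm S * norm y) by (intros; rewrite Rmult_1_l; apply lift_norm).
exact (taylor_bilinear (U := Op) lift lift_op_plus lift_plus lift_op_scal (fun l S y => lift_scal S l y) 1 Rle_0_1 B n S y).
Qed.
End Lift.

Section ResolventFormula.
Context {X : CBanach}.

Lemma const_bounded (x : X) : Defs.bounded (fun _ => x).
Proof. exists (norm x). intros. lra. Qed.
Lemma const_uc (x : X) : Defs.uniformly_continuous (fun _ => x).
Proof. intros e He. exists 1. split; [lra|]. intros. eapply Rle_lt_trans; [right; apply norm_minus_self|exact He]. Qed.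
Definition buc_const (x : X) : BUC X := MkBUC (const_bounded x) (const_uc x).

Lemma C0_bounded (eps : R -> X) : C0 eps -> exists M, 0 <= M /\ forall t, half_line t -> norm (eps t) <= M.
Proof.
intros [Hc Hv]. rewrite vanishingE in Hv. destruct (Hv 1 Rlt_0_1) as (T & HT).
destruct (cont_bounded_on (ext eps) T (cont_ext eps Hc)) as (M & M0 & HM).
exists (M + 1). split; [lra|]. intros t Ht. destruct (Rle_dec t T) as [L|L].
- assert (Q := HM t (conj Ht L)). rewrite ext_eq in Q by exact Ht. lra.
- assert (Q := HT t ltac:(lra)). lra.
Qed.

Variable a : R.
Hypothesis Ha : 0 < a <= 1.
Variable A : operator X.
Variables f u : BUC X.
Variable eps : R -> X.
Hypothesis Heps : C0 eps.
Hypothesis Hu : mild_solution a A (fun t => plus (f t) (eps t)) u.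

Let g (t : R) : X := plus (f t) (eps t).

Lemma forcing_continuous : continuous_on half_line g.
Proof.
apply continuous_onE. intros t Ht e He.
destruct (proj1 (continuous_onE f) (buc_continuous f) t Ht (e / 2)) as (d & Hd & H); [lra|].
destruct (proj1 (continuous_onE eps) (proj1 Heps) t Ht (e / 2)) as (d' & Hd' & H'); [lra|].
exists (Rmin d d'). split; [apply Rmin_pos; assumption|]. intros s Hs Hst.
assert (A1 := H s Hs (Rlt_le_trans _ _ _ Hst (Rmin_l _ _))). assert (A2 := H' s Hs (Rlt_le_trans _ _ _ Hst (Rmin_r _ _))).
unfold g. assert (ID : minus (plus (f s) (eps s)) (plus (f t) (eps t)) = plus (minus (f s) (f t)) (minus (eps s) (eps t))) by (vring X).
eapply Rle_lt_trans; [right; exact (f_equal norm ID)|]. replace e with (e / 2 + e / 2) by field.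
exact (Rle_lt_trans _ _ _ (norm_tri _ _) (Rplus_lt_compat _ _ _ _ A1 A2)).
Qed.

Lemma forcing_bounded : exists M, forall t, half_line t -> norm (g t) <= M.
Proof.
destruct (buc_norm f) as (M & M0 & HM). destruct (C0_bounded eps Heps) as (M' & M0' & HM').
exists (M + M'). intros t Ht. eapply Rle_trans; [apply norm_tri|]. apply Rplus_le_compat; auto.
Qed.

Let v : BUC X := buc_minus u (buc_const (u 0)).

Section AtPoint.
Variable l : C.
Variable S : bounded_operators X.
Hypothesis Hl : slit_plane l.
Hypothesis HS : is_resolvent A (cpow l a) S.

(** S is a left inverse of l^a - A on the domain of A, so A can be eliminated from S A y. *)
Lemma resolvent_inverse y : dom A y -> ap S (op A y) = minus (scal (cpow l a) (ap S y)) y.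
Proof.
intros Hy. assert (E := proj2 (HS (minus (scal (cpow l a) y) (op A y)) y) (conj Hy eq_refl)).
assert (E' : minus (scal (cpow l a) (ap S y)) (ap S (op A y)) = y).
{ exact (eq_trans (eq_sym (eq_trans (ap_minus S (scal (cpow l a) y) (op A y))
    (f_equal (fun z => minus z (ap S (op A y))) (ap_scal S (cpow l a) y)))) E). }
transitivity (minus (scal (cpow l a) (ap S y)) (minus (scal (cpow l a) (ap S y)) (ap S (op A y)))).
- generalize (ap S (op A y)) (scal (cpow l a) (ap S y)). intros. vring X.
- exact (f_equal (minus (scal (cpow l a) (ap S y))) E').
Qed.

Let m (t : R) : X := plus (plus (scal (cpow l a) (ap S (ext u t))) (ap S (ext g t))) (scal (RtoC (-1)) (ext u t)).

Lemma cont_ap h : cont h -> cont (fun t => ap S (h t)).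
Proof. exact (cont_linear (ap S) (norm S) (ap_minus S) (ap_norm S) h). Qed.

Lemma cont_scal_const (c : C) (h : R -> X) : cont h -> cont (fun t => scal c (h t)).
Proof. intros Hh. apply (cont_scal (fun _ => c)); [apply cont_CB_const|exact Hh]. Qed.

Lemma m_cont : cont m.
Proof.
assert (Cu := cont_ext u (buc_continuous u)). assert (Cg := cont_ext g forcing_continuous).
apply cont_plus; [apply cont_plus|].
- apply cont_scal_const, cont_ap, Cu.
- apply cont_ap, Cg.
- apply cont_scal_const, Cu.
Qed.

Lemma fracint_scal (c : C) (h q : R -> X) : cont h -> fracint a h q -> fracint a (fun t => scal c (h t)) (fun t => scal c (q t)).
Proof.
intros Hh Hq. apply (fracint_linear a Ha (fun x => scal c x) (Cmod c)); auto.
- intros; vring X.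
- intros; vring X.
- intros; right; apply norm_scal_X.
Qed.

(** [resolvent_inverse] replaces S A J^a u by l^a S J^a u - J^a u, and the bounded operator S
    commutes with J^a. *)
Lemma mild_fracint : fracint a m (bmap S v).
Proof.
assert (Cu := cont_ext u (buc_continuous u)). assert (Cg := cont_ext g forcing_continuous).
assert (Fu := J_fracint a Ha u (buc_continuous u)). assert (Fg := J_fracint a Ha g forcing_continuous).
assert (FSu := fracint_linear a Ha (ap S) (norm S) _ _ (ap_minus S) (ap_scal S) (ap_norm S) Cu Fu).
assert (FSg := fracint_linear a Ha (ap S) (norm S) _ _ (ap_minus S) (ap_scal S) (ap_norm S) Cg Fg).
assert (F := fracint_plus a Ha _ _ _ _ (cont_plus _ _ (cont_scal_const (cpow l a) _ (cont_ap _ Cu)) (cont_ap _ Cg)) (cont_scal_const (RtoC (-1)) _ Cu)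
  (fracint_plus a Ha _ _ _ _ (cont_scal_const (cpow l a) _ (cont_ap _ Cu)) (cont_ap _ Cg) (fracint_scal (cpow l a) _ _ (cont_ap _ Cu) FSu) FSg)
  (fracint_scal (RtoC (-1)) _ _ Cu Fu)).
refine (fracint_ext a _ _ _ _ (fun t _ => eq_refl) _ F).
intros t Ht. destruct (proj2 Hu t Ht) as [HD E]. fold g in E.
assert (Ev : v t = plus (op A (J a u t)) (J a g t)).
{ unfold v. rewrite buc_minusE. change (minus (u t) (u 0) = plus (op A (J a u t)) (J a g t)). rewrite E at 1.
  generalize (op A (J a u t)) (J a g t) (u 0). intros. vring X. }
change (plus (plus (scal (cpow l a) (ap S (J a u t))) (ap S (J a g t))) (scal (RtoC (-1)) (J a u t)) = ap S (v t)).
assert (E2 := eq_trans (eq_trans (f_equal (ap S) Ev) (ap_plus S (op A (J a u t)) (J a g t)))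
  (f_equal (fun z => plus z (ap S (J a g t))) (resolvent_inverse _ HD))).
refine (eq_trans _ (eq_sym E2)).
generalize (ap S (J a u t)) (ap S (J a g t)) (J a u t). intros. vring X.
Qed.

Hypothesis Hr : Re l <> 0.

(** Z is a bounded solution of [ode l u]. By [hop_ode] its first term contributes m - l^a S v, the
    constant l^(a-1) S u(0) restores l^a S u(0), and S V, with V a bounded solution for the forcing
    f + eps, cancels S (f + eps) in m. *)
Lemma Rz_mild : Rz l (cls u) =
  lift S (plus (cls (hop a l v)) (plus (scal (cpow l a / l)%C (cls (buc_const (u 0)))) (Rz l (cls f)))).
Proof.
destruct forcing_bounded as (M & HM).
destruct (ode_exists l g M Hr forcing_continuous HM) as (V & HV & _).
(* V has forcing f + eps; as eps vanishes at infinity, its class is still [hat f l]. *)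
assert (EV : Rz l (cls f) = cls V).
{ destruct (Rz_ode_ex l f Hr) as (U & HU & ->).
  apply (ode_cls_unique l f g U V Hr (buc_continuous f) forcing_continuous HU HV).
  intros e He. destruct (proj1 (vanishingE eps) (proj2 Heps) e He) as (T & HT). exists T. intros t Ht.
  eapply Rle_lt_trans; [|exact (HT t Ht)]. right. unfold g.
  assert (ID : minus (f t) (plus (f t) (eps t)) = scal (RtoC (-1)) (eps t)) by (vring X).
  eapply eq_trans; [exact (f_equal norm ID)|]. rewrite norm_scal_X, Cmod_R, Rabs_left by lra. ring. }
set (Z := buc_plus (hop a l (bmap S v)) (buc_plus (buc_scal (cpow l a / l)%C (bmap S (buc_const (u 0)))) (bmap S V))).
assert (l0 := slit_neq_0 l Hl).
assert (HZ : ode l u Z).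
{ intros t Ht.
  assert (D1 := hop_ode a Ha l m (bmap S v) Hl m_cont mild_fracint t Ht).
  assert (D2 := dv_const half_line (scal (cpow l a / l)%C (ap S (u 0))) t).
  assert (D3 := dv_linear (ap S) (norm S) half_line V t _ (ap_minus S) (ap_scal S) (ap_norm S) (HV t Ht)).
  assert (D := dv_plus _ _ _ _ _ _ D1 (dv_plus _ _ _ _ _ _ D2 D3)).
  refine (dv_value _ _ _ _ _ _ D).
  assert (ES1 : ap S (v t) = minus (ap S (u t)) (ap S (u 0))).
  { exact (eq_trans (f_equal (ap S) (buc_minusE u (buc_const (u 0)) t)) (ap_minus S (u t) (u 0))). }
  assert (ES2 : ap S (minus (scal l (V t)) (g t)) = minus (scal l (ap S (V t))) (ap S (g t))).
  { exact (eq_trans (ap_minus S (scal l (V t)) (g t)) (f_equal (fun z => minus z (ap S (g t))) (ap_scal S l (V t)))). }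
  unfold m. rewrite !ext_eq by exact Ht.
  refine (eq_trans (f_equal2 (fun p q => plus (plus (scal l (hop a l (bmap S v) t))
    (minus (plus (plus (scal (cpow l a) (ap S (u t))) (ap S (g t))) (scal (RtoC (-1)) (u t))) (scal (cpow l a) p))) (plus zero q)) ES1 ES2) _).
  change (Z t) with (plus (hop a l (bmap S v) t) (plus (scal (cpow l a / l)%C (ap S (u 0))) (ap S (V t)))).
  assert (E : cpow l a = (l * (cpow l a / l))%C) by (field; exact l0).
  rewrite E at 1 2. generalize (cpow l a / l)%C (ap S (u 0)) (ap S (u t)) (ap S (g t)) (ap S (V t)) (hop a l (bmap S v) t) (u t). intros. vring X. }
rewrite (Rz_ode l u Z Hr HZ), EV.
set (c := (cpow l a / l)%C) in *. set (k := buc_const (u 0)) in *. set (W := buc_plus (hop a l v) (buc_plus (buc_scal c k) V)).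
assert (EW : plus (cls (hop a l v)) (plus (scal c (cls k)) (cls V)) = cls W).
{ eapply eq_trans; [exact (f_equal (fun y => plus (cls (hop a l v)) (plus y (cls V))) (cls_scal c k))|].
  eapply eq_trans; [exact (f_equal (plus (cls (hop a l v))) (cls_plus (buc_scal c k) V))|]. apply cls_plus. }
refine (eq_trans _ (eq_sym (eq_trans (f_equal (lift S) EW) (lift_cls S W)))). apply cls_pw. intros t Ht.
assert (H := hop_linear a Ha (ap S) (norm S) l v (bmap S v) t (ap_minus S) (ap_scal S) (ap_norm S) Hl Ht (fun _ _ => eq_refl)).
change (plus (hop a l (bmap S v) t) (plus (scal c (ap S (u 0))) (ap S (V t))) = ap S (plus (hop a l v t) (plus (scal c (u 0)) (V t)))).
rewrite H. symmetry. eapply eq_trans; [apply ap_plus|]. f_equal. eapply eq_trans; [apply ap_plus|]. f_equal. apply ap_scal.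
Qed.
End AtPoint.
End ResolventFormula.

Lemma resolvent_spec (V : NormedModule C_AbsRing) (A : operator V) z :
  in_resolvent_set A z -> is_resolvent A z (resolvent A z).
Proof. intros H. exact (epsilon_spec (inhabits zero) (is_resolvent A z) H). Qed.

Lemma cpow_real x a : 0 < x -> cpow (RtoC x) a = RtoC (pw a x).
Proof.
intros Hx. unfold cpow. destruct (Ceq_dec (RtoC x) 0) as [E|E]; [exfalso; assert (Q := RtoC_inj _ _ E); lra|].
assert (Ea : Carg (RtoC x) = 0).
{ unfold Carg. simpl. destruct (Rle_dec 0 0) as [L|L]; [|lra]. rewrite Cmod_R, Rabs_pos_eq by lra.
  replace (x / x) with 1 by (field; lra). apply acos_1. }
rewrite Ea, Rmult_0_r, cos_0, sin_0, Cmod_R, Rabs_pos_eq by lra. rewrite pw_pos by exact Hx.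
apply injective_projections; simpl; unfold Rpower; ring.
Qed.

Lemma cpow_0 a : cpow 0 a = 0%C.
Proof. unfold cpow. destruct (Ceq_dec 0 0) as [_|H]; [reflexivity|contradiction]. Qed.

(** * Continuation off 0 and the limit at 0 *)

Section Assembly.
Context {X : CBanach}.
Variable a : R.
Hypothesis Ha : 0 < a <= 1.
Variable A : operator X.
Variables f u : BUC X.
Variable eps : R -> X.
Hypothesis Heps : C0 eps.
Hypothesis Hu : mild_solution a A (fun t => plus (f t) (eps t)) u.

Let v : BUC X := buc_minus u (buc_const (u 0)).

(** For xi nonzero the point i xi is in the slit plane, where the power is analytic and [rho]
    provides analyticity of the resolvent; the right-hand side of [Rz_mild], with [hat f] continued,
    is then a local extension. *)
Lemma extension_off_0 xi : xi <> 0 -> rho A a (0, xi) -> ~ sp f xi -> exists (F : C -> quotient_space X) d, 0 < d /\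
  forall w, Cmod (w - (0, xi))%C < d -> taylor 3 (fun h => F (w + h)%C) /\ (Re w <> 0 -> F w = Rz w (cls u)).
Proof.
intros Hxi Hrho Hsp. unfold sp in Hsp. apply NNPP in Hsp. destruct Hsp as (Fh & HF).
apply locally_C in HF. destruct HF as (d1 & Hd1 & HF).
apply locally_C in Hrho. destruct Hrho as (d2 & Hd2 & HR).
assert (Hsl : slit_plane (0, xi)) by (unfold slit_plane; simpl; intros [E _]; contradiction).
destruct (slit_near _ Hsl) as (d3 & Hd3 & HS).
exists (fun w => lift (resolvent A (cpow w a)) (plus (cls (hop a w v)) (plus (scal (cpow w a / w)%C (cls (buc_const (u 0)))) (Fh w)))).
exists (Rmin d1 (Rmin d2 d3)). split; [repeat apply Rmin_pos; assumption|]. intros w Hw.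
assert (m1 := Rmin_l d1 (Rmin d2 d3)). assert (m2 := Rmin_r d1 (Rmin d2 d3)).
assert (m3 := Rmin_l d2 d3). assert (m4 := Rmin_r d2 d3).
destruct (HF w ltac:(lra)) as [F1 F2]. destruct (HR w ltac:(lra)) as [R1 R2].
assert (Hl : slit_plane w).
{ replace w with ((0, xi) + (w - (0, xi)))%C by ring. apply HS. lra. }
assert (w0 := slit_neq_0 w Hl). split.
- apply (taylor_lift 3 (fun h => resolvent A (cpow (w + h)%C a))).
  + exact (taylor_of_analytic 3 (fun w => resolvent A (cpow w a)) w (R2 Hl)).
  + apply taylor_plus; [apply hop_taylor; assumption|]. apply taylor_plus.
    * apply (taylor_scal 3 (fun h => cpow (w + h) a / (w + h))%C); [|apply taylor_const].
      apply (taylor_mult 3 (fun h => cpow (w + h) a)%C (fun h => / (w + h))%C); [apply cpow_taylor; assumption|apply taylor_inv; exact w0].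
    * exact (taylor_of_analytic 3 Fh w F1).
- intros Hre. rewrite (F2 Hre). symmetry.
  exact (Rz_mild a Ha A f u eps Heps Hu w _ Hl (resolvent_spec _ A _ R1) Hre).
Qed.

(** y = S x satisfies y = S0 (x - c y), and |c| |S0| <= 1/2 lets the term in y be absorbed. Since 0
    is not in the slit plane, [rho] supplies inverses there but no analyticity, so the resolvents
    near 0 are bounded in this way. *)
Lemma resolvent_bound_near_0 (S0 S : bounded_operators X) (c : C) : is_resolvent A (RtoC 0) S0 -> is_resolvent A c S ->
  Cmod c * norm S0 <= 1 / 2 -> norm S <= 2 * norm S0.
Proof.
intros H0 HS Hc. assert (N := norm_ge_0 S0).
apply (op_norm_le (S := S)); [lra|]. intros x. set (y := blin_fun S x).
destruct (proj1 (HS x y) eq_refl) as [Dy Ey].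
assert (E : ap S0 (minus x (scal c y)) = y).
{ apply (proj2 (H0 (minus x (scal c y)) y)). split; [exact Dy|]. rewrite <- Ey.
  generalize (op A y). intros. vring X. }
assert (B : norm y <= norm S0 * (norm x + Cmod c * norm y)).
{ eapply Rle_trans; [right; exact (f_equal norm (eq_sym E))|]. eapply Rle_trans; [apply ap_norm|].
  apply Rmult_le_compat_l; [exact N|]. eapply Rle_trans; [apply norm_minus_X|]. apply Rplus_le_compat_l. right. apply norm_scal_X. }
assert (Ny := norm_ge_0 y).
assert (B2 : Cmod c * norm S0 * norm y <= 1 / 2 * norm y) by (apply Rmult_le_compat_r; assumption).
change (norm y <= 2 * norm S0 * norm x). lra.
Qed.

(** In [Rz_mild] at l = x the resolvent stays bounded, and x times its argument is at most x |H_x v|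
    + x^a |u(0)| + x |hat f (x)|. The first term is small by [hop_small], and [hat f] is bounded
    near 0 by its continuation. *)
Lemma abelian_at_0 : rho A a 0%C -> ~ sp f 0 -> forall e, 0 < e -> exists d, 0 < d /\
  forall x, 0 < x < d -> x * norm (Rz (RtoC x) (cls u)) < e.
Proof.
intros Hrho Hsp e He. unfold sp in Hsp. apply NNPP in Hsp. destruct Hsp as (Fh & HF).
apply locally_C in HF. destruct HF as (d1 & Hd1 & HF).
apply locally_C in Hrho. destruct Hrho as (d2 & Hd2 & HR).
destruct (HR 0%C) as [R0 _].
{ replace (0 - 0)%C with (RtoC 0) by ring. rewrite Cmod_0. exact Hd2. }
rewrite cpow_0 in R0. destruct R0 as [S0 HS0].
destruct (HF 0%C) as [F0 _].
{ replace (0 - (0, 0))%C with (RtoC 0) by (apply injective_projections; simpl; ring). rewrite Cmod_0. exact Hd1. }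
destruct (taylor_of_analytic 0 Fh 0%C F0) as (M & d3 & Hd3 & HM).
assert (N := norm_ge_0 S0). assert (NC := norm_ge_0 (cls (buc_const (u 0)))).
(* The three terms receive e/3, e/6 and e/6; the added ones keep K, N1 and the denominator of d6
   positive. *)
set (K := 2 * norm S0 + 1). set (N1 := norm (cls (buc_const (u 0))) + 1).
assert (K1 : 1 <= K) by (unfold K; lra).
destruct (hop_small a Ha v (e / (3 * K))) as (d4 & Hd4 & H4); [apply Rdiv_lt_0_compat; lra|].
destruct (pw_small a Ha (Rmin (e / (6 * K * N1)) (/ (2 * K)))) as (d5 & Hd5 & H5).
{ apply Rmin_pos; [apply Rdiv_lt_0_compat; [exact He|apply Rmult_lt_0_compat; unfold N1; lra]|apply Rinv_0_lt_compat; lra]. }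
set (d6 := e / (6 * K * (Rabs M + 1))). assert (MM := Rabs_pos M).
assert (Hd6 : 0 < d6) by (apply Rdiv_lt_0_compat; [exact He|apply Rmult_lt_0_compat; lra]).
exists (Rmin d1 (Rmin d2 (Rmin d3 (Rmin d4 (Rmin d5 d6))))). split; [repeat apply Rmin_pos; assumption|]. intros x Hx.
assert (x < d1 /\ x < d2 /\ x < d3 /\ x < d4 /\ x < d5 /\ x < d6) as (x1 & x2 & x3 & x4 & x5 & x6).
{ destruct Hx as [_ Hx]. repeat (match goal with H : x < Rmin ?p ?q |- _ =>
    assert (x < p) by (eapply Rlt_le_trans; [exact H|apply Rmin_l]);
    assert (x < q) by (eapply Rlt_le_trans; [exact H|apply Rmin_r]); clear H end). tauto. }
assert (x0 : 0 < x) by lra.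
assert (Cx : Cmod (RtoC x) = x) by (rewrite Cmod_R; apply Rabs_pos_eq; lra).
assert (Hl : slit_plane (RtoC x)) by (unfold slit_plane; simpl; lra).
assert (Hre : Re (RtoC x) <> 0) by (simpl; lra).
destruct (HR (RtoC x)) as [R1 _].
{ replace (RtoC x - 0)%C with (RtoC x) by ring. lra. }
assert (F1 : Fh (RtoC x) = Rz (RtoC x) (cls f)).
{ apply (HF (RtoC x)); [|exact Hre]. replace (RtoC x - (0, 0))%C with (RtoC x); [lra|].
  apply injective_projections; simpl; ring. }
assert (F2 : norm (Rz (RtoC x) (cls f)) <= Rabs M).
{ rewrite <- F1. eapply Rle_trans; [|apply Rle_abs]. assert (Q := HM (RtoC x) ltac:(lra)). rewrite Cplus_0_l in Q. exact Q. }
rewrite (Rz_mild a Ha A f u eps Heps Hu (RtoC x) _ Hl (resolvent_spec _ A _ R1) Hre).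
rewrite (cpow_real x a x0).
assert (P5 := H5 x ltac:(lra)). assert (p0 := pw_ge0 a x).
assert (Q1 := Rle_trans _ _ _ P5 (Rmin_l _ _)). assert (Q2 := Rle_trans _ _ _ P5 (Rmin_r _ _)).
set (S := resolvent A (RtoC (pw a x))).
assert (NS : norm S <= K).
{ apply Rle_trans with (2 * norm S0); [|unfold K; lra].
  apply (resolvent_bound_near_0 S0 S (RtoC (pw a x)) HS0).
  - assert (Q := resolvent_spec _ A _ R1). rewrite (cpow_real x a x0) in Q. exact Q.
  - rewrite Cmod_R, Rabs_pos_eq by exact p0.
    apply Rle_trans with (/ (2 * K) * K); [apply Rmult_le_compat; unfold K in *; lra|right; field; lra]. }
eapply Rle_lt_trans; [apply Rmult_le_compat_l; [lra|]; apply lift_norm|].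
set (h := cls (hop a (RtoC x) v)). set (k := cls (buc_const (u 0))) in *. set (r := Rz (RtoC x) (cls f)) in *.
assert (T : norm (plus h (plus (scal (RtoC (pw a x) / RtoC x)%C k) r)) <= norm h + (pw a x / x * norm k + norm r)).
{ eapply Rle_trans; [exact (@norm_triangle C_AbsRing (quotient_space X) h _)|]. apply Rplus_le_compat_l.
  eapply Rle_trans; [exact (@norm_triangle C_AbsRing (quotient_space X) _ r)|]. apply Rplus_le_compat_r.
  rewrite norm_scal_C, <- RtoC_div, Cmod_R, Rabs_pos_eq; [lra| |lra].
  apply Rmult_le_pos; [exact p0|left; apply Rinv_0_lt_compat, x0]. }
assert (Ny := norm_ge_0 (plus h (plus (scal (RtoC (pw a x) / RtoC x)%C k) r))).
apply Rle_lt_trans with (x * (K * (norm h + (pw a x / x * norm k + norm r)))).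
{ apply Rmult_le_compat_l; [lra|]. apply Rmult_le_compat; [apply norm_ge_0|exact Ny|exact NS|exact T]. }
replace (x * (K * (norm h + (pw a x / x * norm k + norm r)))) with (K * (x * norm h) + K * (pw a x * norm k) + K * (x * norm r)) by (field; lra).
assert (T1 : K * (x * norm h) < e / 3).
{ apply Rlt_le_trans with (K * (e / (3 * K))); [apply Rmult_lt_compat_l; [lra|apply H4; lra]|right; field; lra]. }
assert (T2 : K * (pw a x * norm k) <= e / 6).
{ apply Rle_trans with (K * (e / (6 * K * N1) * N1)); [|right; field; unfold N1; lra].
  apply Rmult_le_compat_l; [lra|]. apply Rmult_le_compat; [exact p0|exact NC|exact Q1|unfold N1; lra]. }
assert (T3 : K * (x * norm r) <= e / 6).
{ apply Rle_trans with (K * (d6 * (Rabs M + 1))); [|right; unfold d6; field; lra].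
  apply Rmult_le_compat_l; [lra|]. apply Rmult_le_compat; try lra. apply norm_ge_0. }
lra.
Qed.

(** The point xi = 0 falls under the hypothesis exactly when tau is not 1, since e^0 = 1, and that
    is the case in which the limit at 0 is asked for. *)
Lemma asymptotic_multiplier (tau : C) : Cmod tau = 1 ->
  (forall xi, Cexp (0, xi) <> tau -> rho A a (0, xi) /\ ~ sp f xi) ->
  vanishing (fun t => minus (u (t + 1)) (scal tau (u t))).
Proof.
intros Ht H.
assert (E : cls (tdiff 1 tau u) = zero).
{ apply (spectral_criterion u tau Ht).
  - intros xi Hxi He. destruct (H xi He). apply extension_off_0; assumption.
  - intros Hne. destruct (H 0) as [H1 H2].
    + intros E. apply Hne. rewrite <- E. exact Cexp_0.
    + apply abelian_at_0; assumption. }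
apply cls_zero_vanishing in E. rewrite vanishingE in E |- *. intros e He. destruct (E e He) as (M & HM).
exists M. intros t Hm. specialize (HM t Hm). rewrite (tdiffE 1 tau u t Rle_0_1) in HM. exact HM.
Qed.
End Assembly.

(** * Values on the two lattices and the conclusion *)

Lemma Cexp_2PI (k : Z) : Cexp (0, 2 * PI * IZR k) = 1%C.
Proof.
assert (S0 : sin (IZR k * PI) = 0) by (apply sin_eq_0_1; exists k; reflexivity).
unfold Cexp. unfold Re, Im; simpl. replace (2 * PI * IZR k) with (2 * (IZR k * PI)) by ring.
rewrite exp_0, cos_2a_sin, sin_2a, S0. apply injective_projections; simpl; ring.
Qed.

Lemma Cexp_odd_PI (k : Z) : Cexp (0, (2 * IZR k + 1) * PI) = RtoC (-1).
Proof.
replace ((0, (2 * IZR k + 1) * PI) : C) with (Cplus (0, 2 * PI * IZR k) (0, PI)) by (apply injective_projections; simpl; ring).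
rewrite Cexp_plus, Cexp_2PI. unfold Cexp, Re, Im. simpl. rewrite exp_0, cos_PI, sin_PI.
apply injective_projections; simpl; ring.
Qed.

Theorem theorem3p9 (X : CompleteNormedModule C_AbsRing)
    (alpha : R) (halpha : 0 < alpha <= 1)
    (A : operator X) (hA : linear_operator A) (f : BUC X) :
  ((forall xi : C, Sigma_i A alpha xi ->
      exists k : Z, xi = (0, 2 * PI * IZR k)) ->
   (forall xi : R, sp f xi -> exists k : Z, xi = 2 * PI * IZR k) ->
   forall u : BUC X, asymptotic_mild_solution alpha A f u ->
     asymptotic_1_periodic u)
  /\
  ((forall xi : C, Sigma_i A alpha xi ->
      exists k : Z, xi = (0, (2 * IZR k + 1) * PI)) ->
   (forall xi : R, sp f xi -> exists k : Z, xi = (2 * IZR k + 1) * PI) ->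
   forall u : BUC X, asymptotic_mild_solution alpha A f u ->
     asymptotic_anti_1_periodic u).
Proof.
split; intros HA Hf u (eps & Heps & Hu).
- assert (V : vanishing (fun t => minus (u (t + 1)) (scal (RtoC 1) (u t)))).
  { apply (asymptotic_multiplier alpha halpha A f u eps Heps Hu); [rewrite Cmod_R; apply Rabs_R1|].
    intros xi Hne. split.
    - apply NNPP. intros Hn. destruct (HA (0, xi) (conj eq_refl Hn)) as (k & E). apply Hne. rewrite E. apply Cexp_2PI.
    - intros Hs. destruct (Hf xi Hs) as (k & E). apply Hne. rewrite E. apply Cexp_2PI. }
  unfold asymptotic_1_periodic. rewrite vanishingE in V |- *. intros e He. destruct (V e He) as (M & HM). exists M.
  intros t Ht. specialize (HM t Ht).
  assert (ID : minus (u (t + 1)) (u t) = minus (u (t + 1)) (scal (RtoC 1) (u t))) by (vring X).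
  eapply Rle_lt_trans; [right; exact (f_equal norm ID)|exact HM].
- assert (V : vanishing (fun t => minus (u (t + 1)) (scal (RtoC (-1)) (u t)))).
  { apply (asymptotic_multiplier alpha halpha A f u eps Heps Hu); [rewrite Cmod_R, Rabs_left by lra; ring|].
    intros xi Hne. split.
    - apply NNPP. intros Hn. destruct (HA (0, xi) (conj eq_refl Hn)) as (k & E). apply Hne. rewrite E. apply Cexp_odd_PI.
    - intros Hs. destruct (Hf xi Hs) as (k & E). apply Hne. rewrite E. apply Cexp_odd_PI. }
  unfold asymptotic_anti_1_periodic. rewrite vanishingE in V |- *. intros e He. destruct (V e He) as (M & HM). exists M.
  intros t Ht. specialize (HM t Ht).
  assert (ID : plus (u (t + 1)) (u t) = minus (u (t + 1)) (scal (RtoC (-1)) (u t))) by (vring X).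
  eapply Rle_lt_trans; [right; exact (f_equal norm ID)|exact HM].
Qed.
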